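(* Let $\mathcal{L}=\sum_{|I|=\nu}c_IX_I$ be a generalized Rockland operator on $\mathbb{R}^n$ (in the sense defined in the context), assume that $\nu<q$, where $\nu$ is the homogeneity degree of $\mathcal{L}$ and $q=\sum_{i=1}^n\sigma_i$ is the homogeneous dimension of $\mathbb{R}^n$, and assume that $\mathcal{L}^*$ is also a generalized Rockland operator. Then there exists a global fundamental solution $\Gamma(x,y)$ of $\mathcal{L}$, that is: (a) for every fixed $x,y\in\mathbb{R}^n$, $\Gamma(\cdot,y)\in L^1_{\mathrm{loc}}(\mathbb{R}^n)$ and $\Gamma(x,\cdot)\in L^1_{\mathrm{loc}}(\mathbb{R}^n)$; also $\Gamma\in L^1_{\mathrm{loc}}(\mathbb{R}^{2n})$ in the joint variables; (b) for every $\varphi\in C_0^\infty(\mathbb{R}^n)$, $\int_{\mathbb{R}^n}\Gamma(x,y)\,\mathcal{L}^*\varphi(x)\,dx=-\varphi(y)$ for all $y\in\mathbb{R}^n$; (c) for every $\varphi\in C_0^\infty(\mathbb{R}^n)$, the function $u(x)=\int_{\mathbb{R}^n}\Gamma(x,y)\varphi(y)\,dy$ is in $L^1_{\mathrm{loc}}(\mathbb{R}^n)$ and satisfies $\mathcal{L}u=-\varphi$ in the distributional sense (therefore $u$ is a.e. equal to a smooth function $u^*$ satisfying $\mathcal{L}u^*=-\varphi$ pointwise). Moreover, $\Gamma$ satisfies the following properties: (I) setting $\mathbb{D}=\{(x,y)\in\mathbb{R}^{2n}:x=y\}$, $\Gamma\in C^\infty(\mathbb{R}^{2n}\setminus\mathbb{D})$;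 (II) $\Gamma$ is jointly $\delta_\lambda$-homogeneous of degree $\nu-q$: $\Gamma(\delta_\lambda(x),\delta_\lambda(y))=\lambda^{\nu-q}\Gamma(x,y)$ for all $(x,y)\in\mathbb{R}^{2n}\setminus\mathbb{D}$ and $\lambda>0$; (III) for every fixed $y\in\mathbb{R}^n$, $\Gamma(x,y)\to0$ as $|x|\to+\infty$; (IV) $\Gamma$ is unique within the class of functions $\gamma(x,y)$ satisfying the properties in (b) and (III); (V) for this uniquely defined $\Gamma$, one has $\Gamma^*(x,y)=\Gamma(y,x)$ for every $x\ne y\in\mathbb{R}^n$, where $\Gamma^*$ is the global fundamental solution of $\mathcal{L}^*$. In particular, if $\mathcal{L}$ is formally self-adjoint (that is, $\mathcal{L}^*=\mathcal{L}$), then $\Gamma(x,y)=\Gamma(y,x)$ for every $x\neq y\in\mathbb{R}^n$.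
   Context: **Assumption on the vector fields.** $X=\{X_1,\dots,X_m\}$ is a family of real smooth vector fields on $\mathbb{R}^n$, linearly independent in the (infinite-dimensional) real vector space of smooth vector fields on $\mathbb{R}^n$, satisfying Hörmander's condition at the origin (the vector fields in the Lie algebra $\mathrm{Lie}(X)$ generated by $X$, evaluated at $0$, span $\mathbb{R}^n$). $\mathbb{R}^n$ carries dilations $\delta_\lambda(x)=(\lambda^{\sigma_1}x_1,\dots,\lambda^{\sigma_n}x_n)$, $\lambda>0$, with integers $1=\sigma_1\le\sigma_2\le\dots\le\sigma_n$, and each $X_i$ is $\delta_\lambda$-homogeneous of positive integer degree $\nu_i$: $X_i(u\circ\delta_\lambda)=\lambda^{\nu_i}(X_iu)\circ\delta_\lambda$ for all $\lambda>0$, $u\in C^\infty(\mathbb{R}^n)$; moreover $1\le\nu_1\le\dots\le\nu_m$. It follows that $N:=\dim\mathrm{Lie}(X)$ is finite and $N\ge n$; put $p=N-n$. **Operators.** For a multi-index $I=(i_1,\dots,i_k)$ with $i_j\in\{1,\dots,m\}$, put $X_I=X_{i_1}\cdots X_{i_k}$ and $|I|=\nu_{i_1}+\dots+\nu_{i_k}$. $\mathcal{L}=\sum_{|I|=\nu}c_IX_I$, with $\nu$ a positive integer and given real constants $c_I$. The formal transpose $\mathcal{L}^*$ is defined by $\int(\mathcal{L}u)v=\int u(\mathcal{L}^*v)$ for $u,v\in C_0^\infty$. One has $X_i^*=-X_i$, so $\mathcal{L}^*=\sum_{|I|=\nu}(-1)^kc_IX_{i_k}\cdots X_{i_1}$,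 which is of the same form. **Homogeneous group.** A homogeneous group $\mathbb{G}=(\mathbb{R}^N,\star,D_\lambda)$ is a Lie group structure on $\mathbb{R}^N$ (with neutral element $0$) together with diagonal dilations $D_\lambda$ (positive exponents) that are group automorphisms; $\mathrm{Lie}(\mathbb{G})$ is the Lie algebra of its left-invariant vector fields; its homogeneous dimension is the sum of the exponents of $D_\lambda$. **Lifting.** Assume $p\ge1$ and write points of $\mathbb{R}^N=\mathbb{R}^n\times\mathbb{R}^p$ as $(x,\xi)$. By a lifting theorem of Biagi and Bonfiglioli there exist a homogeneous group $\mathbb{G}=(\mathbb{R}^N,\star,D_\lambda)$, of homogeneous dimension $Q>q$, with $D_\lambda(x,\xi)=(\delta_\lambda(x),E_\lambda(\xi))$, $E_\lambda(\xi)=(\lambda^{\tau_1}\xi_1,\dots,\lambda^{\tau_p}\xi_p)$ for integers $1\le\tau_1\le\dots\le\tau_p$, and vector fields $\widetilde X_1,\dots,\widetilde X_m\in\mathrm{Lie}(\mathbb{G})$ generating $\mathrm{Lie}(\mathbb{G})$ as a Lie algebra, such that $\widetilde X_j$ is $D_\lambda$-homogeneous of degree $\nu_j$ and $\widetilde X_j=X_j+R_j$, where $R_j$ is a non-vanishing smooth vector field operating only in the $\xi$ variables (with coefficients possibly depending on $(x,\xi)$). This group and these vector fields are fixed. The lifted operator is $\widetilde{\mathcal{L}}=\sum_{|I|=\nu}c_I\widetilde X_I$, with $\widetilde X_I=\widetilde X_{i_1}\cdots\widetilde X_{i_k}$; the lifted operator of $\mathcal{L}^*$ is $(\widetilde{\mathcal{L}})^*$.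 **Generalized Rockland operator.** $\mathcal{L}=\sum_{|I|=\nu}c_IX_I$ is a generalized Rockland operator if $X_1,\dots,X_m$ satisfy the assumption above, $p\ge1$, and the lifted operator $\widetilde{\mathcal{L}}$ is hypoelliptic on $\mathbb{R}^N$ (for every open $\Omega'\subseteq\Omega\subseteq\mathbb{R}^N$ and $u\in\mathcal{D}'(\Omega)$, $\widetilde{\mathcal{L}}u\in C^\infty(\Omega')$ implies $u\in C^\infty(\Omega')$). *)

(* Defs.v *)
From HB Require Import structures.
From mathcomp Require Import all_boot all_order all_algebra.
From mathcomp Require Import all_classical all_reals all_analysis.

Set Implicit Arguments.
Unset Strict Implicit.
Unset Printing Implicit Defensive.

Import Order.TTheory GRing.Theory Num.Theory.
Import numFieldNormedType.Exports.

Local Open Scope classical_set_scope.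
Local Open Scope ring_scope.

Fact rV_display : measure_display.
Proof. exact: default_measure_display. Qed.

(* the product (= Borel) sigma-algebra on R^n *)
Section measurable_rV.
Context {R : realType} (n : nat).

Let coord (i : 'I_n) (x : 'rV[R]_n) : measurableTypeR R := x 0 i.

Let rV_set0 : g_sigma_preimage coord set0.
Proof. exact: sigma_algebra0. Qed.

Let rV_setC A : g_sigma_preimage coord A -> g_sigma_preimage coord (~` A).
Proof. exact: sigma_algebraC. Qed.

Let rV_bigcup (F : _^nat) : (forall i, g_sigma_preimage coord (F i)) ->
  g_sigma_preimage coord (\bigcup_i (F i)).
Proof. exact: sigma_algebra_bigcup. Qed.

HB.instance Definition _ := @isMeasurable.Build rV_display
  'rV[R]_n (g_sigma_preimage coord) rV_set0 rV_setC rV_bigcup.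

End measurable_rV.

Section measurable_fun_rV.
Context {R : realType}.

Lemma measurable_rV_coord n (i : 'I_n) :
  measurable_fun [set: 'rV[R]_n] (fun x => x 0 i : measurableTypeR R).
Proof.
move=> _ Y mY; rewrite setTI; apply: sub_sigma_algebra => /=.
rewrite -bigcup_seq/=; exists i => /=; first by rewrite mem_index_enum.
by exists Y => //; rewrite setTI.
Qed.

Lemma measurable_fun_rV d (T : measurableType d) n (f : T -> 'rV[R]_n) :
  (forall i, measurable_fun [set: T] (fun t => f t 0 i : measurableTypeR R)) ->
  measurable_fun [set: T] f.
Proof.
move=> mf _ A mA; rewrite setTI.
pose F := [set B | measurable (f @^-1` B)].
suff: F A by [].
apply: mA; split.
  split.
  - by rewrite /F /= preimage_set0.
  - by move=> B mB; rewrite /F /= setTD -preimage_setC; exact: measurableC.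
  - move=> G mG; rewrite /F /= preimage_bigcup.
    by apply: bigcup_measurable => k _; exact: mG.
move=> B; rewrite -bigcup_seq => -[i _ [C mC <-]].
by rewrite /F/= setTI; have := mf i measurableT C mC; rewrite setTI.
Qed.

Definition rV_cons n (z : measurableTypeR R * 'rV[R]_n) : 'rV[R]_n.+1 :=
  row_mx (const_mx z.1 : 'rV[R]_1) z.2.

Definition rV_uncons n (x : 'rV[R]_n.+1) : measurableTypeR R * 'rV[R]_n :=
  (x 0 0, @rsubmx _ 1 1 n x).

Lemma rV_consK n : cancel (@rV_cons n) (@rV_uncons n).
Proof.
move=> [a v]; rewrite /rV_uncons row_mxKr; congr pair => /=.
transitivity (rV_cons (a, v) 0 (@lshift 1 n 0)).
  by rewrite /=; congr (rV_cons _ _ _); exact/val_inj.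
by rewrite /rV_cons (@row_mxEl _ 1 1 n) mxE.
Qed.

Lemma rV_unconsK n : cancel (@rV_uncons n) (@rV_cons n).
Proof.
move=> x; rewrite /rV_cons/= (_ : const_mx _ = @lsubmx _ 1 1 n x).
  exact: (@hsubmxK _ 1 1 n).
by apply/rowP => i; rewrite !mxE ord1; congr (x _ _); exact/val_inj.
Qed.

Lemma measurable_rV_cons n : measurable_fun setT (@rV_cons n).
Proof.
apply: measurable_fun_rV => i.
case: (@split_ordP 1 n i) => j ->.
  rewrite [X in measurable_fun _ X](_ : _ = fst); first exact: measurable_fst.
  by apply/funext => z; rewrite /rV_cons (@row_mxEl _ 1 1 n) mxE.
rewrite [X in measurable_fun _ X](_ : _ =
    (fun x : 'rV[R]_n => x 0 j : measurableTypeR R) \o snd).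
  by apply: measurableT_comp; [exact: measurable_rV_coord|exact: measurable_snd].
by apply/funext => z; rewrite /rV_cons (@row_mxEr _ 1 1 n).
Qed.

Lemma measurable_rV_uncons n : measurable_fun setT (@rV_uncons n).
Proof.
apply: measurable_fun_pair; first exact: measurable_rV_coord.
apply: measurable_fun_rV => i.
rewrite [X in measurable_fun _ X](_ : _ =
    fun x : 'rV[R]_n.+1 => x 0 (rshift 1 i)); first exact: measurable_rV_coord.
by apply/funext => x; rewrite mxE.
Qed.

End measurable_fun_rV.

Section lebesgue_rV.
Context {R : realType}.
Local Open Scope ereal_scope.

Definition cons_measure n (m : {sigma_finite_measure set 'rV[R]_n -> \bar R}) :=
  pushforward (lebesgue_measure \x m) (@rV_cons R n).

Section cons_measure_sigma_finite.
Variables (n : nat) (m : {sigma_finite_measure set 'rV[R]_n -> \bar R}).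

Let cons_measure0 : cons_measure m set0 = 0.
Proof. by rewrite /cons_measure /pushforward preimage_set0 measure0. Qed.

Let cons_measure_ge0 A : 0 <= cons_measure m A.
Proof. by rewrite /cons_measure /pushforward; exact: measure_ge0. Qed.

Let cons_measure_sigma_additive : semi_sigma_additive (cons_measure m).
Proof.
exact: (@measure_semi_sigma_additive _ _ _
  (measure_function_pushforward__canonical__measure_function_Measure
     (lebesgue_measure \x m) (@measurable_rV_cons R n))).
Qed.

HB.instance Definition _ := isMeasure.Build _ _ _ (cons_measure m)
  cons_measure0 cons_measure_ge0 cons_measure_sigma_additive.

Let cons_measure_sigma_finite : sigma_finite setT (cons_measure m).
Proof.
have /sigma_finiteP[F [FT ndF Foo]] := sigma_finiteT (@lebesgue_measure R).
have /sigma_finiteP[G [GT ndG Goo]] := sigma_finiteT m.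
exists (fun k => @rV_uncons R n @^-1` (F k `*` G k)).
  rewrite -preimage_bigcup -[LHS](@preimage_setT _ _ (@rV_uncons R n)).
  congr (_ @^-1` _); rewrite -setXTT FT GT predeqE => -[x y]; split.
    move=> [/= [i _ Fix] [k _ Gky]]; exists (maxn i k) => //; split.
    - by move: x Fix; exact/subsetPset/ndF/leq_maxl.
    - by move: y Gky; exact/subsetPset/ndG/leq_maxr.
  by move=> [k _ []/= ? ?]; split; exists k.
move=> k; have [mF Fk] := Foo k; have [mG Gk] := Goo k; split.
  rewrite -[X in measurable X]setTI.
  by apply: measurable_rV_uncons => //; exact: measurableX.
rewrite /cons_measure /pushforward -comp_preimage.
rewrite (_ : _ \o _ = id); last by apply/funext => z /=; rewrite rV_consK.
by rewrite preimage_id product_measure1E// lte_mul_pinfty// ge0_fin_numE.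
Qed.

HB.instance Definition _ := Measure_isSigmaFinite.Build _ _ _ (cons_measure m)
  cons_measure_sigma_finite.

End cons_measure_sigma_finite.

Fixpoint lebesgue_rV n : {sigma_finite_measure set 'rV[R]_n -> \bar R} :=
  match n with
  | 0%N => \d_(0%R : 'rV[R]_0)
  | n'.+1 => cons_measure (lebesgue_rV n')
  end.

Lemma measurable_rV_box n (A : 'I_n -> set (measurableTypeR R)) :
  (forall i, measurable (A i)) ->
  measurable [set x : 'rV[R]_n | forall i, A i (x 0%R i)].
Proof.
move=> mA; rewrite [X in measurable X](_ : _ =
    \bigcap_(i in [set: 'I_n]) ((fun x : 'rV[R]_n => x 0%R i) @^-1` A i)); last first.
  by apply/seteqP; split=> x /= h i; [move=> _; exact: h|exact: h].
apply: fin_bigcap_measurable => // i _.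
by rewrite -[X in measurable X]setTI; exact: measurable_rV_coord.
Qed.

Lemma lebesgue_rV_box n (A : 'I_n -> set (measurableTypeR R)) :
  (forall i, measurable (A i)) ->
  lebesgue_rV n [set x : 'rV[R]_n | forall i, A i (x 0%R i)] =
  \prod_(i < n) lebesgue_measure (A i).
Proof.
elim: n A => [|n IH] A mA.
  by rewrite big_ord0 /= diracE mem_set// => -[].
rewrite big_ord_recl -IH// /= /cons_measure /pushforward.
have mB : measurable [set x : 'rV[R]_n | forall i, A (lift ord0 i) (x 0%R i)].
  exact: (@measurable_rV_box n (fun i => A (lift ord0 i))).
rewrite -(product_measure1E lebesgue_measure (lebesgue_rV n) (mA ord0) mB).
congr (_ _); apply/seteqP; split=> -[a v] /=.
- move=> h; split => [|i].
    have := h ord0.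
    by rewrite -[_ 0%R ord0]/((rV_uncons (rV_cons (a, v))).1) rV_consK.
  have := h (lift ord0 i); rewrite (_ : lift ord0 i = rshift 1 i).
    by rewrite /rV_cons (@row_mxEr _ 1 1 n).
  exact/val_inj.
move=> [Aa Av] i; case: (unliftP ord0 i) => [j|] ->.
  rewrite (_ : rV_cons _ _ _ = v 0%R j)// (_ : lift ord0 j = rshift 1 j).
    by rewrite /rV_cons (@row_mxEr _ 1 1 n).
  exact/val_inj.
by rewrite -[X in A _ X]/((rV_uncons (rV_cons (a, v))).1) rV_consK.
Qed.
End lebesgue_rV.

Section smooth.
Context {R : realType}.

Definition partial n (i : 'I_n) (f : 'rV[R]_n -> R) : 'rV[R]_n -> R :=
  fun x => 'D_(delta_mx 0 i) f x.

Definition partials n (s : seq 'I_n) (f : 'rV[R]_n -> R) : 'rV[R]_n -> R :=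
  foldr (@partial n) f s.

(* f \in C^oo(W), for W open; the values of f outside W are irrelevant. *)
Definition smooth_on n (W : set 'rV[R]_n) (f : 'rV[R]_n -> R) : Prop :=
  forall (s : seq 'I_n) (x : 'rV[R]_n), W x ->
    {for x, continuous (partials s f)} /\
    forall i : 'I_n, derivable (partials s f) x (delta_mx 0 i).

Definition smooth n (f : 'rV[R]_n -> R) : Prop := smooth_on setT f.

Definition smooth_map n k (F : 'rV[R]_n -> 'rV[R]_k) : Prop :=
  forall j : 'I_k, smooth (fun x => F x 0 j).

Definition supported_in n (K : set 'rV[R]_n) (f : 'rV[R]_n -> R) : Prop :=
  forall x, ~ K x -> f x = 0.

(* f \in C_0^oo(W) *)
Definition test_fun n (W : set 'rV[R]_n) (f : 'rV[R]_n -> R) : Prop :=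
  smooth f /\
  exists K : set 'rV[R]_n, [/\ compact K, K `<=` W & supported_in K f].

Definition L1loc n (f : 'rV[R]_n -> R) : Prop :=
  measurable_fun [set: 'rV[R]_n] f /\
  forall K : set 'rV[R]_n, compact K ->
    (\int[lebesgue_rV n]_(x in K) `|f x|%:E < +oo)%E.

(* u \in D'(W); only the values of u on C_0^oo(W) are relevant. Any bound M on
   the derivatives of order at most k stands for the corresponding seminorm. *)
Definition distribution_on n (W : set 'rV[R]_n) (u : ('rV[R]_n -> R) -> R) :
    Prop :=
  (forall (a : R) (f g : 'rV[R]_n -> R), test_fun W f -> test_fun W g ->
     u (fun x => a * f x + g x) = a * u f + u g) /\
  (forall K : set 'rV[R]_n, compact K -> K `<=` W ->
     exists (C : R) (k : nat), forall f, smooth f -> supported_in K f ->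
       forall M : R,
         (forall (s : seq 'I_n) x, (size s <= k)%N -> `|partials s f x| <= M) ->
         `|u f| <= C * M).

(* the restriction of u to W is the distribution defined by some f in C^oo(W) *)
Definition dist_smooth_on n (W : set 'rV[R]_n) (u : ('rV[R]_n -> R) -> R) :
    Prop :=
  exists2 f : 'rV[R]_n -> R, smooth_on W f &
    forall phi, test_fun W phi -> u phi = \int[lebesgue_rV n]_x (f x * phi x).

End smooth.

Section vector_fields.
Context {R : realType}.

Definition vfield n := 'rV[R]_n -> 'rV[R]_n.

(* X = \sum_i X_i(x) \partial_i acting on functions *)
Definition vfapp n (X : vfield n) (f : 'rV[R]_n -> R) : 'rV[R]_n -> R :=
  fun x => \sum_(i < n) X x 0 i * partial i f x.

Definition lie_bracket n (X Y : vfield n) : vfield n := fun x =>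
  \row_j (vfapp X (fun y => Y y 0 j) x - vfapp Y (fun y => X y 0 j) x).

Inductive lie_generated n m (X : 'I_m -> vfield n) : vfield n -> Prop :=
| lie_gen i : lie_generated X (X i)
| lie_zero : lie_generated X (fun=> 0)
| lie_add Y Z : lie_generated X Y -> lie_generated X Z ->
    lie_generated X (fun x => Y x + Z x)
| lie_scale a Y : lie_generated X Y -> lie_generated X (fun x => a *: Y x)
| lie_brack Y Z : lie_generated X Y -> lie_generated X Z ->
    lie_generated X (lie_bracket Y Z).

Definition vf_independent n k (B : 'I_k -> vfield n) : Prop :=
  forall a : 'I_k -> R, (forall x, \sum_i a i *: B i x = 0) ->
    forall i, a i = 0.

Definition vf_dimension n (A : set (vfield n)) (N : nat) : Prop :=
  exists B : 'I_N -> vfield n,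
    [/\ forall i, A (B i), vf_independent B &
        forall Z, A Z ->
          exists a : 'I_N -> R, forall x, Z x = \sum_i a i *: B i x].

Definition hormander_at n m (X : 'I_m -> vfield n) (x : 'rV[R]_n) : Prop :=
  forall v : 'rV[R]_n, exists (k : nat) (Z : 'I_k -> vfield n) (a : 'I_k -> R),
    (forall i, lie_generated X (Z i)) /\ v = \sum_i a i *: Z i x.

Definition dilation n (e : 'I_n -> nat) (lambda : R) (x : 'rV[R]_n) :
    'rV[R]_n :=
  \row_i (lambda ^+ e i * x 0 i).

Definition vf_homogeneous n (e : 'I_n -> nat) (X : vfield n) (d : nat) : Prop :=
  forall (lambda : R) (u : 'rV[R]_n -> R), 0 < lambda -> smooth u ->
    forall x, vfapp X (u \o dilation e lambda) x =
              lambda ^+ d * vfapp X u (dilation e lambda x).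

Record vf_assumption n m (sigma : 'I_n -> nat) (w : 'I_m -> nat)
    (X : 'I_m -> vfield n) : Prop := VfAssumption {
  vfa_dim : (0 < n)%N ;
  vfa_sigma1 : forall i : 'I_n, i = 0%N :> nat -> sigma i = 1%N ;
  vfa_sigma_le : forall i j : 'I_n, (i <= j)%N -> (sigma i <= sigma j)%N ;
  vfa_w_gt0 : forall i, (0 < w i)%N ;
  vfa_w_le : forall i j : 'I_m, (i <= j)%N -> (w i <= w j)%N ;
  vfa_smooth : forall i, smooth_map (X i) ;
  vfa_indep : vf_independent X ;
  vfa_hormander : hormander_at X 0 ;
  vfa_hom : forall i, vf_homogeneous sigma (X i) (w i) }.

(* X_I = X_(i_1) ... X_(i_k) for I = [:: i_1; ...; i_k] *)
Definition vf_word n m (X : 'I_m -> vfield n) (I : seq 'I_m)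
    (f : 'rV[R]_n -> R) : 'rV[R]_n -> R :=
  foldr (fun i g => vfapp (X i) g) f I.

(* \sum_(|I| = nu) c_I X_I with |I| = \sum_(i in I) w i; multi-indices longer
   than nu need not be considered, as the weights w i are positive *)
Definition hom_op n m (X : 'I_m -> vfield n) (w : 'I_m -> nat) (nu : nat)
    (c : seq 'I_m -> R) (f : 'rV[R]_n -> R) : 'rV[R]_n -> R :=
  fun x => \sum_(k < nu.+1) \sum_(I : k.-tuple 'I_m | \sum_(i <- I) w i == nu)
    c I * vf_word X I f x.

(* \sum_(|I| = nu) (-1)^k c_I X_(i_k) ... X_(i_1) = \sum_(|J| = nu) c'_J X_J
   with c'_J = (-1)^|J| c_(rev J); as X_i^* = - X_i, these are the coefficients
   of the formal transpose. *)
Definition transpose_coef m (c : seq 'I_m -> R) : seq 'I_m -> R :=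
  fun I => (-1) ^+ size I * c (rev I).

(* (L u)(phi) = u (L^* phi) *)
Definition dist_hom_op n m (X : 'I_m -> vfield n) (w : 'I_m -> nat) (nu : nat)
    (c : seq 'I_m -> R) (u : ('rV[R]_n -> R) -> R) : ('rV[R]_n -> R) -> R :=
  fun phi => u (hom_op X w nu (transpose_coef c) phi).

Definition hypoelliptic n m (X : 'I_m -> vfield n) (w : 'I_m -> nat) (nu : nat)
    (c : seq 'I_m -> R) : Prop :=
  forall (W W' : set 'rV[R]_n) (u : ('rV[R]_n -> R) -> R),
    open W -> open W' -> W' `<=` W -> distribution_on W u ->
    dist_smooth_on W' (dist_hom_op X w nu c u) -> dist_smooth_on W' u.

End vector_fields.

Section lifting.
Context {R : realType}.

Record homogeneous_group N (e : 'I_N -> nat)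
    (mul : 'rV[R]_N -> 'rV[R]_N -> 'rV[R]_N) (inv : 'rV[R]_N -> 'rV[R]_N) :
    Prop := HomogeneousGroup {
  hg_mulA : associative mul ;
  hg_mul0x : left_id 0 mul ;
  hg_mulx0 : right_id 0 mul ;
  hg_mulVx : left_inverse 0 inv mul ;
  hg_mulxV : right_inverse 0 inv mul ;
  hg_mul_smooth :
    smooth_map (fun z : 'rV[R]_(N + N) => mul (lsubmx z) (rsubmx z)) ;
  hg_inv_smooth : smooth_map inv ;
  hg_exp_gt0 : forall i, (0 < e i)%N ;
  hg_dilation : forall lambda : R, 0 < lambda ->
    {morph dilation e lambda : x y / mul x y} }.

Definition left_invariant N (mul : 'rV[R]_N -> 'rV[R]_N -> 'rV[R]_N)
    (Z : vfield N) : Prop :=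
  smooth_map Z /\
  forall (a : 'rV[R]_N) (u : 'rV[R]_N -> R), smooth u ->
    forall x, vfapp Z (u \o mul a) x = vfapp Z u (mul a x).

(* the exponents of D_lambda(x, xi) = (delta_lambda(x), E_lambda(xi)) *)
Definition cat_exp n p (sigma : 'I_n -> nat) (tau : 'I_p -> nat) :
    'I_(n + p) -> nat :=
  fun k => match fintype.split k with inl i => sigma i | inr j => tau j end.

Record is_lifting n m p (sigma : 'I_n -> nat) (w : 'I_m -> nat)
    (X : 'I_m -> vfield n) (tau : 'I_p -> nat)
    (mul : 'rV[R]_(n + p) -> 'rV[R]_(n + p) -> 'rV[R]_(n + p))
    (inv : 'rV[R]_(n + p) -> 'rV[R]_(n + p))
    (Xt : 'I_m -> vfield (n + p)) : Prop := IsLifting {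
  lift_dim : vf_dimension (lie_generated X) (n + p) ;
  lift_tau_gt0 : forall j, (0 < tau j)%N ;
  lift_tau_le : forall i j : 'I_p, (i <= j)%N -> (tau i <= tau j)%N ;
  lift_group : homogeneous_group (cat_exp sigma tau) mul inv ;
  lift_inv : forall j, left_invariant mul (Xt j) ;
  lift_gen : forall Z, left_invariant mul Z -> lie_generated Xt Z ;
  lift_hom : forall j, vf_homogeneous (cat_exp sigma tau) (Xt j) (w j) ;
  (* R_j is non-vanishing in the sense that it is not identically zero *)
  lift_proj : forall j, exists Rj : 'rV[R]_(n + p) -> 'rV[R]_p,
    [/\ smooth_map Rj, exists z, Rj z != 0 &
        forall z, Xt j z = row_mx (X j (lsubmx z)) (Rj z)] }.

(* \sum_(|I| = nu) c_I X_I is a generalized Rockland operator, with respect to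
   the fixed lifting (mul, inv, Xt) *)
Definition generalized_rockland n m p (sigma : 'I_n -> nat) (w : 'I_m -> nat)
    (X : 'I_m -> vfield n) (tau : 'I_p -> nat)
    (mul : 'rV[R]_(n + p) -> 'rV[R]_(n + p) -> 'rV[R]_(n + p))
    (inv : 'rV[R]_(n + p) -> 'rV[R]_(n + p))
    (Xt : 'I_m -> vfield (n + p)) (nu : nat) (c : seq 'I_m -> R) : Prop :=
  [/\ vf_assumption sigma w X, (0 < p)%N,
      is_lifting sigma w X tau mul inv Xt & hypoelliptic Xt w nu c].

End lifting.

Section fundamental_solution.
Context {R : realType} (n : nat).
Implicit Types (L Ls : ('rV[R]_n -> R) -> 'rV[R]_n -> R)
  (G : 'rV[R]_n -> 'rV[R]_n -> R).

Definition joint G : 'rV[R]_(n + n) -> R := fun z => G (lsubmx z) (rsubmx z).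

Definition fs_integrable G : Prop :=
  [/\ forall y, L1loc (fun x => G x y), forall x, L1loc (fun y => G x y) &
      L1loc (joint G)].

Definition fs_reproducing Ls G : Prop :=
  forall phi, test_fun setT phi ->
    forall y, \int[lebesgue_rV n]_x (G x y * Ls phi x) = - phi y.

Definition fs_solving L Ls G : Prop :=
  forall phi, test_fun setT phi ->
    let u := fun x => \int[lebesgue_rV n]_y (G x y * phi y) in
    [/\ L1loc u,
        (forall psi, test_fun setT psi ->
          \int[lebesgue_rV n]_x (u x * Ls psi x) =
          \int[lebesgue_rV n]_x (- phi x * psi x)) &
        exists us, [/\ smooth us, {ae lebesgue_rV n, forall x, u x = us x} &
                       forall x, L us x = - phi x]].

Definition global_fundamental_solution L Ls G : Prop :=
  [/\ fs_integrable G, fs_reproducing Ls G & fs_solving L Ls G].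

Definition smooth_off_diagonal G : Prop :=
  smooth_on [set z : 'rV[R]_(n + n) | lsubmx z != rsubmx z] (joint G).

Definition jointly_homogeneous (sigma : 'I_n -> nat) (d : int) G : Prop :=
  forall (x y : 'rV[R]_n) (lambda : R), x != y -> 0 < lambda ->
    G (dilation sigma lambda x) (dilation sigma lambda y) =
    lambda ^ d * G x y.

Definition vanishing_at_infinity G : Prop :=
  forall y (eps : R), 0 < eps ->
    exists M : R, forall x, M < `|x| -> `|G x y| < eps.

End fundamental_solution.

(* Main.v *)
(* Let [L~] be the lifted operator on the homogeneous group R^N = R^n x R^p, with dilations
   [D], and let Q be its homogeneous dimension.

   Estimates. If the difference quotients of smooth [u] were not controlled near 0 by the
   sup norms of [u] and of finitely many derivatives of [L~ u], a gliding hump series would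
   give a bounded function with smooth image which is not smooth, against hypoellipticity.
   Rescaling this estimate by [D] yields a Liouville theorem (bounded solutions of [L~ u = 0]
   are constant) and, for the transposed operator, a bound of [phi (0)] by finitely many
   derivatives of [L~* phi], for [phi] supported in the unit ball.

   Kernel on the group. By Hahn-Banach the latter bound gives a local fundamental solution
   [T] at 0. The rescalings [2^(j nu) T (phi o D_(2^j))] differ by smooth functions and converge
   because nu < Q; the limit is homogeneous, smooth off 0 by hypoellipticity, and equals a
   locally integrable function [K] because a homogeneous distribution of this degree which
   is supported at 0 vanishes. Only homogeneity under [D_2] is needed.

   Projection. Put [G (x, y) = \int K ((y, 0)^-1 * (x, xi)) dxi]. Left invariant fields project
   to R^n, so left translation by [(0, eta)] preserves the base coordinates; all the group maps
   involved are triangular by homogeneity, hence preserve Lebesgue measure. This and nu < q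
   give convergence, integrability and decay of [G], and the reproducing property follows
   from that of [K].

   The base. A weak solution on R^n lifts to a weak solution on R^N which is constant along
   the fibres, so regularity and the Liouville theorem descend. Hence two kernels which
   reproduce test functions and vanish at infinity agree; homogeneity and the symmetry
   [G* (x, y) = G (y, x)] are instances of this uniqueness. *)
Require Import Defs.
From mathcomp Require Import all_boot all_order all_algebra.
From mathcomp Require Import all_classical all_reals all_analysis.
From mathcomp Require Import measurable_realfun ring lra.

Set Implicit Arguments.
Unset Strict Implicit.
Unset Printing Implicit Defensive.

Import Order.TTheory GRing.Theory Num.Theory.
Import numFieldNormedType.Exports.

Local Open Scope classical_set_scope.
Local Open Scope ring_scope.

(** * Calculus of smooth functions on row vectors *)

Section epsilon_delta.
Context {R : realType}.

(** Hypoellipticity is qualitative, while the construction needs bounds. The gliding hump converts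
    one into the other, and it needs quantities that pass to pointwise limits: this is why
    difference quotients stand in for derivatives there. Homogeneity does much of the remaining
    work. A continuous function of negative degree vanishes and one of degree zero is constant;
    hence a field of positive weight has [partial i X_i = 0] for each [i], which gives the formal
    transpose, and homogeneous maps are triangular up to sign, which gives their Jacobians without a
    determinant. The exponents enter as follows. [K] has degree nu - Q with Q = q + sum of tau. Then
    nu < Q makes the rescalings converge, nu > 0 makes [K] integrable at the origin and excludes an
    extra term supported there, and nu < q, that is Q - nu > sum of tau, makes the fibre integrals
    converge. Dyadic homogeneity suffices on the group because only geometric series over shells are
    summed; homogeneity for every lambda returns on the base through uniqueness. *)

Lemma cvg_at_normP (U V : normedModType R) (f : U -> V) (x : U) (l : V) :
  (f @ x --> l) <-> (forall e : R, 0 < e ->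
    exists2 d : R, 0 < d & forall y, `|y - x| < d -> `|f y - l| <= e).
Proof.
split=> [/cvgrPdist_le H e /H /nbhs_ballP[d d0 Hd]|H].
  exists d => // y yx; rewrite distrC; apply: Hd.
  by rewrite -ball_normE /= distrC.
apply/cvgrPdist_le => e /H[d d0 Hd]; apply/nbhs_ballP; exists d => //= y.
by rewrite -ball_normE /= distrC => /Hd; rewrite distrC.
Qed.

Lemma cvg_big_sum (T : Type) (F : set_system T) {FF : Filter F} (I : finType)
    (f : I -> T -> R) (l : I -> R) :
  (forall i, f i x @[x --> F] --> l i) ->
  (\sum_i f i x) @[x --> F] --> \sum_i l i.
Proof.
move=> cf; rewrite !unlock /=.
elim: (index_enum I) => [|i s IH] /=; first exact: cvg_cst.
by apply: cvgD => //; exact: cf.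
Qed.

Lemma continuous_normP (U V : normedModType R) (f : U -> V) (x : U) :
  {for x, continuous f} <-> (forall e : R, 0 < e ->
    exists2 d : R, 0 < d & forall y, `|y - x| < d -> `|f y - f x| <= e).
Proof. exact: cvg_at_normP. Qed.

Lemma near_line (V : normedModType R) (P : V -> Prop) (x v : V) :
  (\forall y \near x, P y) -> \forall h \near (0 : R)^', P (h *: v + x).
Proof.
move=> xP.
have H : h *: v + x @[h --> (0 : R)^'] --> x.
  have : h *: v + x @[h --> (0 : R)^'] --> (0 : R) *: v + x.
    apply: cvgD; last exact: cvg_cst.
    by apply: cvgZl; exact: cvg_within.
  by rewrite scale0r add0r.
exact: (H _ xP).
Qed.

Section pointwise_continuity.
Variables (T : topologicalType) (x : T).
Implicit Types f g : T -> R.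

Lemma continuous_at_cst (c : R) : {for x, continuous (fun=> c : R)}.
Proof. exact: cvg_cst. Qed.

Lemma continuous_atD f g : {for x, continuous f} -> {for x, continuous g} ->
  {for x, continuous (fun y => f y + g y)}.
Proof. exact: cvgD. Qed.

Lemma continuous_atM f g : {for x, continuous f} -> {for x, continuous g} ->
  {for x, continuous (fun y => f y * g y)}.
Proof. exact: cvgM. Qed.

Lemma continuous_atV f : f x != 0 -> {for x, continuous f} ->
  {for x, continuous (fun y => (f y)^-1)}.
Proof. by move=> f0 cf; exact: cvgV. Qed.

Lemma continuous_near (U : topologicalType) (f g : T -> U) :
  (\forall y \near x, f y = g y) -> {for x, continuous f} -> {for x, continuous g}.
Proof.
move=> fg cf; have fgx : f x = g x by exact: nbhs_singleton fg.
rewrite /prop_for /continuous_at -fgx; apply: cvg_trans cf.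
by apply: near_eq_cvg.
Qed.

End pointwise_continuity.

End epsilon_delta.

(** * The sup norm, compactness and neighbourhoods on row vectors *)

Section row_vectors.
Context {R : realType}.

Lemma coord_le_norm n (x : 'rV[R]_n) i : `|x 0 i| <= `|x|.
Proof.
rewrite /Num.norm /= mx_normrE; apply/bigmax_geP; right => /=.
by exists (0, i).
Qed.

Lemma norm_rV_le n (x : 'rV[R]_n) (M : R) :
  0 <= M -> (forall i, `|x 0 i| <= M) -> `|x| <= M.
Proof.
move=> M0 xM; rewrite /Num.norm /= mx_normrE; apply/bigmax_leP; split => //= -[i j] _ /=.
by rewrite ord1.
Qed.

Lemma norm_rV_lt n (x : 'rV[R]_n) (M : R) :
  0 < M -> (forall i, `|x 0 i| < M) -> `|x| < M.
Proof.
move=> M0 xM; rewrite /Num.norm /= mx_normrE; apply/bigmax_ltP; split => //= -[i j] _ /=.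
by rewrite ord1.
Qed.

Lemma norm_delta_le n (i : 'I_n) : `|delta_mx 0 i : 'rV[R]_n| <= 1.
Proof.
apply: norm_rV_le => // j; rewrite mxE eqxx /=.
by case: eqP => _; rewrite ?normr1 ?normr0.
Qed.

Lemma cvg_rV T (F : set_system T) {FF : Filter F} n (f : T -> 'rV[R]_n) (l : 'rV[R]_n) :
  (forall i, f x 0 i @[x --> F] --> l 0 i) -> f @ F --> l.
Proof.
move=> cf; apply/cvgrPdist_lt => e e0.
have H : \forall x \near F, forall i, `|l 0 i - f x 0 i| < e.
  by apply: filter_forall => i; have /cvgrPdist_lt := cf i; apply.
apply: filterS H => x H; apply: norm_rV_lt => // i.
by have := H i; rewrite !mxE.
Qed.

Lemma continuous_rV (T : topologicalType) n (f : T -> 'rV[R]_n) x :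
  (forall i, {for x, continuous (fun y => f y 0 i)}) -> {for x, continuous f}.
Proof. by move=> cf; apply: cvg_rV => i; exact: cf. Qed.

Lemma compact_closed_ball_rV n (r : R) : compact [set x : 'rV[R]_n | `|x| <= r].
Proof.
apply: bounded_closed_compact.
  by exists r; split; [exact: num_real|move=> M rM x /=; move/le_trans; apply; exact: ltW].
rewrite (_ : [set x | _] = (fun x : 'rV[R]_n => `|x|) @^-1` [set y | y <= r]) //.
apply: closed_comp; last exact: closed_le.
by move=> x _; exact: norm_continuous.
Qed.

Lemma compact_norm_bound n (K : set 'rV[R]_n) :
  compact K -> exists2 M : R, 0 < M & forall x, K x -> `|x| <= M.
Proof.
move=> /compact_bounded[M [Mr HM]].
exists (`|M| + 1); first by rewrite ltr_wpDl.
by move=> x; apply: HM; rewrite (le_lt_trans (ler_norm M)) // ltrDl.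
Qed.

Lemma compact_closed_rV n (K : set 'rV[R]_n) : compact K -> closed K.
Proof. by apply: compact_closed; exact: norm_hausdorff. Qed.

Lemma compact_continuous_bound (T : topologicalType) (K : set T) (f : T -> R) :
  compact K -> (forall x, K x -> {for x, continuous f}) ->
  exists2 M : R, 0 < M & forall x, K x -> `|f x| <= M.
Proof.
move=> cK cf.
have cfK : {within K, continuous f}.
  by apply: continuous_in_subspaceT => x /set_mem; exact: cf.
have := continuous_compact cfK cK.
move=> /compact_bounded[M [Mr HM]].
exists (`|M| + 1); first by rewrite ltr_wpDl.
move=> x Kx; apply: (HM (`|M| + 1)); last by exists x.
by rewrite (le_lt_trans (ler_norm M)) // ltrDl.
Qed.

Lemma nbhs_norm_lt n (x : 'rV[R]_n) (A : set 'rV[R]_n) :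
  nbhs x A -> exists2 r : R, 0 < r & forall y, `|y - x| < r -> A y.
Proof.
move=> /nbhs_ballP[r r0 rA]; exists r => // y yx; apply: rA.
by rewrite -ball_normE /= distrC.
Qed.

Lemma norm_lt_nbhs n (x : 'rV[R]_n) (A : set 'rV[R]_n) (r : R) :
  0 < r -> (forall y, `|y - x| < r -> A y) -> nbhs x A.
Proof.
move=> r0 rA; apply/nbhs_ballP; exists r => //= y.
by rewrite -ball_normE /= distrC; exact: rA.
Qed.

Lemma open_norm_lt n (x0 : 'rV[R]_n) (r : R) : open [set x | `|x - x0| < r].
Proof.
rewrite openE => x /= xr.
apply: (@norm_lt_nbhs _ _ _ (r - `|x - x0|)); first by rewrite subr_gt0.
move=> y; rewrite ltrBrDr; apply: le_lt_trans.
by rewrite -[y - x0](subrKA x) (le_trans (ler_normD _ _)).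
Qed.

Lemma near_forall (T : topologicalType) (x : T) (I : finType) (P : I -> T -> Prop) :
  (forall i, \forall y \near x, P i y) -> \forall y \near x, forall i, P i y.
Proof. by move=> H; apply: filter_forall. Qed.

End row_vectors.

(** * Mean value theorem along lines, first order expansion, chain rule *)

Section directional_derivative.
Context {R : realType}.

Lemma is_derive_line (V : normedModType R) (f : V -> R) (x v : V) (t : R) :
  derivable f (x + t *: v) v ->
  is_derive t 1 (fun s : R => f (x + s *: v)) ('D_v f (x + t *: v)).
Proof.
move=> df.
have E : (fun h : R => h^-1 *: ((f \o shift (x + t *: v)) (h *: v) - f (x + t *: v))) =
  (fun h : R => h^-1 *: (((fun s : R => f (x + s *: v)) \o shift t) (h *: 1) - f (x + t *: v))).
  apply/funext => h /=; congr (_ *: (f _ - _)).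
  by rewrite [h%:A]mulr1 scalerDl addrCA addrA.
split; first by rewrite /derivable -E.
by rewrite /derive -E.
Qed.

(** Derivability is asked on the symmetric segment so that one statement serves both signs of [t];
    the one-variable theorem is applied on [[t, 0]] or [[0, t]]. *)
Lemma MVT_line (V : normedModType R) (f : V -> R) (x v : V) (t : R) :
  (forall s : R, `|s| <= `|t| -> derivable f (x + s *: v) v) ->
  exists2 s : R, `|s| <= `|t| & f (x + t *: v) - f x = t * 'D_v f (x + s *: v).
Proof.
move=> df.
have dl (s : R) : `|s| <= `|t| ->
    is_derive s 1 (fun s : R => f (x + s *: v)) ('D_v f (x + s *: v)).
  by move=> st; apply: is_derive_line; exact: df.
have cl (a b : R) : (forall s : R, s \in `[a, b] -> `|s| <= `|t|) ->
    {within `[a, b], continuous (fun s : R => f (x + s *: v))}.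
  move=> ab; apply: derivable_within_continuous => s /ab st.
  by have [] := dl _ st.
have [t0|t0|->] := ltgtP t 0.
- have h (s : R) : s \in `[t, 0] -> `|s| <= `|t|.
    rewrite in_itv /= => /andP[ts s0].
    by rewrite ler0_norm // ltr0_norm // lerN2.
  have [||c c0 E] := @MVT_segment R (fun s => f (x + s *: v))
      (fun s => 'D_v f (x + s *: v)) t 0 (ltW t0).
  + by move=> s st; apply: dl; apply: h; apply: subset_itv_oo_cc.
  + exact: cl.
  + exists c; first exact: h.
    move: E; rewrite scale0r addr0 sub0r => /(congr1 -%R); rewrite opprB => ->.
    by rewrite mulrN opprK mulrC.
- have h (s : R) : s \in `[0, t] -> `|s| <= `|t|.
    rewrite in_itv /= => /andP[ts s0].
    by rewrite ger0_norm // gtr0_norm.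
  have [||c c0 E] := @MVT_segment R (fun s => f (x + s *: v))
      (fun s => 'D_v f (x + s *: v)) 0 t (ltW t0).
  + by move=> s st; apply: dl; apply: h; apply: subset_itv_oo_cc.
  + exact: cl.
  + exists c; first exact: h.
    by move: E; rewrite scale0r addr0 subr0 => ->; rewrite mulrC.
- exists 0; first by rewrite normr0.
  by rewrite scale0r addr0 subrr mul0r.
Qed.

Definition C1_at n (f : 'rV[R]_n -> R) (x : 'rV[R]_n) : Prop :=
  (\forall y \near x, forall i : 'I_n, derivable f y (delta_mx 0 i)) /\
  (forall i : 'I_n, {for x, continuous (partial i f)}).

(** The truncations of [h] are the vertices of a path from 0 to [h] whose edges are parallel to the
    axes. *)
Let trunc n (h : 'rV[R]_n) (k : nat) : 'rV[R]_n :=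
  \row_i (if (i < k)%N then h 0 i else 0).

Let truncS n (h : 'rV[R]_n) (k : 'I_n) :
  trunc h k.+1 = trunc h k + h 0 k *: delta_mx 0 k.
Proof.
apply/rowP => i; rewrite !mxE eqxx /= ltnS leq_eqVlt.
have [<-|ik] := eqVneq k i; first by rewrite eqxx /= ltnn mulr1 add0r.
by rewrite mulr0 addr0 -[_ == _ :> nat]/(i == k) eq_sym (negbTE ik).
Qed.

(** Along the path of truncations each edge contributes [h 0 i] times a partial derivative at an
    intermediate point. In the sup norm that point is within [|h|] of [x], so the continuity of the
    partial derivatives at [x] controls the error. *)
Lemma C1_expansion n (f : 'rV[R]_n -> R) (x : 'rV[R]_n) : C1_at f x ->
  forall e : R, 0 < e -> exists2 d : R, 0 < d & forall h : 'rV[R]_n, `|h| < d ->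
    `|f (x + h) - f x - \sum_i h 0 i * partial i f x| <= e * `|h|.
Proof.
move=> [df cf] e e0.
(* [n] errors are added up; dividing by [n.+1] also covers [n = 0]. *)
pose e' : R := e / n.+1%:R.
have e'0 : 0 < e' by rewrite divr_gt0.
have : \forall y \near x, (forall i : 'I_n, derivable f y (delta_mx 0 i)) /\
    (forall i : 'I_n, `|partial i f x - partial i f y| < e').
  have H : \forall y \near x, forall i : 'I_n, `|partial i f x - partial i f y| < e'.
    by apply: near_forall => i; have /cvgrPdist_lt := cf i; apply.
  by near=> y; split; near: y.
move=> /nbhs_norm_lt[d d0 Hd]; exists d => // h hd.
have E : f (x + h) - f x = \sum_(i < n) (f (x + trunc h i.+1) - f (x + trunc h i)).
  rewrite -(big_mkord xpredT (fun i => f (x + trunc h i.+1) - f (x + trunc h i))).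
  rewrite telescope_sumr //; congr (f _ - f _).
    by congr (x + _); apply/rowP => i; rewrite mxE ltn_ord.
  by rewrite (_ : trunc h 0 = 0) ?addr0 //; apply/rowP => i; rewrite !mxE ltn0.
rewrite E -sumrB.
apply: (@le_trans _ _ (\sum_(i < n) e' * `|h|)); last first.
  rewrite sumr_const card_ord -mulr_natr mulrAC ler_wpM2r // /e' -mulrA.
  by rewrite ler_piMr ?(ltW e0) // mulrC ler_pdivrMr // mul1r ler_nat.
apply: le_trans (ler_norm_sum _ _ _) _; apply: ler_sum => i _.
have near_i (s : R) : `|s| <= `|h 0 i| -> `|(x + trunc h i + s *: delta_mx 0 i) - x| < d.
  move=> sh; apply: le_lt_trans hd; rewrite -[x + _ + _]addrA [x + (_ + _)]addrC addrK.
  apply: norm_rV_le => // j; rewrite !mxE eqxx /=.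
  have [->|ij] := eqVneq j i.
    by rewrite ltnn add0r mulr1; apply: le_trans sh _; exact: coord_le_norm.
  rewrite mulr0 addr0; case: ifP => _; last by rewrite normr0.
  exact: coord_le_norm.
rewrite truncS addrA; have [s sh ->] := @MVT_line _ f (x + trunc h i) (delta_mx 0 i) (h 0 i)
  (fun s sh => (Hd _ (near_i s sh)).1 i).
rewrite -mulrBr normrM.
have := (Hd _ (near_i s sh)).2 i; rewrite distrC => /ltW H.
by rewrite mulrC ler_pM // coord_le_norm.
Unshelve. all: by end_near. Qed.


Lemma chain_rule (V : normedModType R) n (F : V -> 'rV[R]_n) (f : 'rV[R]_n -> R)
    (x v : V) : C1_at f (F x) ->
  (forall j, derivable (fun y => F y 0 j) x v) ->
  is_derive x v (f \o F) (\sum_j partial j f (F x) * 'D_v (fun y => F y 0 j) x).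
Proof.
move=> C1f dF.
pose k (h : R) : 'rV[R]_n := F (h *: v + x) - F x.
(* Since the inverse of 0 is 0, [r 0 = 0]. Thus [r] tends to 0 also through steps at which the
   increment [k h] vanishes. *)
pose r (u : 'rV[R]_n) : R := (f (F x + u) - f (F x) - \sum_i u 0 i * partial i f (F x)) / `|u|.
have r0 : r @ (0 : 'rV[R]_n) --> (0 : R).
  apply/cvg_at_normP => e e0.
  have [d d0 Hd] := C1_expansion C1f e0.
  exists d => // u; rewrite subr0 => ud.
  rewrite subr0 /r normrM normfV normr_id.
  have [->|u0] := eqVneq u 0; first by rewrite normr0 invr0 mulr0 ltW.
  by rewrite ler_pdivrMr ?normr_gt0 // Hd.
have kj j : h^-1 * k h 0 j @[h --> 0^'] --> 'D_v (fun y => F y 0 j) x.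
  have := dF j; rewrite /derivable; apply: cvg_trans.
  by apply: near_eq_cvg; near=> h; rewrite /k !mxE.
have kV : (h^-1 *: k h) @[h --> 0^'] --> (\row_j 'D_v (fun y => F y 0 j) x : 'rV[R]_n).
  by apply: cvg_rV => j; rewrite mxE; under eq_fun do rewrite mxE; exact: kj.
have k0 : k @ 0^' --> (0 : 'rV[R]_n).
  have -> : (0 : 'rV[R]_n) = (0 : R) *: (\row_j 'D_v (fun y => F y 0 j) x : 'rV[R]_n).
    by rewrite scale0r.
  have : (h *: (h^-1 *: k h)) @[h --> 0^'] --> (0 : R) *: (\row_j 'D_v (fun y => F y 0 j) x : 'rV[R]_n).
    apply: cvgZ => //; apply: cvg_trans (cvg_within _) _ => //.
  apply: cvg_trans; apply: near_eq_cvg; near=> h.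
  rewrite scalerA divff ?scale1r //; near: h; exact: nbhs_dnbhs_neq.
have lim : h^-1 *: ((f \o F \o shift x) (h *: v) - (f \o F) x) @[h --> 0^'] -->
    \sum_j partial j f (F x) * 'D_v (fun y => F y 0 j) x.
  have : \sum_j partial j f (F x) * (h^-1 * k h 0 j) + h^-1 * `|k h| * r (k h) @[h --> 0^'] -->
    \sum_j partial j f (F x) * 'D_v (fun y => F y 0 j) x + 0.
    apply: cvgD.
      by apply: cvg_big_sum => j; apply: cvgMr; exact: kj.
    apply/norm_cvg0P.
    have -> : (fun h => `|h^-1 * `|k h| * r (k h)|) = (fun h => `|h^-1 *: k h| * `|r (k h)|).
      by apply/funext => h; rewrite !normrM normr_id [in RHS]normrZ.
    have H1 : `|h^-1 *: k h| @[h --> 0^'] --> `|(\row_j 'D_v (fun y => F y 0 j) x : 'rV[R]_n)|.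
      exact: cvg_norm.
    have H2 : `|r (k h)| @[h --> 0^'] --> `|0 : R|.
      by apply: cvg_norm; exact: (cvg_comp _ _ k0 r0).
    rewrite normr0 in H2.
    have : `|h^-1 *: k h| * `|r (k h)| @[h --> 0^'] -->
        `|(\row_j 'D_v (fun y => F y 0 j) x : 'rV[R]_n)| * 0 by exact: cvgM.
    by rewrite mulr0.
  rewrite addr0; apply: cvg_trans; apply: near_eq_cvg; near=> h.
  have -> : (f \o F \o shift x) (h *: v) = f (F x + k h) by rewrite /= /k [F x + _]addrC subrK.
  have -> : forall a b : R, a *: b = a * b by [].
  rewrite /r; under eq_bigr do rewrite mulrCA.
  rewrite -mulr_sumr -mulrA -mulrDr; congr (_ * _).
  have [->|u0] := eqVneq (k h) 0.
    rewrite normr0 mul0r !addr0 subrr; rewrite big1 ?addr0 // => j _.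
    by rewrite mxE mulr0.
  rewrite mulrCA divff ?normr_eq0 // mulr1.
  by under eq_bigr do rewrite mulrC; rewrite addrC subrK.
split; first by apply/cvg_ex; eexists; exact: lim.
exact/cvg_lim.
Unshelve. all: by end_near. Qed.

End directional_derivative.

(** * Smooth functions: a coinduction principle and closure properties *)

Section smooth_functions.
Context {R : realType}.

Lemma is_derive_near (V : normedModType R) (f g : V -> R) (x v : V) :
  (\forall y \near x, f y = g y) -> derivable f x v ->
  is_derive x v g ('D_v f x).
Proof.
move=> fg df.
have fgx : f x = g x by exact: nbhs_singleton fg.
have E : \forall h \near 0^', h^-1 *: ((f \o shift x) (h *: v) - f x) =
    h^-1 *: ((g \o shift x) (h *: v) - g x).
  apply: filterS (near_line v fg) => h /= ->.
  by rewrite fgx.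
have H : h^-1 *: ((g \o shift x) (h *: v) - g x) @[h --> 0^'] --> 'D_v f x.
  by apply: cvg_trans df; apply: near_eq_cvg.
by split; [apply/cvg_ex; eexists; exact: H|exact/cvg_lim].
Qed.

Lemma is_derive_coord n (j : 'I_n) (x v : 'rV[R]_n) :
  is_derive x v (fun y : 'rV[R]_n => y 0 j) (v 0 j).
Proof.
have H : h^-1 *: (((fun y : 'rV[R]_n => y 0 j) \o shift x) (h *: v) - x 0 j)
    @[h --> 0^'] --> v 0 j.
  apply: (@cvg_trans _ ((fun=> v 0 j) @ (0 : R)^')); last exact: cvg_cst.
  apply: near_eq_cvg; near=> h.
  rewrite /= !mxE addrK [_ *: _]mulrA mulVf ?mul1r //; near: h; exact: nbhs_dnbhs_neq.
by split; [apply/cvg_ex; eexists; exact: H|exact/cvg_lim].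
Unshelve. all: by end_near. Qed.

Implicit Types n : nat.

Lemma partial_coord n (i j : 'I_n) (x : 'rV[R]_n) :
  partial i (fun y : 'rV[R]_n => y 0 j) x = (i == j)%:R.
Proof. by rewrite /partial (@derive_val _ _ _ _ _ _ _ (is_derive_coord j x _)) mxE eqxx eq_sym. Qed.

Lemma near_open n (W : set 'rV[R]_n) (P : 'rV[R]_n -> Prop) x :
  open W -> W x -> (forall y, W y -> P y) -> \forall y \near x, P y.
Proof. by move=> oW Wx WP; apply: filterS WP _; exact: open_nbhs_nbhs. Qed.

Lemma partial_eq_on n (W : set 'rV[R]_n) (f g : 'rV[R]_n -> R) (i : 'I_n) : open W ->
  (forall x, W x -> f x = g x) -> forall x, W x -> partial i f x = partial i g x.
Proof.
move=> oW fg x Wx; rewrite /partial /derive (fg x Wx).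
have E : \forall h \near 0^', h^-1 *: ((f \o shift x) (h *: delta_mx 0 i) - g x) =
    h^-1 *: ((g \o shift x) (h *: delta_mx 0 i) - g x).
  by apply: filterS (near_line (delta_mx 0 i) (near_open oW Wx fg)) => h /= ->.
by congr lim; rewrite eqEsubset; split; apply: near_eq_cvg => //; apply: filterS E.
Qed.

Lemma partials_rcons n s (i : 'I_n) (f : 'rV[R]_n -> R) :
  partials (rcons s i) f = partials s (partial i f).
Proof. by rewrite /partials foldr_rcons. Qed.

Lemma partials_cat n s t (f : 'rV[R]_n -> R) :
  partials (s ++ t) f = partials s (partials t f).
Proof. by rewrite /partials foldr_cat. Qed.

Lemma partials_eq_on n (W : set 'rV[R]_n) (f g : 'rV[R]_n -> R) (s : seq 'I_n) : open W ->
  (forall x, W x -> f x = g x) -> forall x, W x -> partials s f x = partials s g x.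
Proof. by move=> oW fg; elim: s => //= i s; exact: partial_eq_on. Qed.

(** Derivatives of members of [P] remain in [P], so information on first derivatives yields all
    orders. The derivative has only to coincide with a member on [W]: the values elsewhere are
    irrelevant to [smooth_on] and the usual formulas may fail there. *)
Lemma smooth_on_coind n (W : set 'rV[R]_n) (P : ('rV[R]_n -> R) -> Prop) : open W ->
  (forall f, P f -> forall x, W x -> {for x, continuous f} /\
    forall i : 'I_n, derivable f x (delta_mx 0 i)) ->
  (forall f (i : 'I_n), P f ->
    exists2 g, P g & forall x, W x -> partial i f x = g x) ->
  forall f, P f -> smooth_on W f.
Proof.
move=> oW P1 P2 f Pf.
have H s : exists2 g, P g & forall x, W x -> partials s f x = g x.
  elim: s => [|i s [g Pg fg]] /=; first by exists f.
  have [g' Pg' gg'] := P2 g i Pg; exists g' => // x Wx.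
  by rewrite -gg' //; exact: (partial_eq_on i oW fg).
move=> s x Wx; have [g Pg fg] := H s.
have [cg dg] := P1 g Pg x Wx.
have gf : \forall y \near x, g y = partials s f y.
  by apply: (near_open oW Wx) => y Wy; rewrite fg.
split; first exact: continuous_near cg.
by move=> i; have [] := is_derive_near gf (dg i).
Qed.

Lemma smooth_on_partials n (W : set 'rV[R]_n) s (f : 'rV[R]_n -> R) :
  smooth_on W f -> smooth_on W (partials s f).
Proof. by move=> sf t x Wx; rewrite -partials_cat; exact: sf. Qed.

Lemma smooth_on_partial n (W : set 'rV[R]_n) i (f : 'rV[R]_n -> R) :
  smooth_on W f -> smooth_on W (partial i f).
Proof. exact: (@smooth_on_partials _ _ [:: i]). Qed.

Lemma smooth_on_continuous n (W : set 'rV[R]_n) (f : 'rV[R]_n -> R) x :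
  smooth_on W f -> W x -> {for x, continuous f}.
Proof. by move=> sf Wx; have [] := sf [::] x Wx. Qed.

Lemma smooth_on_derivable n (W : set 'rV[R]_n) (f : 'rV[R]_n -> R) x (i : 'I_n) :
  smooth_on W f -> W x -> derivable f x (delta_mx 0 i).
Proof. by move=> sf Wx; have [_] := sf [::] x Wx; apply. Qed.

Lemma smooth_on_C1 n (W : set 'rV[R]_n) (f : 'rV[R]_n -> R) x :
  open W -> smooth_on W f -> W x -> C1_at f x.
Proof.
move=> oW sf Wx; split.
  by apply: (near_open oW Wx) => y Wy i; exact: smooth_on_derivable sf Wy.
by move=> i; apply: smooth_on_continuous Wx; exact: smooth_on_partial.
Qed.

Lemma smooth_on_sub n (W W' : set 'rV[R]_n) (f : 'rV[R]_n -> R) :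
  W' `<=` W -> smooth_on W f -> smooth_on W' f.
Proof. by move=> W'W sf s x /W'W; exact: sf. Qed.

Lemma smooth_smooth_on n (W : set 'rV[R]_n) (f : 'rV[R]_n -> R) :
  smooth f -> smooth_on W f.
Proof. exact: smooth_on_sub. Qed.

Lemma smooth_on_ext n (W : set 'rV[R]_n) (f g : 'rV[R]_n -> R) : open W ->
  (forall x, W x -> f x = g x) -> smooth_on W f -> smooth_on W g.
Proof.
move=> oW fg sf s x Wx; have [cf df] := sf s x Wx.
have H : \forall y \near x, partials s f y = partials s g y.
  by apply: (near_open oW Wx) => y Wy; exact: (partials_eq_on s oW fg).
split; first exact: continuous_near cf.
by move=> i; have [] := is_derive_near H (df i).
Qed.

Lemma partial_cst n i (c : R) : partial i (fun=> c : R) = (fun _ : 'rV[R]_n => 0).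
Proof. by apply/funext => x; rewrite /partial derive_cst. Qed.

Lemma smooth_on_cst n (W : set 'rV[R]_n) (c : R) : open W -> smooth_on W (fun=> c).
Proof.
move=> oW; apply: (@smooth_on_coind _ _ (fun f => exists c, f = (fun=> c))) => //.
- move=> _ [{}c ->] x Wx; split; first exact: continuous_at_cst.
  by move=> i; exact: derivable_cst.
- by move=> _ i [{}c ->]; rewrite partial_cst; exists (fun=> 0) => //; exists 0.
- by exists c.
Qed.

Lemma smooth_on_coord n (W : set 'rV[R]_n) j : open W ->
  smooth_on W (fun x : 'rV[R]_n => x 0 j).
Proof.
move=> oW; apply: (@smooth_on_coind _ _
   (fun f => f = (fun x : 'rV[R]_n => x 0 j) \/ exists c, f = (fun=> c))) => //.
- move=> _ [->|[c ->]] x Wx; split.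
  + exact: coord_continuous.
  + by move=> i; have [] := is_derive_coord j x (delta_mx 0 i).
  + exact: continuous_at_cst.
  + by move=> i; exact: derivable_cst.
- move=> _ i [->|[c ->]].
    by exists (fun=> (i == j)%:R) => [|x _]; [right; eexists|rewrite partial_coord].
  by rewrite partial_cst; exists (fun=> 0) => //; right; exists 0.
- by left.
Qed.

Lemma partialD n i (f g : 'rV[R]_n -> R) x :
  derivable f x (delta_mx 0 i) -> derivable g x (delta_mx 0 i) ->
  partial i (fun y => f y + g y) x = partial i f x + partial i g x.
Proof. by move=> df dg; rewrite /partial (deriveD df dg). Qed.

Lemma partialM n i (f g : 'rV[R]_n -> R) x :
  derivable f x (delta_mx 0 i) -> derivable g x (delta_mx 0 i) ->
  partial i (fun y => f y * g y) x = f x * partial i g x + g x * partial i f x.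
Proof. by move=> df dg; rewrite /partial (deriveM df dg). Qed.

Lemma partialZ n i (c : R) (f : 'rV[R]_n -> R) x :
  derivable f x (delta_mx 0 i) ->
  partial i (fun y => c * f y) x = c * partial i f x.
Proof. by move=> df; exact: (deriveZ c df). Qed.

Lemma partialV n i (f : 'rV[R]_n -> R) x : f x != 0 ->
  derivable f x (delta_mx 0 i) ->
  partial i (fun y => (f y)^-1) x = - 1 * (f x)^-1 * (f x)^-1 * partial i f x.
Proof.
move=> f0 df; rewrite /partial (deriveV f0 df).
by rewrite [_ *: _]mulNr mulN1r !mulNr expr2 invfM.
Qed.

Lemma partial_comp n k (W : set 'rV[R]_n) (V : set 'rV[R]_k)
    (F : 'rV[R]_n -> 'rV[R]_k) f x i : open V -> smooth_on V f ->
  (forall j, smooth_on W (fun y => F y 0 j)) -> W x -> V (F x) ->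
  is_derive x (delta_mx 0 i) (fun y => f (F y))
    (\sum_j partial j f (F x) * partial i (fun y => F y 0 j) x).
Proof.
move=> oV sf sF Wx VFx; apply: (@chain_rule R _ k F f x (delta_mx 0 i)).
  exact: smooth_on_C1 VFx.
by move=> j; exact: smooth_on_derivable (sF j) Wx.
Qed.

Inductive smooth_closure n (W : set 'rV[R]_n) : ('rV[R]_n -> R) -> Prop :=
| SC_base f : smooth_on W f -> smooth_closure W f
| SC_add f g : smooth_closure W f -> smooth_closure W g ->
    smooth_closure W (fun x => f x + g x)
| SC_mul f g : smooth_closure W f -> smooth_closure W g ->
    smooth_closure W (fun x => f x * g x)
| SC_inv f : smooth_closure W f -> (forall x, W x -> f x != 0) ->
    smooth_closure W (fun x => (f x)^-1)
| SC_comp k (V : set 'rV[R]_k) (F : 'rV[R]_n -> 'rV[R]_k) f :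
    open V -> smooth_on V f -> (forall x, W x -> V (F x)) ->
    (forall j, smooth_on W (fun x => F x 0 j)) ->
    smooth_closure W (fun x => f (F x)).

Lemma smooth_closure_sum n (W : set 'rV[R]_n) (I : Type) (s : seq I)
    (f : I -> 'rV[R]_n -> R) : open W -> (forall i, smooth_closure W (f i)) ->
  smooth_closure W (fun x => \sum_(i <- s) f i x).
Proof.
move=> oW sf; elim: s => [|i s IH].
  under eq_fun do rewrite big_nil.
  by apply: SC_base; exact: smooth_on_cst.
by under eq_fun do rewrite big_cons; exact: SC_add.
Qed.

Lemma smooth_closure_smooth n (W : set 'rV[R]_n) f : open W ->
  smooth_closure W f -> smooth_on W f.
Proof.
move=> oW; apply: smooth_on_coind => //.
- move=> {}f; elim=> {f} [f sf|f g _ IHf _ IHg|f g _ IHf _ IHg|f _ IHf f0|k V F f oV sf WV sF] x Wx.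
  + by split => [|i]; [exact: smooth_on_continuous Wx|exact: smooth_on_derivable sf Wx].
  + have [cf df] := IHf x Wx; have [cg dg] := IHg x Wx; split; first exact: continuous_atD.
    by move=> i; exact: derivableD.
  + have [cf df] := IHf x Wx; have [cg dg] := IHg x Wx; split; first exact: continuous_atM.
    by move=> i; exact: derivableM.
  + have [cf df] := IHf x Wx; split; first by apply: continuous_atV => //; exact: f0.
    by move=> i; apply: derivableV => //; exact: f0.
  + split.
      apply: (@continuous_comp _ _ _ F f).
        by apply: continuous_rV => j; exact: smooth_on_continuous Wx.
      exact: smooth_on_continuous (WV _ Wx).
    by move=> i; have [] := partial_comp i oV sf sF Wx (WV _ Wx).
(* Derivability is carried along the induction because the sum, product and inverse rules ask for
   it. *)
- move=> {}f i; suff H : smooth_closure W f ->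
    (forall x, W x -> derivable f x (delta_mx 0 i)) /\ exists2 g : 'rV[R]_n -> R, smooth_closure W g &
      forall x, W x -> partial i f x = g x by move=> /H[].
  elim=> {f} [f sf|f g scf [df [f' sf' ff']] scg [dg [g' sg' gg']]|
      f g scf [df [f' sf' ff']] scg [dg [g' sg' gg']]|f scf [df [f' sf' ff']] f0|k V F f oV sf WV sF]; split.
  + by move=> x Wx; exact: smooth_on_derivable sf Wx.
  + by exists (partial i f) => //; apply: SC_base; exact: smooth_on_partial.
  + by move=> x Wx; apply: derivableD; [exact: df|exact: dg].
  + exists (fun x => f' x + g' x); first exact: SC_add.
    by move=> x Wx; rewrite partialD ?ff' ?gg' //; [exact: df|exact: dg].
  + by move=> x Wx; apply: derivableM; [exact: df|exact: dg].
  + exists (fun x => f x * g' x + g x * f' x).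
      by apply: SC_add; exact: SC_mul.
    by move=> x Wx; rewrite partialM ?ff' ?gg' //; [exact: df|exact: dg].
  + by move=> x Wx; apply: derivableV; [exact: f0|exact: df].
  + exists (fun x => -1 * (f x)^-1 * (f x)^-1 * f' x).
      apply: SC_mul => //; apply: SC_mul; last exact: SC_inv.
      by apply: SC_mul; [apply: SC_base; exact: smooth_on_cst|exact: SC_inv].
    by move=> x Wx; rewrite partialV ?ff' //; [exact: f0|exact: df].
  + by move=> x Wx; have [] := partial_comp i oV sf sF Wx (WV _ Wx).
  + exists (fun x => \sum_j partial j f (F x) * partial i (fun y => F y 0 j) x).
      apply: smooth_closure_sum => // j; apply: SC_mul.
        by apply: (@SC_comp _ _ _ V) => //; exact: smooth_on_partial.
      by apply: SC_base; exact: smooth_on_partial.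
    by move=> x Wx; exact: (@derive_val _ _ _ _ _ _ _ (partial_comp i oV sf sF Wx (WV _ Wx))).
Qed.

Lemma smooth_onD n (W : set 'rV[R]_n) (f g : 'rV[R]_n -> R) : open W ->
  smooth_on W f -> smooth_on W g -> smooth_on W (fun x => f x + g x).
Proof. by move=> oW sf sg; apply: smooth_closure_smooth => //; apply: SC_add; exact: SC_base. Qed.

Lemma smooth_onM n (W : set 'rV[R]_n) (f g : 'rV[R]_n -> R) : open W ->
  smooth_on W f -> smooth_on W g -> smooth_on W (fun x => f x * g x).
Proof. by move=> oW sf sg; apply: smooth_closure_smooth => //; apply: SC_mul; exact: SC_base. Qed.

Lemma smooth_onZ n (W : set 'rV[R]_n) c (f : 'rV[R]_n -> R) : open W ->
  smooth_on W f -> smooth_on W (fun x => c * f x).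
Proof. by move=> oW sf; apply: smooth_onM => //; exact: smooth_on_cst. Qed.

Lemma smooth_onN n (W : set 'rV[R]_n) (f : 'rV[R]_n -> R) : open W ->
  smooth_on W f -> smooth_on W (fun x => - f x).
Proof. by move=> oW sf; under eq_fun do rewrite -mulN1r; exact: smooth_onZ. Qed.

Lemma smooth_onB n (W : set 'rV[R]_n) (f g : 'rV[R]_n -> R) : open W ->
  smooth_on W f -> smooth_on W g -> smooth_on W (fun x => f x - g x).
Proof. by move=> oW sf sg; exact: (smooth_onD oW sf (smooth_onN oW sg)). Qed.

Lemma smooth_onV n (W : set 'rV[R]_n) (f : 'rV[R]_n -> R) : open W ->
  smooth_on W f -> (forall x, W x -> f x != 0) -> smooth_on W (fun x => (f x)^-1).
Proof. by move=> oW sf f0; apply: smooth_closure_smooth => //; apply: SC_inv => //; exact: SC_base. Qed.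

Lemma smooth_on_comp n k (W : set 'rV[R]_n) (V : set 'rV[R]_k)
    (F : 'rV[R]_n -> 'rV[R]_k) (f : 'rV[R]_k -> R) : open W -> open V ->
  smooth_on V f -> (forall x, W x -> V (F x)) ->
  (forall j, smooth_on W (fun x => F x 0 j)) ->
  smooth_on W (fun x => f (F x)).
Proof. by move=> oW oV sf WV sF; apply: smooth_closure_smooth => //; exact: (@SC_comp _ _ _ V). Qed.

Lemma smooth_on_sum n (W : set 'rV[R]_n) (I : Type) (s : seq I) (P : pred I)
    (f : I -> 'rV[R]_n -> R) : open W -> (forall i, P i -> smooth_on W (f i)) ->
  smooth_on W (fun x => \sum_(i <- s | P i) f i x).
Proof.
move=> oW sf; elim: s => [|i s IH].
  by under eq_fun do rewrite big_nil; exact: smooth_on_cst.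
have [Pi|Pi] := boolP (P i); last by under eq_fun do rewrite big_cons (negbTE Pi).
by under eq_fun do rewrite big_cons Pi; apply: smooth_onD => //; exact: sf.
Qed.

Lemma smooth_on_prod n (W : set 'rV[R]_n) (I : Type) (s : seq I)
    (f : I -> 'rV[R]_n -> R) : open W -> (forall i, smooth_on W (f i)) ->
  smooth_on W (fun x => \prod_(i <- s) f i x).
Proof.
move=> oW sf; elim: s => [|i s IH].
  by under eq_fun do rewrite big_nil; exact: smooth_on_cst.
by under eq_fun do rewrite big_cons; exact: smooth_onM.
Qed.

Lemma smooth_comp n k (F : 'rV[R]_n -> 'rV[R]_k) (f : 'rV[R]_k -> R) :
  smooth f -> smooth_map F -> smooth (fun x => f (F x)).
Proof. by move=> sf sF; apply: (@smooth_on_comp _ _ _ setT) => //; exact: openT. Qed.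

Lemma smooth_map_comp n k l (F : 'rV[R]_n -> 'rV[R]_k) (G : 'rV[R]_k -> 'rV[R]_l) :
  smooth_map G -> smooth_map F -> smooth_map (fun x => G (F x)).
Proof. by move=> sG sF j; exact: (smooth_comp (sG j)). Qed.

Lemma smooth_continuous n (f : 'rV[R]_n -> R) : smooth f -> continuous f.
Proof. by move=> sf x; exact: smooth_on_continuous sf _. Qed.

Lemma smooth_derivable n (f : 'rV[R]_n -> R) x (i : 'I_n) :
  smooth f -> derivable f x (delta_mx 0 i).
Proof. by move=> sf; exact: smooth_on_derivable sf _. Qed.

Lemma smooth_map_continuous n k (F : 'rV[R]_n -> 'rV[R]_k) :
  smooth_map F -> continuous F.
Proof. by move=> sF x; apply: continuous_rV => i; exact: smooth_continuous. Qed.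

Lemma partial_smooth_comp n k (F : 'rV[R]_n -> 'rV[R]_k) (f : 'rV[R]_k -> R) i x :
  smooth f -> smooth_map F -> partial i (fun y => f (F y)) x =
  \sum_j partial j f (F x) * partial i (fun y => F y 0 j) x.
Proof.
move=> sf sF; have H := @partial_comp n k setT setT F f x i openT sf sF I I.
exact: (@derive_val _ _ _ _ _ _ _ H).
Qed.

End smooth_functions.

(** * Flat functions and smooth cutoffs *)

Section cutoff_functions.
Context {R : realType}.

Lemma is_derive_of_line (V : normedModType R) (f : V -> R) (x v : V) (d : R) :
  is_derive (0 : R) (1 : R) (fun h : R => f (h *: v + x)) d -> is_derive x v f d.
Proof.
have E : (fun h : R => h^-1 *: ((f \o shift x) (h *: v) - f x)) =
  (fun h : R => h^-1 *: (((fun h : R => f (h *: v + x)) \o shift 0) (h *: 1) - f (0 *: v + x))).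
  apply/funext => h /=; congr (_ *: (f _ - f _)).
    by rewrite [h%:A]mulr1 addr0.
  by rewrite scale0r add0r.
by move=> [d1 d2]; split; [rewrite /derivable E|rewrite /derive E].
Qed.

(* The functions [t^-k exp(-1/t)], extended by [0] to [t <= 0], are closed
   under differentiation up to linear combinations. *)
Definition flat_exp (k : nat) (t : R) : R :=
  if 0 < t then t^-1 ^+ k * expR (- t^-1) else 0.

Lemma flat_exp_le0 k t : t <= 0 -> flat_exp k t = 0.
Proof. by rewrite /flat_exp ltNge => ->. Qed.

Lemma flat_exp_ge0 k t : 0 <= flat_exp k t.
Proof.
rewrite /flat_exp; case: ifP => // t0.
by rewrite mulr_ge0 ?expR_ge0 // exprn_ge0 // invr_ge0 ltW.
Qed.

Lemma flat_exp0_gt0 t : 0 < t -> 0 < flat_exp 0 t.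
Proof. by move=> t0; rewrite /flat_exp t0 expr0 mul1r expR_gt0. Qed.

(** With [m = k + 2], raising [1 + x <= expR x] to the power [m] gives (s / m)^m <= expR s at s = 1
    / t. A quadratic bound is what makes the derivative at the origin equal to 0. *)
Lemma flat_exp_le_sqr k t : flat_exp k t <= k.+2%:R ^+ k.+2 * t ^+ 2.
Proof.
rewrite /flat_exp; case: ifPn => [t0|_]; last by rewrite mulr_ge0 ?sqr_ge0 ?exprn_ge0.
set m := k.+2.
have m0 : 0 < m%:R :> R by rewrite ltr0n.
have H : (t^-1 / m%:R) ^+ m <= expR t^-1.
  have {2}-> : t^-1 = m%:R * (t^-1 / m%:R).
    by rewrite mulrC divfK // lt0r_neq0.
  rewrite expRM_natl.
  apply: lerXn2r; rewrite ?nnegrE ?expR_ge0 ?divr_ge0 ?invr_ge0 ?(ltW t0) //.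
  by apply: le_trans (expR_ge1Dx _); rewrite lerDr.
rewrite expRN ler_pdivrMr ?expR_gt0 //.
apply: le_trans (_ : _ <= m%:R ^+ m * t ^+ 2 * (t^-1 / m%:R) ^+ m) _; last first.
  by rewrite ler_wpM2l // mulr_ge0 ?sqr_ge0 ?exprn_ge0.
rewrite -mulrA [t ^+ 2 * _]mulrC mulrA -exprMn [m%:R * _]mulrC divfK ?lt0r_neq0 //.
by rewrite /m -addn2 exprD -mulrA -exprMn mulVf ?lt0r_neq0 // expr1n mulr1.
Qed.

Lemma is_derive_flat_exp k (t : R) :
  is_derive t (1 : R) (flat_exp k) (flat_exp k.+2 t - k%:R * flat_exp k.+1 t).
Proof.
have [t0|t0|->] := ltgtP t 0.
- rewrite !flat_exp_le0 ?(ltW t0) // mulr0 subr0.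
  have -> : (0 : R) = 'D_1 (fun=> 0 : R) t by rewrite derive_cst.
  apply: is_derive_near; last exact: derivable_cst.
  near=> s; rewrite flat_exp_le0 // ltW //.
  by near: s; exact: lt_nbhsl.
- have H : is_derive t (1 : R) (fun s : R => s^-1 ^+ k * expR (- s^-1))
      (flat_exp k.+2 t - k%:R * flat_exp k.+1 t).
    have dV : is_derive t (1 : R) (fun s : R => s^-1) (- t ^- 2).
      have H := @is_deriveV R id t 1 1 (lt0r_neq0 t0) (is_derive_id _ _).
      by apply: (is_derive_eq H); exact: mulr1.
    have dE : is_derive t (1 : R) (fun s : R => expR (- s^-1)) (t ^- 2 * expR (- t^-1)).
      have H := @is_derive1_comp _ expR (fun s => - s^-1) t _ _ (is_derive_expR _) (is_deriveN dV).
      by apply: (is_derive_eq H); rewrite opprK mulrC.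
    have dX : is_derive t (1 : R) (fun s : R => s^-1 ^+ k) (- k%:R * t^-1 ^+ k.+1).
      elim: {+}k => [|j IH].
        under eq_fun do rewrite expr0; rewrite oppr0 mul0r; exact: is_derive_cst.
      under eq_fun do rewrite exprS.
      apply: (is_derive_eq (is_deriveM dV IH)) => /=.
      have E (a b : R) : a *: b = a * b by [].
      by rewrite !E -exprVn -natr1 !exprS expr0; ring.
    apply: (is_derive_eq (is_deriveM dX dE)) => /=.
    have E (a b : R) : a *: b = a * b by [].
    by rewrite /flat_exp t0 !E -exprVn !exprS expr0; ring.
  have := @is_derive_near _ _ _ (flat_exp k) t 1 _ (@ex_derive _ _ _ _ _ _ _ H).
  rewrite (@derive_val _ _ _ _ _ _ _ H); apply.
  near=> s; rewrite /flat_exp ifT //; near: s; exact: lt_nbhsr.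
- rewrite !flat_exp_le0 // mulr0 subr0.
  have L : h^-1 *: ((flat_exp k \o shift 0) (h *: 1) - flat_exp k 0) @[h --> (0 : R)^'] --> (0 : R).
    apply/cvgr0Pnorm_le => e e0.
    near=> h.
    rewrite /= addr0 [h%:A]mulr1 (flat_exp_le0 k (lexx 0)) subr0 normrZ normfV.
    rewrite (ger0_norm (flat_exp_ge0 _ _)).
    have h0 : h != 0 by near: h; exact: nbhs_dnbhs_neq.
    rewrite ler_pdivrMl ?normr_gt0 //.
    apply: le_trans (flat_exp_le_sqr _ _) _.
    rewrite -[h ^+ 2]real_normK ?num_real // expr2 mulrCA ler_wpM2l //.
    rewrite mulrC -ler_pdivlMr ?exprn_gt0 ?ltr0n //.
    by near: h; apply: dnbhs0_le; rewrite divr_gt0 // exprn_gt0 // ltr0n.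
  by split; [apply/cvg_ex; eexists; exact: L|exact/cvg_lim].
Unshelve. all: by end_near. Qed.

Definition flat_comb (l : seq (R * nat)) (t : R) : R :=
  \sum_(c <- l) c.1 * flat_exp c.2 t.

(** Coefficients of [b] times the derivative, read off from [is_derive_flat_exp]. The factor [b] is
    the inner derivative when the argument is affine. *)
Definition flat_comb_derive (b : R) (l : seq (R * nat)) : seq (R * nat) :=
  flatten [seq [:: (b * c.1, c.2.+2); (- (b * c.1 * c.2%:R), c.2.+1)] | c <- l].

Lemma is_derive_flat_comb (b : R) l (t : R) :
  is_derive t (1 : R) (fun s => b * flat_comb l s) (flat_comb (flat_comb_derive b l) t).
Proof.
elim: l => [|[c k] l IH].
  rewrite /flat_comb /flat_comb_derive; under eq_fun do rewrite big_nil mulr0.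
  by rewrite big_nil; exact: is_derive_cst.
rewrite /flat_comb /=; under eq_fun do rewrite big_cons mulrDr /= mulrA.
rewrite !big_cons /=.
have H := is_deriveD (@is_deriveZ _ _ _ _ (b * c) _ _ _ (is_derive_flat_exp k t)) IH.
apply: (is_derive_eq H).
have E (x y : R) : x *: y = x * y by [].
by rewrite E addrA; congr (_ + _); ring.
Qed.

Lemma smooth_flat_comb n l (a b : R) (j : 'I_n) :
  smooth (fun x : 'rV[R]_n => flat_comb l (a + b * x 0 j)).
Proof.
have D l' (x : 'rV[R]_n) (i : 'I_n) :
    is_derive x (delta_mx 0 i) (fun x : 'rV[R]_n => flat_comb l' (a + b * x 0 j))
      (flat_comb (flat_comb_derive (b * (i == j)%:R) l') (a + b * x 0 j)).
  apply: is_derive_of_line.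
  have E : (fun h : R => flat_comb l' (a + b * (h *: delta_mx 0 i + x) 0 j)) =
     flat_comb l' \o (fun h : R => h * (b * (i == j)%:R) + (a + b * x 0 j)).
    by apply/funext => h /=; rewrite !mxE eqxx /= eq_sym; congr flat_comb; ring.
  rewrite E.
  have H1 : is_derive (0 : R) (1 : R) (fun h : R => h * (b * (i == j)%:R) + (a + b * x 0 j)) (b * (i == j)%:R).
    have H := is_deriveD (is_deriveM (is_derive_id (0 : R) (1 : R)) (is_derive_cst (b * (i == j)%:R : R) (0 : R) (1 : R)))
      (is_derive_cst (a + b * x 0 j : R) (0 : R) (1 : R)).
    apply: (is_derive_eq H); have E' (c d : R) : c *: d = c * d by [].
    by rewrite !E' /cst; ring.
  have H2 := is_derive_flat_comb 1 l' ((fun h : R => h * (b * (i == j)%:R) + (a + b * x 0 j)) 0).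
  have {}H2 : is_derive ((fun h : R => h * (b * (i == j)%:R) + (a + b * x 0 j)) 0) (1 : R)
      (flat_comb l') (flat_comb (flat_comb_derive 1 l') (a + b * x 0 j)).
    by move: H2; under eq_fun do rewrite mul1r; rewrite mul0r add0r.
  have H := @is_derive1_comp R _ (fun h : R => h * (b * (i == j)%:R) + (a + b * x 0 j)) 0 _ _ H2 H1.
  apply: (is_derive_eq H).
  rewrite mulrC /flat_comb mulr_sumr /flat_comb_derive.
  elim: l' {E H2 H} => [|c l' IH] /=; first by rewrite !big_nil.
  by rewrite !big_cons /= -IH !mul1r; ring.
apply: (@smooth_on_coind _ _ _ (fun f => exists l, f = (fun x : 'rV[R]_n => flat_comb l (a + b * x 0 j)))).
- exact: openT.
- move=> _ [l' ->] x _; split; last by move=> i; have [] := D l' x i.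
  apply: (@continuous_comp _ _ _ (fun x : 'rV[R]_n => a + b * x 0 j) (flat_comb l')).
    apply: continuous_atD; first exact: continuous_at_cst.
    by apply: continuous_atM; [exact: continuous_at_cst|exact: coord_continuous].
  apply: differentiable_continuous; apply/derivable1_diffP.
  have [+ _] := is_derive_flat_comb 1 l' (a + b * x 0 j).
  by under eq_fun do rewrite mul1r.
- move=> _ i [l' ->]; eexists; first by eexists.
  by move=> x _; rewrite /partial (@derive_val _ _ _ _ _ _ _ (D l' x i)).
- by exists l.
Qed.

Definition smooth_step (t : R) : R :=
  flat_exp 0 t / (flat_exp 0 t + flat_exp 0 (1 - t)).

Lemma smooth_step_denom t : 0 < flat_exp 0 t + flat_exp 0 (1 - t).
Proof.
have [t0|t0] := ltP 0 t.
  by rewrite ltr_pwDl // ?flat_exp0_gt0 // flat_exp_ge0.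
by rewrite ltr_wpDl // ?flat_exp0_gt0 ?flat_exp_ge0 // subr_gt0 (le_lt_trans t0).
Qed.

Lemma smooth_step_ge0 t : 0 <= smooth_step t.
Proof. by rewrite divr_ge0 ?flat_exp_ge0 // ltW // smooth_step_denom. Qed.

Lemma smooth_step_le1 t : smooth_step t <= 1.
Proof. by rewrite ler_pdivrMr ?smooth_step_denom // mul1r lerDl flat_exp_ge0. Qed.

Lemma smooth_step_eq0 t : t <= 0 -> smooth_step t = 0.
Proof. by move=> t0; rewrite /smooth_step flat_exp_le0 // mul0r. Qed.

Lemma smooth_step_eq1 t : 1 <= t -> smooth_step t = 1.
Proof.
move=> t1; have := smooth_step_denom t.
rewrite /smooth_step [flat_exp 0 (1 - t)]flat_exp_le0 ?subr_le0 // addr0 => t0.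
by rewrite divff // lt0r_neq0.
Qed.

Lemma smooth_smooth_step n (a b : R) (j : 'I_n) :
  smooth (fun x : 'rV[R]_n => smooth_step (a + b * x 0 j)).
Proof.
have E (c d : R) : smooth (fun x : 'rV[R]_n => flat_exp 0 (c + d * x 0 j)).
  have := @smooth_flat_comb n [:: (1, 0%N)] c d j.
  by under eq_fun do rewrite /flat_comb big_seq1 /= mul1r.
apply: smooth_onM; [exact: openT|exact: E|].
apply: smooth_onV; first exact: openT.
  apply: smooth_onD; [exact: openT|exact: E|].
  have := E (1 - a) (- b).
  by under eq_fun do rewrite mulNr -addrA -opprD.
by move=> x _; rewrite lt0r_neq0 // smooth_step_denom.
Qed.

(** [k] is a slope. The cutoff vanishes outside the open box with corners [a] and [b] and tends
    pointwise to its indicator as [k] grows, which is how integrals over boxes are reached from test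
    functions. *)
Definition box_cutoff n (k : R) (a b : 'I_n -> R) (x : 'rV[R]_n) : R :=
  \prod_i (smooth_step (k * (x 0 i - a i)) * smooth_step (k * (b i - x 0 i))).

Lemma smooth_box_cutoff n k (a b : 'I_n -> R) : smooth (box_cutoff k a b).
Proof.
apply: smooth_on_prod => [|i]; first exact: openT.
apply: smooth_onM; first exact: openT.
  have := @smooth_smooth_step n (- (k * a i)) k i.
  by under eq_fun do rewrite addrC -mulrBr.
have := @smooth_smooth_step n (k * b i) (- k) i.
by under eq_fun do rewrite mulNr -mulrBr.
Qed.

Lemma box_cutoff_ge0 n k (a b : 'I_n -> R) (x : 'rV[R]_n) : 0 <= box_cutoff k a b x.
Proof. by apply: prodr_ge0 => i _; rewrite mulr_ge0 // smooth_step_ge0. Qed.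

Lemma box_cutoff_le1 n k (a b : 'I_n -> R) (x : 'rV[R]_n) : box_cutoff k a b x <= 1.
Proof.
suff /andP[] : 0 <= box_cutoff k a b x <= 1 by [].
apply: (big_ind (fun y : R => 0 <= y <= 1)) => [|y z /andP[y0 y1] /andP[z0 z1]|i _].
- by rewrite ler01 lexx.
- by rewrite mulr_ge0 //= mulr_ile1.
- by rewrite mulr_ge0 ?smooth_step_ge0 //= mulr_ile1 ?smooth_step_ge0 ?smooth_step_le1.
Qed.

Lemma box_cutoff_eq0 n (k : R) (a b : 'I_n -> R) (x : 'rV[R]_n) : 0 <= k ->
  ~ (forall i, a i < x 0 i < b i) -> box_cutoff k a b x = 0.
Proof.
move=> k0 /existsNP[i]; rewrite /box_cutoff (bigD1 i) //= => H.
have [ax|xa] := ltP (a i) (x 0 i); last first.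
  by rewrite [smooth_step (k * (x 0 i - a i))]smooth_step_eq0 ?mul0r // mulr_ge0_le0 // subr_le0.
have [xb|bx] := ltP (x 0 i) (b i); first by case: H; rewrite ax xb.
by rewrite [smooth_step (k * (b i - x 0 i))]smooth_step_eq0 ?mulr0 ?mul0r // mulr_ge0_le0 // subr_le0.
Qed.

Lemma box_cutoff_eq1 n (k : R) (a b : 'I_n -> R) (x : 'rV[R]_n) :
  (forall i, 1 <= k * (x 0 i - a i) /\ 1 <= k * (b i - x 0 i)) -> box_cutoff k a b x = 1.
Proof.
by move=> H; rewrite /box_cutoff big1 // => i _; have [h1 h2] := H i; rewrite !smooth_step_eq1 // mulr1.
Qed.

Lemma smooth_cutoff n (r s : R) (x0 : 'rV[R]_n) : 0 <= r -> r < s -> exists chi : 'rV[R]_n -> R,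
  [/\ smooth chi, forall x, 0 <= chi x <= 1, forall x, `|x - x0| <= r -> chi x = 1 &
      forall x, s <= `|x - x0| -> chi x = 0].
Proof.
move=> r0 rs; have s0 : 0 < s by exact: le_lt_trans rs.
(* With this slope each factor climbs from 0 at distance [s] to 1 at distance [r]. *)
exists (box_cutoff (s - r)^-1 (fun i => x0 0 i - s) (fun i => x0 0 i + s)); split.
- exact: smooth_box_cutoff.
- by move=> x; rewrite box_cutoff_ge0 box_cutoff_le1.
- move=> x xr; apply: box_cutoff_eq1 => i.
  have := le_trans (coord_le_norm (x - x0) i) xr; rewrite !mxE ler_norml => /andP[h1 h2].
  by rewrite !ler_pdivlMl ?subr_gt0 // !mulr1; split; lra.
- move=> x sx; apply: box_cutoff_eq0; first by rewrite invr_ge0 subr_ge0 ltW.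
  move=> H; have : `|x - x0| < s.
    apply: norm_rV_lt => // i; have /andP[h1 h2] := H i; rewrite !mxE ltr_norml.
    by apply/andP; split; lra.
  by rewrite ltNge sx.
Qed.

End cutoff_functions.
(** * Differential operators built from vector fields *)

Section vector_field_calculus.
Context {R : realType}.
Implicit Types n m : nat.

Lemma partial_scale_add n (i : 'I_n) (a : R) (f g : 'rV[R]_n -> R) x :
  smooth f -> smooth g ->
  partial i (fun y => a * f y + g y) x = a * partial i f x + partial i g x.
Proof.
move=> sf sg; rewrite partialD; last exact: smooth_derivable sg.
- by rewrite partialZ //; exact: smooth_derivable sf.
- by apply: smooth_derivable; exact: (smooth_onZ _ openT sf).
Qed.

Lemma partials_scale_add n (s : seq 'I_n) (a : R) (f g : 'rV[R]_n -> R) x :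
  smooth f -> smooth g ->
  partials s (fun y => a * f y + g y) x = a * partials s f x + partials s g x.
Proof.
elim: s x => //= i s IH x sf sg.
have -> : partials s (fun y => a * f y + g y) = (fun y => a * partials s f y + partials s g y).
  by apply/funext => y; exact: IH.
by rewrite partial_scale_add; [|exact: smooth_on_partials sf|exact: smooth_on_partials sg].
Qed.

Lemma smooth_scale_add n (a : R) (f g : 'rV[R]_n -> R) :
  smooth f -> smooth g -> smooth (fun y => a * f y + g y).
Proof.
by move=> sf sg; exact: (smooth_onD openT (smooth_onZ _ openT sf) sg).
Qed.

Lemma vfapp_scale_add n (X : @vfield R n) (a : R) (f g : 'rV[R]_n -> R) x :
  smooth f -> smooth g ->
  vfapp X (fun y => a * f y + g y) x = a * vfapp X f x + vfapp X g x.
Proof.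
move=> sf sg; rewrite /vfapp mulr_sumr -big_split /=; apply: eq_bigr => i _.
by rewrite (partial_scale_add _ _ _ sf sg) mulrDr mulrCA.
Qed.

Lemma vfapp0 n (X : @vfield R n) : vfapp X (fun=> 0) = (fun=> 0).
Proof.
by apply/funext => x; rewrite /vfapp big1 // => i _; rewrite partial_cst mulr0.
Qed.

Lemma vfappZ n (X : @vfield R n) (a : R) (f : 'rV[R]_n -> R) x :
  smooth f -> vfapp X (fun y => a * f y) x = a * vfapp X f x.
Proof.
move=> sf; have := @vfapp_scale_add n X a f (fun=> 0) x sf (smooth_on_cst _ openT).
by rewrite vfapp0 addr0; under eq_fun do rewrite addr0.
Qed.

Lemma smooth_vfapp n (X : @vfield R n) (f : 'rV[R]_n -> R) :
  smooth_map X -> smooth f -> smooth (vfapp X f).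
Proof.
move=> sX sf; apply: smooth_on_sum => [|i _]; first exact: openT.
exact: (smooth_onM openT (sX i) (smooth_on_partial i sf)).
Qed.

Lemma vfapp_coord n (X : @vfield R n) j x : vfapp X (fun y => y 0 j) x = X x 0 j.
Proof.
rewrite /vfapp (bigD1 j) //= partial_coord eqxx mulr1 big1 ?addr0 // => i /negbTE ij.
by rewrite partial_coord ij mulr0.
Qed.

Lemma vfapp_eq_on n (W : set 'rV[R]_n) (X : @vfield R n) (f g : 'rV[R]_n -> R) : open W ->
  (forall x, W x -> f x = g x) -> forall x, W x -> vfapp X f x = vfapp X g x.
Proof.
move=> oW fg x Wx; apply: eq_bigr => i _; congr (_ * _).
exact: partial_eq_on fg _ Wx.
Qed.

(** * Words in vector fields and the operators they form *)

Section words.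
Variables (n m : nat) (X : 'I_m -> @vfield R n) (w : 'I_m -> nat).
Hypothesis smX : forall i, smooth_map (X i).

Lemma smooth_vf_word I f : smooth f -> smooth (vf_word X I f).
Proof. by move=> sf; elim: I => [|i I IH]; [exact: sf|exact: (smooth_vfapp (smX i) IH)]. Qed.

Lemma vf_word_scale_add I a f g x : smooth f -> smooth g ->
  vf_word X I (fun y => a * f y + g y) x = a * vf_word X I f x + vf_word X I g x.
Proof.
move=> sf sg; elim: I x => //= i I IH x.
have -> : vf_word X I (fun y => a * f y + g y) =
    (fun y => a * vf_word X I f y + vf_word X I g y) by exact/funext.
by rewrite vfapp_scale_add; [|exact: smooth_vf_word sf|exact: smooth_vf_word sg].
Qed.

Lemma vf_word_eq_on (W : set 'rV[R]_n) I f g : open W ->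
  (forall x, W x -> f x = g x) -> forall x, W x -> vf_word X I f x = vf_word X I g x.
Proof. by move=> oW fg; elim: I => //= i I; exact: vfapp_eq_on. Qed.

Lemma smooth_hom_op nu c f : smooth f -> smooth (hom_op X w nu c f).
Proof.
move=> sf; apply: smooth_on_sum => [|k _]; first exact: openT.
apply: smooth_on_sum => [|I _]; first exact: openT.
exact: (smooth_onZ _ openT (smooth_vf_word _ sf)).
Qed.

Lemma hom_op_scale_add nu c a f g x : smooth f -> smooth g ->
  hom_op X w nu c (fun y => a * f y + g y) x =
  a * hom_op X w nu c f x + hom_op X w nu c g x.
Proof.
move=> sf sg; rewrite /hom_op mulr_sumr -big_split /=; apply: eq_bigr => k _.
rewrite mulr_sumr -big_split /=; apply: eq_bigr => I _.
by rewrite (vf_word_scale_add _ _ _ sf sg) mulrDr mulrCA.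
Qed.

Lemma hom_op0 nu c x : hom_op X w nu c (fun=> 0) x = 0.
Proof.
have s0 : smooth (fun _ : 'rV[R]_n => 0 : R) by apply: smooth_on_cst; exact: openT.
have := @hom_op_scale_add nu c (-1) _ _ x s0 s0.
by under eq_fun do rewrite mulr0 addr0; rewrite mulN1r addNr.
Qed.

Lemma hom_opZ nu c a f x : smooth f ->
  hom_op X w nu c (fun y => a * f y) x = a * hom_op X w nu c f x.
Proof.
move=> sf; have s0 : smooth (fun _ : 'rV[R]_n => 0 : R) by apply: smooth_on_cst; exact: openT.
have := @hom_op_scale_add nu c a _ _ x sf s0.
by under eq_fun do rewrite addr0; rewrite hom_op0 addr0.
Qed.

Lemma hom_op_eq_on (W : set 'rV[R]_n) nu c f g : open W ->
  (forall x, W x -> f x = g x) ->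
  forall x, W x -> hom_op X w nu c f x = hom_op X w nu c g x.
Proof.
move=> oW fg x Wx; apply: eq_bigr => k _; apply: eq_bigr => I _; congr (_ * _).
exact: (vf_word_eq_on _ oW fg Wx).
Qed.

Lemma hom_op_supported (K : set 'rV[R]_n) nu c f : closed K ->
  supported_in K f -> supported_in K (hom_op X w nu c f).
Proof.
move=> cK Kf x Kx.
rewrite (@hom_op_eq_on (~` K) nu c f (fun=> 0)) ?hom_op0 //.
exact: closed_openC.
Qed.

Lemma partials_supported (K : set 'rV[R]_n) s (f : 'rV[R]_n -> R) : closed K ->
  supported_in K f -> supported_in K (partials s f).
Proof.
move=> cK Kf x Kx.
rewrite (@partials_eq_on _ _ (~` K) f (fun=> 0) s) //; last exact: closed_openC.
by elim: s x {Kx} => //= i s IH x; rewrite (_ : partials s _ = fun=> 0) ?partial_cst //; exact/funext.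
Qed.

End words.

(** Reversing twice and squaring the sign: whatever is proved for an operator and its transpose can
    be used with the two exchanged. *)
Lemma transpose_coefK m (c : seq 'I_m -> R) : transpose_coef (transpose_coef c) = c.
Proof.
apply/funext => I; rewrite /transpose_coef size_rev revK mulrA -exprMn.
by rewrite mulrNN mulr1 expr1n mul1r.
Qed.

(** * Dilations and homogeneous operators *)

Section dilations.
Variables (n : nat) (e : 'I_n -> nat).

Lemma dilation_coord (l : R) (x : 'rV[R]_n) i : dilation e l x 0 i = l ^+ e i * x 0 i.
Proof. by rewrite mxE. Qed.

Lemma dilation1 (x : 'rV[R]_n) : dilation e 1 x = x.
Proof. by apply/rowP => i; rewrite mxE expr1n mul1r. Qed.

Lemma dilation_dilation (l k : R) (x : 'rV[R]_n) :
  dilation e l (dilation e k x) = dilation e (l * k) x.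
Proof. by apply/rowP => i; rewrite !mxE exprMn mulrA. Qed.

Lemma dilationK (l : R) : l != 0 -> cancel (dilation e l) (dilation e l^-1).
Proof. by move=> l0 x; rewrite dilation_dilation mulVf // dilation1. Qed.

Lemma dilationVK (l : R) : l != 0 -> cancel (dilation e l^-1) (dilation e l).
Proof. by move=> l0 x; rewrite dilation_dilation divff // dilation1. Qed.

Lemma dilation0 (l : R) : dilation e l 0 = 0.
Proof. by apply/rowP => i; rewrite !mxE mulr0. Qed.

Lemma dilation_eq0 (l : R) x : l != 0 -> dilation e l x = 0 -> x = 0.
Proof. by move=> l0 /(congr1 (dilation e l^-1)); rewrite dilationK // dilation0. Qed.

Lemma smooth_dilation (l : R) : smooth_map (dilation e l).
Proof.
move=> j; under eq_fun do rewrite mxE.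
by apply: smooth_onZ; [exact: openT|apply: smooth_on_coord; exact: openT].
Qed.

Lemma partial_dilation (l : R) i (f : 'rV[R]_n -> R) x : smooth f ->
  partial i (f \o dilation e l) x = l ^+ e i * partial i f (dilation e l x).
Proof.
move=> sf; rewrite /comp (partial_smooth_comp _ _ sf); last exact: smooth_dilation.
have E j : partial i (fun y => dilation e l y 0 j) x = l ^+ e j * (i == j)%:R.
  under eq_fun do rewrite mxE.
  rewrite partialZ ?partial_coord //.
  by apply: smooth_derivable; apply: smooth_on_coord; exact: openT.
rewrite (bigD1 i) //= E eqxx mulr1 big1 ?addr0 1?mulrC // => j /negbTE ji.
by rewrite E eq_sym ji !mulr0.
Qed.

Lemma partials_dilation (l : R) s (f : 'rV[R]_n -> R) x : smooth f ->
  partials s (f \o dilation e l) x =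
  l ^+ (\sum_(i <- s) e i)%N * partials s f (dilation e l x).
Proof.
move=> sf; elim: s x => [|i s IH] x /=; first by rewrite big_nil mul1r.
have -> : partials s (f \o dilation e l) =
    (fun y => l ^+ (\sum_(i <- s) e i)%N * (partials s f \o dilation e l) y).
  by apply/funext => y; exact: IH.
have sp : smooth (partials s f) by exact: smooth_on_partials.
rewrite partialZ; last first.
  by apply: smooth_derivable; exact: (smooth_comp sp (smooth_dilation _)).
by rewrite (partial_dilation _ _ _ sp) mulrA big_cons addnC exprD.
Qed.

Section homogeneous_words.
Variables (m : nat) (X : 'I_m -> @vfield R n) (w : 'I_m -> nat).
Hypotheses (smX : forall i, smooth_map (X i))
  (homX : forall i, vf_homogeneous e (X i) (w i)).

Lemma vf_word_dilation I (l : R) u x : 0 < l -> smooth u ->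
  vf_word X I (u \o dilation e l) x =
  l ^+ (\sum_(i <- I) w i)%N * vf_word X I u (dilation e l x).
Proof.
move=> l0 su; elim: I x => [|i I IH] x /=; first by rewrite big_nil mul1r.
have -> : vf_word X I (u \o dilation e l) =
    (fun y => l ^+ (\sum_(i <- I) w i)%N * (vf_word X I u \o dilation e l) y).
  by apply/funext => y; exact: IH.
have sw : smooth (vf_word X I u) by exact: smooth_vf_word.
rewrite vfappZ; last exact: (smooth_comp sw (smooth_dilation _)).
by rewrite (homX _ l0 sw) mulrA big_cons addnC exprD.
Qed.

Lemma hom_op_dilation nu c (l : R) u x : 0 < l -> smooth u ->
  hom_op X w nu c (u \o dilation e l) x = l ^+ nu * hom_op X w nu c u (dilation e l x).
Proof.
move=> l0 su; rewrite /hom_op mulr_sumr; apply: eq_bigr => k _.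
rewrite mulr_sumr; apply: eq_bigr => I /eqP wI.
by rewrite (vf_word_dilation _ _ l0 su) wI mulrCA.
Qed.

End homogeneous_words.

End dilations.

(** * Left invariant operators commute with left translations *)

Section left_invariant_words.
Variables (N m : nat) (mul : 'rV[R]_N -> 'rV[R]_N -> 'rV[R]_N)
  (X : 'I_m -> @vfield R N) (w : 'I_m -> nat).
Hypotheses (linv : forall i, left_invariant mul (X i))
  (smul : forall a, smooth_map (mul a)).

Lemma hom_op_left_translation nu c a u x : smooth u ->
  hom_op X w nu c (u \o mul a) x = hom_op X w nu c u (mul a x).
Proof.
move=> su; rewrite /hom_op; apply: eq_bigr => k _; apply: eq_bigr => I _; congr (_ * _).
elim: (val I) x => [//|i J IH] x /=.
have -> : vf_word X J (u \o mul a) = vf_word X J u \o mul a by exact/funext.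
have [sX ->] := linv i; first by [].
by apply: smooth_vf_word su => j; have [] := linv j.
Qed.

End left_invariant_words.
End vector_field_calculus.
(** * Lebesgue measure and integration on row vectors *)

Section transport_of_measure.
Context {R : realType} {d1 d2 d3 : measure_display} {T1 : measurableType d1}
  {T2 : measurableType d2} {T3 : measurableType d3}.
Local Open Scope ereal_scope.

Definition push_measure (m : {measure set T1 -> \bar R}) (F : T1 -> T2)
    (mF : measurable_fun setT F) : {measure set T2 -> \bar R} :=
  measure_function_pushforward__canonical__measure_function_Measure m mF.

(** [m2] is the image of [m1] under [F]. It is stated as a relation between set functions, so that
    maps can be composed without building image measures, which carry a measurability proof. *)
Definition transports (m1 : set T1 -> \bar R) (m2 : set T2 -> \bar R)
    (F : T1 -> T2) : Prop :=
  measurable_fun setT F /\ forall A, measurable A -> m1 (F @^-1` A) = m2 A.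

Variables (m1 : {measure set T1 -> \bar R}) (m2 : {measure set T2 -> \bar R})
  (F : T1 -> T2).
Hypothesis tF : transports m1 m2 F.

Lemma transports_ge0_integral (f : T2 -> \bar R) : measurable_fun [set: T2] f ->
  (forall y, 0 <= f y) -> \int[m1]_x f (F x) = \int[m2]_y f y.
Proof.
have [mF FE] := tF => mf f0.
rewrite -(@eq_measure_integral _ _ _ _ m2 (push_measure m1 mF)); last by move=> A mA _; exact: FE.
by rewrite (ge0_integral_pushforward mF) // => y _.
Qed.

(** Positive and negative parts are transported separately, so the identity also covers functions
    that are not integrable. *)
Lemma transports_integral (f : T2 -> \bar R) : measurable_fun [set: T2] f ->
  \int[m1]_x f (F x) = \int[m2]_y f y.
Proof.
move=> mf; rewrite integralE [RHS]integralE; congr (_ - _).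
  have := @transports_ge0_integral f^\+ (measurable_funepos mf) (funepos_ge0 f).
  by move=> <-; apply: eq_integral => x _; rewrite ?funeposE ?funenegE.
have := @transports_ge0_integral f^\- (measurable_funeneg mf) (funeneg_ge0 f).
by move=> <-; apply: eq_integral => x _; rewrite ?funeposE ?funenegE.
Qed.

Lemma transports_Rintegral (f : T2 -> R) : measurable_fun setT f ->
  (\int[m1]_x f (F x) = \int[m2]_y f y)%R.
Proof.
move=> mf; rewrite /Rintegral -(@transports_integral (EFin \o f)) //.
exact/measurable_EFinP.
Qed.

Lemma transports_integrable (f : T2 -> R) : measurable_fun setT f ->
  m2.-integrable setT (EFin \o f) <-> m1.-integrable setT (EFin \o (f \o F)).
Proof.
have [mF FE] := tF => mf.
have E : \int[m1]_x `|(f (F x))%:E| = \int[m2]_y `|(f y)%:E|.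
  rewrite (@transports_ge0_integral (fun y => `|(f y)%:E|)) //.
  by apply: measurableT_comp => //; exact/measurable_EFinP.
split=> /integrableP[_ H]; apply/integrableP; split.
- by apply/measurable_EFinP; exact: measurableT_comp mF.
- by rewrite /= E.
- exact/measurable_EFinP.
- by rewrite /= -E.
Qed.

End transport_of_measure.

Lemma transports_comp {R : realType} {d1 d2 d3 : measure_display} {T1 : measurableType d1}
  {T2 : measurableType d2} {T3 : measurableType d3} (m1 : set T1 -> \bar R)
  (m2 : set T2 -> \bar R) (m3 : set T3 -> \bar R) (F : T1 -> T2) (G : T2 -> T3) :
  transports m1 m2 F -> transports m2 m3 G -> transports m1 m3 (G \o F).
Proof.
move=> [mF FE] [mG GE]; split; first exact: measurableT_comp.
move=> A mA; rewrite -GE // -FE // -[X in measurable X]setTI.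
exact: mG.
Qed.

(** * Borel sets, and measurability of continuous maps *)

Section measurable_rV_functions.
Context {R : realType}.

Lemma continuous_at_ext (T U : topologicalType) (f g : T -> U) (x : T) :
  f =1 g -> {for x, continuous g} -> {for x, continuous f}.
Proof. by move=> /funext ->. Qed.

Lemma measurable_ball_rV n (x : 'rV[R]_n) (r : R) : 0 < r ->
  measurable [set y : 'rV[R]_n | `|y - x| < r].
Proof.
move=> r0; rewrite (_ : [set y | _] = [set y : 'rV[R]_n | forall i, `]x 0 i - r, x 0 i + r[%classic (y 0 i)]).
  by apply: (@measurable_rV_box R n (fun i => `]x 0 i - r, x 0 i + r[%classic)) => i; exact: measurable_itv.
apply/seteqP; split=> y /=.
  move=> yx i; have := le_lt_trans (coord_le_norm _ i) yx; rewrite !mxE ltr_norml.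
  by rewrite in_itv /= => /andP[h1 h2]; apply/andP; split; lra.
move=> H; apply: norm_rV_lt => // i; have := H i; rewrite !mxE in_itv /= ltr_norml.
by move=> /andP[h1 h2]; apply/andP; split; lra.
Qed.

(** The sigma-algebra is generated by the coordinates, so balls of the sup norm are measurable as
    boxes, and an open set is a countable union of balls with rational centres and radii
    [k.+1%:R^-1]. A ball that is not contained in [U] contributes the empty set. *)
Lemma open_measurable_rV n (U : set 'rV[R]_n) : open U -> measurable U.
Proof.
move=> oU.
pose c (q : {ffun 'I_n -> rat}) : 'rV[R]_n := \row_i ratr (q i).
pose B (t : {ffun 'I_n -> rat} * nat) : set 'rV[R]_n :=
  [set y | `|y - c t.1| < t.2.+1%:R^-1 /\ (forall z, `|z - c t.1| < t.2.+1%:R^-1 -> U z)].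
have -> : U = \bigcup_t B t.
  apply/seteqP; split => [x Ux|x [t _ [xt]]]; last by apply.
  have /nbhs_norm_lt[r r0 rU] : nbhs x U by exact: open_nbhs_nbhs.
  (* A ball of radius less than r / 2 that contains [x] lies in the ball of radius [r] around
     [x]. *)
  have [k _ kr] : exists2 k, True & (k.+1%:R^-1 : R) < r / 2.
    have r2 : 0 < r / 2 by rewrite divr_gt0.
    have := archi_boundP (ltW (etrans (invr_gt0 _) r2)); set k := Num.bound _ => kr.
    exists k => //.
    rewrite invf_plt ?posrE // (lt_le_trans kr) // ler_nat //.
  have /choice[q Hq] : forall i, exists q : rat, ratr q \in `]x 0 i - k.+1%:R^-1, x 0 i + k.+1%:R^-1[.
    by move=> i; apply: rat_in_itvoo; rewrite ltrD2l gtrN // invr_gt0.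
  have xc : `|x - c [ffun i => q i]| < k.+1%:R^-1.
    apply: norm_rV_lt => // i; have := Hq i; rewrite !mxE ffunE in_itv /= ltr_norml.
    by move: (k.+1%:R^-1 : R) => z /andP[h1 h2]; apply/andP; split; lra.
  exists ([ffun i => q i], k) => //; split => //= z zc; apply: rU.
  rewrite -(subrKA (c [ffun i => q i])) (le_lt_trans (ler_normD _ _)) //.
  by rewrite [X in _ < X]splitr ltrD // ?(lt_trans zc) // distrC (lt_trans xc).
apply: countable_bigcupT_measurable; first exact: countableP.
move=> t; have [H|H] := pselect (forall z, `|z - c t.1| < t.2.+1%:R^-1 -> U z).
  rewrite (_ : B t = [set y | `|y - c t.1| < t.2.+1%:R^-1]); first exact: measurable_ball_rV.
  by apply/seteqP; split => y //= -[].
rewrite (_ : B t = set0); first exact: measurable0.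
by apply/seteqP; split => y //= -[].
Qed.

Lemma closed_measurable_rV n (U : set 'rV[R]_n) : closed U -> measurable U.
Proof.
by move=> cU; rewrite -(setCK U); apply: measurableC; apply: open_measurable_rV; exact: closed_openC.
Qed.

Lemma compact_measurable_rV n (K : set 'rV[R]_n) : compact K -> measurable K.
Proof. by move=> cK; apply: closed_measurable_rV; exact: compact_closed_rV. Qed.

Lemma measurable_fun_open_rV n (W : set 'rV[R]_n) (f : 'rV[R]_n -> R) : open W ->
  (forall x, W x -> {for x, continuous f}) -> measurable_fun W f.
Proof.
move=> oW cf; apply: (measurability _ (RGenOpens.measurableE R)) => _ [_ [a [b ->]] <-].
apply: open_measurable_rV; rewrite openE => x [Wx xab].
apply: filterI; first exact: open_nbhs_nbhs.
by apply: (cf x Wx); apply: open_nbhs_nbhs; split => //; exact: interval_open.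
Qed.

Lemma continuous_measurable_rV n (f : 'rV[R]_n -> R) :
  continuous f -> measurable_fun setT f.
Proof. by move=> cf; apply: measurable_fun_open_rV => [|x _]; [exact: openT|exact: cf]. Qed.

Lemma measurable_restrict_open_rV n (W : set 'rV[R]_n) (f : 'rV[R]_n -> R) : open W ->
  (forall x, W x -> {for x, continuous f}) -> measurable_fun setT (f \_ W).
Proof.
move=> oW cf; have mW := open_measurable_rV oW.
apply/(measurable_restrictT _ mW).
exact: measurable_fun_open_rV.
Qed.

Lemma continuous_map_measurable n k (F : 'rV[R]_n -> 'rV[R]_k) :
  continuous F -> measurable_fun setT F.
Proof.
move=> cF; apply: measurable_fun_rV => i; apply: continuous_measurable_rV => x.
apply: (@continuous_comp _ _ _ F (fun y : 'rV[R]_k => y 0 i)); first exact: cF.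
exact: coord_continuous.
Qed.

Lemma measurable_row_mx d (T : measurableType d) n k (f : T -> 'rV[R]_n) (g : T -> 'rV[R]_k) :
  measurable_fun setT f -> measurable_fun setT g ->
  measurable_fun setT (fun t => row_mx (f t) (g t)).
Proof.
move=> mf mg; apply: measurable_fun_rV => i; case: (split_ordP i) => j ->.
  under eq_fun do rewrite row_mxEl.
  exact: (measurableT_comp (measurable_rV_coord j) mf).
under eq_fun do rewrite row_mxEr.
exact: (measurableT_comp (measurable_rV_coord j) mg).
Qed.

Lemma continuous_lsubmx n k : continuous (@lsubmx R 1 n k).
Proof.
move=> x; apply: continuous_rV => i.
apply: (continuous_at_ext (fun y => mxE _ _ _ _)); exact: coord_continuous.
Qed.

Lemma continuous_rsubmx n k : continuous (@rsubmx R 1 n k).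
Proof.
move=> x; apply: continuous_rV => i.
apply: (continuous_at_ext (fun y => mxE _ _ _ _)); exact: coord_continuous.
Qed.

Lemma continuous_row_mx (T : topologicalType) n k (f : T -> 'rV[R]_n) (g : T -> 'rV[R]_k) x :
  {for x, continuous f} -> {for x, continuous g} ->
  {for x, continuous (fun t => row_mx (f t) (g t))}.
Proof.
move=> cf cg; apply: continuous_rV => i; case: (split_ordP i) => j ->.
  apply: (continuous_at_ext (fun y => row_mxEl _ _ _ _)).
  by apply: (@continuous_comp _ _ _ f (fun y : 'rV[R]_n => y 0 j)) => //; exact: coord_continuous.
apply: (continuous_at_ext (fun y => row_mxEr _ _ _ _)).
by apply: (@continuous_comp _ _ _ g (fun y : 'rV[R]_k => y 0 j)) => //; exact: coord_continuous.
Qed.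

Lemma measurable_lsubmx n k : measurable_fun setT (@lsubmx R 1 n k).
Proof. by apply: continuous_map_measurable; exact: continuous_lsubmx. Qed.

Lemma measurable_rsubmx n k : measurable_fun setT (@rsubmx R 1 n k).
Proof. by apply: continuous_map_measurable; exact: continuous_rsubmx. Qed.

End measurable_rV_functions.

(** * Maps preserving Lebesgue measure: shears and triangular maps *)

Section lebesgue_rV_transport.
Context {R : realType}.
Local Open Scope ereal_scope.
Local Notation leb := (@lebesgue_measure R).
Local Notation lebV n := (@lebesgue_rV R n).

Let boxes n : set (set 'rV[R]_n) :=
  [set B | exists2 A : 'I_n -> set (measurableTypeR R), (forall i, measurable (A i)) &
     B = [set x : 'rV[R]_n | forall i, A i (x 0%R i)]].

(** Boxes with measurable sides are stable under intersection and generate the sigma-algebra; the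
    cubes [g k] exhaust the space and have finite measure. *)
Lemma lebesgue_rV_unique n (mu : {measure set 'rV[R]_n -> \bar R}) :
  (forall A : 'I_n -> set (measurableTypeR R), (forall i, measurable (A i)) ->
    mu [set x : 'rV[R]_n | forall i, A i (x 0%R i)] = \prod_i leb (A i)) ->
  forall B, measurable B -> mu B = lebV n B.
Proof.
move=> muE B mB; apply/esym.
pose g (k : nat) : set 'rV[R]_n := [set x | forall i, (`[(- k%:R)%R, k%:R%R]%classic : set R) (x 0%R i)].
apply: (measure_unique (@boxes n) g) => //.
- apply/seteqP; split => [A|A].
    move=> mA; apply: mA; split; first exact: smallest_sigma_algebra.
    move=> {}A; rewrite -bigcup_seq => -[i _ [C mC <-]].
    apply: sub_sigma_algebra.
    exists (fun j => if j == i then C else setT); first by move=> j; case: ifP.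
    rewrite setTI; apply/seteqP; split => x /=.
      by move=> Cx j; case: eqP => [->|].
    by move=> /(_ i); rewrite eqxx.
  apply: smallest_sub; first exact: sigma_algebra_measurable.
  by move=> _ [C mC ->]; exact: measurable_rV_box.
- move=> _ _ [A mA ->] [C mC ->]; exists (fun i => A i `&` C i).
    by move=> i; exact: measurableI.
  apply/seteqP; split => x /=; first by move=> [h1 h2] i.
  by move=> h; split => i; have [] := h i.
- by move=> k; exists (fun=> `[(- k%:R)%R, k%:R%R]%classic) => // i; exact: measurable_itv.
- apply/seteqP; split => // x _.
  exists (Num.bound `|x|) => // i /=; rewrite in_itv /= -ler_norml.
  rewrite (le_trans (coord_le_norm _ _)) // ltW //.
  by have := archi_boundP (normr_ge0 x).
- by move=> _ [A mA ->]; rewrite muE //; exact: lebesgue_rV_box.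
- move=> k.
  have E : lebV n (g k) = \prod_(i < n) leb `[(- k%:R)%R, k%:R%R]%classic.
    by apply: (@lebesgue_rV_box R n (fun=> `[(- k%:R)%R, k%:R%R]%classic)) => i; exact: measurable_itv.
  suff : \prod_(i < n) leb `[(- k%:R)%R, k%:R%R]%classic \is a fin_num.
    by move=> H; apply: (eq_ind_r (fun z => z < +oo) _ E); rewrite ltey_eq H.
  apply: (big_ind (fun y : \bar R => y \is a fin_num)) => // [x y|i _]; first exact: fin_numM.
  by rewrite lebesgue_measure_itv /=; case: ifP.
Qed.

Lemma measurable_affine (s b : R) :
  measurable_fun [set: measurableTypeR R] (fun x : measurableTypeR R => s * x + b : measurableTypeR R)%R.
Proof.
by apply: measurable_funD => //; apply: measurable_funM.
Qed.

(** Uniqueness of Lebesgue measure is tested on half-open intervals. A negative slope exchanges the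
    closed and the open end, hence the two cases. *)
Lemma lebesgue_measure_affine (s b : R) (A : set (measurableTypeR R)) : s != 0%R -> measurable A ->
  leb A = `|s|%:E * leb ((fun x => s * x + b)%R @^-1` A).
Proof.
move=> s0 mA.
pose mu : {measure set (measurableTypeR R) -> \bar R} :=
  mscale (NngNum (normr_ge0 s)) (push_measure leb (measurable_affine s b)).
rewrite -[RHS]/(mu A).
apply: (@lebesgue_measure_unique R mu) => // X [[a c] _ <-] /=.
rewrite /mscale /= /pushforward.
have [s_lt0|s_gt0|s00] := ltgtP s 0%R; last by rewrite s00 eqxx in s0.
- rewrite (_ : _ @^-1` _ = `[((c - b) / s)%R, ((a - b) / s)%R[%classic); last first.
    apply/seteqP; split => x /=; rewrite !in_itv /= => /andP[h1 h2]; apply/andP; split.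
    + by rewrite ler_ndivrMr // mulrC; lra.
    + by rewrite ltr_ndivlMr // mulrC; lra.
    + by move: h2; rewrite ltr_ndivlMr // mulrC; lra.
    + by move: h1; rewrite ler_ndivrMr // mulrC; lra.
  rewrite !lebesgue_measure_itv /= !lte_fin ltr_nM2r ?invr_lt0 // ltrD2r.
  case: ifPn => _; last by rewrite mule0.
  rewrite -!EFinD -EFinM ltr0_norm //; congr EFin.
  by field.
- rewrite (_ : _ @^-1` _ = `]((a - b) / s)%R, ((c - b) / s)%R]%classic); last first.
    apply/seteqP; split => x /=; rewrite !in_itv /= => /andP[h1 h2]; apply/andP; split.
    + by rewrite ltr_pdivrMr // mulrC; lra.
    + by rewrite ler_pdivlMr // mulrC; lra.
    + by move: h1; rewrite ltr_pdivrMr // mulrC; lra.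
    + by move: h2; rewrite ler_pdivlMr // mulrC; lra.
  rewrite !lebesgue_measure_itv /= !lte_fin ltr_pM2r ?invr_gt0 // ltrD2r.
  case: ifPn => _; last by rewrite mule0.
  rewrite -!EFinD -EFinM gtr0_norm //; congr EFin.
  by field.
Qed.

Definition affine_rV n (s b : 'I_n -> R) (x : 'rV[R]_n) : 'rV[R]_n :=
  \row_i (s i * x 0%R i + b i)%R.

Lemma measurable_affine_rV n (s b : 'I_n -> R) : measurable_fun setT (affine_rV s b).
Proof.
apply: measurable_fun_rV => i; under eq_fun do rewrite mxE.
exact: (measurableT_comp (measurable_affine (s i) (b i)) (measurable_rV_coord i)).
Qed.

Lemma lebesgue_rV_affine n (s b : 'I_n -> R) A : (forall i, s i != 0%R) -> measurable A ->
  lebV n A = (\prod_i `|s i|)%R%:E * lebV n (affine_rV s b @^-1` A).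
Proof.
move=> s0 mA; apply/esym.
have P0 : (0 <= \prod_i `|s i|)%R by apply: prodr_ge0.
pose mu := mscale (NngNum P0) (push_measure (lebV n) (measurable_affine_rV s b)).
rewrite -[LHS]/(mu A); apply: lebesgue_rV_unique => // B mB.
rewrite /mu /= /mscale /= /pushforward.
rewrite (_ : _ @^-1` _ = [set x : 'rV[R]_n | forall i, ((fun t => s i * t + b i)%R @^-1` B i) (x 0%R i)]); last first.
  by apply/seteqP; split => x /= H i; have := H i; rewrite mxE.
rewrite (@lebesgue_rV_box R n (fun i => (fun t => s i * t + b i)%R @^-1` B i)); last first.
  by move=> i; have := measurable_affine (s i) (b i) measurableT (mB i); rewrite setTI.
rewrite -prodEFin -big_split /=; apply: eq_bigr => i _.
by rewrite -(lebesgue_measure_affine (b i) (s0 i) (mB i)).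
Qed.

Definition rV_insert n (i : 'I_n.+1) (z : 'rV[R]_n * measurableTypeR R) : 'rV[R]_n.+1 :=
  \row_j (if unlift i j is Some k then z.1 0%R k else z.2).

Lemma measurable_rV_insert n (i : 'I_n.+1) : measurable_fun setT (rV_insert i).
Proof.
apply: measurable_fun_rV => j; under eq_fun do rewrite mxE.
case: (unlift i j) => [k|]; last exact: measurable_snd.
exact: (measurableT_comp (measurable_rV_coord k) measurable_fst).
Qed.

(** Singles out the coordinate [i], so that Fubini can be used with that coordinate innermost. *)
Lemma transports_insert n (i : 'I_n.+1) :
  transports (lebV n \x leb) (lebV n.+1) (rV_insert i).
Proof.
split; first exact: measurable_rV_insert.
move=> A mA; rewrite -[LHS]/(push_measure (lebV n \x leb) (measurable_rV_insert i) A).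
apply: lebesgue_rV_unique => // B mB; rewrite /= /pushforward.
have mC : measurable [set v : 'rV[R]_n | forall k, B (lift i k) (v 0%R k)].
  exact: (@measurable_rV_box R n (fun k => B (lift i k))).
rewrite (_ : _ @^-1` _ = [set v : 'rV[R]_n | forall k, B (lift i k) (v 0%R k)] `*` B i); last first.
  apply/seteqP; split => -[v t] /=.
    move=> H; split => [k|]; [have := H (lift i k)|have := H i]; rewrite mxE ?liftK ?unlift_none //.
  move=> [H Ht] j; rewrite mxE; case: (unliftP i j) => [k ->|-> //]; exact: H.
have E : lebV n [set v : 'rV[R]_n | forall k, B (lift i k) (v 0%R k)] = \prod_(k < n) leb (B (lift i k)).
  exact: (@lebesgue_rV_box R n (fun k => B (lift i k))).
rewrite product_measure1E // [X in X * _]E muleC.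
by rewrite (bigD1_ord i).
Qed.

Lemma transports_row_mx n k :
  transports (lebV n \x lebV k) (lebV (n + k)) (fun z => row_mx z.1 z.2).
Proof.
have mF : measurable_fun [set: 'rV[R]_n * 'rV[R]_k] (fun z => row_mx z.1 z.2).
  by apply: measurable_row_mx; [exact: measurable_fst|exact: measurable_snd].
split => // A mA; rewrite -[LHS]/(push_measure (lebV n \x lebV k) mF A).
apply: lebesgue_rV_unique => // B mB; rewrite /= /pushforward.
have m1 : measurable [set v : 'rV[R]_n | forall j, B (lshift k j) (v 0%R j)].
  exact: (@measurable_rV_box R n (fun j => B (lshift k j))).
have m2 : measurable [set v : 'rV[R]_k | forall j, B (rshift n j) (v 0%R j)].
  exact: (@measurable_rV_box R k (fun j => B (rshift n j))).
rewrite (_ : _ @^-1` _ = [set v : 'rV[R]_n | forall j, B (lshift k j) (v 0%R j)] `*`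
     [set v : 'rV[R]_k | forall j, B (rshift n j) (v 0%R j)]); last first.
  apply/seteqP; split => -[v t] /=.
    move=> H; split => j; [have := H (lshift k j)|have := H (rshift n j)].
      by rewrite row_mxEl.
    by rewrite row_mxEr.
  by move=> [H1 H2] j; case: (split_ordP j) => l ->; rewrite ?row_mxEl ?row_mxEr.
have E1 := @lebesgue_rV_box R n (fun j => B (lshift k j)) (fun j => mB _).
have E2 := @lebesgue_rV_box R k (fun j => B (rshift n j)) (fun j => mB _).
by rewrite product_measure1E // [X in X * _]E1 [X in _ * X]E2 big_split_ord.
Qed.

(** With the coordinate [i] innermost, [F] acts on each line as t -> t + h or t -> - t + h, where
    [h] is constant on the line because [g] does not see that coordinate. *)
Lemma shear_preserves n (i : 'I_n) (b : bool) (g : 'rV[R]_n -> R) (F : 'rV[R]_n -> 'rV[R]_n) :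
  measurable_fun setT g ->
  (forall x y : 'rV[R]_n, (forall j, j != i -> x 0%R j = y 0%R j) -> g x = g y) ->
  (forall (x : 'rV[R]_n) j, F x 0%R j = if j == i then ((-1) ^+ b * x 0%R i + g x)%R else x 0%R j) ->
  transports (lebV n) (lebV n) F.
Proof.
case: n i g F => [[]//|n] i g F mg gi FE.
have mF : measurable_fun setT F.
  apply: measurable_fun_rV => j; under eq_fun do rewrite FE.
  case: eqP => _; last exact: measurable_rV_coord.
  apply: measurable_funD => //; apply: measurable_funM => //.
  exact: measurable_rV_coord.
split => // A mA.
have [mI IE] := transports_insert i.
have mFA : measurable (F @^-1` A) by rewrite -[X in measurable X]setTI; exact: mF.
have mIA B : measurable B -> measurable (rV_insert i @^-1` B).
  by move=> mB; rewrite -[X in measurable X]setTI; exact: mI.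
rewrite -!IE //; rewrite /product_measure1 /=.
apply: eq_integral => v _ /=.
pose h := g (rV_insert i (v, 0%R : measurableTypeR R)).
have mX : measurable (xsection (rV_insert i @^-1` A) v) by apply: measurable_xsection; exact: mIA.
have s0 : ((-1) ^+ b != 0 :> R)%R by rewrite signr_eq0.
rewrite [RHS](lebesgue_measure_affine h s0 mX) normr_sign mul1e.
have E t : F (rV_insert i (v, t)) = rV_insert i (v, ((-1) ^+ b * t + h)%R).
  apply/rowP => j; rewrite FE !mxE unlift_none.
  have -> : g (rV_insert i (v, t)) = h.
    by apply: gi => k ki; rewrite !mxE; case: unliftP ki => // ->; rewrite eqxx.
  by case: unliftP => [k ->|->]; rewrite ?eqxx // eq_sym (negbTE (neq_lift _ _)).
by congr (leb _); apply/seteqP; split => t; rewrite /xsection /= !inE /= E.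
Qed.

(* Composing shears, the coordinates of largest weight are changed first. *)
Lemma triangular_preserves n (e : 'I_n -> nat) (b : 'I_n -> bool)
    (g : 'I_n -> 'rV[R]_n -> R) (F : 'rV[R]_n -> 'rV[R]_n) :
  (forall i, measurable_fun setT (g i)) ->
  (forall i (x y : 'rV[R]_n), (forall j, (e j < e i)%N -> x 0%R j = y 0%R j) -> g i x = g i y) ->
  (forall (x : 'rV[R]_n) i, F x 0%R i = ((-1) ^+ b i * x 0%R i + g i x)%R) ->
  transports (lebV n) (lebV n) F.
Proof.
move=> mg gi FE.
(* [FA A] changes only the coordinates in [A], which is kept closed under passing to larger
   weights. *)
pose FA (A : {set 'I_n}) (x : 'rV[R]_n) : 'rV[R]_n := \row_i (if i \in A then F x 0%R i else x 0%R i).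
suff H (A : {set 'I_n}) : (forall i j, i \in A -> (e i < e j)%N -> j \in A) -> transports (lebV n) (lebV n) (FA A).
  have -> : F = FA (finset xpredT) by apply/funext => x; apply/rowP => i; rewrite mxE inE.
  by apply: H => i j _ _; rewrite inE.
have [k] := ubnP #|A|; elim: k A => // k IH A; rewrite ltnS => Ak upA.
have [->|[i0 i0A]] := set_0Vmem A.
  have -> : FA finset.set0 = id by apply/funext => x; apply/rowP => i; rewrite mxE inE.
  by split; [exact: measurable_id|].
(* [i] has least weight in [A]. The coordinates on which [g i] depends therefore lie outside [A] and
   are unchanged after [FA A'], so the last factor is a shear. *)
case: (arg_minnP e i0A) => i iA imin.
pose A' := A :\ i.
have A'E : FA A = (fun x => FA (finset (pred1 i)) x) \o FA A'.
  apply/funext => x; apply/rowP => j; rewrite !mxE inE.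
  rewrite /= in_setD1; have [->|ji //] := eqVneq j i.
  have -> : i \in A by exact: iA.
  rewrite !FE mxE in_setD1 eqxx /=; congr (_ + _)%R.
  apply: gi => l lt_li; rewrite mxE in_setD1.
  by case: ifP => // /andP[_ lA]; have := imin l lA; rewrite leqNgt lt_li.
rewrite A'E; apply: transports_comp.
  apply: IH; first by rewrite (leq_trans _ Ak) // [X in (_ < X)%N](cardsD1 i) (iA : i \in A).
  move=> j l; rewrite !in_setD1 => /andP[ji jA] jl; rewrite (upA j l jA jl) andbT.
  by apply: contraTneq jl => ->; rewrite -leqNgt imin.
apply: (@shear_preserves n i (b i) (g i)).
- exact: mg.
- by move=> x y xy; apply: gi => j ji; apply: xy; apply: contraTneq ji => ->; rewrite ltnn.
- by move=> x j; rewrite mxE inE /=; case: eqP => [->|//]; rewrite FE.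
Qed.

End lebesgue_rV_transport.

(** * Integrable functions, Fubini and change of scale *)

Section integrals_on_rV.
Context {R : realType}.
Local Notation lebV n := (@lebesgue_rV R n).

Definition Rintegrable d (T : measurableType d) (m : set T -> \bar R) (f : T -> R) : Prop :=
  integrable m setT (EFin \o f).

Lemma lebesgue_rV_compact_lty n (K : set 'rV[R]_n) : compact K -> (lebV n K < +oo)%E.
Proof.
move=> cK; have [M M0 KM] := compact_norm_bound cK.
have mB := @measurable_rV_box R n (fun=> `[- M, M]%classic) (fun=> measurable_itv _).
apply: (@le_lt_trans _ _ (lebV n [set x : 'rV[R]_n | forall i, `[- M, M]%classic (x 0 i)])).
  apply: le_measure; rewrite ?inE //; first exact: compact_measurable_rV.
  move=> x /KM xM i /=; rewrite in_itv /= -ler_norml.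
  exact: le_trans (coord_le_norm _ _) xM.
have E := @lebesgue_rV_box R n (fun=> `[- M, M]%classic) (fun=> measurable_itv _).
apply: (eq_ind_r (fun z => z < +oo)%E _ E).
suff H : (\prod_(i < n) lebesgue_measure (`[(- M)%R, M%R]%classic : set R))%E \is a fin_num.
  by rewrite ltey_eq H.
apply: (big_ind (fun y : \bar R => y \is a fin_num)) => // [x y|i _]; first exact: fin_numM.
by rewrite lebesgue_measure_itv /=; case: ifP.
Qed.

Lemma L1loc_mul_integrable n (v f : 'rV[R]_n -> R) (K : set 'rV[R]_n) (M : R) :
  L1loc v -> measurable_fun setT f -> compact K -> supported_in K f ->
  (forall x, `|f x| <= M) -> Rintegrable (lebV n) (fun x => v x * f x).
Proof.
move=> [mv vK] mf cK Kf fM; apply/integrableP; split.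
  by apply/measurable_EFinP; exact: measurable_funM.
have M0 : 0 <= M by apply: le_trans (fM 0).
have mK := compact_measurable_rV cK.
apply: (@le_lt_trans _ _ (\int[lebV n]_(x in K) (M%:E * `|v x|%:E))%E).
  rewrite [leRHS]integral_mkcond; apply: ge0_le_integral => //=.
  - by apply/measurable_EFinP; apply: measurableT_comp => //; exact: measurable_funM.
  - apply/(measurable_restrictT _ mK); apply: measurable_funS (measurableT) _ _ => //.
    apply: measurable_funeM; apply/measurable_EFinP; exact: measurableT_comp.
  - move=> x _; rewrite patchE; case: ifPn => [_|/negP xK].
      by rewrite -EFinM lee_fin normrM mulrC ler_wpM2r.
    by rewrite Kf ?mulr0 ?normr0 // => Kx; apply: xK; rewrite inE.
rewrite ge0_integralZl //; last first.
  apply: measurable_funS (measurableT) _ _ => //.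
  by apply/measurable_EFinP; exact: measurableT_comp.
by apply: lte_mul_pinfty; rewrite ?lee_fin //; exact: vK.
Qed.

Lemma L1loc_bounded n (f : 'rV[R]_n -> R) : measurable_fun setT f ->
  (forall K : set 'rV[R]_n, compact K -> exists M, forall x, K x -> `|f x| <= M) -> L1loc f.
Proof.
move=> mf fK; split => // K cK; have [M KM] := fK K cK.
have mK := compact_measurable_rV cK.
apply: (@le_lt_trans _ _ (\int[lebV n]_(x in K) `|M|%:E)%E).
  apply: ge0_le_integral => //.
  - apply: measurable_funS (measurableT) _ _ => //.
    by apply/measurable_EFinP; exact: measurableT_comp.
  - by move=> x Kx; rewrite lee_fin (le_trans (KM x Kx)) // ler_norm.
rewrite integral_cst //; apply: lte_mul_pinfty; rewrite ?lee_fin //.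
exact: lebesgue_rV_compact_lty.
Qed.

Lemma L1loc_continuous n (f : 'rV[R]_n -> R) : continuous f -> L1loc f.
Proof.
move=> cf; apply: L1loc_bounded; first exact: continuous_measurable_rV.
move=> K cK; have [M M0 KM] := compact_continuous_bound cK (fun x _ => cf x).
by exists M.
Qed.

Lemma bounded_supported_integrable n (f : 'rV[R]_n -> R) (K : set 'rV[R]_n) (M : R) :
  measurable_fun setT f -> compact K -> supported_in K f ->
  (forall x, `|f x| <= M) -> Rintegrable (lebV n) f.
Proof.
move=> mf cK Kf fM; have : L1loc (fun _ : 'rV[R]_n => 1 : R) by apply: L1loc_continuous => x; exact: continuous_at_cst.
move=> /L1loc_mul_integrable /(_ mf cK Kf fM); rewrite /Rintegrable.
by under eq_fun do rewrite mul1r.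
Qed.

Lemma supported_bound n (f : 'rV[R]_n -> R) (K : set 'rV[R]_n) : continuous f ->
  compact K -> supported_in K f -> exists2 M : R, 0 < M & forall x, `|f x| <= M.
Proof.
move=> cf cK Kf; have [M M0 KM] := compact_continuous_bound cK (fun x _ => cf x).
exists M => // x; have [/KM //|/Kf ->] := pselect (K x).
by rewrite normr0 ltW.
Qed.

Lemma supported_integrable n (f : 'rV[R]_n -> R) (K : set 'rV[R]_n) :
  continuous f -> compact K -> supported_in K f -> Rintegrable (lebV n) f.
Proof.
move=> cf cK Kf; have [M _ fM] := supported_bound cf cK Kf.
by apply: bounded_supported_integrable cK Kf fM; exact: continuous_measurable_rV.
Qed.

Section product_Rintegral.
Context {d1 d2 : measure_display} {T1 : measurableType d1} {T2 : measurableType d2}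
  (m1 : {sigma_finite_measure set T1 -> \bar R}) (m2 : {sigma_finite_measure set T2 -> \bar R}).
Variable f : T1 * T2 -> R.

(** The inner integral is [fine] of a difference of two Tonelli integrals, each measurable in the
    parameter. Fibre integrals are thus measurable even where they diverge. *)
Lemma measurable_Rintegral_snd : measurable_fun setT f ->
  measurable_fun setT (fun x => \int[m2]_y f (x, y)).
Proof.
move=> mf; have mEf : measurable_fun setT (EFin \o f) by exact/measurable_EFinP.
rewrite /Rintegral.
apply: (measurableT_comp (fine_measurable measurableT)).
under eq_fun do rewrite integralE.
apply: emeasurable_funB.
  have := @measurable_fun_fubini_tonelli_F _ _ T1 T2 R m2 ((EFin \o f)^\+)%E (measurable_funepos mEf) (funepos_ge0 _).
  by apply: eq_measurable_fun => x _; apply: eq_integral => y _; rewrite !funeposE.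
have := @measurable_fun_fubini_tonelli_F _ _ T1 T2 R m2 ((EFin \o f)^\-)%E (measurable_funeneg mEf) (funeneg_ge0 _).
by apply: eq_measurable_fun => x _; apply: eq_integral => y _; rewrite !funenegE.
Qed.

Hypothesis intf : Rintegrable (m1 \x m2)%E f.

Let mEf : measurable_fun setT (EFin \o f).
Proof. by case/integrableP: intf. Qed.

Lemma Rintegral_prod_fst : \int[(m1 \x m2)%E]_z f z = \int[m1]_x \int[m2]_y f (x, y).
Proof.
rewrite /Rintegral -(integral12_prod_meas1 intf); congr fine.
(* The inner extended integral is finite only almost everywhere; elsewhere [fine] substitutes a
   default value. *)
apply: ae_eq_integral => //.
- exact: (measurable_fubini_F intf).
- apply/measurable_EFinP; apply: measurable_Rintegral_snd; exact/measurable_EFinP.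
- have := ae_integrable1 intf; apply: filterS => x ix _.
  by rewrite /Rintegral fineK //; exact: integrable_fin_num ix.
Qed.

Lemma Rintegrable_prod_fst : Rintegrable m1 (fun x => \int[m2]_y f (x, y)).
Proof.
have := integrable_fubini_F intf.
move=> /integrableP[mF Foo]; apply/integrableP; split.
  by apply/measurable_EFinP; apply: measurable_Rintegral_snd; exact/measurable_EFinP.
rewrite (ae_eq_integral (fun x => `|fubini_F m2 (EFin \o f) x|)%E) //.
- apply: measurableT_comp => //; apply/measurable_EFinP; apply: measurable_Rintegral_snd; exact/measurable_EFinP.
- exact: measurableT_comp.
- have := ae_integrable1 intf; apply: filterS => x ix _ /=.
  rewrite -abse_EFin /Rintegral fineK //; exact: integrable_fin_num ix.
Qed.

End product_Rintegral.

Lemma Rintegral_prod_snd {d1 d2 : measure_display} {T1 : measurableType d1} {T2 : measurableType d2}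
  (m1 : {sigma_finite_measure set T1 -> \bar R}) (m2 : {sigma_finite_measure set T2 -> \bar R})
  (f : T1 * T2 -> R) : Rintegrable (m1 \x m2)%E f ->
  \int[(m1 \x m2)%E]_z f z = \int[m2]_y \int[m1]_x f (x, y).
Proof.
move=> intf; have mf : measurable_fun setT f by case/integrableP: intf => /measurable_EFinP.
rewrite /Rintegral -(integral21_prod_meas1 intf); congr fine.
apply: ae_eq_integral => //.
- exact: (measurable_fubini_G intf).
- apply/measurable_EFinP.
  apply: (@measurable_Rintegral_snd _ _ T2 T1 m1 (fun z => f (z.2, z.1))).
  by apply: (measurableT_comp mf); apply: measurable_fun_pair; [exact: measurable_snd|exact: measurable_fst].
- have := ae_integrable2 intf; apply: filterS => x ix _.
  by rewrite /Rintegral fineK //; exact: integrable_fin_num ix.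
Qed.

(** * Fubini for a splitting into two blocks of coordinates *)

Section split_rV.
Variables n k : nat.

Lemma ge0_integral_row (f : 'rV[R]_(n + k) -> \bar R) : measurable_fun setT f ->
  (forall z, 0 <= f z)%E ->
  (\int[lebV (n + k)]_z f z = \int[lebV n]_x \int[lebV k]_y f (row_mx x y))%E.
Proof.
move=> mf f0; have tr := @transports_row_mx R n k.
rewrite -(transports_ge0_integral tr mf f0) fubini_tonelli1 //.
by apply: (measurableT_comp mf); have [] := tr.
Qed.

Variable f : 'rV[R]_(n + k) -> R.

Lemma measurable_Rintegral_row : measurable_fun setT f ->
  measurable_fun setT (fun x : 'rV[R]_n => \int[lebV k]_y f (row_mx x y)).
Proof.
move=> mf; apply: (@measurable_Rintegral_snd _ _ 'rV[R]_n 'rV[R]_k (lebV k) (fun z => f (row_mx z.1 z.2))).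
by apply: (measurableT_comp mf); have [] := @transports_row_mx R n k.
Qed.

Lemma Rintegrable_rowP : measurable_fun setT f ->
  Rintegrable (lebV (n + k)) f <->
  (\int[lebV n]_x \int[lebV k]_y `|f (row_mx x y)|%:E < +oo)%E.
Proof.
move=> mf; have mf' : measurable_fun setT (fun z => `|f z|%:E).
  by apply/measurable_EFinP; exact: measurableT_comp.
rewrite -(ge0_integral_row mf') //; split => [/integrableP[]//|H].
by apply/integrableP; split => //; exact/measurable_EFinP.
Qed.

Hypothesis intf : Rintegrable (lebV (n + k)) f.

Let mf : measurable_fun setT f.
Proof. by case/integrableP: intf => /measurable_EFinP. Qed.

Let intf' : Rintegrable (lebV n \x lebV k)%E (fun z => f (row_mx z.1 z.2)).
Proof. exact/(transports_integrable (@transports_row_mx R n k) mf). Qed.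

Lemma Rintegral_row : \int[lebV (n + k)]_z f z = \int[lebV n]_x \int[lebV k]_y f (row_mx x y).
Proof.
rewrite -(transports_Rintegral (@transports_row_mx R n k) mf).
exact: (Rintegral_prod_fst intf').
Qed.

Lemma Rintegral_row_swap : \int[lebV (n + k)]_z f z = \int[lebV k]_y \int[lebV n]_x f (row_mx x y).
Proof.
rewrite -(transports_Rintegral (@transports_row_mx R n k) mf).
exact: (Rintegral_prod_snd intf').
Qed.

Lemma Rintegrable_row : Rintegrable (lebV n) (fun x => \int[lebV k]_y f (row_mx x y)).
Proof. exact: (Rintegrable_prod_fst intf'). Qed.

End split_rV.

Lemma preserves_translation n (b : 'rV[R]_n) : transports (lebV n) (lebV n) (fun x => x + b).
Proof.
have E : (fun x : 'rV[R]_n => x + b) = affine_rV (fun=> 1) (fun i => b 0 i).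
  by apply/funext => x; apply/rowP => i; rewrite !mxE mul1r.
split; first by rewrite E; exact: measurable_affine_rV.
move=> A mA; rewrite E [RHS](@lebesgue_rV_affine R n (fun=> 1) (fun i => b 0 i)) //.
by rewrite big1 ?mul1e // => i _; rewrite normr1.
Qed.

Lemma measurable_dilation n (e : 'I_n -> nat) (l : R) : measurable_fun setT (dilation e l).
Proof. by apply: continuous_map_measurable; apply: smooth_map_continuous; exact: smooth_dilation. Qed.

Lemma lebesgue_rV_dilation n (e : 'I_n -> nat) (l : R) A : 0 < l -> measurable A ->
  (lebV n A = (l ^+ (\sum_i e i)%N)%:E * lebV n (dilation e l @^-1` A))%E.
Proof.
move=> l0 mA; rewrite [LHS](@lebesgue_rV_affine R n (fun i => l ^+ e i) (fun=> 0)) //; last first.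
  by move=> i; rewrite lt0r_neq0 // exprn_gt0.
have -> : affine_rV (fun i => l ^+ e i) (fun=> 0) = dilation e l.
  by apply/funext => x; apply/rowP => i; rewrite !mxE addr0.
congr (_%:E * _)%E; rewrite expr_sum; apply: eq_bigr => i _.
by rewrite gtr0_norm // exprn_gt0.
Qed.

Lemma ge0_integral_dilation n (e : 'I_n -> nat) (l : R) (f : 'rV[R]_n -> \bar R) : 0 < l ->
  measurable_fun setT f -> (forall x, 0 <= f x)%E ->
  (\int[lebV n]_x f x = (l ^+ (\sum_i e i)%N)%:E * \int[lebV n]_x f (dilation e l x))%E.
Proof.
move=> l0 mf f0.
have L0 : 0 <= l ^+ (\sum_i e i)%N by rewrite exprn_ge0 // ltW.
rewrite (@eq_measure_integral _ _ _ _ (mscale (NngNum L0) (push_measure (lebV n) (measurable_dilation e l)))); last first.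
  by move=> A mA _; exact: lebesgue_rV_dilation.
rewrite ge0_integral_mscale //; congr (_ * _)%E.
by rewrite (ge0_integral_pushforward (measurable_dilation e l)).
Qed.

Lemma Rintegrable_dilation n (e : 'I_n -> nat) (l : R) (f : 'rV[R]_n -> R) : 0 < l ->
  Rintegrable (lebV n) f -> Rintegrable (lebV n) (f \o dilation e l).
Proof.
move=> l0 /integrableP[/measurable_EFinP mf foo]; apply/integrableP; split.
  by apply/measurable_EFinP; apply: (measurableT_comp mf); exact: measurable_dilation.
have mf' : measurable_fun setT (fun z => `|f z|%:E).
  by apply/measurable_EFinP; exact: measurableT_comp.
move: foo; rewrite (ge0_integral_dilation e l0 mf') //.
have L0 : 0 < l ^+ (\sum_i e i)%N by rewrite exprn_gt0.
rewrite !ltey_eq; case: (\int[_]_x _)%E => //=.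
by rewrite mulry gtr0_sg // mul1e.
Qed.

(** Covers functions that are not integrable: a positive factor keeps the infinite values of the
    positive and negative parts, hence also the default value returned by [fine]. This is the
    purpose of the case analysis. *)
Lemma Rintegral_dilation n (e : 'I_n -> nat) (l : R) (f : 'rV[R]_n -> R) : 0 < l ->
  measurable_fun setT f ->
  \int[lebV n]_x f x = l ^+ (\sum_i e i)%N * \int[lebV n]_x f (dilation e l x).
Proof.
move=> l0 mf; have mEf : measurable_fun setT (EFin \o f) by exact/measurable_EFinP.
have L0 : 0 < l ^+ (\sum_i e i)%N by rewrite exprn_gt0.
rewrite /Rintegral integralE [in RHS]integralE.
rewrite (ge0_integral_dilation e l0 (measurable_funepos mEf)) //.
rewrite (ge0_integral_dilation e l0 (measurable_funeneg mEf)) //.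
have -> : (\int[lebV n]_x ((fun x => (f (dilation e l x))%:E)^\+ x) = \int[lebV n]_x (EFin \o f)^\+ (dilation e l x))%E.
  by apply: eq_integral => x _; rewrite !funeposE.
have -> : (\int[lebV n]_x ((fun x => (f (dilation e l x))%:E)^\- x) = \int[lebV n]_x (EFin \o f)^\- (dilation e l x))%E.
  by apply: eq_integral => x _; rewrite !funenegE.
case: (\int[_]_x _)%E => [a| |]; case: (\int[_]_x _)%E => [c| |] //=.
- by rewrite mulrBr.
- by rewrite mulry gtr0_sg // mul1e /= mulr0.
- by rewrite mulrNy gtr0_sg // mul1e /= mulr0.
- by rewrite mulry gtr0_sg // mul1e /= mulr0.
- by rewrite mulry gtr0_sg // mul1e /= mulr0.
- by rewrite mulry mulrNy gtr0_sg // !mul1e /= mulr0.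
- by rewrite mulrNy gtr0_sg // mul1e /= mulr0.
- by rewrite mulry mulrNy gtr0_sg // !mul1e /= mulr0.
- by rewrite mulrNy gtr0_sg // !mul1e /= mulr0.
Qed.

End integrals_on_rV.

(** * Dominated convergence and differentiation under the integral *)

Section limits_and_integrals.
Context {R : realType} {d : measure_display} {T : measurableType d}
  (mu : {measure set T -> \bar R}).

Lemma Rintegrable_measurable (f : T -> R) : Rintegrable mu f -> measurable_fun setT f.
Proof. by case/integrableP => /measurable_EFinP. Qed.

Lemma Rintegrable_le (f g : T -> R) : measurable_fun setT f -> Rintegrable mu g ->
  (forall x, `|f x| <= g x) -> Rintegrable mu f.
Proof.
move=> mf ig fg; apply: (le_integrable measurableT _ _ ig); first exact/measurable_EFinP.
by move=> x _ /=; rewrite lee_fin (le_trans (fg x)) // ler_norm.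
Qed.

Lemma RintegrableD (f g : T -> R) : Rintegrable mu f -> Rintegrable mu g ->
  Rintegrable mu (fun x => f x + g x).
Proof. by move=> If Ig; exact: (integrableD measurableT If Ig). Qed.

Lemma RintegrableN (f : T -> R) : Rintegrable mu f -> Rintegrable mu (fun x => - f x).
Proof. by move=> If; exact: (integrableN If). Qed.

Lemma RintegrableB (f g : T -> R) : Rintegrable mu f -> Rintegrable mu g ->
  Rintegrable mu (fun x => f x - g x).
Proof. by move=> If Ig; exact: (RintegrableD If (RintegrableN Ig)). Qed.

Lemma RintegrableZ (c : R) (f : T -> R) : Rintegrable mu f -> Rintegrable mu (fun x => c * f x).
Proof. by move=> If; exact: (integrableZl measurableT _ If). Qed.

Lemma Rintegrable0 : Rintegrable mu (fun=> 0).
Proof. exact: integrable0. Qed.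

Lemma Rintegrable_abs (f : T -> R) : Rintegrable mu f -> Rintegrable mu (fun x => `|f x|).
Proof.
move=> If; apply: (le_integrable measurableT _ _ If).
  by apply/measurable_EFinP; apply: measurableT_comp => //; exact: Rintegrable_measurable.
by move=> x _ /=; rewrite normr_id.
Qed.

Lemma Rintegral_big_sum (I : Type) (s : seq I) (P : pred I) (f : I -> T -> R) :
  (forall i, P i -> Rintegrable mu (f i)) ->
  Rintegrable mu (fun x => \sum_(i <- s | P i) f i x) /\
  \int[mu]_x (\sum_(i <- s | P i) f i x) = \sum_(i <- s | P i) \int[mu]_x f i x.
Proof.
move=> If; elim: s => [|i s [IH1 IH2]].
  under eq_fun do rewrite big_nil; rewrite big_nil; split; first exact: Rintegrable0.
  by rewrite /Rintegral integral0.
have [Pi|Pi] := boolP (P i); last first.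
  under eq_fun do rewrite big_cons (negbTE Pi).
  by rewrite big_cons (negbTE Pi).
under eq_fun do rewrite big_cons Pi.
rewrite big_cons Pi; split; first by apply: RintegrableD => //; exact: If.
by rewrite RintegralD // ?IH2 //; exact: If.
Qed.

Lemma norm_Rintegral_le (f g : T -> R) : measurable_fun setT f -> Rintegrable mu g ->
  (forall x, `|f x| <= g x) -> `|\int[mu]_x f x| <= \int[mu]_x g x.
Proof.
move=> mf ig fg; have If := Rintegrable_le mf ig fg.
apply: le_trans (le_normr_Rintegral measurableT If) _.
by apply: le_Rintegral => //; exact: Rintegrable_abs.
Qed.

Lemma Rdominated_cvg (f_ : nat -> T -> R) (f g : T -> R) :
  (forall k, measurable_fun setT (f_ k)) ->
  (forall x, f_ k x @[k --> \oo] --> f x) -> Rintegrable mu g ->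
  (forall k x, `|f_ k x| <= g x) ->
  Rintegrable mu f /\ \int[mu]_x f_ k x @[k --> \oo] --> \int[mu]_x f x.
Proof.
move=> mf_ f_f ig f_g.
have fg x : `|f x| <= g x.
  have cN : `|f_ k x| @[k --> \oo] --> `|f x| by apply: cvg_norm; exact: f_f.
  rewrite -(cvg_lim _ cN) //; apply: limr_le; first by apply/cvg_ex; eexists; exact: cN.
  by apply: nearW => k.
have mf : measurable_fun setT f.
  exact: (measurable_fun_cvg mf_ (fun x _ => f_f x)).
have If : Rintegrable mu f by exact: Rintegrable_le ig fg.
split => //; apply: fine_cvg; rewrite fineK; last exact: (integrable_fin_num measurableT If).
apply: (@dominated_cvg _ _ _ mu setT measurableT (fun k x => (f_ k x)%:E) (EFin \o f) (EFin \o g)) => //.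
- by move=> k; exact/measurable_EFinP.
- by move=> x _; apply: cvg_EFin; [exact: nearW|exact: f_f].
- by move=> k x _; rewrite lee_fin.
Qed.

(** Dominated convergence concerns sequences, so a failure of continuity is turned into points [u k]
    tending to [t0] at which the integral stays at distance more than [e]. *)
Lemma continuous_Rintegral (U : normedModType R) (F : U -> T -> R) (t0 : U) (g : T -> R) (r : R) :
  0 < r -> (forall t, `|t - t0| < r -> measurable_fun setT (F t)) ->
  (forall x, {for t0, continuous (F^~ x)}) -> Rintegrable mu g ->
  (forall t x, `|t - t0| < r -> `|F t x| <= g x) ->
  {for t0, continuous (fun t => \int[mu]_x F t x)}.
Proof.
move=> r0 mF cF ig Fg; apply/continuous_normP => e e0; apply: contrapT => H.
have /choice[u Hu] : forall k : nat, exists y, `|y - t0| < Num.min r k.+1%:R^-1 /\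
    e < `|\int[mu]_x F y x - \int[mu]_x F t0 x|.
  move=> k; apply: contrapT => H2; apply: H; exists (Num.min r k.+1%:R^-1).
    by rewrite lt_min r0 invr_gt0 ltr0n.
  by move=> y yd; rewrite leNgt; apply/negP => H3; apply: H2; exists y.
have ut : u @ \oo --> t0.
  apply/cvgrPdist_lt => eps eps0; near=> k.
  rewrite distrC; have [+ _] := Hu k; rewrite lt_min => /andP[_ /lt_le_trans]; apply.
  near: k; have [k0 _ Hk] := near_infty_natSinv_lt (PosNum eps0).
  by exists k0 => // k /= k0k; apply: ltW; exact: Hk.
have [_ L] : Rintegrable mu (F t0) /\ \int[mu]_x F (u k) x @[k --> \oo] --> \int[mu]_x F t0 x.
  apply: (@Rdominated_cvg _ _ g) => // [k|x|k x].
  - by apply: mF; have [+ _] := Hu k; rewrite lt_min => /andP[].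
  - exact: (cvg_comp _ _ ut (cF x)).
  by apply: Fg; have [+ _] := Hu k; rewrite lt_min => /andP[].
have /cvgrPdist_lt/(_ e e0)[k _ /(_ k (leqnn k))] := L.
by have [_ h1] := Hu k; rewrite distrC => h2; have := lt_trans h1 h2; rewrite ltxx.
Unshelve. all: by end_near. Qed.

Lemma is_derive_Rintegral (V : normedModType R) (F : V -> T -> R) (t0 v : V) (g : T -> R) (r : R) :
  0 < r -> (forall t, `|t - t0| < r -> Rintegrable mu (F t)) ->
  (forall t x, `|t - t0| < r -> derivable (F^~ x) t v) -> Rintegrable mu g ->
  (forall t x, `|t - t0| < r -> `|'D_v (F^~ x) t| <= g x) ->
  is_derive t0 v (fun t => \int[mu]_x F t x) (\int[mu]_x 'D_v (F^~ x) t0).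
Proof.
move=> r0 IF dF ig Fg.
(* Keeps [t0 + h *: v] in the ball of radius [r] for [|h| < rho]; the added 1 allows [v = 0]. *)
pose rho := r / (`|v| + 1).
have v0 : 0 < `|v| + 1 by rewrite ltr_wpDl.
have rho0 : 0 < rho by rewrite divr_gt0.
have near_h (h : R) : `|h| < rho -> `|(t0 + h *: v) - t0| < r.
  move=> hr; rewrite addrC addKr normrZ.
  apply: le_lt_trans (_ : `|h| * (`|v| + 1) < r); first by rewrite ler_wpM2l // lerDl.
  by rewrite -ltr_pdivlMr.
pose f (h : R) (x : T) := F (t0 + h *: v) x.
have inI (h : R) : (`]- rho, rho[%classic : set R) h -> `|h| < rho by rewrite /= in_itv /= -ltr_norml.
have dl (h : R) x : `|h| < rho -> is_derive h 1 (f^~ x) ('D_v (F^~ x) (t0 + h *: v)).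
  by move=> hr; apply: (@is_derive_line _ _ (F^~ x)); apply: dF; exact: near_h.
have I0 : (`]- rho, rho[%classic : set R) 0 by rewrite /= in_itv /= oppr_lt0 rho0.
have H := @cvg_differentiation_under_integral R d T mu f setT measurableT 0 (- rho) rho I0.
apply: is_derive_of_line.
have E : (fun h : R => \int[mu]_x F (h *: v + t0) x) = (fun h : R => \int[mu]_x f h x).
  by apply/funext => h; rewrite /f addrC.
rewrite E.
have E2 : \int[mu]_x 'D_v (F^~ x) t0 = \int[mu]_y (partial1of2 f 0 y).
  apply: eq_Rintegral => x _; rewrite partial1of2E.
  rewrite (@derive_val _ _ _ _ _ _ _ (dl 0 x _)) ?normr0 //.
  by rewrite scale0r addr0.
rewrite E2.
have {}H : h^-1 *: ((fun h : R => \int[mu]_x f h x) (h + 0) - (fun h : R => \int[mu]_x f h x) 0)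
    @[h --> 0^'] --> \int[mu]_y (partial1of2 f 0 y).
  have g0 x : 0 <= g x by apply: le_trans (Fg t0 x _); rewrite ?subrr ?normr0.
  apply: (H _ _ g g0 ig).
  - by move=> h /inI hr; apply: IF; exact: near_h.
  - by move=> h x /inI hr _; have [] := dl h x hr.
  - move=> h x /inI hr _; rewrite partial1of2E (@derive_val _ _ _ _ _ _ _ (dl h x hr)).
    by apply: Fg; exact: near_h.
have E3 : (fun h : R => h^-1 *: (((fun h : R => \int[mu]_x f h x) \o shift 0) (h *: 1) - \int[mu]_x f 0 x)) =
    (fun h : R => h^-1 *: ((fun h : R => \int[mu]_x f h x) (h + 0) - (fun h : R => \int[mu]_x f h x) 0)).
  by apply/funext => h /=; rewrite [h%:A]mulr1.
split; first by rewrite /derivable E3; apply/cvg_ex; eexists; exact: H.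
by rewrite /derive E3; exact/cvg_lim.
Qed.

End limits_and_integrals.

(** * Integration by parts for fields with [partial i X_i = 0] *)

Section integration_by_parts.
Context {R : realType}.
Local Notation lebV n := (@lebesgue_rV R n).
Implicit Types n : nat.

Lemma smooth_supported_integrable n (f : 'rV[R]_n -> R) K : smooth f -> compact K ->
  supported_in K f -> Rintegrable (lebV n) f.
Proof. by move=> /smooth_continuous cf; exact: supported_integrable. Qed.

(* By translation invariance the difference quotients of [f] have integral 0. *)
Lemma integral_partial n (i : 'I_n) (f : 'rV[R]_n -> R) K : smooth f -> compact K ->
  supported_in K f -> \int[lebV n]_x partial i f x = 0.
Proof.
move=> sf cK Kf; have [M M0 KM] := compact_norm_bound cK.
have cclK := compact_closed_rV cK.
have spf : smooth (partial i f) by exact: smooth_on_partial.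
have Kpf : supported_in K (partial i f) by exact: (@partials_supported _ _ _ [:: i]).
have [C C0 fC] := supported_bound (smooth_continuous spf) cK Kpf.
pose h (k : nat) : R := k.+1%:R^-1.
have h0 k : 0 < h k by rewrite invr_gt0.
have h1 k : h k <= 1 by rewrite invf_le1 // ler1n.
pose g k (x : 'rV[R]_n) := (h k)^-1 * (f (x + h k *: delta_mx 0 i) - f x).
have If : Rintegrable (lebV n) f by exact: smooth_supported_integrable cK Kf.
have mf := Rintegrable_measurable If.
have tr k := preserves_translation (h k *: delta_mx 0 i : 'rV[R]_n).
have Ig0 k : Rintegrable (lebV n) (fun x => f (x + h k *: delta_mx 0 i)).
  exact/(transports_integrable (tr k) mf).
have g0 k : \int[lebV n]_x g k x = 0.
  rewrite RintegralZl //; last exact: RintegrableB.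
  rewrite RintegralB //; last exact: Ig0.
  have -> : \int[lebV n]_x f (x + h k *: delta_mx 0 i) = \int[lebV n]_x f x.
    exact: (transports_Rintegral (tr k) mf).
  by rewrite subrr mulr0.
(* Steps are at most 1, so one ball contains the supports of all the difference quotients. *)
pose B : set 'rV[R]_n := [set x | `|x| <= M + 1].
have cB : compact B by exact: compact_closed_ball_rV.
have IB : Rintegrable (lebV n) (fun x => C * \1_B x).
  apply: (@bounded_supported_integrable _ _ _ B C) => //.
  - by apply: measurable_funM => //; apply: measurable_indic; exact: compact_measurable_rV.
  - move=> x nB; rewrite indicE (_ : x \in B = false) ?mulr0 //.
    by apply/negbTE/negP => /set_mem.
  - by move=> x; rewrite indicE; case: (_ \in _); rewrite ?mulr1 ?mulr0 ?normr0 ?gtr0_norm // ltW.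
have [_] : Rintegrable (lebV n) (partial i f) /\ \int[lebV n]_x g k x @[k --> \oo] --> \int[lebV n]_x partial i f x.
  apply: (@Rdominated_cvg _ _ _ _ g (partial i f) (fun x => C * \1_B x)) => //.
  - move=> k; apply: measurable_funM => //; apply: measurable_funB => //.
    exact: Rintegrable_measurable (Ig0 k).
  - move=> x; have df : derivable f x (delta_mx 0 i) by exact: smooth_derivable sf.
    have hk : h @ \oo --> (0 : R).
      apply/cvgrPdist_lt => eps eps0; rewrite /h; near=> k.
      rewrite sub0r normrN gtr0_norm ?invr_gt0 //.
      by near: k; exact: (near_infty_natSinv_lt (PosNum eps0)).
    have : (fun y : R => y^-1 *: ((f \o shift x) (y *: delta_mx 0 i) - f x)) (h k) @[k --> \oo] --> partial i f x.
      by move/cvgr_dnbhsP: df; apply; split => // k; rewrite lt0r_neq0.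
    by apply: cvg_trans; apply: near_eq_cvg; apply: nearW => k; rewrite /g /= [x + _]addrC.
  - move=> k x; rewrite indicE; case: (boolP (x \in B)) => [_|nB].
      rewrite mulr1 /g normrM normfV (gtr0_norm (h0 k)) ler_pdivrMl //.
      have [s sh ->] := @MVT_line _ _ f x (delta_mx 0 i) (h k) (fun s _ => smooth_derivable sf).
      by rewrite normrM (gtr0_norm (h0 k)); apply: ler_wpM2l; [exact: ltW|exact: fC].
    rewrite mulr0 /g !Kf ?subrr ?mulr0 ?normr0 //.
      by move=> /KM xM; move/negP: nB; apply; rewrite inE /B /= (le_trans xM) // lerDl.
    move=> /KM xM; move/negP: nB; apply; rewrite inE /B /=.
    rewrite -[x](addrK (h k *: delta_mx 0 i)) (le_trans (ler_normB _ _)) // lerD //.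
    rewrite normrZ gtr0_norm // -[leRHS]mulr1 ler_pM // ?(ltW (h0 _)) //.
    exact: norm_delta_le.
under eq_fun do rewrite g0.
by move=> H; rewrite -(cvg_lim _ H) // lim_cst.
Unshelve. all: by end_near. Qed.

Lemma test_mul n (f g : 'rV[R]_n -> R) K : supported_in K g -> supported_in K (fun x => f x * g x).
Proof. by move=> Kg x /Kg ->; rewrite mulr0. Qed.

(** As each [partial i X_i] vanishes, [X f] is the sum of the derivatives [partial i (X_i f)], and
    every one of them integrates to 0. *)
Lemma integral_vfapp n (X : @vfield R n) (f : 'rV[R]_n -> R) K : smooth_map X ->
  (forall i x, partial i (fun y => X y 0 i) x = 0) ->
  smooth f -> compact K -> supported_in K f ->
  Rintegrable (lebV n) (vfapp X f) /\ \int[lebV n]_x vfapp X f x = 0.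
Proof.
move=> sX X0 sf cK Kf; have cclK := compact_closed_rV cK.
have E : vfapp X f = (fun x => \sum_i partial i (fun y => X y 0 i * f y) x).
  apply/funext => x; apply: eq_bigr => i _.
  rewrite (partialM (smooth_derivable (sX i)) (smooth_derivable sf)).
  by rewrite X0 mulr0 addr0.
have sXf i : smooth (fun y => X y 0 i * f y) by exact: (smooth_onM openT (sX i) sf).
have KXf i : supported_in K (fun y => X y 0 i * f y) by exact: test_mul.
have Ip i : true -> Rintegrable (lebV n) (partial i (fun y => X y 0 i * f y)).
  move=> _; apply: (smooth_supported_integrable _ cK); first exact: (smooth_on_partial i (sXf i)).
  exact: (@partials_supported _ _ _ [:: i] _ cclK (KXf i)).
have [H1 H2] := @Rintegral_big_sum R _ _ (lebV n) 'I_n (index_enum _) xpredT _ Ip.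
rewrite E; split => //; rewrite H2 big1 // => i _.
exact: (integral_partial i (sXf i) cK (KXf i)).
Qed.

Lemma vfappM n (X : @vfield R n) (f g : 'rV[R]_n -> R) x : smooth f -> smooth g ->
  vfapp X (fun y => f y * g y) x = f x * vfapp X g x + g x * vfapp X f x.
Proof.
move=> sf sg; rewrite /vfapp !mulr_sumr -big_split /=; apply: eq_bigr => i _.
rewrite (partialM (smooth_derivable sf) (smooth_derivable sg)).
by rewrite mulrDr !mulrA ![X x 0 i * _]mulrC.
Qed.

Lemma vfapp_supported n (X : @vfield R n) (f : 'rV[R]_n -> R) K : closed K ->
  supported_in K f -> supported_in K (vfapp X f).
Proof.
move=> cK Kf x Kx; rewrite (@vfapp_eq_on R n (~` K) X f (fun=> 0)) ?vfapp0 //.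
exact: closed_openC.
Qed.

Lemma integral_vfapp_parts n (X : @vfield R n) (f g : 'rV[R]_n -> R) K : smooth_map X ->
  (forall i x, partial i (fun y => X y 0 i) x = 0) ->
  smooth f -> smooth g -> compact K -> supported_in K g ->
  \int[lebV n]_x (vfapp X f x * g x) = - \int[lebV n]_x (f x * vfapp X g x).
Proof.
move=> sX X0 sf sg cK Kg; have cclK := compact_closed_rV cK.
have sXf := smooth_vfapp sX sf; have sXg := smooth_vfapp sX sg.
have [H1 H2] := integral_vfapp sX X0 (smooth_onM openT sf sg) cK (test_mul _ Kg).
have I1 : Rintegrable (lebV n) (fun x => vfapp X f x * g x).
  exact: (smooth_supported_integrable (smooth_onM openT sXf sg) cK (test_mul _ Kg)).
have I2 : Rintegrable (lebV n) (fun x => f x * vfapp X g x).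
  apply: (smooth_supported_integrable (smooth_onM openT sf sXg) cK).
  by apply: test_mul; exact: vfapp_supported.
apply/eqP; rewrite -addr_eq0 -RintegralD //; apply/eqP.
rewrite -[RHS]H2; apply: eq_Rintegral => x _.
by rewrite (vfappM _ _ sf sg) addrC [g x * _]mulrC.
Qed.

Lemma vf_word_rcons n m (X : 'I_m -> @vfield R n) I i f :
  vf_word X (rcons I i) f = vf_word X I (vfapp (X i) f).
Proof. by rewrite /vf_word foldr_rcons. Qed.

Lemma integral_vf_word_parts n m (X : 'I_m -> @vfield R n) I (f g : 'rV[R]_n -> R) K :
  (forall i, smooth_map (X i)) ->
  (forall j i x, partial i (fun y => X j y 0 i) x = 0) ->
  smooth f -> smooth g -> compact K -> supported_in K g ->
  \int[lebV n]_x (vf_word X I f x * g x) =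
  (-1) ^+ size I * \int[lebV n]_x (f x * vf_word X (rev I) g x).
Proof.
move=> sX X0 sf sg cK Kg; have cclK := compact_closed_rV cK.
elim: I g sg Kg => [|i I IH] g sg Kg; first by rewrite expr0 mul1r.
rewrite /= (integral_vfapp_parts (sX i) (X0 i) (smooth_vf_word sX I sf) sg cK Kg).
rewrite IH; [|exact: smooth_vfapp|exact: vfapp_supported].
by rewrite rev_cons vf_word_rcons exprS mulN1r mulNr.
Qed.

Lemma vf_word_supported n m (X : 'I_m -> @vfield R n) I (f : 'rV[R]_n -> R) K : closed K ->
  supported_in K f -> supported_in K (vf_word X I f).
Proof. by move=> cK Kf; elim: I => //= i I; exact: vfapp_supported. Qed.

(** Letters pass to the other factor one at a time, each with a sign, which reverses the word.
    Reindexing the sum by [rev], which preserves length and weight, produces exactly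
    [transpose_coef]. *)
Lemma integral_hom_op_parts n m (X : 'I_m -> @vfield R n) w nu c (f g : 'rV[R]_n -> R) K :
  (forall i, smooth_map (X i)) ->
  (forall j i x, partial i (fun y => X j y 0 i) x = 0) ->
  smooth f -> smooth g -> compact K -> supported_in K g ->
  \int[lebV n]_x (hom_op X w nu c f x * g x) =
  \int[lebV n]_x (f x * hom_op X w nu (transpose_coef c) g x).
Proof.
move=> sX X0 sf sg cK Kg; have cclK := compact_closed_rV cK.
have E1 : (fun x => hom_op X w nu c f x * g x) = (fun x => \sum_(k < nu.+1)
    \sum_(I : k.-tuple 'I_m | (\sum_(i <- I) w i == nu)%N) c I * (vf_word X I f x * g x)).
  apply/funext => x; rewrite mulr_suml; apply: eq_bigr => k _.
  by rewrite mulr_suml; apply: eq_bigr => I _; rewrite mulrA.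
have E2 : (fun x => f x * hom_op X w nu (transpose_coef c) g x) = (fun x => \sum_(k < nu.+1)
    \sum_(I : k.-tuple 'I_m | (\sum_(i <- I) w i == nu)%N) transpose_coef c I * (f x * vf_word X I g x)).
  apply/funext => x; rewrite mulr_sumr; apply: eq_bigr => k _.
  by rewrite mulr_sumr; apply: eq_bigr => I _; rewrite mulrCA.
have J1 (I : seq 'I_m) : Rintegrable (lebV n) (fun x => vf_word X I f x * g x).
  exact: (smooth_supported_integrable (smooth_onM openT (smooth_vf_word sX I sf) sg) cK (test_mul _ Kg)).
have J2 (I : seq 'I_m) : Rintegrable (lebV n) (fun x => f x * vf_word X I g x).
  apply: (smooth_supported_integrable (smooth_onM openT sf (smooth_vf_word sX I sg)) cK).
  by apply: test_mul; exact: vf_word_supported.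
rewrite (_ : \int[_]_x _ = Rintegral (lebV n) setT (fun x => hom_op X w nu c f x * g x)) // E1.
rewrite (_ : \int[_]_x _ = Rintegral (lebV n) setT (fun x => f x * hom_op X w nu (transpose_coef c) g x)) // E2.
have K1 (k : nat) (P : pred (k.-tuple 'I_m)) := @Rintegral_big_sum R _ _ (lebV n) _ (index_enum _) P
  (fun (I : k.-tuple 'I_m) x => c I * (vf_word X I f x * g x)) (fun I _ => RintegrableZ _ (J1 I)).
have K2 (k : nat) (P : pred (k.-tuple 'I_m)) := @Rintegral_big_sum R _ _ (lebV n) _ (index_enum _) P
  (fun (I : k.-tuple 'I_m) x => transpose_coef c I * (f x * vf_word X I g x)) (fun I _ => RintegrableZ _ (J2 I)).
have [_ ->] := @Rintegral_big_sum R _ _ (lebV n) _ (index_enum _) xpredT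
  (fun (k : 'I_nu.+1) x => \sum_(I : k.-tuple 'I_m | (\sum_(i <- I) w i == nu)%N) c I * (vf_word X I f x * g x))
  (fun k _ => (K1 k _).1).
have [_ ->] := @Rintegral_big_sum R _ _ (lebV n) _ (index_enum _) xpredT
  (fun (k : 'I_nu.+1) x => \sum_(I : k.-tuple 'I_m | (\sum_(i <- I) w i == nu)%N)
     transpose_coef c I * (f x * vf_word X I g x))
  (fun k _ => (K2 k _).1).
apply: eq_bigr => k _; rewrite (K1 k _).2 (K2 k _).2.
rewrite [RHS](reindex_inj (h := fun I : k.-tuple 'I_m => [tuple of rev I])) /=; last first.
  by move=> I J /(congr1 val) /= /(congr1 rev); rewrite !revK => /val_inj.
have wr (I : seq 'I_m) : (\sum_(i <- rev I) w i = \sum_(i <- I) w i)%N.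
  by apply: perm_big; rewrite perm_rev.
apply: eq_big => [I|I _]; first by rewrite wr.
apply: (etrans (RintegralZl (c I) measurableT (J1 I))).
apply: (etrans (congr1 _ (integral_vf_word_parts I sX X0 sf sg cK Kg))).
apply/esym; apply: (etrans (RintegralZl (transpose_coef c (rev I)) measurableT (J2 (rev I)))).
by rewrite /transpose_coef size_rev revK mulrCA mulrA.
Qed.

End integration_by_parts.

(** * The fundamental lemma, for continuous and for locally integrable functions *)

Section fundamental_lemma.
Context {R : realType}.
Local Notation lebV n := (@lebesgue_rV R n).
Implicit Types n : nat.

Lemma compact_ball_at n (x0 : 'rV[R]_n) (r : R) : compact [set x : 'rV[R]_n | `|x - x0| <= r].
Proof.
apply: (subclosed_compact _ (@compact_closed_ball_rV R n (r + `|x0|))); last first.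
  move=> x /= xr; rewrite -[x](subrK x0) (le_trans (ler_normD _ _)) //.
  by rewrite lerD2r.
have -> : [set x : 'rV[R]_n | `|x - x0| <= r] = ~` [set x | r < `|x - x0|].
  by apply/seteqP; split => x /=; rewrite leNgt => /negP.
apply: open_closedC; rewrite openE => x /= rx.
apply: (@norm_lt_nbhs _ _ _ _ (`|x - x0| - r)); first by rewrite subr_gt0.
move=> y yx; rewrite /= -subr_gt0.
have : `|x - x0| <= `|y - x| + `|y - x0|.
  by rewrite [`|y - x|]distrC -[x - x0](subrKA y) ler_normD.
move: yx; lra.
Qed.

Lemma lebesgue_ball_gt0 n (x0 : 'rV[R]_n) (r : R) : 0 < r ->
  (0 < lebV n [set x : 'rV[R]_n | (`|x - x0| < r)%R])%E.
Proof.
move=> r0; pose A (i : 'I_n) : set (measurableTypeR R) := `]x0 0 i - r, x0 0 i + r[%classic.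
have -> : [set x : 'rV[R]_n | `|x - x0| < r] = [set x : 'rV[R]_n | forall i, A i (x 0 i)].
  apply/seteqP; split => x /=.
    move=> xr i; rewrite /A /= in_itv /= -ltr_distl; apply: le_lt_trans xr.
    by have := coord_le_norm (x - x0) i; rewrite !mxE.
  move=> h; apply: norm_rV_lt => // i; rewrite !mxE ltr_distl.
  by have := h i; rewrite /A /= in_itv.
have mA i : measurable (A i) by exact: measurable_itv.
rewrite (lebesgue_rV_box mA); apply: (big_ind (fun y => (0 < y)%E)) => //.
  by move=> a b; exact: mule_gt0.
move=> i _; have -> : lebesgue_measure (A i) = (r + r)%:E.
  apply: (etrans (lebesgue_measure_itv _)); rewrite /= lte_fin.
  case: ifPn => h; last by exfalso; move/negP: h; apply; lra.
  by rewrite -EFinB; congr EFin; lra.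
by rewrite lte_fin addr_gt0.
Qed.

(* [f] is irrelevant outside [W], but the product need not be measurable there
   unless the factor vanishes. *)
Lemma continuous_on_mul_integrable n (W : set 'rV[R]_n) (f phi : 'rV[R]_n -> R) K : open W ->
  (forall x, W x -> {for x, continuous f}) ->
  continuous phi -> compact K -> K `<=` W -> supported_in K phi ->
  Rintegrable (lebV n) (fun x => f x * phi x).
Proof.
move=> oW cf cphi cK KW Kphi.
have E : (fun x => f x * phi x) = (fun x => (f \_ W) x * phi x).
  apply/funext => x; rewrite patchE; case: ifPn => // /negP xW.
  by rewrite Kphi ?mulr0 // => /KW Wx; apply: xW; rewrite inE.
have [M M0 fM] := compact_continuous_bound cK (fun x Kx => cf x (KW x Kx)).
have [M' M'0 phiM] := supported_bound cphi cK Kphi.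
rewrite E; apply: (@bounded_supported_integrable _ _ _ K (M * M')) => //.
- apply: measurable_funM; first exact: measurable_restrict_open_rV.
  exact: continuous_measurable_rV.
- by move=> x /Kphi ->; rewrite mulr0.
- move=> x; case: (pselect (K x)) => [Kx|/Kphi ->]; last first.
    by rewrite mulr0 normr0 mulr_ge0 // ltW.
  by rewrite normrM ler_pM // patchE ifT ?fM // inE; exact: KW.
Qed.

Lemma ball_test_fun n (W : set 'rV[R]_n) (x0 : 'rV[R]_n) (r : R) : 0 < r ->
  (forall x, `|x - x0| < r -> W x) ->
  exists phi, [/\ smooth phi, (forall x, 0 <= phi x <= 1),
    (forall x, `|x - x0| <= r / 4 -> phi x = 1),
    supported_in [set x | `|x - x0| <= r / 2] phi & test_fun W phi].
Proof.
move=> r0 rW; have r4 : 0 <= r / 4 by lra.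
have r42 : r / 4 < r / 2 by lra.
have [chi [schi c01 c1 c0]] := smooth_cutoff x0 r4 r42.
have sc : supported_in [set x | `|x - x0| <= r / 2] chi.
  by move=> x /= /negP; rewrite -ltNge => /ltW; exact: c0.
exists chi; split; [exact: schi|exact: c01|exact: c1|exact: sc|].
split; first exact: schi.
exists [set x | `|x - x0| <= r / 2]; split; [exact: compact_ball_at| |exact: sc].
by move=> x /= xr; apply: rW; apply: le_lt_trans xr _; lra.
Qed.

Lemma bump_integral_gt0 n (phi : 'rV[R]_n -> R) x0 (r : R) : 0 < r ->
  Rintegrable (lebV n) phi -> (forall x, 0 <= phi x) ->
  (forall x, `|x - x0| <= r -> phi x = 1) -> 0 < \int[lebV n]_x phi x.
Proof.
move=> r0 Ip p0 p1; pose B : set 'rV[R]_n := [set x | `|x - x0| < r].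
have mB : measurable B by exact: measurable_ball_rV.
have Bf : (lebV n B < +oo)%E.
  apply: le_lt_trans (lebesgue_rV_compact_lty (@compact_ball_at n x0 r)).
  apply: le_measure; rewrite ?inE //; last by move=> x /= /ltW.
  by apply: compact_measurable_rV; exact: compact_ball_at.
have H : (lebV n B <= \int[lebV n]_x (phi x)%:E)%E.
  rewrite -[leLHS]/(lebV n B) -(setIT B) -(integral_indic (lebV n) measurableT mB).
  apply: ge0_le_integral => //.
  - by apply/measurable_EFinP; exact: measurable_indic.
  - by apply/measurable_EFinP; exact: (Rintegrable_measurable Ip).
  - move=> x _; rewrite lee_fin indicE; case: (boolP (x \in B)) => //.
    by rewrite inE => /ltW /p1 ->.
have := lt_le_trans (lebesgue_ball_gt0 x0 r0) H.
rewrite -(fineK (integrable_fin_num measurableT Ip)) lte_fin.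
exact.
Qed.

(** If [f x0 > M], then [f] exceeds the mean of [M] and [f x0] on a small ball, and a bump function
    supported there contradicts the integral inequality. *)
Lemma fundamental_lemma_le n (W : set 'rV[R]_n) (f : 'rV[R]_n -> R) (M : R) : open W ->
  (forall x, W x -> {for x, continuous f}) ->
  (forall phi, test_fun W phi -> (forall x, 0 <= phi x) ->
    \int[lebV n]_x (f x * phi x) <= M * \int[lebV n]_x phi x) ->
  forall x, W x -> f x <= M.
Proof.
move=> oW cf H x0 Wx0; rewrite leNgt; apply/negP => fM.
have e0 : 0 < (f x0 - M) / 2 by rewrite divr_gt0 // subr_gt0.
have /continuous_normP/(_ _ e0)[d d0 fd] := cf x0 Wx0.
have [r1 r10 rW] := nbhs_norm_lt (open_nbhs_nbhs (conj oW Wx0)).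
have r0 : 0 < Num.min d r1 by rewrite lt_min d0 r10.
have rW' (x : 'rV[R]_n) : `|x - x0| < Num.min d r1 -> W x.
  by rewrite lt_min => /andP[_]; exact: rW.
have [phi [sphi p01 p1 Kp tp]] := ball_test_fun r0 rW'.
have p0 x : 0 <= phi x by have /andP[] := p01 x.
have cp := smooth_continuous sphi.
have cB := @compact_ball_at n x0 (Num.min d r1 / 2).
have Ip : Rintegrable (lebV n) phi by exact: (supported_integrable cp cB Kp).
have Ifp : Rintegrable (lebV n) (fun x => f x * phi x).
  apply: (continuous_on_mul_integrable oW cf cp cB _ Kp) => x /= xr.
  by apply: rW'; apply: le_lt_trans xr _; lra.
have pp : 0 < \int[lebV n]_x phi x.
  by apply: (@bump_integral_gt0 _ _ x0 (Num.min d r1 / 4)) => //; lra.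
have := H phi tp p0; apply/negP; rewrite -ltNge.
apply: lt_le_trans (_ : (M + (f x0 - M) / 2) * \int[lebV n]_x phi x <= _).
  by rewrite ltr_pM2r //; lra.
rewrite -RintegralZl //; apply: le_Rintegral => //.
  exact: RintegrableZ.
move=> x _; case: (pselect (`|x - x0| <= Num.min d r1 / 2)) => [xr|/Kp ->]; last by rewrite !mulr0.
rewrite ler_wpM2r //.
have : `|f x - f x0| <= (f x0 - M) / 2.
  apply: fd; apply: le_lt_trans xr _.
  by apply: lt_le_trans (_ : Num.min d r1 <= _); [lra|rewrite ge_min lexx].
by rewrite ler_norml => /andP[]; lra.
Qed.

Lemma fundamental_lemma_norm_le n (W : set 'rV[R]_n) (f : 'rV[R]_n -> R) (M : R) : open W ->
  (forall x, W x -> {for x, continuous f}) ->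
  (forall phi, test_fun W phi -> (forall x, 0 <= phi x) ->
    `|\int[lebV n]_x (f x * phi x)| <= M * \int[lebV n]_x phi x) ->
  forall x, W x -> `|f x| <= M.
Proof.
move=> oW cf H x Wx; rewrite ler_norml; apply/andP; split; last first.
  apply: (fundamental_lemma_le oW cf _ Wx) => phi tp p0.
  by apply: le_trans (H phi tp p0); exact: ler_norm.
rewrite lerNl -mulN1r.
apply: (@fundamental_lemma_le _ W (fun x => -1 * f x) M oW _ _ x Wx).
  by move=> y Wy; apply: continuous_atM; [exact: continuous_at_cst|exact: cf].
move=> phi tp p0; apply: le_trans (H phi tp p0).
have Ifp : Rintegrable (lebV n) (fun x => f x * phi x).
  by case: (tp) => sp [K [cK KW Kp]]; apply: (continuous_on_mul_integrable oW cf (smooth_continuous sp) cK KW Kp).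
under eq_Rintegral do rewrite -mulrA.
by rewrite RintegralZl // mulN1r -normrN ler_norm.
Qed.

Lemma fundamental_lemma n (W : set 'rV[R]_n) (f : 'rV[R]_n -> R) : open W ->
  (forall x, W x -> {for x, continuous f}) ->
  (forall phi, test_fun W phi -> \int[lebV n]_x (f x * phi x) = 0) ->
  forall x, W x -> f x = 0.
Proof.
move=> oW cf H x Wx; apply/normr0_eq0/eqP; rewrite eq_le normr_ge0 andbT.
by apply: (fundamental_lemma_norm_le oW cf _ Wx) => phi tp p0; rewrite H // normr0 mul0r.
Qed.

Definition open_boxes n : set (set 'rV[R]_n) :=
  [set B | exists a b : 'I_n -> R, B = [set x : 'rV[R]_n | forall i, a i < x 0 i < b i]].

Lemma open_box_margin n (a b : 'I_n -> R) (x : 'rV[R]_n) : (forall i, a i < x 0 i < b i) ->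
  exists2 d : R, 0 < d & forall i, d <= x 0 i - a i /\ d <= b i - x 0 i.
Proof.
move=> Bx; pose d : R := \big[Num.min/1]_i Num.min (x 0 i - a i) (b i - x 0 i); exists d.
  apply: (big_ind (fun y : R => 0 < y)) => // [u v u0 v0|i _]; first by rewrite lt_min u0.
  by have /andP[h1 h2] := Bx i; rewrite lt_min !subr_gt0 h1.
move=> i; have : d <= Num.min (x 0 i - a i) (b i - x 0 i) by rewrite /d (bigD1 i) //= ge_min lexx.
by rewrite le_min => /andP[].
Qed.

Lemma open_open_box n (a b : 'I_n -> R) : open [set x : 'rV[R]_n | forall i, a i < x 0 i < b i].
Proof.
rewrite openE => x /= Bx.
have [d d0 dx] := open_box_margin Bx.
apply: (norm_lt_nbhs d0) => y yd i; have [h1 h2] := dx i.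
have := le_lt_trans (coord_le_norm (y - x) i) yd; rewrite !mxE ltr_norml => /andP[h3 h4].
by apply/andP; split; lra.
Qed.

Lemma measurable_open_boxes n : @measurable _ 'rV[R]_n = <<s @open_boxes n >>.
Proof.
apply/seteqP; split => [A|]; last first.
  apply: smallest_sub; first exact: sigma_algebra_measurable.
  by move=> _ [a [b ->]]; apply: open_measurable_rV; exact: open_open_box.
move=> mA; apply: mA; split; first exact: smallest_sigma_algebra.
move=> {}A; rewrite -bigcup_seq => -[i _ [C mC <-]]; rewrite setTI.
have [s0 sC sU] := @smallest_sigma_algebra _ [set: 'rV[R]_n] (@open_boxes n).
pose S : set (set R) := [set D | <<s @open_boxes n >> ((fun x : 'rV[R]_n => x 0 i) @^-1` D)].
suff : S C by [].
move: mC; rewrite RGenOpens.measurableE; apply.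
split.
  split => [|D|F]; rewrite /S /=.
  - by rewrite preimage_set0.
  - by move=> /sC; rewrite !setTD -preimage_setC.
  - by move=> SF; rewrite preimage_bigcup; exact: sU.
move=> _ [a [b ->]]; rewrite /S /=.
have -> : (fun x : 'rV[R]_n => x 0 i) @^-1` `]a, b[%classic = \bigcup_(k : nat)
    [set x : 'rV[R]_n | forall j, (if j == i then a else - k%:R) < x 0 j < (if j == i then b else k%:R)].
  apply/seteqP; split => x /=.
    rewrite in_itv /= => xi; exists (Num.bound `|x|) => // j; case: eqP => [->//|_].
    rewrite -ltr_norml; apply: le_lt_trans (coord_le_norm _ _) _.
    exact: archi_boundP.
  by move=> [k _ /(_ i)]; rewrite eqxx in_itv.
apply: sU => k; apply: sub_gen_smallest.
by exists (fun j => if j == i then a else - k%:R), (fun j => if j == i then b else k%:R).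
Qed.

(** The cutoffs [box_cutoff k] converge to the indicator of the box and are dominated on a ball
    containing it, so the vanishing of the pairings passes to the limit. *)
Lemma integral_open_box n (f : 'rV[R]_n -> R) (a b : 'I_n -> R) : L1loc f ->
  (forall phi, test_fun setT phi -> \int[lebV n]_x (f x * phi x) = 0) ->
  Rintegrable (lebV n) (f \_ [set x : 'rV[R]_n | forall i, a i < x 0 i < b i]) /\
  \int[lebV n]_x (f \_ [set x : 'rV[R]_n | forall i, a i < x 0 i < b i]) x = 0.
Proof.
move=> Lf H; set B := [set x | _].
pose M : R := \sum_i (`|a i| + `|b i|).
have BM (x : 'rV[R]_n) : B x -> `|x| <= M.
  move=> Bx; apply: norm_rV_le; first by apply: sumr_ge0 => i _; rewrite addr_ge0.
  move=> i; rewrite /M (bigD1 i) //=; apply: le_trans (_ : `|a i| + `|b i| <= _); last first.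
    by rewrite lerDl; apply: sumr_ge0 => j _; rewrite addr_ge0.
  have /andP[h1 h2] := Bx i; rewrite ler_norml.
  have := ler_norm (b i); have := lerNnormlW (lexx `|a i|).
  by have := normr_ge0 (a i); have := normr_ge0 (b i); lra.
have cM := @compact_closed_ball_rV R n M.
have c0 k : supported_in [set x : 'rV[R]_n | `|x| <= M] (box_cutoff k%:R a b).
  by move=> x /= xM; apply: box_cutoff_eq0 => // h; apply: xM; exact: BM.
have sB k := @smooth_box_cutoff R n k%:R a b.
have mbk k : measurable_fun setT (@box_cutoff R n k%:R a b).
  by apply: continuous_measurable_rV; exact: (smooth_continuous (sB k)).
have b1 k x : `|@box_cutoff R n k%:R a b x| <= 1.
  by rewrite ger0_norm ?box_cutoff_ge0 ?box_cutoff_le1.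
have mBM : measurable [set x : 'rV[R]_n | `|x| <= M] by exact: compact_measurable_rV.
have [|x| | |IfB L] := @Rdominated_cvg _ _ _ (lebV n) (fun k x => f x * box_cutoff k%:R a b x) (f \_ B)
    (fun x => `|f x * \1_[set x : 'rV[R]_n | `|x| <= M] x|).
- by move=> k; apply: measurable_funM => //; case: Lf.
- rewrite patchE; case: ifPn; rewrite ?inE ?notin_setE => Bx; last first.
    rewrite (_ : (fun k : nat => _) = cst 0); first exact: cvg_cst.
    by apply/funext => k; rewrite box_cutoff_eq0 ?mulr0.
  have [d d0 dx] := open_box_margin Bx.
  apply: cvg_near_cst; near=> k.
  rewrite box_cutoff_eq1 ?mulr1 // => i.
  have kd : 1 <= k%:R * d.
    by rewrite -ler_pdivrMr // mul1r; near: k; exact: nbhs_infty_ger.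
  by have [d1 d2] := dx i; split; apply: le_trans kd _; rewrite ler_wpM2l.
- apply: Rintegrable_abs; apply: (@L1loc_mul_integrable _ _ _ _ _ 1 Lf _ cM).
  + exact: measurable_indic.
  + by move=> x nM; rewrite indicE memNset.
  + by move=> x; rewrite indicE ger0_norm // lern1 leq_b1.
- move=> k x; rewrite !normrM ler_wpM2l // indicE.
  case: (pselect (`|x| <= M)) => xM; last by rewrite c0 // normr0.
  by rewrite mem_set // normr1.
- split => //; rewrite -(cvg_lim _ L) //.
  rewrite (_ : (fun k : nat => _) = cst 0) ?lim_cst //.
  apply/funext => k; apply: H; split; first exact: sB.
  by exists [set x : 'rV[R]_n | `|x| <= M]; split => //; exact: c0.
Unshelve. all: by end_near. Qed.

(** Without continuity there is no localisation at a point. Instead the integrals over open boxes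
    vanish, hence those over all Borel subsets of a cube, and a function whose integrals all vanish
    is zero almost everywhere. Cubes keep [f] integrable. *)
Lemma fundamental_lemma_ae n (f : 'rV[R]_n -> R) : L1loc f ->
  (forall phi, test_fun setT phi -> \int[lebV n]_x (f x * phi x) = 0) ->
  {ae lebV n, forall x, f x = 0}.
Proof.
move=> Lf H; pose B (k : nat) : set 'rV[R]_n := [set x | forall i, - k%:R < x 0 i < k%:R].
suff Hk (k : nat) : {ae lebV n, forall x, B k x -> f x = 0}.
  apply: filterS (ae_foralln Hk) => x Hx; apply: (Hx (Num.bound `|x|)) => i.
  rewrite -ltr_norml; apply: le_lt_trans (coord_le_norm _ _) _.
  exact: archi_boundP.
have mB j : measurable (B j) by apply: open_measurable_rV; exact: open_open_box.
have [IB IB0] := integral_open_box (fun=> - k%:R) (fun=> k%:R) Lf H.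
pose F := EFin \o (f \_ (B k)).
have IF : (lebV n).-integrable setT F by exact: IB.
have IFA A : measurable A -> (lebV n).-integrable A F.
  by move=> mA; exact: (integrableS measurableT mA _ IF).
have mF : measurable_fun setT F by case/integrableP: IF.
have F0 : (\int[lebV n]_x F x = 0)%E.
  by rewrite -(fineK (integrable_fin_num measurableT IF)); congr EFin.
(* Dynkin's theorem: open boxes are stable under intersection and generate the Borel sets, and a box
   cut by the cube [B k] is again a box. *)
have P A : measurable A -> (\int[lebV n]_(x in A) F x = 0)%E.
  move=> mA; have := mA; rewrite measurable_open_boxes.
  apply: (@dynkin_induction _ _ _ (fun A => \int[lebV n]_(x in A) F x = 0)%E (@measurable_open_boxes n)) => //.
  - move=> _ _ [a1 [b1 ->]] [a2 [b2 ->]].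
    exists (fun i => Num.max (a1 i) (a2 i)), (fun i => Num.min (b1 i) (b2 i)).
    apply/seteqP; split => x /=.
      move=> [h1 h2] i; have := h1 i; have := h2 i.
      by rewrite gt_max lt_min => /andP[-> ->] /andP[-> ->].
    move=> h; split => i; have := h i; rewrite gt_max lt_min => /andP[/andP[h1 h2] /andP[h3 h4]];
    exact/andP.
  - move=> _ [a [b ->]] /=.
    have [IC IC0] := integral_open_box (fun i => Num.max (a i) (- k%:R)) (fun i => Num.min (b i) k%:R) Lf H.
    rewrite integral_mkcond (_ : F \_ _ = EFin \o (f \_ [set x : 'rV[R]_n | forall i,
        Num.max (a i) (- k%:R) < x 0 i < Num.min (b i) k%:R])).
      by apply: (etrans (esym (fineK (integrable_fin_num measurableT IC)))); congr EFin; exact: IC0.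
    apply/funext => x; rewrite /F /patch /= .
    case: (pselect (B k x)) => Bx; case: (pselect (forall i, a i < x 0 i < b i)) => ax.
    + rewrite !mem_set // => i; rewrite gt_max lt_min.
      by have /andP[-> ->] := Bx i; have /andP[-> ->] := ax i.
    + rewrite !memNset // => h; apply: ax => i.
      by have := h i; rewrite gt_max lt_min => /andP[/andP[-> _] /andP[-> _]].
    + rewrite (memNset Bx) if_same; case: ifPn => //; rewrite inE => h; exfalso; apply: Bx => i.
      by have := h i; rewrite gt_max lt_min => /andP[/andP[_ ->] /andP[_ ->]].
    + rewrite (memNset Bx) if_same; case: ifPn => //; rewrite inE => h; exfalso; apply: Bx => i.
      by have := h i; rewrite gt_max lt_min => /andP[/andP[_ ->] /andP[_ ->]].
  - move=> S mS S0; have mSC := measurableC mS.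
    have := integral_setU (lebV n) mS mSC (measurable_funTS mF).
    rewrite setUCr F0 S0 add0e => -> //.
    by apply/disj_setPS; rewrite setICr.
  - move=> G mG tG G0; rewrite integral_bigcup //; last by apply: IFA; exact: bigcup_measurable.
    by apply: eseries0 => i _ _; exact: G0.
have : ae_eq (lebV n) setT F (cst 0%E).
  by apply: integral_ae_eq => // E _ mE; rewrite P // integral0.
by apply: filterS => x /(_ Logic.I) + Bx; rewrite /F /= patchE mem_set // => -[].
Qed.

End fundamental_lemma.
(** * Homogeneity *)

Section homogeneous_functions.
Context {R : realType}.
Local Notation lebV n := (@lebesgue_rV R n).
Implicit Types n : nat.

Lemma derive_sum_partial n (g : 'rV[R]_n -> R) (x v : 'rV[R]_n) : smooth g ->
  is_derive x v g (\sum_j partial j g x * v 0 j).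
Proof.
move=> sg; have C1 : C1_at g x by exact: (smooth_on_C1 openT sg).
have H := @chain_rule R 'rV[R]_n n id g x v C1 (fun j => @ex_derive _ _ _ _ _ _ _ (is_derive_coord j x v)).
apply: (is_derive_eq H); apply: eq_bigr => j _; congr (_ * _).
exact: (@derive_val _ _ _ _ _ _ _ (is_derive_coord j x v)).
Qed.

(** Along the segment from [x] to [y] the derivative is the sum of [partial j g] times the j-th
    increment; in each term one of the two factors is zero. *)
Lemma zero_partials_eq n (g : 'rV[R]_n -> R) (P : pred 'I_n) (x y : 'rV[R]_n) : smooth g ->
  (forall j z, P j -> partial j g z = 0) -> (forall j, ~~ P j -> x 0 j = y 0 j) -> g x = g y.
Proof.
move=> sg g0 xy.
have D (z : 'rV[R]_n) := derive_sum_partial z (y - x) sg.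
have [s _] := @MVT_line R 'rV[R]_n g x (y - x) 1 (fun s _ => @ex_derive _ _ _ _ _ _ _ (D _)).
rewrite scale1r [x + (y - x)]addrC subrK (@derive_val _ _ _ _ _ _ _ (D _)) mul1r big1 => [|j _].
  by move/eqP; rewrite subr_eq0 => /eqP.
have [Pj|Pj] := boolP (P j); first by rewrite g0 // mul0r.
by rewrite !mxE xy // subrr mulr0.
Qed.

Lemma norm_dilation_le n (e : 'I_n -> nat) (l : R) (x : 'rV[R]_n) : (forall i, 0 < e i)%N ->
  0 <= l <= 1 -> `|dilation e l x| <= l * `|x|.
Proof.
move=> e0 /andP[l0 l1]; apply: norm_rV_le; first by rewrite mulr_ge0.
move=> i; rewrite dilation_coord normrM ler_pM // ?coord_le_norm //.
rewrite ger0_norm ?exprn_ge0 //; case: (e i) (e0 i) => // k _.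
by rewrite exprS -[leRHS]mulr1 ler_wpM2l // exprn_ile1.
Qed.

Section homogeneous.
Variables (n : nat) (e : 'I_n -> nat) (g : 'rV[R]_n -> R) (a b : nat).
Hypothesis e0 : forall i, (0 < e i)%N.
(** Homogeneity of degree [a - b], written with two natural exponents so that negative degrees are
    included. *)
Hypothesis hom : forall (l : R) x, 0 < l -> l ^+ a * g x = l ^+ b * g (dilation e l x).

(** [g x] is a positive power of [l] times [g] at the contracted point, where [g] stays bounded; let
    [l] tend to 0. *)
Lemma homogeneous_neg_eq0 x : continuous g -> (a < b)%N -> g x = 0.
Proof.
move=> cg ab.
have [M M0 gM] := compact_continuous_bound (@compact_closed_ball_rV R n `|x|) (fun y _ => cg y).
have H (l : R) : 0 < l -> l <= 1 -> `|g x| <= l * M.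
  move=> l0 l1.
  have -> : g x = l ^+ (b - a) * g (dilation e l x).
    apply: (@mulfI _ (l ^+ a)); first by rewrite expf_neq0 // gt_eqF.
    by rewrite mulrA -exprD subnKC ?(ltnW ab) // hom.
  rewrite normrM normrX gtr0_norm // ler_pM ?exprn_ge0 ?(ltW l0) //; last first.
    apply: gM => /=; apply: le_trans (norm_dilation_le x e0 _) _; first by rewrite (ltW l0).
    by rewrite -[leRHS]mul1r ler_wpM2r.
  have := ab; rewrite -subn_gt0; case: (b - a)%N => // k _.
  by rewrite exprS -[leRHS]mulr1 ler_wpM2l ?(ltW l0) // exprn_ile1 // ltW.
apply/normr0_eq0/eqP; rewrite eq_le normr_ge0 andbT leNgt; apply/negP => gx.
(* At this scale the bound is at most half of [|g x|]. *)
have := H (Num.min 1 (`|g x| / (2 * M))).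
rewrite lt_min ltr01 divr_gt0 ?mulr_gt0 //= ge_min lexx => /(_ isT isT).
apply/negP; rewrite -ltNge.
apply: le_lt_trans (_ : `|g x| / (2 * M) * M < _).
  by rewrite ler_wpM2r ?(ltW M0) // ge_min lexx orbT.
by rewrite invfM mulrA mulfVK ?gt_eqF //; lra.
Qed.

(** [g] is constant along the dilation orbit of [x], which runs into the origin, where [g] is
    continuous. *)
Lemma homogeneous_zero_const x : continuous g -> a = b -> g x = g 0.
Proof.
move=> cg ab; apply/eqP; rewrite -subr_eq0; apply/eqP/normr0_eq0/eqP.
rewrite eq_le normr_ge0 andbT leNgt; apply/negP => gx.
have /continuous_normP/(_ (`|g x - g 0| / 2))[] := cg 0; first by rewrite divr_gt0.
move=> d d0 /(_ (dilation e (Num.min 1 (d / (2 * (`|x| + 1)))) x)).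
set l := Num.min _ _.
have x1 : 0 < `|x| + 1 by rewrite ltr_wpDl.
have l0 : 0 < l by rewrite lt_min ltr01 divr_gt0 ?mulr_gt0.
have l1 : l <= 1 by rewrite ge_min lexx.
have <- : g x = g (dilation e l x).
  by apply: (@mulfI _ (l ^+ a)); [rewrite expf_neq0 // gt_eqF|rewrite hom // ab].
move=> H; have : `|g x - g 0| <= `|g x - g 0| / 2.
  apply: H; rewrite subr0; apply: le_lt_trans (norm_dilation_le x e0 _) _; first by rewrite (ltW l0).
  apply: le_lt_trans (_ : d / (2 * (`|x| + 1)) * (`|x| + 1) < d).
    by apply: ler_pM => //; rewrite ?(ltW l0) // ?ge_min ?lexx ?orbT // lerDl.
  by rewrite invfM mulrA mulfVK ?gt_eqF //; lra.
by apply/negP; rewrite -ltNge; move: gx; rewrite normr_gt0 -normr_gt0; lra.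
Qed.

Lemma homogeneous_partial k (l : R) x : smooth g -> 0 < l ->
  l ^+ a * partial k g x = l ^+ (b + e k) * partial k g (dilation e l x).
Proof.
move=> sg l0.
have sgl := smooth_comp sg (smooth_dilation e l).
have E : (fun y => l ^+ a * g y) = (fun y => l ^+ b * (g \o dilation e l) y).
  by apply/funext => y; rewrite hom.
rewrite -(partialZ (l ^+ a) (smooth_derivable sg)) E.
rewrite (partialZ (l ^+ b) (smooth_derivable sgl)).
by rewrite (partial_dilation e l k x sg) mulrA -exprD.
Qed.

End homogeneous.

(** The derivative has degree [a - b - e k < 0]. So a smooth homogeneous function does not depend on
    the coordinates heavier than its degree; all triangularity below comes from this. *)
Lemma homogeneous_partial_eq0 n (e : 'I_n -> nat) (g : 'rV[R]_n -> R) a b k x :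
  (forall i, 0 < e i)%N ->
  (forall (l : R) x, 0 < l -> l ^+ a * g x = l ^+ b * g (dilation e l x)) ->
  smooth g -> (a < b + e k)%N -> partial k g x = 0.
Proof.
move=> e0 hom sg ab; apply: (@homogeneous_neg_eq0 n e _ a (b + e k) e0) => //.
  by move=> l y l0; exact: homogeneous_partial.
exact: (smooth_continuous (smooth_on_partial k sg)).
Qed.

Lemma vf_coef_homogeneous n (e : 'I_n -> nat) (X : @vfield R n) d i (l : R) x :
  vf_homogeneous e X d -> 0 < l ->
  l ^+ e i * X x 0 i = l ^+ d * X (dilation e l x) 0 i.
Proof.
move=> hX l0; have sc : smooth (fun y : 'rV[R]_n => y 0 i) by exact: (smooth_on_coord i openT).
have := hX l _ l0 sc x; rewrite !vfapp_coord => <-.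
rewrite (_ : _ \o _ = (fun y : 'rV[R]_n => l ^+ e i * y 0 i)); last first.
  by apply/funext => y /=; rewrite dilation_coord.
by rewrite (vfappZ _ _ _ sc) vfapp_coord.
Qed.

(** The i-th coefficient has degree [e i - d], hence its i-th derivative has degree [- d < 0]. *)
Lemma vf_divergence0 n (e : 'I_n -> nat) (X : @vfield R n) d i x :
  (forall i, 0 < e i)%N -> (0 < d)%N -> smooth_map X -> vf_homogeneous e X d ->
  partial i (fun y => X y 0 i) x = 0.
Proof.
move=> e0 d0 sX hX.
have H (l : R) y : 0 < l -> l ^+ e i * X y 0 i = l ^+ d * X (dilation e l y) 0 i.
  exact: vf_coef_homogeneous.
by apply: (homogeneous_partial_eq0 _ e0 H (sX i)); rewrite -[ltnLHS]add0n ltn_add2r.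
Qed.

Lemma cat_exp_lshift k n (e1 : 'I_k -> nat) (e2 : 'I_n -> nat) i : cat_exp e1 e2 (lshift n i) = e1 i.
Proof. by rewrite /cat_exp (unsplitK (inl i)). Qed.

Lemma cat_exp_rshift k n (e1 : 'I_k -> nat) (e2 : 'I_n -> nat) i : cat_exp e1 e2 (rshift k i) = e2 i.
Proof. by rewrite /cat_exp (unsplitK (inr i)). Qed.

Lemma cat_exp_gt0 k n (e1 : 'I_k -> nat) (e2 : 'I_n -> nat) :
  (forall i, 0 < e1 i)%N -> (forall i, 0 < e2 i)%N -> forall i, (0 < cat_exp e1 e2 i)%N.
Proof. by move=> e10 e20 i; rewrite /cat_exp; case: fintype.split. Qed.

Lemma sum_cat_exp k n (e1 : 'I_k -> nat) (e2 : 'I_n -> nat) :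
  (\sum_i cat_exp e1 e2 i = \sum_i e1 i + \sum_i e2 i)%N.
Proof.
rewrite big_split_ord /=; congr (_ + _)%N; apply: eq_bigr => i _.
  by rewrite cat_exp_lshift.
by rewrite cat_exp_rshift.
Qed.

Lemma dilation_row_mx k n (e1 : 'I_k -> nat) (e2 : 'I_n -> nat) (l : R) x y :
  dilation (cat_exp e1 e2) l (row_mx x y) = row_mx (dilation e1 l x) (dilation e2 l y).
Proof.
apply/rowP => i; rewrite dilation_coord; case: (split_ordP i) => j ->.
  by rewrite cat_exp_lshift !row_mxEl dilation_coord.
by rewrite cat_exp_rshift !row_mxEr dilation_coord.
Qed.

Lemma lsubmx_dilation k n (e1 : 'I_k -> nat) (e2 : 'I_n -> nat) (l : R) z :
  lsubmx (dilation (cat_exp e1 e2) l z) = dilation e1 l (lsubmx z).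
Proof. by rewrite -{1}[z]hsubmxK dilation_row_mx row_mxKl. Qed.

Lemma rsubmx_dilation k n (e1 : 'I_k -> nat) (e2 : 'I_n -> nat) (l : R) z :
  rsubmx (dilation (cat_exp e1 e2) l z) = dilation e2 l (rsubmx z).
Proof. by rewrite -{1}[z]hsubmxK dilation_row_mx row_mxKr. Qed.

(* Homogeneity makes the map triangular with respect to the weights. *)
Lemma homogeneous_map_preserves k n (e1 : 'I_k -> nat) (e2 : 'I_n -> nat) (b : 'I_n -> bool)
    (F : 'rV[R]_(k + n) -> 'rV[R]_n) :
  (forall i, 0 < e1 i)%N -> (forall i, 0 < e2 i)%N -> smooth_map F ->
  (forall (l : R) z, 0 < l -> F (dilation (cat_exp e1 e2) l z) = dilation e2 l (F z)) ->
  (forall i j, partial (rshift k j) (fun z => F z 0 i) 0 = (i == j)%:R * (-1) ^+ b i) ->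
  forall t, transports (lebV n) (lebV n) (fun z => F (row_mx t z)).
Proof.
move=> e10 e20 sF hF dF t.
have ec0 := cat_exp_gt0 e10 e20.
(* [h i] is what remains of [F_i] without its diagonal term, and has degree [e2 i]; it has to be
   independent of the fibre coordinates of weight at least [e2 i]. *)
pose h i (z : 'rV[R]_(k + n)) := F z 0 i - (-1) ^+ b i * z 0 (rshift k i).
have sh i : smooth (h i).
  apply: (smooth_onB openT (sF i)); apply: (smooth_onZ _ openT).
  exact: (smooth_on_coord _ openT).
have hh i (l : R) z : 0 < l -> l ^+ e2 i * h i z = l ^+ 0 * h i (dilation (cat_exp e1 e2) l z).
  by move=> l0; rewrite /h hF // !dilation_coord cat_exp_rshift expr0 mul1r mulrBr mulrCA.
have h0 i j z : ~~ (e2 j < e2 i)%N -> partial (rshift k j) (h i) z = 0.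
  rewrite -leqNgt => ij.
  move: ij; rewrite leq_eqVlt => /orP[/eqP ij|ij]; last first.
    by apply: (homogeneous_partial_eq0 _ ec0 (hh i) (sh i)); rewrite add0n cat_exp_rshift.
  (* Equal weights: the derivative has degree zero, so it is constant, and [dF] shows that its value
     at the origin is 0. *)
  have -> : partial (rshift k j) (h i) z = partial (rshift k j) (h i) 0.
    apply: (@homogeneous_zero_const _ _ _ (e2 i) (e2 j) ec0) => //.
      move=> l y l0; have := homogeneous_partial (hh i) (rshift k j) y (sh i) l0.
      by rewrite add0n cat_exp_rshift.
    exact: (smooth_continuous (smooth_on_partial (rshift k j) (sh i))).
  have sc : smooth (fun z : 'rV[R]_(k + n) => z 0 (rshift k i)) by exact: (smooth_on_coord _ openT).
  have E : h i = (fun z => (- (-1) ^+ b i) * z 0 (rshift k i) + F z 0 i).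
    by apply/funext => y; rewrite /h mulNr addrC.
  rewrite E (partial_scale_add _ _ _ sc (sF i)) partial_coord dF.
  rewrite (inj_eq (@rshift_inj _ _)) eq_sym mulrC.
  by rewrite mulrN addrC subrr.
apply: (@triangular_preserves R n e2 b (fun i z => h i (row_mx t z))).
- move=> i; apply: (measurableT_comp (f := h i)).
    exact: (continuous_measurable_rV (smooth_continuous (sh i))).
  by apply: measurable_row_mx => //.
- move=> i x y xy.
  apply: (@zero_partials_eq _ _ (fun l => if fintype.split l is inr j then ~~ (e2 j < e2 i)%N else false)) => //.
    move=> l z; case: (split_ordP l) => // j ->; exact: h0.
  move=> l; case: (split_ordP l) => j ->; first by rewrite !row_mxEl.
  by rewrite negbK !row_mxEr; exact: xy.
- by move=> x i; rewrite /h row_mxEr addrC subrK.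
Qed.

End homogeneous_functions.
(** * A priori estimates for hypoelliptic operators *)

Section parametrised_integrals.
Context {R : realType} {d : measure_display} {T : measurableType d}
  (mu : {measure set T -> \bar R}) (n : nat) (W : set 'rV[R]_n) (F : 'rV[R]_n -> T -> R).
Hypothesis oW : open W.
Hypothesis sF : forall t, smooth_on W (F^~ t).
Hypothesis mF : forall s x, W x -> measurable_fun setT (fun t => partials s (F^~ t) x).
Hypothesis dF : forall s x, W x -> exists (r : R) (g : T -> R),
  [/\ 0 < r, Rintegrable mu g & forall y t, `|y - x| < r -> `|partials s (F^~ t) y| <= g t].

Let local s x : W x -> exists (r : R) (g : T -> R), [/\ 0 < r, Rintegrable mu g,
  (forall y, `|y - x| < r -> W y) & forall y t, `|y - x| < r -> `|partials s (F^~ t) y| <= g t].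
Proof.
move=> Wx; have [r [g [r0 ig Fg]]] := dF s Wx.
have [r1 r10 rW] := nbhs_norm_lt (open_nbhs_nbhs (conj oW Wx)).
exists (Num.min r r1), g; split => //; first by rewrite lt_min r0.
  by move=> y; rewrite lt_min => /andP[_]; exact: rW.
by move=> y t; rewrite lt_min => /andP[h _]; exact: Fg.
Qed.

Let derive_step s x i : W x -> is_derive x (delta_mx 0 i)
  (fun y => \int[mu]_t partials s (F^~ t) y) (\int[mu]_t partials (i :: s) (F^~ t) x).
Proof.
move=> Wx; have [r0 [g0 [r00 ig0 rW0 Fg0]]] := local s Wx.
have [r1 [g1 [r10 ig1 rW1 Fg1]]] := local (i :: s) Wx.
have r0' : 0 < Num.min r0 r1 by rewrite lt_min r00.
apply: (@is_derive_Rintegral R _ _ mu _ (fun y t => partials s (F^~ t) y) x (delta_mx 0 i) g1 _ r0') => //.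
- move=> y; rewrite lt_min => /andP[h0 h1].
  by apply: (Rintegrable_le _ ig0); [apply: mF; exact: rW0|move=> t; exact: Fg0].
- move=> y t; rewrite lt_min => /andP[h0 h1].
  exact: (smooth_on_derivable (smooth_on_partials s (@sF t)) (rW0 _ h0)).
- by move=> y t; rewrite lt_min => /andP[h0 h1]; exact: Fg1.
Qed.

(** Coinduction over the integrals of all [partials s F], which satisfy the same domination
    hypotheses. With the counting measure this is termwise differentiation of a series. *)
Lemma smooth_on_Rintegral : smooth_on W (fun x => \int[mu]_t F x t).
Proof.
apply: (smooth_on_coind (P := fun f => exists s, f = (fun x => \int[mu]_t partials s (F^~ t) x)) oW).
- move=> _ [s ->] x Wx; split; last first.
    by move=> i; exact: (@ex_derive _ _ _ _ _ _ _ (derive_step s i Wx)).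
  have [r [g [r0 ig rW Fg]]] := local s Wx.
  apply: (continuous_Rintegral r0 _ _ ig Fg).
    by move=> y yr; apply: mF; exact: rW.
  by move=> t; exact: (smooth_on_continuous (smooth_on_partials s (@sF t)) Wx).
- move=> _ i [s ->]; exists (fun x => \int[mu]_t partials (i :: s) (F^~ t) x); first by exists (i :: s).
  by move=> x Wx; exact: (@derive_val _ _ _ _ _ _ _ (derive_step s i Wx)).
- by exists [::].
Qed.

End parametrised_integrals.

(** * Series as integrals for the counting measure, and dyadic majorants *)

Section series.
Context {R : realType}.
Local Notation count := (@counting nat R).

Lemma nneseries_le (f : nat -> R) (M : R) : (forall k, 0 <= f k) ->
  (forall k, \sum_(0 <= i < k) f i <= M) -> (\sum_(0 <= k <oo) (f k)%:E <= M%:E)%E.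
Proof.
move=> f0 fM; apply: lime_le; first by apply: is_cvg_nneseries => k _ _; rewrite lee_fin.
by apply: nearW => k; rewrite sumEFin lee_fin.
Qed.

Lemma geometric_half_sum k : \sum_(0 <= i < k) (2^-1 : R) ^+ i <= 2.
Proof.
suff : \sum_(0 <= i < k) (2^-1 : R) ^+ i = 2 - 2 * 2^-1 ^+ k.
  by move=> ->; rewrite gerBl mulr_ge0 // exprn_ge0 // invr_ge0.
elim: k => [|k IH]; first by rewrite big_nil expr0 mulr1 subrr.
by rewrite big_nat_recr //= IH exprS; lra.
Qed.

Lemma nneseries_geometric (A : R) : 0 <= A ->
  (\sum_(0 <= k <oo) (A * 2^-1 ^+ k)%:E <= (A * 2)%:E)%E.
Proof.
move=> A0; apply: nneseries_le; first by move=> k; rewrite mulr_ge0 // exprn_ge0 // invr_ge0.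
by move=> k; rewrite -mulr_sumr ler_wpM2l // geometric_half_sum.
Qed.

(** The majorant is the sum of [c k] times the indicator of [E k]. The volume condition makes its
    integral at most a geometric series; the last hypothesis makes it finite at every point, so that
    it is a real function. It serves shrinking sets near a singularity as well as growing sets at
    infinity. *)
Lemma dyadic_dominant d (T : measurableType d) (mu : {measure set T -> \bar R})
    (E : nat -> set T) (c : nat -> R) (A : R) :
  (forall k, measurable (E k)) -> (forall k, 0 <= c k) -> 0 <= A ->
  (forall k, (c k)%:E * mu (E k) <= (A * 2^-1 ^+ k)%:E)%E ->
  (forall x, exists M : R, forall k, \sum_(0 <= i < k) c i * \1_(E i) x <= M) ->
  exists2 g : T -> R, Rintegrable mu g & forall k x, E k x -> c k <= g x.
Proof.
move=> mE c0 A0 cE Efin.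
pose f k x : R := c k * \1_(E k) x.
have f0 k x : 0 <= f k x by rewrite mulr_ge0.
have f0' k x : (0 <= (f k x)%:E)%E by rewrite lee_fin.
pose S x := (\sum_(0 <= k <oo) (f k x)%:E)%E.
have mf k : measurable_fun setT (fun x => (f k x)%:E).
  by apply/measurable_EFinP; apply: measurable_funM => //; exact: measurable_indic.
have mS : measurable_fun setT S by apply: ge0_emeasurable_sum => //.
have S0 x : (0 <= S x)%E by apply: nneseries_ge0.
have Sf x : S x \is a fin_num.
  by have [M HM] := Efin x; rewrite ge0_fin_numE //; apply: le_lt_trans (nneseries_le (f0^~ x) HM) (ltry _).
exists (fine \o S); last first.
  move=> k x Ekx; rewrite -lee_fin /= fineK //.
  rewrite /S (nneseries_split _ k.+1) //= big_nat_recr //= -addeA.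
  apply: (@le_trans _ _ (f k x)%:E); first by rewrite /f indicE mem_set // mulr1.
  rewrite addeCA leeDl // adde_ge0 ?nneseries_ge0 //.
  by apply: sume_ge0.
have E1 : EFin \o (fine \o S) = S by apply/funext => x /=; rewrite fineK.
rewrite /Rintegrable E1; apply/integrableP; split => //.
under eq_integral do rewrite gee0_abs //.
rewrite /S integral_nneseries //.
apply: le_lt_trans (ltry (A * 2)).
apply: le_trans (nneseries_geometric A0); apply: lee_nneseries => [k _ _|k _]; first exact: integral_ge0.
under eq_integral do rewrite /f EFinM.
rewrite ge0_integralZl //; last 2 first.
- by apply/measurable_EFinP; exact: measurable_indic.
- by rewrite lee_fin.
by rewrite integral_indic // setIT.
Qed.

Lemma Rintegrable_geometric (A : R) : Rintegrable count (fun k => A * 2^-1 ^+ k).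
Proof.
apply: RintegrableZ; apply/integrableP; split => //.
rewrite (@ge0_integral_count _ (fun k => `|(2^-1 ^+ k : R)|%:E)) //.
apply: le_lt_trans (ltry (1 * 2)); apply: le_trans (nneseries_geometric ler01).
apply: lee_nneseries => // k _.
by rewrite mul1r lee_fin ger0_norm // exprn_ge0 // invr_ge0.
Qed.

(** A partial sum is the integral of a truncation of [f]; the truncations are eventually constant at
    each index and dominated by [|f|]. *)
Lemma Rintegral_counting_cvg (f : nat -> R) : Rintegrable count f ->
  (\sum_(i < k) f i) @[k --> \oo] --> \int[count]_i f i.
Proof.
move=> If; pose f_ (k : nat) (j : nat) : R := if (j < k)%N then f j else 0.
have c1 (i : nat) : count [set i] = 1%E.
  rewrite /counting asboolT; last exact: finite_set1.
  by rewrite fset_set1 finmap.cardfs1.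
have K1 (i : nat) : (\int[count]_j (\1_[set i] j)%:E = 1)%E.
  by rewrite -(c1 i) -[in RHS](setIT [set i]); apply: integral_indic.
have I0 (i : nat) : Rintegrable count (\1_[set i] : nat -> R).
  apply/integrableP; split => //.
  under eq_integral do rewrite /= ger0_norm //.
  by apply: (eq_ind_r (fun y => (y < +oo)%E) _ (K1 i)); rewrite ltry.
have I1 (i : nat) : Rintegrable count (fun j => f i * \1_[set i] j).
  exact: RintegrableZ.
have J1 (i : nat) : \int[count]_j (f i * \1_[set i] j) = f i.
  apply: (etrans (RintegralZl (f i) measurableT (I0 i))).
  by rewrite (_ : \int[count]_j _ = 1) ?mulr1 //; exact: (congr1 fine (K1 i)).
have E k : \int[count]_j f_ k j = \sum_(i < k) f i.
  have -> : f_ k = (fun j => \sum_(i < k) f i * \1_[set (i : nat)] j).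
    apply/funext => j; rewrite /f_; case: ltnP => jk.
      rewrite (bigD1 (Ordinal jk)) //= indicE mem_set // mulr1 big1 ?addr0 // => i ij.
      rewrite indicE memNset ?mulr0 // => /= ji; move/negP: ij; apply; apply/eqP.
      by apply: val_inj; rewrite /= ji.
    rewrite big1 // => i _; rewrite indicE memNset ?mulr0 // => /= ji.
    by move: jk; rewrite leqNgt ji ltn_ord.
  have [_ ->] := @Rintegral_big_sum R _ _ count _ (index_enum _) xpredT
    (fun (i : 'I_k) j => f i * \1_[set (i : nat)] j) (fun i _ => I1 i).
  by apply: eq_bigr.
have [_] : Rintegrable count f /\ \int[count]_i f_ k i @[k --> \oo] --> \int[count]_i f i.
  apply: (@Rdominated_cvg _ _ _ count f_ f (fun i => `|f i|)) => //.
  - move=> j; apply: cvg_near_cst; near=> k; rewrite /f_ ifT //.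
    by near: k; exists j.+1.
  - exact: Rintegrable_abs.
  - by move=> k j; rewrite /f_; case: ifP; rewrite ?normr0.
by under eq_fun do rewrite E.
Unshelve. all: by end_near. Qed.

End series.

(** * The gliding hump *)

Section gliding_hump.
Context {R : realType} (U T : Type) (P : nat -> U -> Prop) (h : T -> R) (q : U -> T -> R).
Hypothesis h_gt0 : forall t, 0 < h t.
Hypothesis q_le : forall k u t, P k u -> `|q u t| <= (h t)^-1.
Hypothesis q_bounded : forall k u, P k u -> exists D : R, forall t, `|q u t| <= D.
Hypothesis q_unbounded : forall k (B : R), exists u t, P k u /\ B < `|q u t|.

(* The term [a k * q (u k)] dominates at [t k]: the earlier terms are bounded and
   the coefficients of the later ones are chosen small with respect to [h (t k)]. *)
Lemma gliding_hump : exists (u : nat -> U) (t : nat -> T) (a : nat -> R),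
  [/\ forall k, P k (u k), forall k, 0 < a k <= 2^-1 ^+ k &
      forall k j, (k < j)%N -> k%:R <= `|\sum_(i < j) a i * q (u i) (t k)|].
Proof.
(* At stage [k] the state is [(A, H)]: [A] bounds the sum of the earlier terms uniformly in [t], and
   [H] is the least of 1 and the values of [h] at the earlier points. The choice returns a new
   function, a point where it is large, and a uniform bound [D]. *)
have step (z : nat * (R * R)) : exists x : U * T * R, 0 < z.2.2 -> [/\ P z.1 x.1.1,
    (forall t, `|q x.1.1 t| <= x.2) &
    z.1%:R + 2 + z.2.1 < 2^-1 ^+ z.1 * z.2.2 * `|q x.1.1 x.1.2|].
  case: z => k [A H] /=; have [u [t [Pu qu]]] := q_unbounded k ((k%:R + 2 + A) / (2^-1 ^+ k * H)).
  have [D uD] := q_bounded Pu; exists (u, t, D) => /= H0; split => //.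
  by move: qu; rewrite ltr_pdivrMr ?mulr_gt0 ?exprn_gt0 ?invr_gt0 // mulrC.
have [G HG] := choice step.
pose st := fix st k : R * R := if k is k'.+1 then
  (let x := G (k', st k') in ((st k').1 + 2^-1 ^+ k' * (st k').2 * x.2, Num.min (st k').2 (h x.1.2)))
  else (0, 1).
pose u k := (G (k, st k)).1.1; pose t k := (G (k, st k)).1.2; pose D k := (G (k, st k)).2.
pose a k : R := 2^-1 ^+ k * (st k).2.
have H0 k : 0 < (st k).2 by elim: k => //= k IH; rewrite lt_min IH h_gt0.
have a0 k : 0 < a k by rewrite mulr_gt0 // exprn_gt0 // invr_gt0.
have stS k : st k.+1 = ((st k).1 + a k * D k, Num.min (st k).2 (h (t k))) by [].
have Hdec k i : (k < i)%N -> (st i).2 <= h (t k).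
  elim: i => // i IH; rewrite ltnS leq_eqVlt stS /= => /orP[/eqP->|/IH ki].
    by rewrite ge_min lexx orbT.
  by rewrite ge_min ki.
have H1 k : (st k).2 <= 1 by elim: k => //= k IH; rewrite ge_min IH.
have HP k : [/\ P k (u k), (forall t, `|q (u k) t| <= D k) & k%:R + 2 + (st k).1 < a k * `|q (u k) (t k)|].
  exact: (HG (k, st k) (H0 k)).
exists u, t, a; split.
- by move=> k; have [] := HP k.
- move=> k; rewrite a0 /a -[leRHS]mulr1 ler_wpM2l // exprn_ge0 // invr_ge0 //.
- move=> k j kj; pose b i := a i * q (u i) (t k).
  (* Earlier terms add up to at most [(st k).1]. For a later term, [a i <= 2^-1 ^+ i * h (t k)]
     cancels against [q_le], so those add up to at most the geometric sum 2, the margin reserved in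
     [step]. *)
  have bound i : \sum_(0 <= l < i | l != k) `|b l| <=
      if (i <= k)%N then (st i).1 else (st k).1 + \sum_(0 <= l < i) 2^-1 ^+ l.
    elim: i => [|i IH]; first by rewrite big_nil.
    rewrite big_mkcond big_nat_recr //= -big_mkcond /=.
    have [ik|ki|ik] := ltngtP i k.
    + rewrite (ltnW ik) in IH; rewrite lerD // /b normrM gtr0_norm //.
      by have [_ qD _] := HP i; rewrite ler_wpM2l // ltW.
    + rewrite leqNgt ki /= in IH.
      rewrite big_nat_recr //= addrA lerD //.
      rewrite /b normrM gtr0_norm // -[leRHS]mulr1 /a -mulrA ler_wpM2l ?exprn_ge0 ?invr_ge0 //.
      have [Pi _ _] := HP i.
      rewrite -(@mulfV _ (h (t k))) ?gt_eqF //; apply: ler_pM => //; rewrite ?(ltW (H0 _)) //.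
        exact: Hdec.
      exact: q_le Pi.
    + rewrite ik leqnn in IH; rewrite ik addr0; apply: le_trans IH _; rewrite lerDl.
      by apply: sumr_ge0 => l _; rewrite exprn_ge0 // invr_ge0.
  have := bound j; rewrite leqNgt kj /= => bj.
  have gj : \sum_(0 <= i < j) (2^-1 : R) ^+ i <= 2 by exact: geometric_half_sum.
  have [_ _ big] := HP k.
  rewrite -(big_mkord xpredT b) (bigD1_seq k) /= ?mem_index_iota ?iota_uniq //.
  have : `|b k| <= `|b k + \sum_(0 <= i < j | i != k) b i| + `|\sum_(0 <= i < j | i != k) b i|.
    by rewrite -[X in `|X| <= _](addrK (\sum_(0 <= i < j | i != k) b i)) ler_normB.
  have : `|\sum_(0 <= i < j | i != k) b i| <= \sum_(0 <= i < j | i != k) `|b i| by exact: ler_norm_sum.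
  have -> : `|b k| = a k * `|q (u k) (t k)| by rewrite /b normrM gtr0_norm.
  move: bj gj big; lra.
Qed.

End gliding_hump.

(** * From hypoellipticity to an estimate *)

Section a_priori_estimate.
Context {R : realType}.
Local Notation lebV n := (@lebesgue_rV R n).
Local Notation count := (@counting nat R).
Implicit Types n : nat.

Lemma L1loc_distribution n (v : 'rV[R]_n -> R) (W : set 'rV[R]_n) : L1loc v ->
  distribution_on W (fun phi => \int[lebV n]_x (v x * phi x)).
Proof.
move=> Lv; split.
  move=> a f g [sf [K [cK _ Kf]]] [sg [K' [cK' _ Kg]]].
  have I1 : Rintegrable (lebV n) (fun x => v x * f x).
    have [M M0 fM] := supported_bound (smooth_continuous sf) cK Kf.
    apply: (L1loc_mul_integrable Lv _ cK Kf fM).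
    exact: (continuous_measurable_rV (smooth_continuous sf)).
  have I2 : Rintegrable (lebV n) (fun x => v x * g x).
    have [M M0 fM] := supported_bound (smooth_continuous sg) cK' Kg.
    apply: (L1loc_mul_integrable Lv _ cK' Kg fM).
    exact: (continuous_measurable_rV (smooth_continuous sg)).
  rewrite -RintegralZl // -RintegralD //; last exact: RintegrableZ.
  by apply: eq_Rintegral => x _; rewrite mulrDr mulrCA.
move=> K cK _; have mK := compact_measurable_rV cK.
have I1 : Rintegrable (lebV n) (fun x => v x * \1_K x).
  apply: (@L1loc_mul_integrable _ _ _ _ K 1 Lv) => //.
  - by move=> x nK; rewrite indicE memNset.
  - by move=> x; rewrite indicE ger0_norm // lern1 leq_b1.
exists (\int[lebV n]_x `|v x * \1_K x|), 0%N => f sf Kf M fM.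
have f0 x : `|f x| <= M by exact: (fM [::]).
rewrite mulrC -RintegralZl //; last exact: Rintegrable_abs.
apply: norm_Rintegral_le.
- apply: measurable_funM; first by case: Lv.
  exact: (continuous_measurable_rV (smooth_continuous sf)).
- by apply: RintegrableZ; exact: Rintegrable_abs.
- move=> x; case: (pselect (K x)) => [Kx|nK]; last by rewrite Kf // mulr0 normr0 mulr_ge0 // (le_trans _ (f0 x)).
  by rewrite indicE mem_set // mulr1 normrM mulrC ler_wpM2r.
Qed.

Lemma cvg_seq_unique (u v : nat -> R) (l l' : R) : u =1 v ->
  u @ \oo --> l -> v @ \oo --> l' -> l = l'.
Proof. by move=> /funext -> ul vl; rewrite -(cvg_lim _ ul) // -(cvg_lim _ vl). Qed.

Lemma eventually_bounded_uniform (T : Type) (f : nat -> T -> R) (k : nat) (B : R) :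
  (forall j, exists M : R, forall t, `|f j t| <= M) ->
  (forall j t, (k <= j)%N -> `|f j t| <= B) -> exists A : R, forall j t, `|f j t| <= A.
Proof.
move=> fM; elim: k B => [|k IH] B fB; first by exists B => j t; exact: fB.
have [M kM] := fM k; apply: (IH (Num.max B M)) => j t.
rewrite leq_eqVlt le_max => /orP[/eqP<-|/fB->//]; by rewrite kM orbT.
Qed.

Lemma partialsZ n s (a : R) (f : 'rV[R]_n -> R) x : smooth f ->
  partials s (fun y => a * f y) x = a * partials s f x.
Proof.
move=> sf; have s0 : smooth (fun _ : 'rV[R]_n => 0 : R) by exact: (@smooth_on_cst _ _ setT 0 openT).
have := partials_scale_add s a x sf s0.
rewrite (@partials_supported R n set0 s (fun=> 0) closed0) // addr0 => <-.
by congr (partials s _ x); apply/funext => y; rewrite addr0.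
Qed.

Section estimate.
Variables (n m : nat) (X : 'I_m -> @vfield R n) (w : 'I_m -> nat) (nu : nat) (c : seq 'I_m -> R).
Hypothesis sX : forall i, smooth_map (X i).
Hypothesis X0 : forall j i x, partial i (fun y => X j y 0 i) x = 0.
Local Notation L := (hom_op X w nu c).
Local Notation Ls := (hom_op X w nu (transpose_coef c)).

Lemma difference_quotient_bound (g : 'rV[R]_n -> R) (r s : R) : 0 < r -> 0 <= s ->
  (forall x, `|x| <= r + s -> forall i, derivable g x (delta_mx 0 i)) ->
  (forall x i, `|x| <= r + s -> {for x, continuous (partial i g)}) ->
  exists2 D : R, 0 < D & forall (x : 'rV[R]_n) (h : R) i, `|x| <= r -> 0 < h <= s ->
    `|(g (x + h *: delta_mx 0 i) - g x) / h| <= D.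
Proof.
move=> r0 s0 dg cg.
have /choice[M HM] : forall i, exists M : R, 0 < M /\ forall x, `|x| <= r + s -> `|partial i g x| <= M.
  move=> i; have [M M0 HM] := compact_continuous_bound (@compact_closed_ball_rV R n (r + s)) (fun x => @cg x i).
  by exists M.
exists (1 + \sum_i M i); first by rewrite ltr_wpDr // sumr_ge0 // => i _; apply: ltW; have [] := HM i.
move=> x h i xr /andP[h0 hs].
have ball (t : R) : `|t| <= `|h| -> `|x + t *: delta_mx 0 i| <= r + s.
  move=> th; apply: le_trans (ler_normD _ _) _; apply: lerD => //.
  rewrite normrZ; apply: le_trans (_ : `|t| * 1 <= _); first by rewrite ler_wpM2l // norm_delta_le.
  by rewrite mulr1; apply: le_trans th _; rewrite gtr0_norm.
have [t th ->] := @MVT_line R _ g x (delta_mx 0 i) h (fun t th => dg _ (ball t th) i).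
rewrite mulrC mulKf ?gt_eqF //.
have [_ /(_ _ (ball t th)) h1] := HM i; apply: le_trans h1 _.
rewrite (bigD1 i) //=; have : 0 <= \sum_(j | j != i) M j by rewrite sumr_ge0 // => j _; apply: ltW; have [] := HM j.
by lra.
Qed.

(** The sum of the series is bounded, and in the weak sense [L] of it is the sum of the
    [a j * L (u j)]. The latter is smooth, since at each order of derivation all but finitely many
    terms obey the bound 1. Hypoellipticity then makes the sum itself smooth. *)
Lemma hypoelliptic_series (u : nat -> 'rV[R]_n -> R) (a : nat -> R) : hypoelliptic X w nu c ->
  (forall j, smooth (u j)) -> (forall j, 0 <= a j <= 2^-1 ^+ j) ->
  (forall j x, `|x| < 2 -> `|u j x| <= 1) ->
  (forall j s x, (size s <= j)%N -> `|x| < 2 -> `|partials s (L (u j)) x| <= 1) ->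
  exists2 g : 'rV[R]_n -> R, smooth_on [set x | `|x| < 2] g &
    forall x, `|x| < 2 -> (\sum_(i < k) a i * u i x) @[k --> \oo] --> g x.
Proof.
move=> hypo su a01 u1 Lu1.
have sLu j := smooth_hom_op w sX nu c (su j).
have a0 j : 0 <= a j by have /andP[] := a01 j.
pose W : set 'rV[R]_n := [set x | `|x| < 2].
have oW : open W by have := @open_norm_lt R n 0 2; rewrite /W; under eq_fun do rewrite subr0.
have uW j x : W x -> `|u j x| <= 1 by exact: u1.
pose U0 (x : 'rV[R]_n) : R := \int[count]_j (a j * u j x).
pose f (x : 'rV[R]_n) : R := \int[count]_j (a j * L (u j) x).
have geo j (b A : R) : `|b| <= A -> `|a j * b| <= A * 2^-1 ^+ j.
  move=> bA; rewrite normrM ger0_norm // mulrC ler_pM //.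
  by have /andP[] := a01 j.
have mcount (g : nat -> R) : measurable_fun setT g by [].
have Iau (g : nat -> R) (A : R) : (forall j, `|g j| <= A) -> Rintegrable count (fun j => a j * g j).
  by move=> gA; apply: (Rintegrable_le _ (Rintegrable_geometric A)) => // j; exact: geo.
have cU0 x : W x -> {for x, continuous U0}.
  move=> Wx; have [r r0 rW] := nbhs_norm_lt (open_nbhs_nbhs (conj oW Wx)).
  apply: (continuous_Rintegral (F := fun y j => a j * u j y) r0 _ _ (Rintegrable_geometric 1)) => //.
    move=> j; apply: continuous_atM; first exact: continuous_at_cst.
    exact: (smooth_continuous (su j)).
  by move=> y j yr; apply: geo; apply: uW; exact: rW.
have sf : smooth_on W f.
  have E s j x : partials s (fun y => a j * L (u j) y) x = a j * partials s (L (u j)) x.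
    exact: (partialsZ s (a j) x (sLu j)).
  apply: (smooth_on_Rintegral (F := fun x j => a j * L (u j) x) oW) => //.
    by move=> j; apply: smooth_smooth_on; exact: (smooth_onZ _ openT (sLu j)).
  move=> s x Wx.
  (* The terms of index below [size s] escape the hypothesis; there are finitely many and each is
     bounded by compactness. *)
  have [j|j y jk|A HA] := @eventually_bounded_uniform {x : 'rV[R]_n | W x}
      (fun j y => partials s (L (u j)) (sval y)) (size s) 1.
  - have [M M0 HM] := compact_continuous_bound (@compact_closed_ball_rV R n 2)
      (fun x _ => smooth_on_continuous (smooth_on_partials s (sLu j)) (Logic.I : setT x)).
    by exists M => -[y Wy] /=; apply: HM => /=; exact: ltW.
  - by case: y => y Wy /=; exact: Lu1.
  have [r r0 rW] := nbhs_norm_lt (open_nbhs_nbhs (conj oW Wx)).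
  exists r, (fun j => A * 2^-1 ^+ j); split => //; first exact: Rintegrable_geometric.
  move=> y j yr; rewrite E; apply: geo; exact: (HA j (exist _ y (rW y yr))).
have [A A0 LA] : exists2 A : R, 0 <= A & forall j x, W x -> `|L (u j) x| <= A.
  have [j|j y jk|A HA] := @eventually_bounded_uniform {x : 'rV[R]_n | W x}
      (fun j y => L (u j) (sval y)) 0 1.
  - have [M M0 HM] := compact_continuous_bound (@compact_closed_ball_rV R n 2)
      (fun x _ => smooth_on_continuous (sLu j) (Logic.I : setT x)).
    by exists M => -[y Wy] /=; apply: HM => /=; exact: ltW.
  - by case: y => y Wy /=; exact: (Lu1 _ [::]).
  exists `|A| => // j x Wx; apply: le_trans (ler_norm _); exact: (HA j (exist _ x Wx)).
have fcvg (x : 'rV[R]_n) : W x -> (\sum_(i < k) a i * L (u i) x) @[k --> \oo] --> f x.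
  by move=> Wx; apply: Rintegral_counting_cvg; apply: (Iau _ A) => j; exact: LA.
(* Continuity of the sum is known only on [W]; the cut at its boundary gives a function measurable
   on the whole space. *)
pose V := U0 \_ W.
have mV : measurable_fun setT V by exact: measurable_restrict_open_rV.
have pcvg (x : 'rV[R]_n) : W x -> (\sum_(i < k) a i * u i x) @[k --> \oo] --> U0 x.
  by move=> Wx; apply: Rintegral_counting_cvg; apply: (Iau _ 1) => j; exact: uW.
have psum (k : nat) (b : nat -> R) (B : R) : 0 <= B -> (forall j, `|b j| <= B) -> `|\sum_(i < k) a i * b i| <= B * 2.
  move=> B0 bB; apply: le_trans (ler_norm_sum _ _ _) _.
  apply: le_trans (_ : \sum_(i < k) B * 2^-1 ^+ i <= _); first by apply: ler_sum => j _; exact: geo.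
  rewrite -mulr_sumr ler_wpM2l //; by rewrite -(big_mkord xpredT (fun i => 2^-1 ^+ i)) geometric_half_sum.
have V2 x : `|V x| <= 2.
  rewrite /V patchE; case: ifPn => [/set_mem Wx|_]; last by rewrite normr0.
  have cN : `|\sum_(i < k) a i * u i x| @[k --> \oo] --> `|U0 x| by apply: cvg_norm; exact: pcvg.
  rewrite -(cvg_lim _ cN) //; apply: limr_le; first by apply/cvg_ex; eexists; exact: cN.
  by apply: nearW => k; rewrite -[leRHS]mul1r; exact: (psum k (u^~ x) 1 ler01 (fun j => uW j x Wx)).
have LV : L1loc V by apply: L1loc_bounded => // K _; exists 2.
(* Integration by parts holds for each partial sum, and both sides converge, dominated by multiples
   of [|Ls phi|] and of [|phi|]. *)
have weak phi : test_fun W phi ->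
    \int[lebV n]_x (V x * Ls phi x) = \int[lebV n]_x (f x * phi x).
  move=> [sphi [K [cK KW Kphi]]].
  have sLp := smooth_hom_op w sX nu (transpose_coef c) sphi.
  have KLp : supported_in K (Ls phi) by apply: hom_op_supported => //; exact: compact_closed_rV.
  have Ij (j : nat) : Rintegrable (lebV n) (fun x => u j x * Ls phi x).
    exact: (smooth_supported_integrable (smooth_onM openT (su j) sLp) cK (test_mul _ KLp)).
  have Jj (j : nat) : Rintegrable (lebV n) (fun x => L (u j) x * phi x).
    exact: (smooth_supported_integrable (smooth_onM openT (sLu j) sphi) cK (test_mul _ Kphi)).
  have Eq k : \int[lebV n]_x (\sum_(i < k) a i * (u i x * Ls phi x)) =
              \int[lebV n]_x (\sum_(i < k) a i * (L (u i) x * phi x)).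
    have [_ ->] := @Rintegral_big_sum R _ _ (lebV n) _ (index_enum _) xpredT
      (fun (i : 'I_k) x => a i * (u i x * Ls phi x)) (fun i _ => RintegrableZ _ (Ij i)).
    have [_ ->] := @Rintegral_big_sum R _ _ (lebV n) _ (index_enum _) xpredT
      (fun (i : 'I_k) x => a i * (L (u i) x * phi x)) (fun i _ => RintegrableZ _ (Jj i)).
    apply: eq_bigr => i _.
    apply: (etrans (RintegralZl (a i) measurableT (Ij i))).
    apply/esym; apply: (etrans (RintegralZl (a i) measurableT (Jj i))); congr (_ * _).
    exact: (integral_hom_op_parts w nu c sX X0 (su i) sphi cK Kphi).
  have [|x| | |_ L1] := @Rdominated_cvg _ _ _ (lebV n) (fun k x => \sum_(i < k) a i * (u i x * Ls phi x))
      (fun x => V x * Ls phi x) (fun x => 2 * `|Ls phi x|).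
  - by move=> k; have [/Rintegrable_measurable] := @Rintegral_big_sum R _ _ (lebV n) _ (index_enum _) xpredT
      (fun (i : 'I_k) x => a i * (u i x * Ls phi x)) (fun i _ => RintegrableZ _ (Ij i)).
  - case: (pselect (W x)) => Wx; last first.
      rewrite (KLp x) ?mulr0; last by move=> /KW.
      by under eq_fun do under eq_bigr do rewrite !mulr0; under eq_fun do rewrite big1 //; exact: cvg_cst.
    under eq_fun do under eq_bigr do rewrite mulrA; under eq_fun do rewrite -mulr_suml.
    rewrite /V patchE mem_set //; apply: cvgM; [exact: pcvg|exact: cvg_cst].
  - apply: RintegrableZ; apply: Rintegrable_abs.
    exact: (smooth_supported_integrable sLp cK KLp).
  - move=> k x; case: (pselect (W x)) => Wx; last first.
      by rewrite (KLp x) ?normr0 ?mulr0 ?big1 ?normr0 // => [i _|/KW //]; rewrite !mulr0.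
    under eq_bigr do rewrite mulrA; rewrite -mulr_suml normrM ler_wpM2r //.
    by rewrite -[leRHS]mul1r; exact: (psum k (u^~ x) 1 ler01 (fun j => uW j x Wx)).
  have [|x| | |_ L2] := @Rdominated_cvg _ _ _ (lebV n) (fun k x => \sum_(i < k) a i * (L (u i) x * phi x))
      (fun x => f x * phi x) (fun x => A * 2 * `|phi x|).
  - by move=> k; have [/Rintegrable_measurable] := @Rintegral_big_sum R _ _ (lebV n) _ (index_enum _) xpredT
      (fun (i : 'I_k) x => a i * (L (u i) x * phi x)) (fun i _ => RintegrableZ _ (Jj i)).
  - case: (pselect (W x)) => Wx; last first.
      rewrite (Kphi x) ?mulr0; last by move=> /KW.
      by under eq_fun do under eq_bigr do rewrite !mulr0; under eq_fun do rewrite big1 //; exact: cvg_cst.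
    under eq_fun do under eq_bigr do rewrite mulrA; under eq_fun do rewrite -mulr_suml.
    apply: cvgM; [exact: fcvg|exact: cvg_cst].
  - by apply: RintegrableZ; apply: Rintegrable_abs; exact: (smooth_supported_integrable sphi cK Kphi).
  - move=> k x; case: (pselect (W x)) => Wx; last first.
      by rewrite (Kphi x) ?normr0 ?mulr0 ?big1 ?normr0 // => [i _|/KW //]; rewrite !mulr0.
    under eq_bigr do rewrite mulrA; rewrite -mulr_suml normrM ler_wpM2r //.
    exact: (psum k (fun j => L (u j) x) A A0 (fun j => LA j x Wx)).
  exact: (cvg_seq_unique Eq L1 L2).
have hV : dist_smooth_on W (fun phi => \int[lebV n]_x (V x * phi x)).
  apply: (hypo W W _ oW oW) => //; first exact: L1loc_distribution.
  by exists f => //; exact: weak.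
have [g sg Hg] := hV.
exists g; first exact: sg.
(* The sum and the smooth density define the same distribution on [W] and are both continuous there,
   so they agree at every point. *)
suff gU x : W x -> U0 x = g x by move=> x Wx; rewrite -gU //; exact: pcvg.
move=> Wx; apply/eqP; rewrite -subr_eq0; apply/eqP.
have cg y : W y -> {for y, continuous g} by move=> Wy; exact: (smooth_on_continuous sg Wy).
have cd y : W y -> {for y, continuous (fun z => U0 z + - 1 * g z)}.
  move=> Wy; apply: continuous_atD; first exact: cU0.
  by apply: continuous_atM; [exact: continuous_at_cst|exact: cg].
rewrite -mulN1r; apply: (fundamental_lemma oW cd _ Wx) => phi tphi.
have [sphi [K [cK KW Kphi]]] := tphi.
have I1 := continuous_on_mul_integrable oW cU0 (smooth_continuous sphi) cK KW Kphi.
have I2 := continuous_on_mul_integrable oW cg (smooth_continuous sphi) cK KW Kphi.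
rewrite (_ : \int[_]_x _ = \int[lebV n]_x (U0 x * phi x - g x * phi x)).
  rewrite RintegralB // -Hg //; apply/eqP; rewrite subr_eq0; apply/eqP.
  apply: eq_Rintegral => y _; rewrite /V patchE; case: ifPn => // /negP yW.
  by rewrite Kphi ?mulr0 // => /KW Wy; apply: yW; exact: mem_set.
by apply: eq_Rintegral => y _; rewrite mulrDl mulN1r mulNr.
Qed.

(** Failure for every [C] and [k] produces normalised functions whose derivatives are arbitrarily
    large at points of the unit ball. Their difference quotients are large too, while for each step
    the quotient of a function bounded by 1 is at most 2 / h, which is the a priori bound [q_le] of
    the gliding hump. *)
Lemma hypoelliptic_estimate : hypoelliptic X w nu c ->
  exists (C : R) (k : nat), 0 < C /\ forall (u : 'rV[R]_n -> R) (M : R), smooth u ->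
    (forall x, `|x| < 2 -> `|u x| <= M) ->
    (forall s x, (size s <= k)%N -> `|x| < 2 -> `|partials s (L u) x| <= M) ->
    forall i x, `|x| < 1 -> `|partial i u x| <= C * M.
Proof.
move=> hypo; apply: contrapT => HC.
pose P (k : nat) (u : 'rV[R]_n -> R) := [/\ smooth u, (forall x, `|x| < 2 -> `|u x| <= 1) &
  forall s x, (size s <= k)%N -> `|x| < 2 -> `|partials s (L u) x| <= 1].
(* Steps at most 1/2 keep [x + h e_i] inside the ball of radius 2, where the bounds are assumed. *)
pose T := {t : 'rV[R]_n * R * 'I_n | `|t.1.1| < 1 /\ 0 < t.1.2 <= 2^-1}.
pose q (u : 'rV[R]_n -> R) (t : T) : R := let: (x, h, i) := sval t in (u (x + h *: delta_mx 0 i) - u x) / h.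
have ball2 (x : 'rV[R]_n) (h : R) i : `|x| < 1 -> 0 < h <= 2^-1 -> `|x + h *: delta_mx 0 i| < 2.
  move=> x1 /andP[h0 h1]; apply: le_lt_trans (ler_normD _ _) _.
  rewrite normrZ gtr0_norm //; have := norm_delta_le i : `|delta_mx 0 i : 'rV[R]_n| <= 1.
  by move=> d1; have : h * `|delta_mx 0 i : 'rV[R]_n| <= 2^-1 * 1 by [apply: ler_pM => //; exact: ltW]; lra.
have q_le k u t : P k u -> `|q u t| <= ((sval t).1.2 / 2)^-1.
  case: t => -[[x h] i] /= [x1 h01] [su u1 _]; have /andP[h0 h1] := h01.
  rewrite /q /= invf_div normrM normfV (gtr0_norm h0) ler_wpM2r ?invr_ge0 ?(ltW h0) //.
  apply: le_trans (ler_normB _ _) _; have := u1 _ (ball2 x h i x1 h01).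
  have := u1 x; move=> /(_ (lt_trans x1 _)) => /(_ ltac:(lra)); lra.
have q_bd (g : 'rV[R]_n -> R) : (forall x, `|x| <= 1 + 2^-1 -> forall i, derivable g x (delta_mx 0 i)) ->
    (forall x i, `|x| <= 1 + 2^-1 -> {for x, continuous (partial i g)}) ->
    exists D : R, forall t, `|q g t| <= D.
  move=> dg cg; have [D D0 gD] := difference_quotient_bound ltr01 (ltac:(lra) : 0 <= 2^-1 :> R) dg cg.
  by exists D => -[[[x h] i] /= [x1 h1]]; rewrite /q /=; apply: gD => //; exact: ltW.
have q_bounded k u : P k u -> exists D : R, forall t, `|q u t| <= D.
  move=> [su _ _]; apply: q_bd => x; first by move=> _ i; exact: smooth_derivable su.
  by move=> i _; exact: (smooth_continuous (smooth_on_partial i su)).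
have q_unbounded k (B : R) : exists u t, P k u /\ B < `|q u t|.
  (* One unit pays for replacing the derivative at [x] by a nearby one, the other makes the final
     inequality strict. *)
  pose C : R := `|B| + 2.
  have C0 : 0 < C by rewrite ltr_wpDl.
  have : ~ forall (u : 'rV[R]_n -> R) (M : R), smooth u -> (forall x, `|x| < 2 -> `|u x| <= M) ->
    (forall s x, (size s <= k)%N -> `|x| < 2 -> `|partials s (L u) x| <= M) ->
    forall i x, `|x| < 1 -> `|partial i u x| <= C * M.
    by move=> H; apply: HC; exists C, k.
  move/existsNP => [u /existsNP[M]] /not_implyP[su] /not_implyP[uM] /not_implyP[LuM] /existsNP[i].
  move=> /existsNP[x] /not_implyP[x1] /negP; rewrite -ltNge => CM.
  have M0 : 0 <= M by apply: le_trans (uM 0 _); rewrite // normr0.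
  have d0 : 0 < `|partial i u x| by apply: le_lt_trans CM; rewrite mulr_ge0 // ltW.
  (* Normalisation: the derivative at [x] gets absolute value exactly [C], while the bound [M]
     becomes at most 1. *)
  pose l : R := C / `|partial i u x|.
  have l0 : 0 < l by rewrite divr_gt0.
  have lM : l * M <= 1 by rewrite /l mulrAC ler_pdivrMr // mul1r ltW.
  pose v (y : 'rV[R]_n) : R := l * u y.
  have sv : smooth v by exact: (smooth_onZ l openT su).
  have Pv : P k v.
    split => //.
      by move=> y y2; rewrite normrM (gtr0_norm l0); apply: le_trans lM; rewrite ler_wpM2l ?(ltW l0) ?uM.
    move=> s y sk y2.
    have -> : partials s (L v) y = l * partials s (L u) y.
      have -> : L v = (fun z => l * L u z).
        by apply/funext => z; exact: (hom_opZ w sX nu c l z su).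
      exact: (partialsZ s l y (smooth_hom_op w sX nu c su)).
    by rewrite normrM (gtr0_norm l0); apply: le_trans lM; rewrite ler_wpM2l ?(ltW l0) ?LuM.
  have vC : `|partial i v x| = C.
    by rewrite /v (partialZ l (smooth_derivable su)) normrM (gtr0_norm l0) mulfVK // gt_eqF.
  have cv : {for x, continuous (partial i v)} by exact: (smooth_continuous (smooth_on_partial i sv)).
  have /continuous_normP/(_ 1 ltr01)[d dd0 vd] := cv.
  pose h : R := Num.min 2^-1 (d / 2).
  have h0 : 0 < h by rewrite lt_min; apply/andP; split; lra.
  have h12 : h <= 2^-1 by rewrite ge_min lexx.
  have hd : h <= d / 2 by rewrite ge_min lexx orbT.
  have h01 : 0 < h <= 2^-1 by rewrite h0.
  exists v, (exist _ (x, h, i) (conj x1 h01)); split; first exact: Pv.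
  rewrite /q /=.
  have [t th ->] := @MVT_line R _ v x (delta_mx 0 i) h (fun t _ => smooth_derivable sv).
  rewrite mulrC mulKf ?gt_eqF //.
  have : `|partial i v (x + t *: delta_mx 0 i) - partial i v x| <= 1.
    apply: vd; rewrite addrC addKr normrZ; apply: le_lt_trans (_ : `|t| * 1 < d).
      by rewrite ler_wpM2l // norm_delta_le.
    by rewrite mulr1; apply: le_lt_trans th _; rewrite gtr0_norm //; lra.
  rewrite -[partial i v _]/('D_(delta_mx 0 i) v _).
  set A := 'D_ _ v (x + _) => h1.
  have : `|partial i v x| <= `|A| + 1.
    rewrite -[partial i v x](subKr A); apply: le_trans (ler_normB _ _) _; rewrite lerD2l //.
  by rewrite vC /C; have := ler_norm B; lra.
have h_gt0 (t : T) : 0 < (sval t).1.2 / 2.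
  by case: t => -[[x h] i] /= [_ /andP[h0 _]]; rewrite divr_gt0.
have [u [t [a [Pu a01 Hbig]]]] := gliding_hump h_gt0 q_le q_bounded q_unbounded.

have su j : smooth (u j) by have [] := Pu j.
have a01' j : 0 <= a j <= 2^-1 ^+ j by have /andP[/ltW -> ->] := a01 j.
have [g sg gcvg] := hypoelliptic_series hypo su a01' (fun j => let: And3 _ h _ := Pu j in h)
  (fun j => let: And3 _ _ h := Pu j in h).
have W2 (x : 'rV[R]_n) : `|x| <= 1 + 2^-1 -> `|x| < 2 by move=> x32; apply: le_lt_trans x32 _; lra.
have [D gD] : exists D : R, forall t, `|q g t| <= D.
  apply: q_bd => x; first by move=> xr i; exact: (smooth_on_derivable sg (W2 x xr)).
  by move=> i xr; exact: (smooth_on_continuous (smooth_on_partial i sg) (W2 x xr)).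
have qcvg t' : (\sum_(i < k) a i * q (u i) t') @[k --> \oo] --> q g t'.
  case: t' => -[[x h] i] /= [x1 h01]; rewrite /q /=.
  have x2 : `|x| < 2 by apply: lt_trans x1 _; lra.
  have -> : (fun k : nat => \sum_(i0 < k) a i0 * ((u i0 (x + h *: 'e_i) - u i0 x) / h)) =
      (fun k : nat => ((\sum_(i0 < k) a i0 * u i0 (x + h *: 'e_i)) - \sum_(i0 < k) a i0 * u i0 x) / h).
    apply/funext => k; rewrite -sumrB mulr_suml; apply: eq_bigr => j _.
    by rewrite mulrA mulrBr.
  apply: cvgM; last exact: cvg_cst.
  by apply: cvgB; [apply: gcvg; exact: ball2|exact: gcvg].
(* The lower bounds on the partial sums survive the limit and contradict the boundedness of the
   quotients of the smooth function [g]. *)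
have qk k : k%:R <= `|q g (t k)|.
  have cN : `|\sum_(i < j) a i * q (u i) (t k)| @[j --> \oo] --> `|q g (t k)|.
    by apply: cvg_norm; exact: qcvg.
  rewrite -(cvg_lim _ cN) //; apply: limr_ge; first by apply/cvg_ex; eexists; exact: cN.
  by exists k.+1 => // j /=; exact: Hbig.
have D0 : 0 <= D by apply: le_trans (gD (t 0%N)).
have := archi_boundP D0; rewrite ltNge => /negP; apply.
exact: le_trans (qk _) (gD _).
Qed.

End estimate.

End a_priori_estimate.

(** * Consequences of rescaling the estimate *)

Section scaling_consequences.
Context {R : realType} (n m : nat) (e : 'I_n -> nat) (X : 'I_m -> @vfield R n) (w : 'I_m -> nat)
  (nu : nat) (c : seq 'I_m -> R).
Hypothesis e_gt0 : forall i, (0 < e i)%N.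
Hypothesis sX : forall i, smooth_map (X i).
Hypothesis X0 : forall j i x, partial i (fun y => X j y 0 i) x = 0.
Hypothesis hX : forall j, vf_homogeneous e (X j) (w j).
Hypothesis hypo : hypoelliptic X w nu c.
Local Notation L := (hom_op X w nu c).

Lemma expr_ge_self (l : R) k : (0 < k)%N -> 1 <= l -> l <= l ^+ k.
Proof.
case: k => // k _ l1; rewrite exprS -[leLHS]mulr1 ler_wpM2l ?exprn_ege1 //.
exact: le_trans l1.
Qed.

(** For [u o dilation e l] the bounds do not change with [l], whereas the derivative at the
    contracted point carries a factor at least [l]. Hence every [partial i u z] is at most
    [C M / l]. *)
Lemma liouville (u : 'rV[R]_n -> R) (M : R) : smooth u -> (forall x, `|u x| <= M) ->
  (forall x, L u x = 0) -> forall x y, u x = u y.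
Proof.
move=> su uM Lu0 x y; have [C [k [C0 HC]]] := hypoelliptic_estimate sX X0 hypo.
apply: (@zero_partials_eq _ _ _ predT x y su) => // i z _.
apply/normr0_eq0/eqP; rewrite eq_le normr_ge0 andbT leNgt; apply/negP => dz.
have M0 : 0 <= M by exact: le_trans (uM 0).
(* The first summand brings the contracted [z] into the unit ball; the second makes
   [l * |partial i u z|] exceed [C M]. *)
pose l : R := `|z| + 1 + (C * M + 1) / `|partial i u z|.
have lz : `|z| + 1 <= l by rewrite lerDl divr_ge0 // addr_ge0 // mulr_ge0 // ltW.
have l1 : 1 <= l by apply: le_trans lz; rewrite lerDr.
have l0 : 0 < l by exact: lt_le_trans l1.
have zl : `|dilation e l^-1 z| < 1.
  apply: le_lt_trans (norm_dilation_le z e_gt0 _) _; first by rewrite invr_ge0 (ltW l0) invf_le1.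
  by rewrite mulrC ltr_pdivrMr // mul1r; apply: lt_le_trans lz; rewrite ltrDl.
have sul := smooth_comp su (smooth_dilation e l).
have LuM s y' : (size s <= k)%N -> `|y'| < 2 -> `|partials s (L (u \o dilation e l)) y'| <= M.
  move=> _ _; have -> : L (u \o dilation e l) = fun=> 0.
    by apply/funext => t; rewrite (hom_op_dilation sX hX nu c t l0 su) Lu0 mulr0.
  by rewrite (@partials_supported R n set0 s (fun=> 0) closed0) // normr0.
have := HC _ M sul (fun x _ => uM _) LuM i _ zl.
rewrite (partial_dilation e l i _ su) dilationVK ?gt_eqF // normrM normrX gtr0_norm //.
apply/negP; rewrite -ltNge; apply: lt_le_trans (_ : l * `|partial i u z| <= _); last first.
  by rewrite ler_wpM2r // expr_ge_self.
rewrite /l mulrDl mulfVK ?gt_eqF //; have : 0 <= (`|z| + 1) * `|partial i u z| by rewrite mulr_ge0 // addr_ge0.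
lra.
Qed.

(** Self-improvement of S = sup |phi|. The estimate for [phi o dilation e l] with [l] large bounds
    [partial i0 phi] by a sixth of S + l^B M. Three units along [i0] lead out of the support, so S
    <= (S + l^B M) / 2, and S is absorbed on the left. *)
Lemma test_fun_estimate (i0 : 'I_n) : exists (C : R) (k : nat), 0 < C /\
  forall (phi : 'rV[R]_n -> R) (M : R), smooth phi -> supported_in [set x | `|x| <= 1] phi ->
  (forall s x, (size s <= k)%N -> `|partials s (L phi) x| <= M) -> forall x, `|phi x| <= C * M.
Proof.
have [C [k [C0 HC]]] := hypoelliptic_estimate sX X0 hypo.
(* [l >= 2] moves the unit ball into the open unit ball under the inverse dilation, and [6 * C]
   produces the sixth. In [B], the operator accounts for l^nu and each of at most [k] derivatives
   for at most l to the sum of the weights. *)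
pose l : R := 2 + 6 * C; pose B := (nu + k * \sum_i e i)%N.
have l2 : 2 <= l by rewrite lerDl mulr_ge0 // ltW.
have l1 : 1 <= l by apply: le_trans l2; lra.
have l0 : 0 < l by exact: lt_le_trans l1.
exists (l ^+ B); exists k; split; first exact: exprn_gt0.
move=> phi M sphi Kphi LM.
have cB := @compact_closed_ball_rV R n 1.
have cclB := compact_closed_rV cB.
have M0 : 0 <= M by apply: le_trans (LM [::] 0 _).
have step (S : R) : (forall x, `|phi x| <= S) -> forall x, `|phi x| <= (S + l ^+ B * M) / 2.
  move=> phiS; set M' := S + l ^+ B * M.
  have S0 : 0 <= S by exact: le_trans (phiS 0).
  have lM0 : 0 <= l ^+ B * M by rewrite mulr_ge0 // exprn_ge0 // ltW.
  have spl := smooth_comp sphi (smooth_dilation e l).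
  have sLphi := smooth_hom_op w sX nu c sphi.
  have b1 x : `|x| < 2 -> `|(phi \o dilation e l) x| <= M'.
    by move=> _; apply: le_trans (phiS _) _; rewrite lerDl.
  have b2 s x : (size s <= k)%N -> `|x| < 2 -> `|partials s (L (phi \o dilation e l)) x| <= M'.
    move=> sk _; have -> : L (phi \o dilation e l) = (fun y => l ^+ nu * (L phi \o dilation e l) y).
      by apply/funext => t; rewrite (hom_op_dilation sX hX nu c t l0 sphi).
    rewrite (partialsZ s _ _ (smooth_comp sLphi (smooth_dilation e l))).
    rewrite (partials_dilation e l s x sLphi) mulrA -exprD normrM normrX gtr0_norm //.
    apply: le_trans (_ : l ^+ B * M <= _); last by rewrite lerDr.
    apply: ler_pM => //; rewrite ?exprn_ge0 ?(ltW l0) ?LM //.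
    rewrite ler_weXn2l // leq_add2l; apply: (@leq_trans (size s * \sum_i e i)); last by rewrite leq_mul2r sk orbT.
    elim: s {sk} => [|i s IH]; first by rewrite big_nil.
    by rewrite big_cons /= mulSn leq_add // (bigD1 i) //= leq_addr.
  have dphi y : `|partial i0 phi y| <= M' / 6.
    have M'0 : 0 <= M' by rewrite addr_ge0.
    case: (pselect (`|y| <= 1)) => [y1|ny]; last first.
      rewrite [partial _ _ _](@partials_supported R n _ [:: i0] _ cclB Kphi y ny) normr0.
      by rewrite divr_ge0.
    have yl : `|dilation e l^-1 y| < 1.
      apply: le_lt_trans (norm_dilation_le y e_gt0 _) _; first by rewrite invr_ge0 (ltW l0) invf_le1.
      by rewrite mulrC ltr_pdivrMr // mul1r; apply: le_lt_trans y1 _; lra.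
    have := HC _ M' spl b1 b2 i0 _ yl.
    rewrite (partial_dilation e l i0 _ sphi) dilationVK ?gt_eqF // normrM normrX gtr0_norm //.
    move=> h; have : 6 * C * `|partial i0 phi y| <= C * M'.
      apply: le_trans h; rewrite ler_wpM2r //; apply: le_trans (expr_ge_self (e_gt0 i0) l1).
      by rewrite /l lerDr.
    rewrite -mulrA mulrCA ler_pM2l // => h2; rewrite ler_pdivlMr //; lra.
  move=> x; case: (pselect (`|x| <= 1)) => [x1|/Kphi->]; last first.
    by rewrite normr0 divr_ge0 // addr_ge0.
  (* This length 3 and the constant 6 together give the factor one half. *)
  have far : phi (x + 3 *: delta_mx 0 i0) = 0.
    apply: Kphi => /= h; have := le_trans (coord_le_norm _ i0) h.
    rewrite !mxE !eqxx mulr1 ler_norml => /andP[_ h2].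
    have := le_trans (coord_le_norm x i0) x1; rewrite ler_norml => /andP[h3 _]; lra.
  have [t _] := @MVT_line R _ phi x (delta_mx 0 i0) 3 (fun t _ => smooth_derivable sphi).
  rewrite far sub0r => h; rewrite -normrN h normrM gtr0_norm //.
  have := dphi (x + t *: delta_mx 0 i0); rewrite /partial; lra.
have [S0 S00 phiS0] := supported_bound (smooth_continuous sphi) cB Kphi.
pose A := [set `|phi x| | x in [set: 'rV[R]_n]].
have hA : has_sup A by split; [exists `|phi 0|, 0|exists S0 => _ [x _ <-]].
have phiS x : `|phi x| <= sup A by apply: (sup_upper_bound hA); exists x.
have : sup A <= (sup A + l ^+ B * M) / 2.
  by apply: sup_le_ub; [case: hA|move=> _ [x _ <-]; exact: step].
by move=> h x; apply: le_trans (phiS x) _; lra.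
Qed.

End scaling_consequences.
(** * The homogeneous fundamental solution on the lifted space *)

Section hahn_banach.
Context {R : realType} (T : Type) (p : (T -> R) -> R -> Prop).
(* [p f M] reads: [M] is at least the seminorm of [f], which may be infinite. *)
Hypothesis p0 : p (fun=> 0) 0.
Hypothesis pZ : forall a f M, p f M -> p (fun x => a * f x) (`|a| * M).
Hypothesis pD : forall f g M M', p f M -> p g M' -> p (fun x => f x + g x) (M + M').
Implicit Types (A B : set ((T -> R) * R)).

(** Partial functionals are represented by graphs. That a graph is single-valued is not part of
    [good]: it follows from linearity and the bound, because [p] assigns 0 to the zero function. *)
Let linear_graph A := forall (a : R) u v, A u -> A v -> A (fun x => a * u.1 x + v.1 x, a * u.2 + v.2).
Let bounded_graph A := forall f y M, A (f, y) -> p f M -> y <= M.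
Let good A := [/\ linear_graph A, bounded_graph A & A (fun=> 0, 0)].

(** The value at [f0] has to lie above all [y - M] with [p (g - f0) M] and below all [M' - y'] with
    [p (h + f0) M']. Subadditivity makes these compatible, and the supremum of the former is chosen;
    homogeneity reduces multiples of [f0] to plus or minus [f0]. *)
Let extension_step B f0 M0 : good B -> p f0 M0 -> exists A, [/\ good A, B `<=` A & exists c, A (f0, c)].
Proof.
move=> [lB bB B0] pf0.
pose S := [set z | exists g y M, [/\ B (g, y), p (fun x => g x - f0 x) M & z = y - M]].
have S1 z h y' M' : S z -> B (h, y') -> p (fun x => h x + f0 x) M' -> z <= M' - y'.
  move=> [g [y [M [Bg pg ->]]]] Bh ph.
  have := lB 1 _ _ Bg Bh; rewrite /= mul1r => Bgh.
  have pgh : p (fun x => 1 * g x + h x) (M + M').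
    have := pD pg ph; congr (p _ _); apply/funext => x; ring.
  have := bB _ _ _ Bgh pgh; lra.
have hS : has_sup S.
  split.
    exists (0 - `|-1| * M0), (fun=> 0), 0, (`|-1| * M0); split => //.
    by have := pZ (-1) pf0; congr (p _ _); apply/funext => x; ring.
  exists (M0 - 0) => z Sz; apply: (S1 _ _ _ _ Sz B0).
  by congr (p _ _): pf0; apply/funext => x; ring.
pose c := sup S.
have cU h y' M' : B (h, y') -> p (fun x => h x + f0 x) M' -> y' + c <= M'.
  move=> Bh ph; have : c <= M' - y' by apply: sup_le_ub; [case: hS|move=> z Sz; exact: S1 Bh ph].
  lra.
have cL h y' M' : B (h, y') -> p (fun x => h x - f0 x) M' -> y' - c <= M'.
  move=> Bh ph; have : y' - M' <= c by apply: (sup_upper_bound hS); exists h, y', M'.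
  lra.
pose A := [set v | exists g y a, B (g, y) /\ v = (fun x => g x + a * f0 x, y + a * c)].
have scale b g y : B (g, y) -> B (fun x => b * g x, b * y).
  move=> Bg; have := lB b _ _ Bg B0; rewrite /= addr0; congr (B (_, _)).
  by apply/funext => x; rewrite addr0.
exists A; split; last by exists c, (fun=> 0), 0, 1; split => //; congr pair; [apply/funext => x|]; ring.
  split.
  - move=> a _ _ [g [y [b [Bg ->]]]] [h [z [b' [Bh ->]]]] /=.
    exists (fun x => a * g x + h x), (a * y + z), (a * b + b'); split; first exact: (lB a _ _ Bg Bh).
    by congr pair; [apply/funext => x|]; ring.
  - move=> f z M [g [y [a [Bg [-> ->]]]]] pf.
    have [a0|a0|a0] := ltgtP a 0.
    + have na0 : 0 < - a by rewrite oppr_gt0.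
      have := pZ (- a)^-1 pf; rewrite ger0_norm ?invr_ge0 ?(ltW na0) // => pf'.
      have := cL _ _ ((- a)^-1 * M) (scale (- a)^-1 _ _ Bg).
      have -> : (fun x => (- a)^-1 * g x - f0 x) = (fun x => (- a)^-1 * (g x + a * f0 x)).
        by apply/funext => x; field; rewrite lt_eqF.
      move=> /(_ pf'); rewrite lerBlDr -(ler_pM2l na0) mulrDr !mulVKf ?gt_eqF //; lra.
    + have := pZ a^-1 pf; rewrite ger0_norm ?invr_ge0 ?(ltW a0) // => pf'.
      have := cU _ _ (a^-1 * M) (scale a^-1 _ _ Bg).
      have -> : (fun x => a^-1 * g x + f0 x) = (fun x => a^-1 * (g x + a * f0 x)).
        by apply/funext => x; field; rewrite gt_eqF.
      by move=> /(_ pf'); rewrite -(ler_pM2l a0) mulrDr !mulVKf ?gt_eqF.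
    + rewrite a0 mul0r addr0; apply: bB Bg _.
      by congr (p _ _): pf; apply/funext => x; rewrite a0 mul0r addr0.
  - by exists (fun=> 0), 0, 0; split => //; congr pair; [apply/funext => x|]; ring.
move=> [g y] Bg; exists g, y, 0; split => //; congr pair; [apply/funext => x|]; ring.
Qed.

Lemma hahn_banach (G : set ((T -> R) * R)) :
  (forall (a : R) u v, G u -> G v -> G (fun x => a * u.1 x + v.1 x, a * u.2 + v.2)) ->
  (forall f y M, G (f, y) -> p f M -> y <= M) -> G (fun=> 0, 0) ->
  exists F : (T -> R) -> R, [/\ forall f y, G (f, y) -> F f = y,
    forall f M, p f M -> `|F f| <= M &
    forall a f g M M', p f M -> p g M' -> F (fun x => a * f x + g x) = a * F f + F g].
Proof.
move=> lG bG G0; have gG : good G by [].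
(* The union with [G] is built into the property so that the empty chain has an admissible union,
   namely [G] itself. *)
have [A [PA maxA]] : exists A, good (A `|` G) /\ (forall B, A `<` B -> ~ good (B `|` G)).
  apply: (@Zorn_bigcup _ (fun A => good (A `|` G))) => F FP Ftot.
  split; last by right.
    move=> a u v [[X FX Xu]|Gu] [[Y FY Yv]|Gv].
    - have [XY|YX] := Ftot X Y FX FY.
        have [lY _ _] := FP _ FY; have [|] := lY a u v (or_introl (XY _ Xu)) (or_introl Yv); last by right.
        by left; exists Y.
      have [lX _ _] := FP _ FX; have [|] := lX a u v (or_introl Xu) (or_introl (YX _ Yv)); last by right.
      by left; exists X.
    - have [lX _ _] := FP _ FX; have [|] := lX a u v (or_introl Xu) (or_intror Gv); last by right.
      by left; exists X.
    - have [lY _ _] := FP _ FY; have [|] := lY a u v (or_intror Gu) (or_introl Yv); last by right.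
      by left; exists Y.
    - by right; exact: lG.
  move=> f y M [[X FX Xf]|Gf]; last exact: bG.
  by have [_ bX _] := FP _ FX; apply: bX; left.
pose B := A `|` G; have [lB bB B0] := PA.
have total f M : p f M -> exists y, B (f, y).
  move=> pf; apply: contrapT => nB; have [A' [gA' BA' [c A'c]]] := extension_step PA pf.
  apply: (maxA A').
    split; first by move=> u Au; apply: BA'; left.
    by move=> /(_ _ A'c) Ac; apply: nB; exists c; left.
  by rewrite (_ : A' `|` G = A') //; apply/seteqP; split => [u []// Gu|u]; [apply: BA'; right|left].
have le0 y : B (fun=> 0, y) -> y = 0.
  move=> By; apply/eqP; rewrite eq_le (bB _ _ _ By p0) /= -oppr_le0.
  have E : (fun x : T => -1 * (fun=> 0) x + (fun=> 0) x, -1 * y + 0) = ((fun=> 0) : T -> R, - y).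
    by congr pair; [apply/funext => x|]; ring.
  by have := lB (-1) _ _ By B0; rewrite /= in E *; rewrite E => /bB; apply.
have uniq f y y' : B (f, y) -> B (f, y') -> y = y'.
  move=> By By'; have E : (fun x : T => -1 * f x + f x, -1 * y + y') = ((fun=> 0) : T -> R, y' - y).
    by congr pair; [apply/funext => x|]; ring.
  by have := lB (-1) _ _ By By'; rewrite /= in E *; rewrite E => /le0; lra.
(* Functions outside the graph get the default value 0; by [total], every function of finite
   seminorm is in it. *)
pose F f : R := xget 0 [set y | B (f, y)].
have FB f M : p f M -> B (f, F f).
  by move=> /total[y By]; rewrite /F; case: xgetP => [z -> //|/(_ y)].
have FE f y : B (f, y) -> F f = y.
  by move=> By; rewrite /F; case: xgetP => [z -> Bz|/(_ y)//]; exact: uniq Bz By.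
exists F; split.
- by move=> f y Gf; apply: FE; right.
- move=> f M pf; have Bf := FB _ _ pf; rewrite ler_norml (bB _ _ _ Bf pf) andbT lerNl.
  have Bm := lB (-1) _ _ Bf B0; have := bB _ _ _ Bm; rewrite /= addr0 mulN1r; apply.
  have := pZ (-1) pf; rewrite normrN1 mul1r; congr (p _ _); apply/funext => x; ring.
- by move=> a f g M M' pf pg; apply: FE; exact: (lB a _ _ (FB _ _ pf) (FB _ _ pg)).
Qed.

End hahn_banach.

(** * Uniform bounds on derivatives up to order [k] *)

Section derivative_bounds.
Context {R : realType}.

Definition Ck_bound n k (f : 'rV[R]_n -> R) (M : R) : Prop :=
  forall (s : seq 'I_n) x, (size s <= k)%N -> `|partials s f x| <= M.

Lemma Ck_bound_test n k (f : 'rV[R]_n -> R) K : smooth f -> compact K -> supported_in K f ->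
  exists2 M : R, 0 < M & Ck_bound k f M.
Proof.
elim: k f => [|k IH] f sf cK Kf; have [M0 M00 fM0] := supported_bound (smooth_continuous sf) cK Kf.
  by exists M0 => // -[].
have cclK := compact_closed_rV cK.
have /choice[M HM] : forall i : 'I_n, exists M : R, 0 < M /\ Ck_bound k (partial i f) M.
  move=> i; have [||M ? ?] := IH (partial i f) _ cK; last by exists M.
    exact: smooth_on_partial.
  exact: (@partials_supported _ _ _ [:: i]).
have S0 (P : pred 'I_n) : 0 <= \sum_(i | P i) M i by apply: sumr_ge0 => i _; apply: ltW; have [] := HM i.
exists (M0 + \sum_i M i); first by rewrite ltr_wpDr.
move=> s x; case/lastP: s => [_|s i]; first by apply: le_trans (fM0 x) _; rewrite lerDl.
rewrite size_rcons ltnS partials_rcons => sk; have [_ h] := HM i.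
apply: le_trans (h s x sk) _; rewrite (bigD1 i) //=; have := S0 (fun j => j != i); lra.
Qed.

(** Leibniz rule by induction on the order, stated for all [chi] supported in [K] since the
    derivatives of [chi] replace it. The constant is independent of [g]. The innermost derivative,
    last in the list, is the one peeled off. *)
Lemma Ck_bound_mul n k (chi : 'rV[R]_n -> R) K : smooth chi -> compact K -> supported_in K chi ->
  exists2 C : R, 0 < C & forall g M, smooth g -> Ck_bound k g M ->
    Ck_bound k (fun x => chi x * g x) (C * M).
Proof.
elim: k chi => [|k IH] chi sc cK Kc; have [M0 M00 cM0] := supported_bound (smooth_continuous sc) cK Kc.
  exists M0 => // g M sg gM [] // x _; rewrite normrM ler_pM //; exact: (gM [::]).
have cclK := compact_closed_rV cK.
have [C C0 HC] := IH chi sc cK Kc.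
have /choice[D HD] : forall i : 'I_n, exists D : R, 0 < D /\ forall g M, smooth g -> Ck_bound k g M ->
    Ck_bound k (fun x => partial i chi x * g x) (D * M).
  move=> i; have [||D ? ?] := IH (partial i chi) _ cK; last by exists D.
    exact: smooth_on_partial.
  exact: (@partials_supported _ _ _ [:: i]).
have S0 (P : pred 'I_n) : 0 <= \sum_(i | P i) D i by apply: sumr_ge0 => i _; apply: ltW; have [] := HD i.
exists (M0 + C + \sum_i D i); first by rewrite ltr_wpDr // addr_gt0.
move=> g M sg gM s x.
have M1 : 0 <= M by apply: le_trans (gM [::] 0 _).
case/lastP: s => [_|s i].
  apply: le_trans (_ : M0 * M <= _).
    by rewrite normrM ler_pM //; exact: (gM [::]).
  by rewrite ler_wpM2r //; have := S0 predT; lra.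
rewrite size_rcons ltnS partials_rcons => sk.
have spg := smooth_on_partial i sg; have spc := smooth_on_partial i sc.
have -> : partial i (fun y => chi y * g y) = (fun y => 1 * (chi y * partial i g y) + partial i chi y * g y).
  apply/funext => y; rewrite (partialM (smooth_derivable sc) (smooth_derivable sg)).
  by rewrite mul1r [g y * _]mulrC.
rewrite (partials_scale_add s 1 x (smooth_onM openT sc spg) (smooth_onM openT spc sg)) mul1r.
apply: le_trans (ler_normD _ _) _.
have h1 : `|partials s (fun y => chi y * partial i g y) x| <= C * M.
  apply: (HC _ _ spg) => // t y tk; rewrite -partials_rcons; apply: gM.
  by rewrite size_rcons.
have h2 : `|partials s (fun y => partial i chi y * g y) x| <= D i * M.
  have [_ h] := HD i; apply: (h _ _ sg) => // t y tk; apply: gM; exact: leq_trans tk _.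
apply: le_trans (lerD h1 h2) _; rewrite -mulrDl ler_wpM2r // (bigD1 i) //=.
by have := S0 (fun j => j != i); lra.
Qed.

Lemma Ck_bound_scale_add n k (a : R) (f g : 'rV[R]_n -> R) (M M' : R) : smooth f -> smooth g ->
  Ck_bound k f M -> Ck_bound k g M' -> Ck_bound k (fun x => a * f x + g x) (`|a| * M + M').
Proof.
move=> sf sg fM gM s x sk; rewrite (partials_scale_add s a x sf sg).
by apply: le_trans (ler_normD _ _) _; rewrite normrM lerD ?ler_wpM2l ?fM ?gM.
Qed.

Lemma sum_weights_le n (e : 'I_n -> nat) s : (\sum_(i <- s) e i <= size s * \sum_i e i)%N.
Proof.
elim: s => [|i s IH]; first by rewrite big_nil.
by rewrite big_cons /= mulSn leq_add // (bigD1 i) //= leq_addr.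
Qed.

(** A derivative along the coordinate [i] yields l^(e i). The maximum with 1 covers expansions and
    contractions at once; for [l <= 1] the bound does not grow. *)
Lemma Ck_bound_dilation n k (e : 'I_n -> nat) (l : R) (f : 'rV[R]_n -> R) (M : R) : smooth f ->
  0 <= l -> Ck_bound k f M ->
  Ck_bound k (f \o dilation e l) ((Num.max 1 l) ^+ (k * \sum_i e i) * M).
Proof.
move=> sf l0 fM s x sk; rewrite (partials_dilation e l s x sf) normrM.
apply: ler_pM => //; last exact: fM.
have m1 : 1 <= Num.max 1 l by rewrite le_max lexx.
rewrite normrX ger0_norm //; apply: le_trans (_ : Num.max 1 l ^+ (\sum_(i <- s) e i) <= _).
  by apply: lerXn2r; rewrite ?nnegrE ?le_max ?lexx ?l0 ?orbT.
rewrite ler_weXn2l //; apply: (leq_trans (sum_weights_le e s)).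
by rewrite leq_mul2r sk orbT.
Qed.

End derivative_bounds.

(** * Dyadic shells and dyadically homogeneous kernels *)

Section dyadic_dilations.
Context {R : realType} (n : nat) (e : 'I_n -> nat).
Hypothesis e_gt0 : forall i, (0 < e i)%N.

Lemma norm_dilation_ge (l : R) (x : 'rV[R]_n) : 1 <= l -> l * `|x| <= `|dilation e l x|.
Proof.
move=> l1; have l0 : 0 < l by exact: lt_le_trans l1.
rewrite -{1}[x](dilationK e (lt0r_neq0 l0)) mulrC -ler_pdivlMr // mulrC.
by apply: norm_dilation_le => //; rewrite invr_ge0 (ltW l0) invf_le1.
Qed.

Lemma norm_dilation_le_expr (l : R) (x : 'rV[R]_n) : 1 <= l ->
  `|dilation e l x| <= l ^+ (\sum_i e i) * `|x|.
Proof.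
move=> l1; have l0 : 0 <= l by exact: le_trans l1.
apply: norm_rV_le => [|i]; first by rewrite mulr_ge0 // exprn_ge0.
rewrite dilation_coord normrM normrX ger0_norm // ler_pM ?exprn_ge0 ?coord_le_norm //.
by rewrite ler_weXn2l // (bigD1 i) //= leq_addr.
Qed.

Lemma expr2_ge_nat k : k%:R <= 2 ^+ k :> R.
Proof. by rewrite -natrX ler_nat; exact: (ltnW (ltn_expl k (ltnSn 1))). Qed.

Lemma dyadic_inner_shell (x : 'rV[R]_n) : x != 0 -> `|x| < 1 ->
  exists k, `|dilation e (2 ^+ k) x| < 1 /\ 1 <= `|dilation e (2 ^+ k.+1) x|.
Proof.
move=> x0 x1; have nx : 0 < `|x| by rewrite normr_gt0.
have ex : exists k, 1 <= `|dilation e (2 ^+ k) x|.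
  exists (Num.bound `|x|^-1); apply: le_trans (norm_dilation_ge _ _); last by rewrite exprn_ege1 // ler1n.
  rewrite -ler_pdivrMr // mul1r; apply: le_trans (expr2_ge_nat _).
  by apply: ltW; apply: archi_boundP; rewrite invr_ge0.
case: (ex_minnP ex) => -[|k] k1 kmin; first by move: k1; rewrite expr0 dilation1 leNgt x1.
by exists k; split => //; rewrite ltNge; apply/negP => /kmin; rewrite ltnn.
Qed.

Lemma dyadic_outer_shell (x : 'rV[R]_n) : 1 <= `|x| ->
  exists k, 1 <= `|dilation e (2^-1 ^+ k) x| /\ `|dilation e (2^-1 ^+ k.+1) x| < 1.
Proof.
move=> x1; have nx : 0 < `|x| by exact: lt_le_trans x1.
have ex : exists k, `|dilation e (2^-1 ^+ k) x| < 1.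
  have kb : `|x| < 2 ^+ Num.bound `|x|.
    by apply: lt_le_trans (expr2_ge_nat _); exact: archi_boundP.
  exists (Num.bound `|x|); apply: le_lt_trans (norm_dilation_le _ e_gt0 _) _.
    by rewrite exprn_ge0 ?exprn_ile1 ?invr_ge0 ?invf_le1 ?ler1n.
  by rewrite exprVn mulrC ltr_pdivrMr ?exprn_gt0 // mul1r.
case: (ex_minnP ex) => -[|k] k1 kmin; first by move: k1; rewrite expr0 dilation1 ltNge x1.
by exists k; split => //; rewrite leNgt; apply/negP => /kmin; rewrite ltnn.
Qed.

Lemma dilation2S k (x : 'rV[R]_n) : dilation e 2 (dilation e (2 ^+ k) x) = dilation e (2 ^+ k.+1) x.
Proof. by rewrite dilation_dilation exprS. Qed.

Section homogeneous_kernel.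
Variables (K : 'rV[R]_n -> R) (d : nat).
Hypothesis homK : forall x : 'rV[R]_n, x != 0 -> K (dilation e 2 x) * 2 ^+ d = K x.

Lemma dyadic_homogeneous k x : x != 0 -> K (dilation e (2 ^+ k) x) * 2 ^+ (d * k) = K x.
Proof.
move=> x0; elim: k => [|k IH]; first by rewrite expr0 dilation1 muln0 expr0 mulr1.
rewrite -dilation2S mulnS exprD mulrA homK //.
by apply/eqP => /dilation_eq0 h; move/eqP: x0; apply; apply: h; rewrite expf_neq0.
Qed.

Hypothesis cK : forall x : 'rV[R]_n, x != 0 -> {for x, continuous K}.

Lemma homogeneous_shell_bound (r s : R) : 0 < r -> exists2 C : R, 0 < C &
  forall x, r <= `|x| -> `|x| <= s -> `|K x| <= C.
Proof.
move=> r0; pose S : set 'rV[R]_n := [set x | r <= `|x| /\ `|x| <= s].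
have cS : compact S.
  apply: (subclosed_compact _ (@compact_closed_ball_rV R n s)); last by move=> x [].
  rewrite (_ : S = ~` [set x | `|x| < r] `&` [set x | `|x| <= s]); last first.
    by apply/seteqP; split => x /= [h1 h2]; split => //; [rewrite ltNge h1|rewrite leNgt; apply/negP].
  apply: closedI; last by apply: compact_closed_rV; exact: compact_closed_ball_rV.
  by apply: open_closedC; have := @open_norm_lt R n 0 r; under eq_fun do rewrite subr0.
have [C C0 HC] := compact_continuous_bound cS (fun x (Sx : S x) => cK (x := x) (ltac:(by rewrite -normr_gt0; exact: lt_le_trans Sx.1))).
by exists C => // x rx xs; apply: HC.
Qed.

(** The dilation by 2^(k+1) carries the k-th shell into the fixed shell between the radii 1 and 2 to
    the sum of the weights, where continuity gives a bound. *)
Lemma homogeneous_inner_bound : exists2 C : R, 0 < C &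
  forall k x, `|dilation e (2 ^+ k) x| < 1 -> 1 <= `|dilation e (2 ^+ k.+1) x| -> `|K x| <= C * 2 ^+ (d * k.+1).
Proof.
have [C C0 HC] := homogeneous_shell_bound (2 ^+ (\sum_i e i)) ltr01.
exists C => // k x k1 k2.
have x0 : x != 0.
  by apply/eqP => x0; move: k2; rewrite x0 dilation0 normr0 leNgt ltr01.
rewrite -(dyadic_homogeneous k.+1 x0) normrM [`|2 ^+ _|]ger0_norm ?exprn_ge0 // ler_wpM2r ?exprn_ge0 //.
apply: HC => //; rewrite -dilation2S; apply: le_trans (norm_dilation_le_expr _ _) _; first by rewrite ler1n.
by rewrite -[leRHS]mulr1 ler_wpM2l ?exprn_ge0 // ltW.
Qed.

Hypothesis d_lt : (d < \sum_i e i)%N.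
Hypothesis mK : measurable_fun setT K.
Hypothesis K0 : K 0 = 0.
Local Notation leb := (@lebesgue_rV R n).

(** Near the origin, [|K|] is at most C 2^(d (k+1)) on the k-th shell, which lies in a set of volume
    at most v 2^(-Q k); d < Q makes the products geometric. Outside the unit ball [K] is bounded on
    compact sets. *)
Lemma L1loc_homogeneous : L1loc K.
Proof.
have [C C0 HC] := homogeneous_inner_bound.
set Q := (\sum_i e i)%N.
(* With the origin removed each point lies in finitely many of these sets, so the majorant is finite
   everywhere. *)
pose E k : set 'rV[R]_n := [set x | x != 0 /\ `|dilation e (2 ^+ k) x| < 1].
have oB1 : open [set x : 'rV[R]_n | `|x| < 1].
  by have := @open_norm_lt R n 0 1; under eq_fun do rewrite subr0.
have mE k : measurable (E k).
  apply: (@measurableI _ _ [set x : 'rV[R]_n | x != 0] [set x | `|dilation e (2 ^+ k) x| < 1]).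
    rewrite (_ : [set x | _] = ~` [set x : 'rV[R]_n | `|x| <= 0]); last first.
      by apply/seteqP; split => x /=; rewrite normr_le0 => /negP.
    by apply: measurableC; apply: compact_measurable_rV; exact: compact_closed_ball_rV.
  have := @measurable_dilation R n e (2 ^+ k) measurableT _ (open_measurable_rV oB1).
  by rewrite setTI.
pose v := fine (leb [set x : 'rV[R]_n | `|x| <= 1]).
have cB1 := @compact_closed_ball_rV R n 1.
have mB1 := compact_measurable_rV cB1.
have vE : leb [set x : 'rV[R]_n | `|x| <= 1] = v%:E.
  by rewrite fineK // ge0_fin_numE //; exact: lebesgue_rV_compact_lty.
have Evol k : (leb (E k) <= (v * 2^-1 ^+ (Q * k))%:E)%E.
  have h0 : 0 < 2 ^+ k :> R by rewrite exprn_gt0.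
  have mP : measurable (dilation e (2 ^+ k) @^-1` [set x : 'rV[R]_n | `|x| <= 1]).
    by have := @measurable_dilation R n e (2 ^+ k) measurableT _ mB1; rewrite setTI.
  apply: (@le_trans _ _ (leb (dilation e (2 ^+ k) @^-1` [set x : 'rV[R]_n | `|x| <= 1]))).
    by apply: le_measure; rewrite ?inE // => x [_ /ltW].
  have := lebesgue_rV_dilation e h0 mB1; rewrite vE -/Q => h.
  have fin : leb (dilation e (2 ^+ k) @^-1` [set x : 'rV[R]_n | `|x| <= 1]) \is a fin_num.
    rewrite ge0_fin_numE // ltey; apply/eqP => hoo; move: h; by rewrite hoo gt0_muley // lte_fin exprn_gt0.
  rewrite -(fineK fin) lee_fin; move: h; rewrite -(fineK fin) -EFinM => -[->].
  by rewrite mulrAC -exprM mulnC -exprMn mulfV ?expr1n ?mul1r.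
have v0 : 0 <= v by rewrite fine_ge0.
pose c k : R := C * 2 ^+ (d * k.+1).
have [g Ig Kg] : exists2 g : 'rV[R]_n -> R, Rintegrable leb g & forall k x, E k x -> c k <= g x.
  apply: (@dyadic_dominant _ _ _ _ E c (C * 2 ^+ d * v)) => //.
  - by move=> k; rewrite mulr_ge0 ?exprn_ge0 // ltW.
  - by rewrite !mulr_ge0 ?exprn_ge0 // ltW.
  - move=> k; apply: (@le_trans _ _ ((c k)%:E * (v * 2^-1 ^+ (Q * k))%:E)%E).
      by apply: lee_wpmul2l; [rewrite lee_fin mulr_ge0 ?exprn_ge0 // ltW|exact: Evol].
    rewrite -EFinM lee_fin /c mulnS exprD !mulrA -[leRHS]mulrA -[leLHS]mulrA.
    have -> : C * 2 ^+ d * 2 ^+ (d * k) * (v * 2^-1 ^+ (Q * k)) = C * 2 ^+ d * v * (2 ^+ (d * k) * 2^-1 ^+ (Q * k)) by ring.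
    rewrite -mulrA ler_wpM2l ?mulr_ge0 ?exprn_ge0 ?(ltW C0) // ler_wpM2l //.
    rewrite (_ : (Q * k = d * k + (Q - d) * k)%N); last by rewrite -mulnDl subnKC // ltnW.
    rewrite exprD mulrA -exprMn mulfV // expr1n mul1r.
    rewrite ler_wiXn2l ?invr_ge0 ?invf_le1 ?ler1n //.
    by rewrite -{1}[k]mul1n leq_mul2r subn_gt0 d_lt orbT.
  - move=> x; case: (eqVneq x 0) => [->|x0].
      exists 0 => k; rewrite big1 // => i _; rewrite indicE memNset ?mulr0 // => -[/eqP].
      by [].
    have nx : 0 < `|x| by rewrite normr_gt0.
    pose k0 := Num.bound `|x|^-1.
    have far k : (k0 <= k)%N -> ~ E k x.
      move=> kk [_]; apply/negP; rewrite -leNgt.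
      apply: le_trans (norm_dilation_ge _ _); last by rewrite exprn_ege1 // ler1n.
      rewrite -ler_pdivrMr // mul1r; apply: le_trans (expr2_ge_nat _).
      apply: le_trans (_ : k0%:R <= _); last by rewrite ler_nat.
      by apply: ltW; apply: archi_boundP; rewrite invr_ge0.
    exists (\sum_(0 <= i < k0) c i * \1_(E i) x) => k.
    have c0 i : 0 <= c i * \1_(E i) x by rewrite !mulr_ge0 ?exprn_ge0 // ltW.
    have [kk|kk] := leqP k k0.
      by rewrite [leRHS](big_cat_nat _ kk) //= lerDl sumr_ge0.
    rewrite (big_cat_nat _ (ltnW kk)) //= [X in _ + X]big1_seq ?addr0 // => i /=.
    rewrite mem_index_iota => /andP[ki _]; rewrite indicE memNset ?mulr0 //; exact: far.
split => // A cA; have [M M0 AM] := compact_norm_bound cA.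
have [D D0 HD] := homogeneous_shell_bound M ltr01.
have mA := compact_measurable_rV cA.
have IA : Rintegrable leb (fun x => `|g x| + D * \1_A x).
  apply: RintegrableD; first exact: Rintegrable_abs.
  apply: RintegrableZ; apply: (@bounded_supported_integrable _ _ _ A 1) => //.
  - by move=> x nA; rewrite indicE memNset.
  - by move=> x; rewrite indicE ger0_norm // lern1 leq_b1.
apply: (@le_lt_trans _ _ (\int[leb]_(x in A) (`|g x| + D * \1_A x)%:E)%E); last first.
  have /integrableP[_] := integrableS measurableT mA (@subsetT _ A) IA.
  apply: le_lt_trans; apply: ge0_le_integral => //.
  - by move=> x _; rewrite lee_fin addr_ge0 // mulr_ge0 // ltW.
  - by apply: measurable_funTS; apply/measurable_EFinP; exact: Rintegrable_measurable IA.
  - apply: measurable_funTS; apply: measurableT_comp => //.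
    by apply/measurable_EFinP; exact: Rintegrable_measurable IA.
  - by move=> x _ /=; rewrite lee_fin ler_norm.
apply: ge0_le_integral => //.
- by apply: measurable_funTS; apply/measurable_EFinP; apply: measurableT_comp.
- by apply: measurable_funTS; apply/measurable_EFinP; exact: Rintegrable_measurable IA.
move=> x Ax; rewrite lee_fin; case: (eqVneq x 0) => [->|x0].
  by rewrite K0 normr0 addr_ge0 // mulr_ge0 // ltW.
case: (ltP `|x| 1) => x1.
  have [k [k1 k2]] := dyadic_inner_shell x0 x1.
  apply: le_trans (HC k x k1 k2) _; apply: le_trans (Kg k x _) _ => //.
  by apply: le_trans (ler_norm _) _; rewrite lerDl mulr_ge0 // ltW.
by rewrite indicE mem_set // mulr1; apply: le_trans (HD x x1 (AM x Ax)) _; rewrite lerDr.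
Qed.

End homogeneous_kernel.

End dyadic_dilations.

(** * From a local solution to the homogeneous kernel *)

Section homogeneous_fundamental_solution.
Context {R : realType} (n m : nat) (e : 'I_n -> nat) (X : 'I_m -> @vfield R n) (w : 'I_m -> nat)
  (nu : nat) (c : seq 'I_m -> R) (i0 : 'I_n).
Hypothesis e_gt0 : forall i, (0 < e i)%N.
Hypothesis sX : forall i, smooth_map (X i).
Hypothesis X0 : forall j i x, partial i (fun y => X j y 0 i) x = 0.
Hypothesis hX : forall j, vf_homogeneous e (X j) (w j).
Hypothesis hypo : hypoelliptic X w nu c.
Hypothesis hypo_tr : hypoelliptic X w nu (transpose_coef c).
Hypothesis nu_gt0 : (0 < nu)%N.
Hypothesis nu_lt : (nu < \sum_i e i)%N.
Local Notation L := (hom_op X w nu c).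
Local Notation Ls := (hom_op X w nu (transpose_coef c)).
Local Notation leb := (@lebesgue_rV R n).
Local Notation Q := (\sum_i e i)%N.
Local Notation dil := (dilation e).

(** Hahn-Banach for the functional sending [Ls phi] to [- phi 0], with [phi] supported in the unit
    ball. The seminorm is [C] times the C^k norm, infinite on functions that are not smooth, and the
    bound on the functional is [test_fun_estimate] for the transposed operator. *)
Lemma local_solution : exists (T : ('rV[R]_n -> R) -> R) (C : R) (k : nat), [/\ 0 < C,
  forall a f g M M', smooth f -> smooth g -> Ck_bound k f M -> Ck_bound k g M' ->
    T (fun x => a * f x + g x) = a * T f + T g,
  forall f M, smooth f -> Ck_bound k f M -> `|T f| <= C * M &
  forall phi, smooth phi -> supported_in [set x | `|x| <= 1] phi -> T (Ls phi) = - phi 0].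
Proof.
have [C [k [C0 HC]]] := test_fun_estimate e_gt0 sX X0 hX hypo_tr i0.
have iC (f : 'rV[R]_n -> R) (M : R) : (forall s x, (size s <= k)%N -> C * `|partials s f x| <= M) <-> Ck_bound k f (M / C).
  by split => h s x sk; have := h s x sk; rewrite ler_pdivlMr // mulrC.
pose p (f : 'rV[R]_n -> R) (M : R) := smooth f /\ Ck_bound k f (M / C).
have s0 : smooth (fun _ : 'rV[R]_n => 0 : R) by exact: (@smooth_on_cst _ _ setT 0 openT).
have z0 s x : partials s (fun _ : 'rV[R]_n => 0 : R) x = 0.
  exact: (@partials_supported R n set0 s (fun=> 0) closed0).
have p0 : p (fun=> 0) 0 by split; [exact: s0|move=> s x _; rewrite z0 normr0 mul0r].
have pZ a f M : p f M -> p (fun x => a * f x) (`|a| * M).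
  move=> [sf fM]; split; first exact: (smooth_onZ a openT sf).
  by move=> s x sk; rewrite (partialsZ s a x sf) normrM -mulrA ler_wpM2l // fM.
have pD f g M M' : p f M -> p g M' -> p (fun x => f x + g x) (M + M').
  move=> [sf fM] [sg gM]; split; first exact: (smooth_onD openT sf sg).
  have := Ck_bound_scale_add 1 sf sg fM gM; rewrite normr1 mul1r -mulrDl.
  by congr (Ck_bound k _ _); apply/funext => x; rewrite mul1r.
(* A relation rather than a function: that [Ls phi] determines [phi 0] is a consequence of the
   estimate. *)
pose G := [set v : ('rV[R]_n -> R) * R | exists phi, [/\ smooth phi,
  supported_in [set x | `|x| <= 1] phi & v = (Ls phi, - phi 0)]].
have [a _ _ [phi [sp Kp ->]] [psi [ss Ks ->]]|f y M [phi [sp Kp [-> ->]]] [_ fM]| |T [TG Tb Tl]] :=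
  @hahn_banach R _ p p0 pZ pD G.
- exists (fun x => a * phi x + psi x); split.
  + exact: (smooth_scale_add a sp ss).
  + by move=> x nx; rewrite Kp // Ks // mulr0 addr0.
  + congr pair; last by rewrite /=; ring.
    by apply/funext => x; rewrite /= (hom_op_scale_add w sX nu _ a x sp ss).
- have := HC phi (M / C) sp Kp fM 0; rewrite mulrCA mulfV ?gt_eqF // mulr1.
  by apply: le_trans; rewrite -normrN ler_norm.
- exists (fun=> 0); split => //; congr pair; last by rewrite oppr0.
  by apply/funext => x; rewrite hom_op0.
exists T, C, k; split => //.
- move=> a f g M M' sf sg fM gM; apply: (Tl a f g (M * C) (M' * C)); split => //.
    by rewrite mulfK // gt_eqF.
  by rewrite mulfK // gt_eqF.
- by move=> f M sf fM; rewrite mulrC; apply: Tb; split => //; rewrite mulfK // gt_eqF.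
- by move=> phi sp Kp; apply: TG; exists phi.
Qed.

Lemma geometric_cauchy (a : nat -> R) (j0 : nat) (A : R) : 0 <= A ->
  (forall j, (j0 <= j)%N -> `|a j.+1 - a j| <= A * 2^-1 ^+ j) ->
  exists2 l : R, a @ \oo --> l & `|l - a j0| <= A * 2.
Proof.
move=> A0 aA; pose b i := a (i + j0).+1 - a (i + j0)%N.
have bA i : `|b i| <= A * 2^-1 ^+ i.
  apply: le_trans (aA _ (leq_addl _ _)) _; rewrite ler_wpM2l //.
  by rewrite ler_wiXn2l ?invr_ge0 ?invf_le1 ?ler1n // leq_addr.
have Ib : Rintegrable (@counting nat R) b.
  by apply: (Rintegrable_le _ (Rintegrable_geometric A)).
have tel k : \sum_(i < k) b i = a (k + j0)%N - a j0.
  elim: k => [|k IH]; first by rewrite big_ord0 add0n subrr.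
  by rewrite big_ord_recr /= IH /b addSn; ring.
have L1 := Rintegral_counting_cvg Ib.
have L2 : a (k + j0)%N @[k --> \oo] --> a j0 + \int[@counting nat R]_i b i.
  have : (fun k => a j0 + \sum_(i < k) b i) @ \oo --> a j0 + \int[@counting nat R]_i b i.
    by apply: cvgD; [exact: cvg_cst|exact: L1].
  by under eq_fun do rewrite tel addrC subrK.
exists (a j0 + \int[@counting nat R]_i b i); first by rewrite -(cvg_shiftn j0).
rewrite addrC addKr.
have cN : `|\sum_(i < k) b i| @[k --> \oo] --> `|\int[@counting nat R]_i b i|.
  by apply: cvg_norm; exact: L1.
rewrite -(cvg_lim _ cN) //; apply: limr_le; first by apply/cvg_ex; eexists; exact: cN.
apply: nearW => k; apply: le_trans (ler_norm_sum _ _ _) _.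
apply: le_trans (_ : \sum_(i < k) A * 2^-1 ^+ i <= _); first by apply: ler_sum => i _; exact: bA.
by rewrite -mulr_sumr ler_wpM2l // -(big_mkord xpredT (fun i => 2^-1 ^+ i)) geometric_half_sum.
Qed.

Lemma test_fun_dilation (l r : R) (f : 'rV[R]_n -> R) : 1 <= l -> supported_in [set x | `|x| <= r] f ->
  supported_in [set x | `|x| <= r / l] (f \o dil l).
Proof.
move=> l1 Kf x /= nx; have l0 : 0 < l by exact: lt_le_trans l1.
apply: Kf => /= h; apply: nx; rewrite ler_pdivlMr // mulrC.
exact: le_trans (norm_dilation_ge e_gt0 x l1) h.
Qed.

Lemma compact_support_ball (K : set 'rV[R]_n) (f : 'rV[R]_n -> R) : compact K -> supported_in K f ->
  exists2 r : R, 0 < r & supported_in [set x | `|x| <= r] f.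
Proof.
move=> cK Kf; have [r r0 Kr] := compact_norm_bound cK.
by exists r => // x nx; apply: Kf => /Kr.
Qed.

Lemma Ls_dilation (l : R) phi : 0 < l -> smooth phi -> (fun x => l ^+ nu * (Ls phi \o dil l) x) = Ls (phi \o dil l).
Proof. by move=> l0 sp; apply/funext => x; rewrite (hom_op_dilation sX hX). Qed.

(** The defect of homogeneity of the local solution has a smooth density [h] on the unit ball, by
    hypoellipticity of [L]. Consecutive rescalings differ by 2^(nu j) times the integral of [h]
    against the dilated test function, which is of size 2^((nu - Q) j), so they converge
    geometrically. Homogeneity of the limit is a shift of the index. *)
Lemma homogeneous_distribution : exists S : ('rV[R]_n -> R) -> R, [/\ distribution_on setT S,
  forall phi, test_fun setT phi -> S (Ls phi) = - phi 0 &
  forall phi, test_fun setT phi -> S (phi \o dil 2) * 2 ^+ nu = S phi].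
Proof.
have [T [C [k [C0 Tl Tb Tsol]]]] := local_solution.
have tame phi : test_fun setT phi -> smooth phi /\ exists2 M : R, 0 < M & Ck_bound k phi M.
  move=> [sp [K [cK _ Kp]]]; split; first exact: sp.
  exact: (Ck_bound_test _ sp cK Kp).
have tdil (l : R) phi : 1 <= l -> test_fun setT phi -> test_fun setT (phi \o dil l).
  move=> l1 [sp [K [cK _ Kp]]]; have [r r0 Kr] := compact_support_ball cK Kp.
  split; first exact: (smooth_comp sp (smooth_dilation e l)).
  exists [set x | `|x| <= r / l]; split => //; first exact: compact_closed_ball_rV.
  exact: test_fun_dilation.
(* On [Ls phi], with [phi] supported in the unit ball, both terms equal [- phi 0], because 2^nu
   times [Ls phi o dil 2] is [Ls (phi o dil 2)]. *)
pose D0 phi : R := 2 ^+ nu * T (phi \o dil 2) - T phi.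
pose W : set 'rV[R]_n := [set x | `|x| < 1].
have oW : open W by have := @open_norm_lt R n 0 1; rewrite /W; under eq_fun do rewrite subr0.
have TlT a f g : test_fun setT f -> test_fun setT g -> T (fun x => a * f x + g x) = a * T f + T g.
  by move=> /tame[sf [M _ fM]] /tame[sg [M' _ gM]]; exact: (Tl a f g M M').
have t0 : test_fun setT (fun _ : 'rV[R]_n => 0 : R).
  split; first exact: (@smooth_on_cst _ _ setT 0 openT).
  by exists set0; split => //; exact: compact0.
have T0 : T (fun=> 0) = 0.
  have := TlT (-1) _ _ t0 t0; rewrite (_ : (fun x : 'rV[R]_n => -1 * 0 + 0) = (fun=> 0)); first lra.
  by apply/funext => x; ring.
have TZ a f : test_fun setT f -> T (fun x => a * f x) = a * T f.
  move=> tf; have := TlT a _ _ tf t0; rewrite T0 addr0 => <-.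
  by congr T; apply/funext => x; rewrite addr0.
have toT phi (V : set 'rV[R]_n) : test_fun V phi -> test_fun setT phi.
  by move=> [sp [K [cK KW Kp]]]; split => //; exists K.
have tLs phi : test_fun setT phi -> test_fun setT (Ls phi).
  move=> [sp [K [cK _ Kp]]]; split; first exact: (smooth_hom_op w sX nu _ sp).
  exists K; split => //; apply: hom_op_supported => //; exact: compact_closed_rV.
have [h sh Hh] : dist_smooth_on W D0.
  apply: (hypo oW oW (@subset_refl _ W)).
    split.
      move=> a f g /toT tf /toT tg.
      have E : T ((fun x => a * f x + g x) \o dil 2) = a * T (f \o dil 2) + T (g \o dil 2).
        exact: (TlT a _ _ (tdil 2 _ (ler1n _ 2) tf) (tdil 2 _ (ler1n _ 2) tg)).
      by rewrite /D0 (TlT _ _ _ tf tg) E; ring.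
    move=> K cK KW; exists (2 ^+ nu * (C * 2 ^+ (k * Q)) + C), k => f sf Kf M fM.
    have h1 : `|T f| <= C * M by exact: Tb.
    have h2 : `|T (f \o dil 2)| <= C * (2 ^+ (k * Q) * M).
      apply: Tb; first exact: (smooth_comp sf (smooth_dilation e 2)).
      have := Ck_bound_dilation e sf (ler0n R 2) fM.
      by rewrite (_ : Num.max 1 2 = 2 :> R) //; apply/max_idPr; rewrite ler1n.
    apply: le_trans (ler_normB _ _) _; rewrite mulrDl lerD // normrM ger0_norm ?exprn_ge0 //.
    by rewrite -!mulrA ler_wpM2l ?exprn_ge0.
  exists (fun=> 0) => [|phi tphi]; first exact: smooth_on_cst.
  have -> : \int[leb]_x (0 * phi x) = 0.
    by under eq_Rintegral do rewrite mul0r; rewrite /Rintegral integral0.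
  have [sp [K [cK KW Kp]]] := tphi.
  have Kp1 : supported_in [set x | `|x| <= 1] phi by move=> x nx; apply: Kp => /KW /ltW.
  rewrite /dist_hom_op /D0 (Tsol _ sp Kp1).
  have sp2 := smooth_comp sp (smooth_dilation e 2).
  have Kp2 : supported_in [set x | `|x| <= 1] (phi \o dil 2).
    have := test_fun_dilation (ler1n R 2) Kp1; move=> H x /= nx; apply: H => /= h; apply: nx.
    by apply: le_trans h _; lra.
  have tL := tLs _ (toT _ _ tphi).
  rewrite -(TZ _ _ (tdil 2 _ (ler1n _ 2) tL)) (Ls_dilation (ltr0Sn R 1) sp).
  by rewrite (Tsol _ sp2 Kp2) /= dilation0; ring.

have [H H0 hH] : exists2 H : R, 0 < H & forall x, `|x| <= 2^-1 -> `|h x| <= H.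
  apply: (compact_continuous_bound (@compact_closed_ball_rV R n 2^-1)) => x /= x1.
  by apply: (smooth_on_continuous sh); apply: le_lt_trans x1 _; lra.
have two j : 1 <= 2 ^+ j :> R by rewrite exprn_ege1 // ler1n.
have two0 j : 0 < 2 ^+ j :> R by rewrite exprn_gt0.
pose a phi j : R := 2 ^+ (nu * j) * T (phi \o dil (2 ^+ j)).
have dilS phi j : (phi \o dil (2 ^+ j)) \o dil 2 = phi \o dil (2 ^+ j.+1).
  by apply/funext => x; rewrite /= dilation_dilation exprSr.
(* The condition on [j] places the support of the dilated function in the ball of radius 1/2, where
   [h] is bounded by [H]; the change of variables contributes 2^(-j Q). *)
have step phi (r : R) j : test_fun setT phi -> supported_in [set x | `|x| <= r] phi -> 2 * r <= 2 ^+ j ->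
    `|a phi j.+1 - a phi j| <= H * \int[leb]_x `|phi x| * 2^-1 ^+ j.
  move=> tp Kr rj; have tj := tdil (2 ^+ j) _ (two j) tp.
  have [sp _] := tp; have [sj _] := tj.
  have Kj : supported_in [set x | `|x| <= 2^-1] (phi \o dil (2 ^+ j)).
    have Kj' := test_fun_dilation (two j) Kr; move=> x nx; apply: Kj' => /= hx; apply: nx => /=.
    by apply: le_trans hx _; rewrite ler_pdivrMr //; lra.
  have cB := @compact_closed_ball_rV R n 2^-1.
  have BW : [set x : 'rV[R]_n | `|x| <= 2^-1] `<=` W by move=> x /= hx; apply: le_lt_trans hx _; lra.
  have -> : a phi j.+1 - a phi j = 2 ^+ (nu * j) * D0 (phi \o dil (2 ^+ j)).
    by rewrite /a /D0 dilS mulnS exprD; ring.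
  rewrite Hh; last by split; [exact: sj|exists [set x | `|x| <= 2^-1]].
  have [sphi [K [cK _ Kphi]]] := tp.
  have Ip := smooth_supported_integrable sphi cK Kphi.
  have mp := Rintegrable_measurable (Rintegrable_abs Ip).
  have Iha : Rintegrable leb (fun x => h x * (phi \o dil (2 ^+ j)) x).
    apply: (continuous_on_mul_integrable oW _ (smooth_continuous sj) cB BW Kj).
    by move=> x Wx; exact: (smooth_on_continuous sh Wx).
  have Ij : Rintegrable leb (fun x => `|phi (dil (2 ^+ j) x)|).
    exact: (Rintegrable_dilation e (two0 j) (Rintegrable_abs Ip)).
  have E : \int[leb]_x `|phi (dil (2 ^+ j) x)| = \int[leb]_x `|phi x| * 2^-1 ^+ (j * Q).
    have := Rintegral_dilation e (two0 j) mp; rewrite -exprM => ->.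
    by rewrite mulrAC -exprMn mulfV // expr1n mul1r.
  have b1 : `|\int[leb]_x (h x * (phi \o dil (2 ^+ j)) x)| <= H * (\int[leb]_x `|phi x| * 2^-1 ^+ (j * Q)).
    rewrite -E -RintegralZl //; apply: norm_Rintegral_le.
    - exact: Rintegrable_measurable Iha.
    - exact: RintegrableZ.
    - move=> x; case: (pselect (`|x| <= 2^-1)) => hx; last by rewrite Kj // mulr0 normr0 mulr_ge0 // ltW.
      by rewrite normrM ler_wpM2r // hH.
  rewrite normrM ger0_norm ?exprn_ge0 //; apply: le_trans (ler_wpM2l (exprn_ge0 _ (ler0n R 2)) b1) _.
  have I0 : 0 <= \int[leb]_x `|phi x| by apply: Rintegral_ge0.
  rewrite mulrCA -!mulrA ler_wpM2l ?(ltW H0) // mulrCA ler_wpM2l //.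
  rewrite mulnC (_ : (j * Q = j * nu + j * (Q - nu))%N); last by rewrite -mulnDr subnKC // ltnW.
  rewrite exprD mulrA -exprMn mulfV // expr1n mul1r ler_wiXn2l ?invr_ge0 ?invf_le1 ?ler1n //.
  by rewrite -{1}[j]muln1 leq_mul2l subn_gt0 nu_lt orbT.
have lim_a phi (r : R) j0 : test_fun setT phi -> supported_in [set x | `|x| <= r] phi -> 2 * r <= 2 ^+ j0 ->
    exists2 l : R, a phi @ \oo --> l & `|l - a phi j0| <= H * \int[leb]_x `|phi x| * 2.
  move=> tp Kr rj; apply: geometric_cauchy.
    by rewrite mulr_ge0 ?(ltW H0) //; apply: Rintegral_ge0.
  by move=> j jj; apply: (step _ r) => //; apply: le_trans rj _; rewrite ler_weXn2l // ler1n.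
pose S phi : R := lim (a phi @ \oo).
have rj (r : R) : 0 <= r -> exists j0, 2 * r <= 2 ^+ j0 :> R.
  move=> r0; exists (Num.bound (2 * r)); apply: le_trans (expr2_ge_nat _).
  by apply: ltW; apply: archi_boundP; rewrite mulr_ge0.
have cvgS phi : test_fun setT phi -> a phi @ \oo --> S phi.
  move=> tp; have [_ [K [cK _ Kp]]] := tp; have [r r0 Kr] := compact_support_ball cK Kp.
  have [j0 hj0] := rj r (ltW r0); have [l al _] := lim_a _ r j0 tp Kr hj0.
  by rewrite /S (cvg_lim _ al).
exists S; split.
- split.
    move=> b f g /toT tf /toT tg.
    have tfg : test_fun setT (fun x => b * f x + g x).
      have [sf [K [cK _ Kf]]] := tf; have [sg [K' [cK' _ Kg]]] := tg.
      split; first exact: (smooth_scale_add b sf sg).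
      exists (K `|` K'); split => //; first exact: compactU.
      by move=> x nx; rewrite Kf ?Kg ?mulr0 ?addr0 // => hx; apply: nx; [right|left].
    apply: (@cvg_seq_unique _ (a (fun x => b * f x + g x)) (fun j => b * a f j + a g j)).
    + move=> j; rewrite /a.
      have E : T ((fun x => b * f x + g x) \o dil (2 ^+ j)) = b * T (f \o dil (2 ^+ j)) + T (g \o dil (2 ^+ j)).
        exact: (TlT b _ _ (tdil _ _ (two j) tf) (tdil _ _ (two j) tg)).
      by rewrite E; ring.
    + exact: cvgS.
    + by apply: cvgD; [apply: cvgM; [exact: cvg_cst|exact: cvgS]|exact: cvgS].
  move=> K cK _; have [r r0 Kr] := compact_norm_bound cK.
  have [j0 hj0] := rj r (ltW r0).
  pose B : set 'rV[R]_n := [set x | `|x| <= r].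
  have cB : compact B by exact: compact_closed_ball_rV.
  have IB : Rintegrable leb (\1_B : 'rV[R]_n -> R).
    apply: (@bounded_supported_integrable _ _ _ B 1) => //.
    - by apply: measurable_indic; exact: compact_measurable_rV.
    - by move=> x nB; rewrite indicE memNset.
    - by move=> x; rewrite indicE ger0_norm // lern1 leq_b1.
  exists (H * (\int[leb]_x \1_B x) * 2 + 2 ^+ (nu * j0) * (C * (2 ^+ j0) ^+ (k * Q))), k => f sf Kf M fM.
  have KB : supported_in B f by move=> x nB; apply: Kf => /Kr.
  have tf : test_fun setT f by split => //; exists K.
  have [l al hl] := lim_a _ r j0 tf KB hj0.
  have -> : S f = l by rewrite /S (cvg_lim _ al).
  have M0 : 0 <= M by apply: le_trans (fM [::] 0 _).
  have h1 : `|a f j0| <= 2 ^+ (nu * j0) * (C * (2 ^+ j0) ^+ (k * Q)) * M.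
    rewrite /a normrM ger0_norm ?exprn_ge0 // -mulrA ler_wpM2l ?exprn_ge0 // -mulrA.
    apply: Tb; first exact: (smooth_comp sf (smooth_dilation e _)).
    have := Ck_bound_dilation e sf (ltW (two0 j0)) fM.
    by rewrite (_ : Num.max 1 (2 ^+ j0) = 2 ^+ j0 :> R) //; apply/max_idPr.
  have h2 : \int[leb]_x `|f x| <= M * \int[leb]_x \1_B x.
    rewrite -RintegralZl //; apply: le_Rintegral => //.
    - by apply: Rintegrable_abs; exact: (smooth_supported_integrable sf cK Kf).
    - exact: RintegrableZ.
    - move=> x _; case: (pselect (B x)) => Bx; last by rewrite KB // normr0 mulr_ge0.
      by rewrite indicE mem_set // mulr1; exact: (fM [::]).
  rewrite -[l](subrK (a f j0)) mulrDl; apply: le_trans (ler_normD _ _) _; apply: lerD => //.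
  by apply: le_trans hl _; have := ler_wpM2l (ltW H0) h2; lra.
- move=> phi tp; have [sp [K [cK _ Kp]]] := tp; have [r r0 Kr] := compact_support_ball cK Kp.
  have [j0 hj0] := rj r (ltW r0).
  have := cvgS _ (tLs _ tp); move=> /(cvg_lim (@Rhausdorff R)) <-.
  (* The identity is exact from [j0] on, when the dilated [phi] is supported in the unit ball and
     [Tsol] applies. *)
  apply: lim_near_cst => //; exists j0 => // j /= jj.
  have E := Ls_dilation (two0 j) sp.
  rewrite /a mulnC exprM -(TZ _ _ (tdil _ _ (two j) (tLs _ tp))) E Tsol.
  + by rewrite /= dilation0.
  + exact: (smooth_comp sp (smooth_dilation e _)).
  + have Kj := test_fun_dilation (two j) Kr; move=> x /= nx; apply: Kj => /= hx; apply: nx.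
    apply: le_trans hx _; rewrite ler_pdivrMr // mul1r; apply: le_trans (_ : 2 ^+ j0 <= _); first lra.
    by rewrite ler_weXn2l // ler1n.
- move=> phi tp; have tp2 := tdil 2 _ (ler1n _ 2) tp.
  apply: (@cvg_seq_unique _ (fun j => a (phi \o dil 2) j * 2 ^+ nu) (fun j => a phi j.+1)).
  + move=> j; rewrite /a mulnS exprD.
    have -> : (phi \o dil 2) \o dil (2 ^+ j) = phi \o dil (2 ^+ j.+1).
      by apply/funext => x; rewrite /= dilation_dilation exprS.
    by ring.
  + by apply: cvgM; [exact: cvgS|exact: cvg_cst].
  + by have := cvgS _ tp; rewrite -(cvg_shiftS (a phi)).
Qed.

Lemma test_fun_setT (W : set 'rV[R]_n) phi : test_fun W phi -> test_fun setT phi.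
Proof. by move=> [sp [K [cK _ Kp]]]; split => //; exists K. Qed.

Lemma test_fun_dil (W : set 'rV[R]_n) (l : R) phi : 0 < l -> (forall x, W x -> W (dil l^-1 x)) ->
  test_fun W phi -> test_fun W (phi \o dil l).
Proof.
move=> l0 Wl [sp [K [cK KW Kp]]]; split; first exact: (smooth_comp sp (smooth_dilation e l)).
have ln0 := lt0r_neq0 l0.
exists (dil l^-1 @` K); split.
- apply: continuous_compact => //; apply: continuous_subspaceT.
  exact: (smooth_map_continuous (smooth_dilation e l^-1)).
- by move=> _ [x Kx <-]; apply: Wl; exact: KW.
- move=> x nx; apply: Kp => Kx; apply: nx; exists (dil l x) => //.
  by rewrite dilationK.
Qed.

(** [S] has a smooth density [K] off the origin. The difference [S1] of [S] and [K] satisfies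
    S1(psi) 2^(nu j) = S1(psi o dil 2^(-j)) and depends only on its argument near the origin.
    Stretching does not increase the derivative bounds, so the right side stays bounded in [j], and
    nu > 0 forces S1 = 0. *)
Lemma group_kernel : exists K : 'rV[R]_n -> R, [/\ smooth_on [set x | x != 0] K, K 0 = 0,
  forall x : 'rV[R]_n, x != 0 -> K (dil 2 x) * 2 ^+ (Q - nu) = K x, L1loc K &
  forall phi, test_fun setT phi -> \int[leb]_x (K x * Ls phi x) = - phi 0].
Proof.
have [S [[Sl Sb] Ssol Shom]] := homogeneous_distribution.
pose W : set 'rV[R]_n := [set x | x != 0].
have oW : open W.
  rewrite (_ : W = ~` [set x | `|x| <= 0]); last first.
    by apply/seteqP; split => x /=; rewrite normr_le0 => /negP.
  by apply: closed_openC; apply: compact_closed_rV; exact: compact_closed_ball_rV.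
have [K1 sK1 HK1] : dist_smooth_on W S.
  apply: (hypo openT oW (@subsetT _ W)) => //; exists (fun=> 0); first exact: smooth_on_cst.
  move=> phi [sp [K [cK KW Kp]]]; under eq_Rintegral do rewrite mul0r.
  rewrite /Rintegral integral0 /dist_hom_op Ssol; last by split => //; exists K.
  by rewrite Kp ?oppr0 // => /KW; rewrite /W /= eqxx.
(* The density is arbitrary at the origin; the value 0 keeps [K] measurable and compatible with the
   dyadic relation. *)
pose K := K1 \_ W.
have KW x : W x -> K1 x = K x by move=> Wx; rewrite /K patchE mem_set.
have sK : smooth_on W K by exact: (smooth_on_ext oW KW sK1).
have nW0 : ~ W 0 by rewrite /W /= eqxx.
have K0 : K 0 = 0 by rewrite /K patchE (memNset nW0).
have cK (x : 'rV[R]_n) : x != 0 -> {for x, continuous K} by move=> x0; exact: (smooth_on_continuous sK x0).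
have mK : measurable_fun setT K.
  apply: measurable_restrict_open_rV => // x Wx; exact: (smooth_on_continuous sK1 Wx).
have HK phi : test_fun W phi -> S phi = \int[leb]_x (K x * phi x).
  move=> tp; rewrite HK1 //; have [_ [A [_ AW Ap]]] := tp.
  apply: eq_Rintegral => x _; case: (pselect (W x)) => Wx; first by rewrite KW.
  by rewrite Ap ?mulr0 // => /AW.
have Wdil (l : R) x : 0 < l -> W x -> W (dil l x).
  by move=> l0 /= x0; apply/eqP => /dilation_eq0 h; move/eqP: x0; apply; apply: h; rewrite gt_eqF.
set d := (Q - nu)%N.
have two0 : 0 < 2 :> R by [].
have h0 : 0 < 2^-1 :> R by rewrite invr_gt0.
have Qd : 2 ^+ Q = 2 ^+ nu * 2 ^+ d :> R by rewrite -exprD subnKC // ltnW.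
have mphi phi : smooth phi -> measurable_fun setT (fun x => K x * phi x).
  move=> sp; apply: measurable_funM => //.
  exact: (continuous_measurable_rV (smooth_continuous sp)).
(* Homogeneity of [S] tested on [phi o dil 2^-1]: the Jacobian 2^Q against 2^nu leaves 2^d. *)
have homK (x : 'rV[R]_n) : x != 0 -> K (dil 2 x) * 2 ^+ d = K x.
  move=> x0; apply/eqP; rewrite -subr_eq0; apply/eqP.
  have cd y : W y -> {for y, continuous (fun y => K (dil 2 y) * 2 ^+ d + -1 * K y)}.
    move=> Wy; apply: continuous_atD; last first.
      by apply: continuous_atM; [exact: continuous_at_cst|exact: cK].
    apply: continuous_atM; last exact: continuous_at_cst.
    apply: (@continuous_comp _ _ _ (dil 2) K); first exact: (smooth_map_continuous (smooth_dilation e 2)).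
    by apply: cK; exact: (Wdil 2 y).
  rewrite -mulN1r; apply: (fundamental_lemma oW cd _ x0) => phi tp.
  have [sp [A [cA AW Ap]]] := tp.
  have tpsi : test_fun W (phi \o dil 2^-1).
    by apply: test_fun_dil => // y Wy; apply: Wdil => //; rewrite invrK.
  have [spsi _] := tpsi.
  have E1 : (phi \o dil 2^-1) \o dil 2 = phi by apply/funext => y; rewrite /= dilationK.
  have E2 : S phi * 2 ^+ nu = \int[leb]_x (K x * (phi \o dil 2^-1) x).
    by rewrite -(HK _ tpsi) -(Shom _ (test_fun_setT tpsi)) E1.
  have E3 : \int[leb]_x (K x * (phi \o dil 2^-1) x) = 2 ^+ Q * \int[leb]_x (K (dil 2 x) * phi x).
    rewrite (Rintegral_dilation e two0 (mphi _ spsi)); congr (_ * _).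
    by apply: eq_Rintegral => y _; rewrite /= dilationK.
  have cKW y : W y -> {for y, continuous K} by exact: cK.
  have cK2 y : W y -> {for y, continuous (fun y => K (dil 2 y))}.
    move=> Wy; apply: (@continuous_comp _ _ _ (dil 2) K); first exact: (smooth_map_continuous (smooth_dilation e 2)).
    by apply: cK; exact: (Wdil 2 y).
  have I1 := continuous_on_mul_integrable oW cKW (smooth_continuous sp) cA AW Ap.
  have I2 := continuous_on_mul_integrable oW cK2 (smooth_continuous sp) cA AW Ap.
  have -> : \int[leb]_y ((K (dil 2 y) * 2 ^+ d + -1 * K y) * phi y) =
      2 ^+ d * \int[leb]_y (K (dil 2 y) * phi y) - \int[leb]_y (K y * phi y).
    rewrite -RintegralZl // -RintegralB //; last exact: RintegrableZ.
    by apply: eq_Rintegral => y _; ring.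
  rewrite -HK //; apply/eqP; rewrite subr_eq0; apply/eqP.
  apply: (@mulIf _ (2 ^+ nu)); first by rewrite expf_neq0.
  by rewrite E2 E3 Qd; ring.
have d_lt : (d < Q)%N by rewrite /d ltn_subrL nu_gt0 (leq_ltn_trans _ nu_lt).
have LK : L1loc K by exact: (L1loc_homogeneous e_gt0 homK).
exists K; split => // phi tp.
suff SK psi : test_fun setT psi -> S psi = \int[leb]_x (K x * psi x).
  rewrite -SK ?Ssol //; have [sp [A [cA _ Ap]]] := tp.
  split; first exact: (smooth_hom_op w sX nu _ sp).
  by exists A; split => //; apply: hom_op_supported => //; exact: compact_closed_rV.
move=> {tp phi} {}tp; have [sp [A [cA _ Ap]]] := tp.
pose S1 phi : R := S phi - \int[leb]_x (K x * phi x).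
have [Kl Kb] := L1loc_distribution setT LK.
have S1hom phi : test_fun setT phi -> S1 phi * 2 ^+ nu = S1 (phi \o dil 2^-1).
  move=> tphi; have tphi2 : test_fun setT (phi \o dil 2^-1) by exact: test_fun_dil.
  have [sphi2 _] := tphi2.
  rewrite /S1 -(Shom _ tphi2).
  have -> : (phi \o dil 2^-1) \o dil 2 = phi by apply/funext => y; rewrite /= dilationK.
  rewrite mulrBl; congr (_ - _); rewrite (Rintegral_dilation e two0 (mphi _ sphi2)) Qd.
  rewrite mulrC -mulrA; congr (_ * _).
  have [sphi [B [cB _ Bp]]] := tphi; have [M _ fM] := supported_bound (smooth_continuous sphi) cB Bp.
  have IK : Rintegrable leb (fun x => K x * phi x).
    apply: (L1loc_mul_integrable LK _ cB Bp fM); exact: (continuous_measurable_rV (smooth_continuous sphi)).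
  have EK : (fun x => K (dil 2 x) * (phi \o dil 2^-1) (dil 2 x)) = (fun x => (2 ^+ d)^-1 * (K x * phi x)).
    apply/funext => x; rewrite /= dilationK //; case: (eqVneq x 0) => [->|x0].
      by rewrite dilation0 K0 !mul0r mulr0.
    by rewrite -(homK x x0) mulrA [_ * 2 ^+ d]mulrC mulKf // expf_neq0.
  rewrite (_ : \int[leb]_x (K (dil 2 x) * _) = \int[leb]_x ((2 ^+ d)^-1 * (K x * phi x))); last by rewrite -EK.
  by rewrite RintegralZl // mulVKf // expf_neq0.
have S1j j : S1 psi * 2 ^+ (nu * j) = S1 (psi \o dil (2^-1 ^+ j)) /\ test_fun setT (psi \o dil (2^-1 ^+ j)).
  elim: j => [|j [IH1 IH2]].
    rewrite muln0 expr0 mulr1 expr0; have -> : psi \o dil 1 = psi by apply/funext => x; rewrite /= dilation1.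
    by [].
  have E : (psi \o dil (2^-1 ^+ j)) \o dil 2^-1 = psi \o dil (2^-1 ^+ j.+1).
    by apply/funext => x; rewrite /= dilation_dilation exprSr.
  rewrite -E; split; last exact: test_fun_dil.
  by rewrite mulnSr exprD mulrA IH1 S1hom.
have h1 : 2^-1 < 1 :> R by rewrite invf_lt1 // ltr1n.
have [chi [schi c01 c1 c0]] := @smooth_cutoff R n 2^-1 1 0 (ltW h0) h1.
pose B : set 'rV[R]_n := [set x | `|x| <= 1].
have cB : compact B by exact: compact_closed_ball_rV.
have Bchi : supported_in B chi.
  by move=> x /= nx; apply: c0; rewrite subr0 ltW // ltNge; apply/negP.
have [C1 [k1 HC1]] := Sb B cB (@subsetT _ B).
have [C2 [k2 HC2]] := Kb B cB (@subsetT _ B).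
pose k := maxn k1 k2.
have [C3 C30 HC3] := Ck_bound_mul k schi cB Bchi.
have [M M0 HM] := Ck_bound_test k sp cA Ap.
(* The right side does not depend on [j]: [S] and [K] are bounded on the unit ball by finitely many
   derivatives, and those of the stretched [psi] are at most those of [psi]. *)
have S1b j : `|S1 psi| * 2 ^+ (nu * j) <= (`|C1| + `|C2|) * (C3 * M).
  rewrite -[2 ^+ (nu * j)]ger0_norm ?exprn_ge0 // -normrM; have [-> [sg [A' [cA' _ A'g]]]] := S1j j.
  set g := psi \o dil (2^-1 ^+ j).
  have scg : smooth (fun x => chi x * g x) by exact: (smooth_onM openT schi sg).
  have s1c : smooth (fun x => 1 - chi x) by exact: (smooth_onB openT (smooth_on_cst 1 openT) schi).
  have s1cg : smooth (fun x => (1 - chi x) * g x) by exact: (smooth_onM openT s1c sg).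
  have t1 : test_fun setT (fun x => chi x * g x).
    by split; [exact: scg|exists B; split => // x /Bchi ->; rewrite mul0r].
  have t2 : test_fun W (fun x => (1 - chi x) * g x).
    split; first exact: s1cg.
    exists (A' `&` ~` [set x | `|x - 0| < 2^-1]); split.
    - apply: (subclosed_compact _ cA'); last by move=> x [].
      apply: closedI; [exact: compact_closed_rV|apply: open_closedC; exact: open_norm_lt].
    - by move=> x [_ /=]; rewrite subr0 => hx; apply/eqP => x0; apply: hx; rewrite x0 normr0.
    - move=> x hx; case: (pselect (A' x)) => A'x; last by rewrite /g A'g // mulr0.
      rewrite c1 ?subrr ?mul0r //; apply: ltW; rewrite ltNge; apply/negP => hh.
      by apply: hx; split => //=; apply/negP; rewrite -leNgt.
  have t2' := test_fun_setT t2.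
  have Eg : g = (fun x => 1 * (chi x * g x) + (1 - chi x) * g x).
    by apply/funext => x; ring.
  (* [(1 - chi) g] is a test function off the origin, where [S] and [K] agree. *)
  have -> : S1 g = S1 (fun x => chi x * g x).
    rewrite {1}Eg /S1 (Sl 1 _ _ t1 t2') (Kl 1 _ _ t1 t2') -(HK _ t2).
    by ring.
  have bg : Ck_bound k (fun x => chi x * g x) (C3 * M).
    apply: HC3; first exact: sg.
    have := Ck_bound_dilation e sp (exprn_ge0 j (ltW h0)) HM.
    rewrite (_ : Num.max 1 (2^-1 ^+ j) = 1 :> R) ?expr1n ?mul1r //.
    by apply/max_idPl; rewrite exprn_ile1 // ltW.
  have CM : 0 <= C3 * M by rewrite mulr_ge0 // ltW.
  have Bg : supported_in B (fun x => chi x * g x) by move=> x /Bchi ->; rewrite mul0r.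
  rewrite mulrDl; apply: le_trans (ler_normB _ _) _; apply: lerD.
    apply: le_trans (HC1 _ scg Bg (C3 * M) _) _; last by rewrite ler_wpM2r // ler_norm.
    by move=> s x sk; apply: bg; exact: leq_trans sk (leq_maxl _ _).
  apply: le_trans (HC2 _ scg Bg (C3 * M) _) _; last by rewrite ler_wpM2r // ler_norm.
  by move=> s x sk; apply: bg; exact: leq_trans sk (leq_maxr _ _).
apply/eqP; rewrite -subr_eq0; apply/eqP; rewrite -/(S1 psi).
apply/normr0_eq0/eqP; rewrite eq_le normr_ge0 andbT leNgt; apply/negP => S10.
pose Z := (`|C1| + `|C2|) * (C3 * M); have Z0 : 0 <= Z by rewrite mulr_ge0 ?addr_ge0 // mulr_ge0 // ltW.
have := S1b (Num.bound (Z / `|S1 psi|)); rewrite -/Z mulrC -ler_pdivlMr //.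
apply/negP; rewrite -ltNge; apply: lt_le_trans (archi_boundP _) _; first by rewrite divr_ge0.
apply: le_trans (expr2_ge_nat _) _; rewrite ler_weXn2l ?ler1n //.
by rewrite leq_pmull.
Qed.

End homogeneous_fundamental_solution.
(** * Geometry of the lifting *)

Section partial_along_lines.
Context {R : realType}.

(** A partial derivative only sees the function along one line. Block computations reduce to this,
    without smoothness or chain rule. *)
Lemma partial_line_eq n k (f : 'rV[R]_n -> R) (g : 'rV[R]_k -> R) i j x y :
  (forall t : R, f (t *: delta_mx 0 i + x) = g (t *: delta_mx 0 j + y)) ->
  partial i f x = partial j g y.
Proof.
move=> fg; have E : f x = g y by have := fg 0; rewrite !scale0r !add0r.
rewrite /partial /derive.
suff -> : (fun h : R => h^-1 *: ((f \o shift x) (h *: delta_mx 0 i) - f x)) =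
  (fun h : R => h^-1 *: ((g \o shift y) (h *: delta_mx 0 j) - g y)) by [].
by apply/funext => h; rewrite /= fg E.
Qed.

Lemma lsubmx_add n k (x y : 'rV[R]_(n + k)) : lsubmx (x + y) = lsubmx x + lsubmx y.
Proof. by apply/rowP => i; rewrite !mxE. Qed.

Lemma row_mx_line_l n k (t : R) i (x : 'rV[R]_n) (y : 'rV[R]_k) :
  row_mx (t *: delta_mx 0 i + x) y = t *: delta_mx 0 (lshift k i) + row_mx x y.
Proof.
apply/rowP => j; case: (split_ordP j) => l ->.
  by rewrite row_mxEl [RHS]mxE row_mxEl !mxE (inj_eq (@lshift_inj _ _)).
by rewrite row_mxEr [RHS]mxE row_mxEr !mxE eq_rlshift mulr0 add0r.
Qed.

Lemma row_mx_line_r n k (t : R) i (x : 'rV[R]_n) (y : 'rV[R]_k) :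
  row_mx x (t *: delta_mx 0 i + y) = t *: delta_mx 0 (rshift n i) + row_mx x y.
Proof.
apply/rowP => j; case: (split_ordP j) => l ->.
  by rewrite row_mxEl [RHS]mxE row_mxEl !mxE eq_lrshift mulr0 add0r.
by rewrite row_mxEr [RHS]mxE row_mxEr !mxE (inj_eq (@rshift_inj _ _)).
Qed.

Lemma lsubmx_line_l n k (t : R) i (z : 'rV[R]_(n + k)) :
  lsubmx (t *: delta_mx 0 (lshift k i) + z) = t *: delta_mx 0 i + lsubmx z.
Proof. by rewrite -{1}[z]hsubmxK -row_mx_line_l row_mxKl. Qed.

Lemma lsubmx_line_r n k (t : R) i (z : 'rV[R]_(n + k)) :
  lsubmx (t *: delta_mx 0 (rshift n i) + z) = lsubmx z.
Proof. by rewrite -{1}[z]hsubmxK -row_mx_line_r row_mxKl. Qed.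

Lemma partial_lsubmx_l n k (g : 'rV[R]_n -> R) i (z : 'rV[R]_(n + k)) :
  partial (lshift k i) (fun z => g (lsubmx z)) z = partial i g (lsubmx z).
Proof. by apply: partial_line_eq => t; rewrite lsubmx_line_l. Qed.

Lemma partial_lsubmx_r n k (g : 'rV[R]_n -> R) i (z : 'rV[R]_(n + k)) :
  partial (rshift n i) (fun z => g (lsubmx z)) z = 0.
Proof.
have -> : partial (rshift n i) (fun z => g (lsubmx z)) z = partial i (fun _ : 'rV[R]_k => g (lsubmx z)) 0.
  by apply: partial_line_eq => t; rewrite lsubmx_line_r.
by rewrite partial_cst.
Qed.

Lemma smooth_map_row_mx l n k (F : 'rV[R]_l -> 'rV[R]_n) (G : 'rV[R]_l -> 'rV[R]_k) :
  smooth_map F -> smooth_map G -> smooth_map (fun x => row_mx (F x) (G x)).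
Proof.
move=> sF sG j; case: (split_ordP j) => i ->.
  by under eq_fun do rewrite row_mxEl; exact: sF.
by under eq_fun do rewrite row_mxEr; exact: sG.
Qed.

Lemma smooth_map_lsubmx n k : smooth_map (@lsubmx R 1 n k).
Proof. by move=> j; under eq_fun do rewrite mxE; exact: (smooth_on_coord _ openT). Qed.

Lemma smooth_map_rsubmx n k : smooth_map (@rsubmx R 1 n k).
Proof. by move=> j; under eq_fun do rewrite mxE; exact: (smooth_on_coord _ openT). Qed.

Lemma smooth_map_cst n k (c : 'rV[R]_k) : smooth_map (fun _ : 'rV[R]_n => c).
Proof. by move=> j; exact: (smooth_on_cst _ openT). Qed.

Lemma smooth_map_id n : smooth_map (fun x : 'rV[R]_n => x).
Proof. by move=> j; exact: (smooth_on_coord _ openT). Qed.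

End partial_along_lines.

(** * Fields that project to the base *)

Section projectable_fields.
Context {R : realType} (n k : nat).

Lemma vfapp_lsubmx (Xt : @vfield R (n + k)) (X : @vfield R n) (g : 'rV[R]_n -> R) z :
  lsubmx (Xt z) = X (lsubmx z) ->
  vfapp Xt (fun z => g (lsubmx z)) z = vfapp X g (lsubmx z).
Proof.
move=> XX; rewrite /vfapp big_split_ord /= [X in _ + X]big1 ?addr0; last first.
  by move=> i _; rewrite partial_lsubmx_r mulr0.
by apply: eq_bigr => i _; rewrite partial_lsubmx_l -XX mxE.
Qed.

Section lifted_words.
Variables (m : nat) (Xt : 'I_m -> @vfield R (n + k)) (X : 'I_m -> @vfield R n).
Hypothesis proj : forall j z, lsubmx (Xt j z) = X j (lsubmx z).

Lemma vf_word_lsubmx I (g : 'rV[R]_n -> R) :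
  vf_word Xt I (fun z => g (lsubmx z)) = (fun z => vf_word X I g (lsubmx z)).
Proof.
elim: I => //= i I ->; apply/funext => z.
exact: (@vfapp_lsubmx (Xt i) (X i) (vf_word X I g)).
Qed.

Lemma hom_op_lsubmx w nu c (g : 'rV[R]_n -> R) :
  hom_op Xt w nu c (fun z => g (lsubmx z)) = (fun z => hom_op X w nu c g (lsubmx z)).
Proof.
apply/funext => z; apply: eq_bigr => l _; apply: eq_bigr => I _.
by rewrite vf_word_lsubmx.
Qed.

(** Induction on the generation. In a bracket, the base components of projectable fields are
    functions of the base variables, on which each field acts through its projection. *)
Lemma lie_generated_projectable Z : lie_generated Xt Z ->
  exists Y : @vfield R n, forall z, lsubmx (Z z) = Y (lsubmx z).
Proof.
elim=> [j||Y Z' _ [Y0 HY] _ [Z0 HZ]|a Y _ [Y0 HY]|Y Z' _ [Y0 HY] _ [Z0 HZ]].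
- by exists (X j).
- by exists (fun=> 0) => z; apply/rowP => i; rewrite !mxE.
- by exists (fun x => Y0 x + Z0 x) => z; rewrite lsubmx_add HY HZ.
- by exists (fun x => a *: Y0 x) => z; rewrite -HY; apply/rowP => i; rewrite !mxE.
- exists (lie_bracket Y0 Z0) => z; apply/rowP => j; rewrite !mxE.
  have EY : (fun y => Y y 0 (lshift k j)) = (fun y => Y0 (lsubmx y) 0 j).
    by apply/funext => y; rewrite -HY mxE.
  have EZ : (fun y => Z' y 0 (lshift k j)) = (fun y => Z0 (lsubmx y) 0 j).
    by apply/funext => y; rewrite -HZ mxE.
  rewrite EY EZ (vfapp_lsubmx (fun y => Z0 y 0 j) (HY z)).
  by rewrite (vfapp_lsubmx (fun y => Y0 y 0 j) (HZ z)).
Qed.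

End lifted_words.

End projectable_fields.

(** * Homogeneous groups: inversion, left translations, left invariant fields *)

Section homogeneous_groups.
Context {R : realType} (N : nat) (e : 'I_N -> nat) (mul : 'rV[R]_N -> 'rV[R]_N -> 'rV[R]_N)
  (inv : 'rV[R]_N -> 'rV[R]_N).
Hypothesis hg : homogeneous_group e mul inv.
Local Notation leb := (@lebesgue_rV R N).
Let e_gt0 := hg_exp_gt0 hg.

Lemma smooth_mul k (F G : 'rV[R]_k -> 'rV[R]_N) : smooth_map F -> smooth_map G ->
  smooth_map (fun x => mul (F x) (G x)).
Proof.
move=> sF sG j; have := smooth_map_comp (hg_mul_smooth hg) (smooth_map_row_mx sF sG).
by move=> /(_ j); under eq_fun do rewrite row_mxKl row_mxKr.
Qed.

Lemma smooth_inv k (F : 'rV[R]_k -> 'rV[R]_N) : smooth_map F -> smooth_map (fun x => inv (F x)).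
Proof. by move=> sF; exact: (smooth_map_comp (hg_inv_smooth hg) sF). Qed.

Lemma group_mulKV a x : mul a (mul (inv a) x) = x.
Proof. by rewrite (hg_mulA hg) (hg_mulxV hg) (hg_mul0x hg). Qed.

Lemma group_mulVK a x : mul (inv a) (mul a x) = x.
Proof. by rewrite (hg_mulA hg) (hg_mulVx hg) (hg_mul0x hg). Qed.

Lemma group_inv_unique a b : mul a b = 0 -> b = inv a.
Proof. by move=> ab; rewrite -(group_mulVK a b) ab (hg_mulx0 hg). Qed.

Lemma group_inv0 : inv 0 = 0.
Proof. by apply/esym/group_inv_unique; rewrite (hg_mul0x hg). Qed.

Lemma group_invK a : inv (inv a) = a.
Proof. by apply/esym/group_inv_unique; rewrite (hg_mulVx hg). Qed.

Lemma group_invM a b : inv (mul a b) = mul (inv b) (inv a).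
Proof.
apply/esym/group_inv_unique.
by rewrite -(hg_mulA hg) [mul b _](hg_mulA hg) (hg_mulxV hg) (hg_mul0x hg) (hg_mulxV hg).
Qed.

Lemma group_inv_dilation (l : R) x : 0 < l -> inv (dilation e l x) = dilation e l (inv x).
Proof.
move=> l0; apply/esym/group_inv_unique.
by rewrite -(hg_dilation hg) // (hg_mulxV hg) dilation0.
Qed.

Lemma partial_mul_l0 i j :
  partial (lshift N j) (fun z : 'rV[R]_(N + N) => mul (lsubmx z) (rsubmx z) 0 i) 0 = (i == j)%:R.
Proof.
rewrite -[RHS](_ : partial j (fun y : 'rV[R]_N => y 0 i) 0 = _); last by rewrite partial_coord eq_sym.
apply: partial_line_eq => t; rewrite -(row_mx0 R 1 N N) -row_mx_line_l row_mxKl row_mxKr.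
by rewrite (hg_mulx0 hg).
Qed.

Lemma partial_mul_r0 i j :
  partial (rshift N j) (fun z : 'rV[R]_(N + N) => mul (lsubmx z) (rsubmx z) 0 i) 0 = (i == j)%:R.
Proof.
rewrite -[RHS](_ : partial j (fun y : 'rV[R]_N => y 0 i) 0 = _); last by rewrite partial_coord eq_sym.
apply: partial_line_eq => t; rewrite -(row_mx0 R 1 N N) -row_mx_line_r row_mxKl row_mxKr.
by rewrite (hg_mul0x hg).
Qed.

(** Differentiating x x^-1 = 0 at the origin, where the product has the identity as derivative in
    each factor. *)
Lemma partial_inv0 i j : partial j (fun z => inv z 0 i) 0 = - (i == j)%:R.
Proof.
have sid := @smooth_map_id R N; have sinv := hg_inv_smooth hg.
have := partial_smooth_comp j 0 (hg_mul_smooth hg i) (smooth_map_row_mx sid sinv).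
rewrite group_inv0 row_mx0.
have -> : (fun y => mul (lsubmx (row_mx y (inv y))) (rsubmx (row_mx y (inv y))) 0 i) = (fun=> 0 : R).
  by apply/funext => y; rewrite row_mxKl row_mxKr (hg_mulxV hg) mxE.
rewrite partial_cst big_split_ord /=.
rewrite (bigD1 i) //= big1 => [|l li]; last by rewrite partial_mul_l0 eq_sym (negbTE li) mul0r.
rewrite [X in _ + X](bigD1 i) //= [X in _ + (_ + X)]big1 => [|l li]; last first.
  by rewrite partial_mul_r0 eq_sym (negbTE li) mul0r.
rewrite partial_mul_l0 partial_mul_r0 eqxx !mul1r !addr0.
under eq_fun do rewrite row_mxEl; under [X in _ + partial _ X _]eq_fun do rewrite row_mxEr.
rewrite partial_coord eq_sym => /eqP; rewrite eq_sym addrC addr_eq0 => /eqP ->.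
by rewrite eq_sym.
Qed.

(** The product is homogeneous in both factors jointly, so [a] enters as a parameter block; the
    derivative in the second factor at the origin is the identity. *)
Lemma left_translation_preserves a : transports leb leb (mul a).
Proof.
have H : transports leb leb (fun z => (fun z => mul (lsubmx z) (rsubmx z)) (row_mx a z)).
  apply: (homogeneous_map_preserves (b := fun=> false) e_gt0 e_gt0 (hg_mul_smooth hg)).
    by move=> l z l0; rewrite lsubmx_dilation rsubmx_dilation -(hg_dilation hg).
  by move=> i j; rewrite partial_mul_r0 expr0 mulr1.
by move: H; rewrite (_ : (fun z => _) = mul a) //; apply/funext => z; rewrite row_mxKl row_mxKr.
Qed.

(* The left invariant field equal to the [k]-th coordinate field at the origin. *)
Definition left_field (k : 'I_N) : @vfield R N := fun x =>
  \row_i partial (rshift N k) (fun z : 'rV[R]_(N + N) => mul (lsubmx z) (rsubmx z) 0 i) (row_mx x 0).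

Lemma smooth_left_field k : smooth_map (left_field k).
Proof.
move=> i; under eq_fun do rewrite mxE.
apply: (smooth_comp (smooth_on_partial (rshift N k) (hg_mul_smooth hg i))).
exact: (smooth_map_row_mx (@smooth_map_id R N) (@smooth_map_cst R N N 0)).
Qed.

Lemma vfapp_left_field k u x : smooth u ->
  vfapp (left_field k) u x = partial k (fun y => u (mul x y)) 0.
Proof.
move=> su; have smx := smooth_mul (@smooth_map_cst R N N x) (@smooth_map_id R N).
rewrite (partial_smooth_comp k 0 su smx) (hg_mulx0 hg); apply: eq_bigr => i _.
rewrite mulrC !mxE; congr (_ * _); apply: partial_line_eq => t.
by rewrite -row_mx_line_r row_mxKl row_mxKr.
Qed.

Lemma left_field_invariant k : left_invariant mul (left_field k).
Proof.
split; first exact: smooth_left_field.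
move=> a u su x; have sma := smooth_mul (@smooth_map_cst R N N a) (@smooth_map_id R N).
rewrite (vfapp_left_field k x (smooth_comp su sma)) (vfapp_left_field k _ su).
by under eq_fun do rewrite /= (hg_mulA hg).
Qed.

Lemma left_field_homogeneous k i (l : R) x : 0 < l ->
  l ^+ e i * left_field k x 0 i = l ^+ e k * left_field k (dilation e l x) 0 i.
Proof.
move=> l0; rewrite !mxE.
have H (r : R) z : 0 < r -> r ^+ e i * mul (lsubmx z) (rsubmx z) 0 i =
    r ^+ 0 * (fun z => mul (lsubmx z) (rsubmx z) 0 i) (dilation (cat_exp e e) r z).
  by move=> r0; rewrite lsubmx_dilation rsubmx_dilation -(hg_dilation hg) // dilation_coord expr0 mul1r.
have := homogeneous_partial H (rshift N k) (row_mx x 0) (hg_mul_smooth hg i) l0.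
by rewrite add0n cat_exp_rshift dilation_row_mx dilation0.
Qed.

(** The left fields span the tangent space at every point: writing [u] near [y] through [mul y] and
    [mul (inv y)], each partial derivative at [y] is a combination of the [left_field]
    derivatives. *)
Lemma left_fields_const u : smooth u -> (forall k z, vfapp (left_field k) u z = 0) -> forall z, u z = u 0.
Proof.
move=> su u0 z; apply: (zero_partials_eq (P := predT) su) => // m y _.
have sy := smooth_mul (@smooth_map_cst R N N y) (@smooth_map_id R N).
have siy := smooth_mul (@smooth_map_cst R N N (inv y)) (@smooth_map_id R N).
have E : u = (fun x => (fun v => u (mul y v)) (mul (inv y) x)).
  by apply/funext => x; rewrite group_mulKV.
rewrite E (partial_smooth_comp m y (smooth_comp su sy) siy) big1 // => j _.
by rewrite (hg_mulVx hg) -(vfapp_left_field j y su) u0 mul0r.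
Qed.

End homogeneous_groups.

(** * The fibration of the group over the base *)

Section lifted_group.
Context {R : realType} (n m p : nat) (sigma : 'I_n -> nat) (tau : 'I_p -> nat)
  (X : 'I_m -> @vfield R n) (Xt : 'I_m -> @vfield R (n + p))
  (mul : 'rV[R]_(n + p) -> 'rV[R]_(n + p) -> 'rV[R]_(n + p)) (inv : 'rV[R]_(n + p) -> 'rV[R]_(n + p)).
Hypothesis hg : homogeneous_group (cat_exp sigma tau) mul inv.
Hypothesis gen : forall Z, left_invariant mul Z -> lie_generated Xt Z.
Hypothesis proj : forall j z, lsubmx (Xt j z) = X j (lsubmx z).
Local Notation e := (cat_exp sigma tau).
Local Notation leb k := (@lebesgue_rV R k).

Lemma base_exp_gt0 i : (0 < sigma i)%N.
Proof. by have := hg_exp_gt0 hg (lshift p i); rewrite cat_exp_lshift. Qed.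

Lemma fiber_exp_gt0 i : (0 < tau i)%N.
Proof. by have := hg_exp_gt0 hg (rshift n i); rewrite cat_exp_rshift. Qed.

(* Left invariant fields project to the base, and by homogeneity the coefficient
   of weight [sigma i] of the projection only involves coordinates of smaller
   weight; this drives the induction. *)
Lemma fiber_invariant eta z : lsubmx (mul (row_mx 0 eta) z) = lsubmx z.
Proof.
set h := row_mx 0 eta.
suff H (k : nat) (i : 'I_n) : (sigma i <= k)%N -> forall z, mul h z 0 (lshift p i) = z 0 (lshift p i).
  by apply/rowP => i; rewrite !mxE; exact: (H (sigma i)).
elim: k i => [|k IH] i ik {}z.
  by have := base_exp_gt0 i; rewrite ltnNge ik.
have sh := smooth_mul hg (@smooth_map_cst R (n + p) (n + p) h) (@smooth_map_id R (n + p)).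
have sc : smooth (fun y : 'rV[R]_(n + p) => y 0 (lshift p i)) by exact: (smooth_on_coord _ openT).
(* The change of the i-th base coordinate under the translation. All left fields are shown to
   annihilate it, so it is constant, and it vanishes at the origin because [h] has base part 0. *)
pose g (y : 'rV[R]_(n + p)) : R := (-1) * y 0 (lshift p i) + mul h y 0 (lshift p i).
have sg : smooth g by exact: (smooth_scale_add (-1) sc (sh (lshift p i))).
suff : g z = g 0.
  rewrite /g (hg_mulx0 hg) /h row_mxEl !mxE => /eqP.
  by rewrite mulr0 add0r mulN1r addrC subr_eq0 => /eqP.
apply: (left_fields_const hg sg) => l y.
rewrite (vfapp_scale_add _ (-1) _ sc (sh (lshift p i))) vfapp_coord.
have [_ inv_l] := left_field_invariant hg l.
have -> : vfapp (left_field mul l) (fun x => mul h x 0 (lshift p i)) y = left_field mul l (mul h y) 0 (lshift p i).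
  by rewrite -vfapp_coord -(inv_l h _ sc y).
have [Y HY] := lie_generated_projectable proj (gen (left_field_invariant hg l)).
have EY v : left_field mul l v 0 (lshift p i) = left_field mul l (row_mx (lsubmx v) 0) 0 (lshift p i).
  by have := HY (row_mx (lsubmx v) 0); rewrite row_mxKl -HY => /rowP/(_ i); rewrite !mxE.
pose f (x : 'rV[R]_n) := left_field mul l (row_mx x 0) 0 (lshift p i).
have sf : smooth f.
  apply: (smooth_comp (smooth_left_field hg l (lshift p i))).
  exact: (smooth_map_row_mx (@smooth_map_id R n) (@smooth_map_cst R n p 0)).
have hf (r : R) x : 0 < r -> r ^+ sigma i * f x = r ^+ e l * f (dilation sigma r x).
  move=> r0; have := left_field_homogeneous hg l (lshift p i) (row_mx x 0) r0.
  by rewrite cat_exp_lshift dilation_row_mx dilation0.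
rewrite EY [X in _ + X]EY -!/(f _).
have -> : f (lsubmx (mul h y)) = f (lsubmx y); last by rewrite mulN1r addNr.
apply: (zero_partials_eq (P := fun j => (sigma i <= sigma j)%N) sf).
  move=> j x ij; apply: (homogeneous_partial_eq0 _ base_exp_gt0 hf sf).
  by rewrite -[ltnLHS]add0n -addSn leq_add // (hg_exp_gt0 hg).
move=> j; rewrite -ltnNge => ji; rewrite !mxE; apply: IH.
by rewrite -ltnS (leq_trans ji).
Qed.

(** Here [z] is the homogeneous parameter, and the derivative in [eta] at the origin is the
    identity. *)
Lemma fiber_translation_preserves z :
  transports (leb p) (leb p) (fun eta => rsubmx (mul (row_mx 0 eta) z)).
Proof.
pose F (v : 'rV[R]_((n + p) + p)) := rsubmx (mul (row_mx 0 (rsubmx v)) (lsubmx v)).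
have sF : smooth_map F.
  apply: (smooth_map_comp (@smooth_map_rsubmx R n p)); apply: (smooth_mul hg).
    exact: (smooth_map_row_mx (smooth_map_cst _) (@smooth_map_rsubmx R _ _)).
  exact: smooth_map_lsubmx.
have H : transports (leb p) (leb p) (fun eta => F (row_mx z eta)).
  apply: (homogeneous_map_preserves (b := fun=> false) (hg_exp_gt0 hg) fiber_exp_gt0 sF).
    move=> l v l0; rewrite /F lsubmx_dilation rsubmx_dilation -[RHS](rsubmx_dilation sigma tau); congr rsubmx.
    by rewrite (hg_dilation hg) // dilation_row_mx dilation0.
  move=> i j; rewrite expr0 mulr1.
  rewrite -[RHS](_ : partial j (fun y : 'rV[R]_p => y 0 i) 0 = _); last by rewrite partial_coord eq_sym.
  apply: partial_line_eq => t; rewrite -(row_mx0 R 1 (n + p) p) -row_mx_line_r /F row_mxKl row_mxKr.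
  by rewrite (hg_mulx0 hg) row_mxKr.
by move: H; rewrite (_ : (fun eta => _) = (fun eta => rsubmx (mul (row_mx 0 eta) z))) //;
  apply/funext => eta; rewrite /F row_mxKl row_mxKr.
Qed.

(** As for [fiber_translation_preserves], but the inverse makes the derivative at the origin minus
    the identity, hence the sign [true]. *)
Lemma fiber_inverse_preserves y :
  transports (leb p) (leb p) (fun eta => rsubmx (mul (inv (row_mx 0 eta)) (row_mx y 0))).
Proof.
pose F (v : 'rV[R]_(n + p)) := rsubmx (mul (inv (row_mx 0 (rsubmx v))) (row_mx (lsubmx v) 0)).
have sF : smooth_map F.
  apply: (smooth_map_comp (@smooth_map_rsubmx R n p)); apply: (smooth_mul hg).
    apply: (smooth_inv hg); exact: (smooth_map_row_mx (smooth_map_cst _) (@smooth_map_rsubmx R _ _)).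
  exact: (smooth_map_row_mx (@smooth_map_lsubmx R _ _) (smooth_map_cst _)).
have H : transports (leb p) (leb p) (fun eta => F (row_mx y eta)).
  apply: (homogeneous_map_preserves (b := fun=> true) base_exp_gt0 fiber_exp_gt0 sF).
    move=> l v l0; rewrite /F lsubmx_dilation rsubmx_dilation -[RHS](rsubmx_dilation sigma tau); congr rsubmx.
    by rewrite (hg_dilation hg) // -(group_inv_dilation hg) // !dilation_row_mx !dilation0.
  move=> i j; rewrite expr1 mulrN1.
  rewrite -[RHS](_ : partial (rshift n j) (fun z => inv z 0 (rshift n i)) 0 = _); last first.
    by rewrite (partial_inv0 hg) (inj_eq (@rshift_inj _ _)).
  apply: partial_line_eq => t; rewrite -(row_mx0 R 1 n p) -row_mx_line_r /F row_mxKl row_mxKr.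
  by rewrite row_mx0 (hg_mulx0 hg) mxE.
by move: H; rewrite (_ : (fun eta => _) = (fun eta => rsubmx (mul (inv (row_mx 0 eta)) (row_mx y 0)))) //;
  apply/funext => eta; rewrite /F row_mxKl row_mxKr.
Qed.

(** At the origin the derivative is minus the identity on the base block, which enters through the
    inverse, and the identity on the fibre block. This is the change of variables for integrating
    the kernel in its second argument. *)
Lemma section_inverse_preserves x : transports (leb (n + p)) (leb (n + p))
  (fun v => mul (inv (row_mx (lsubmx v) 0)) (row_mx x (rsubmx v))).
Proof.
pose F (v : 'rV[R]_(n + (n + p))) :=
  mul (inv (row_mx (lsubmx (rsubmx v)) 0)) (row_mx (lsubmx v) (rsubmx (rsubmx v))).
have sr := @smooth_map_rsubmx R n (n + p).
have slr := smooth_map_comp (@smooth_map_lsubmx R n p) sr.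
have srr := smooth_map_comp (@smooth_map_rsubmx R n p) sr.
have sF : smooth_map F.
  apply: (smooth_mul hg); last exact: (smooth_map_row_mx (@smooth_map_lsubmx R _ _) srr).
  by apply: (smooth_inv hg); exact: (smooth_map_row_mx slr (smooth_map_cst _)).
have H : transports (leb (n + p)) (leb (n + p)) (fun v => F (row_mx x v)).
  apply: (homogeneous_map_preserves (b := fun i => if fintype.split i is inl _ then true else false)
    base_exp_gt0 (hg_exp_gt0 hg) sF).
    move=> l v l0; rewrite /F !(lsubmx_dilation, rsubmx_dilation).
    by rewrite (hg_dilation hg) // -(group_inv_dilation hg) // !dilation_row_mx !dilation0.
  move=> i j; case: (split_ordP j) => l ->.
    rewrite (_ : partial _ _ _ = partial (lshift p l) (fun z => inv z 0 i) 0).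
      rewrite (partial_inv0 hg); case: (split_ordP i) => k ->; first by rewrite expr1 mulrN1.
      by rewrite eq_rlshift mul0r oppr0.
    apply: partial_line_eq => t; rewrite -(row_mx0 R 1 n (n + p)) -row_mx_line_r /F row_mxKl row_mxKr.
    by rewrite -(row_mx0 R 1 n p) -row_mx_line_l row_mxKl row_mxKr row_mx0 (hg_mulx0 hg).
  rewrite (_ : partial _ _ _ = partial (rshift n l) (fun z : 'rV[R]_(n + p) => z 0 i) 0).
    rewrite partial_coord eq_sym; case: (split_ordP i) => k ->; first by rewrite eq_lrshift mul0r.
    by rewrite expr0 mulr1.
  apply: partial_line_eq => t; rewrite -(row_mx0 R 1 n (n + p)) -row_mx_line_r /F row_mxKl row_mxKr.
  by rewrite -(row_mx0 R 1 n p) -row_mx_line_r row_mxKl row_mxKr row_mx0 (group_inv0 hg) (hg_mul0x hg).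
by move: H; rewrite (_ : (fun v => _) = (fun v => mul (inv (row_mx (lsubmx v) 0)) (row_mx x (rsubmx v)))) //;
  apply/funext => v; rewrite /F row_mxKl row_mxKr.
Qed.

End lifted_group.
(** * The projected kernel *)

Section fiber_integrals.
Context {R : realType}.
Local Notation leb k := (@lebesgue_rV R k).

Lemma partial_dilation_on n (e : 'I_n -> nat) (W : set 'rV[R]_n) (l : R) i (f : 'rV[R]_n -> R) x :
  open W -> smooth_on W f -> W (dilation e l x) ->
  partial i (f \o dilation e l) x = l ^+ e i * partial i f (dilation e l x).
Proof.
move=> oW sf Wx.
have H := partial_comp i oW sf (fun j => smooth_smooth_on (W := setT) (smooth_dilation e l j)) (I : setT x) Wx.
rewrite /partial (@derive_val _ _ _ _ _ _ _ H) (bigD1 i) //= big1 ?addr0 => [|j ji].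
  have -> : (fun y => dilation e l y 0 i) = (fun y => l ^+ e i * y 0 i).
    by apply/funext => y; rewrite dilation_coord.
  have sc : smooth (fun y : 'rV[R]_n => y 0 i) by exact: (smooth_on_coord i openT).
  by rewrite (partialZ _ (smooth_derivable sc)) partial_coord eqxx mulr1 mulrC.
have -> : (fun y => dilation e l y 0 j) = (fun y => l ^+ e j * y 0 j).
  by apply/funext => y; rewrite dilation_coord.
have sc : smooth (fun y : 'rV[R]_n => y 0 j) by exact: (smooth_on_coord j openT).
by rewrite (partialZ _ (smooth_derivable sc)) partial_coord eq_sym (negbTE ji) !mulr0.
Qed.

(** Each derivative along [i] lowers the degree by [e i]; the set [W] has to be stable under the
    dilation for the relation to be differentiated. *)
Lemma partials_dyadic n (e : 'I_n -> nat) (W : set 'rV[R]_n) (f : 'rV[R]_n -> R) d s :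
  open W -> (forall x, W x -> W (dilation e 2 x)) -> smooth_on W f ->
  (forall x, W x -> f (dilation e 2 x) * 2 ^+ d = f x) ->
  forall x, W x -> partials s f (dilation e 2 x) * 2 ^+ (d + \sum_(i <- s) e i) = partials s f x.
Proof.
move=> oW W2 sf hf; elim: s => [|i s IH] x Wx; first by rewrite big_nil addn0 hf.
rewrite /= big_cons addnA [(d + e i)%N]addnC -addnA exprD.
have sp := smooth_on_partials s sf.
have -> : partial i (partials s f) x =
    partial i (fun y => 2 ^+ (d + \sum_(j <- s) e j) * (partials s f \o dilation e 2) y) x.
  by apply: (partial_eq_on i oW _ Wx) => y Wy; rewrite mulrC IH.
have H := partial_comp i oW sp (fun j => smooth_smooth_on (W := setT) (smooth_dilation e 2 j)) (I : setT x) (W2 x Wx).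
rewrite (partialZ _ (@ex_derive _ _ _ _ _ _ _ H)) (partial_dilation_on i oW sp (W2 x Wx)).
by rewrite mulrC [2 ^+ e i * _]mulrC -mulrA.
Qed.

(** * Decay of functions homogeneous in two groups of variables *)

Section decay.
Variables (k p : nat) (e1 : 'I_k -> nat) (e2 : 'I_p -> nat) (H : 'rV[R]_k -> 'rV[R]_p -> R) (d : nat).
Hypothesis e1_gt0 : forall i, (0 < e1 i)%N.
Hypothesis e2_gt0 : forall i, (0 < e2 i)%N.
Hypothesis hom : forall x (xi : 'rV[R]_p), xi != 0 -> H (dilation e1 2 x) (dilation e2 2 xi) * 2 ^+ d = H x xi.
Hypothesis cH : forall x xi, `|x| <= 2^-1 -> 1 <= `|xi| ->
  {for row_mx x xi, continuous (fun v => H (lsubmx v) (rsubmx v))}.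

Lemma norm_row_mx_le (r : R) (x : 'rV[R]_k) (xi : 'rV[R]_p) : 0 <= r ->
  (`|row_mx x xi| <= r) = (`|x| <= r) && (`|xi| <= r).
Proof.
move=> r0; apply/idP/andP => [h|[h1 h2]].
  split; apply: norm_rV_le => // i.
    by have := le_trans (coord_le_norm _ (lshift p i)) h; rewrite row_mxEl.
  by have := le_trans (coord_le_norm _ (rshift k i)) h; rewrite row_mxEr.
apply: norm_rV_le => // i; case: (split_ordP i) => j ->.
  by rewrite row_mxEl (le_trans (coord_le_norm _ _)).
by rewrite row_mxEr (le_trans (coord_le_norm _ _)).
Qed.

Lemma compact_box_rV (r s : R) :
  compact [set v : 'rV[R]_(k + p) | `|lsubmx v| <= r /\ `|rsubmx v| <= s].
Proof.
have c1 := compact_closed_rV (@compact_closed_ball_rV R k r).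
have c2 := compact_closed_rV (@compact_closed_ball_rV R p s).
have cl : closed [set v : 'rV[R]_(k + p) | `|lsubmx v| <= r /\ `|rsubmx v| <= s].
  apply: (@closedI _ [set v | `|lsubmx v| <= r] [set v | `|rsubmx v| <= s]).
    by apply: (@closed_comp _ _ (@lsubmx R 1 k p) _ _ c1) => x _; exact: continuous_lsubmx.
  by apply: (@closed_comp _ _ (@rsubmx R 1 k p) _ _ c2) => x _; exact: continuous_rsubmx.
apply: (subclosed_compact cl (@compact_closed_ball_rV R (k + p) (`|r| + `|s|))) => v [h1 h2] /=.
rewrite -[v]hsubmxK norm_row_mx_le ?addr_ge0 //; apply/andP; split.
  by apply: le_trans h1 _; apply: le_trans (ler_norm _) _; rewrite lerDl.
by apply: le_trans h2 _; apply: le_trans (ler_norm _) _; rewrite lerDr.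
Qed.

(** Dilating both variables by 2^(-j) multiplies [H] by 2^(d j) and leads to a fixed compact set:
    [xi] goes to a fixed shell and, as 2 r <= 2^j, [x] goes to the ball of radius 1/2. *)
Lemma shell_decay : exists2 C : R, 0 < C & forall (r : R) j x xi, `|x| <= r -> 2 * r <= 2 ^+ j ->
  1 <= `|dilation e2 (2^-1 ^+ j) xi| -> `|dilation e2 (2^-1 ^+ j.+1) xi| < 1 ->
  `|H x xi| <= C * 2^-1 ^+ (d * j).
Proof.
pose E := (\sum_i e2 i)%N.
pose S : set 'rV[R]_(k + p) := [set v | `|lsubmx v| <= 2^-1 /\ `|rsubmx v| <= 2 ^+ E] `&`
  ~` ((@rsubmx R 1 k p) @^-1` [set y | `|y| < 1]).
have cS : compact S.
  apply: (subclosed_compact _ (@compact_box_rV 2^-1 (2 ^+ E))); last by move=> v [].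
  apply: closedI; first by apply: compact_closed_rV; exact: compact_box_rV.
  apply: open_closedC; apply: open_comp; first by move=> v _; exact: continuous_rsubmx.
  by have := @open_norm_lt R p 0 1; under eq_fun do rewrite subr0.
have cHS v : S v -> {for v, continuous (fun v => H (lsubmx v) (rsubmx v))}.
  move=> [[h1 _] /= h2]; rewrite -[v]hsubmxK; apply: cH => //.
  by rewrite leNgt; apply/negP.
have [C C0 HC] := compact_continuous_bound cS cHS.
exists C => // r j x xi xr rj h1 h2.
have hj : 0 < 2^-1 ^+ j :> R by rewrite exprn_gt0 // invr_gt0.
have hj1 : 2^-1 ^+ j <= 1 :> R by rewrite exprn_ile1 // ?invr_ge0 // invf_le1 // ler1n.
have xi0 : xi != 0.
  by apply/eqP => h; move: h1; rewrite h dilation0 normr0 leNgt ltr01.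
have iter l : H (dilation e1 (2^-1 ^+ l) x) (dilation e2 (2^-1 ^+ l) xi) = H x xi * 2 ^+ (d * l).
  elim: l => [|l IH]; first by rewrite expr0 !dilation1 muln0 expr0 mulr1.
  rewrite -hom; last first.
    apply/eqP => /dilation_eq0 h; move/eqP: xi0; apply; apply: h.
    by rewrite expf_neq0 // invr_neq0.
  by rewrite !dilation_dilation exprS mulrA mulfV // mul1r IH mulnSr exprD mulrA.
have -> : H x xi = H (dilation e1 (2^-1 ^+ j) x) (dilation e2 (2^-1 ^+ j) xi) * 2^-1 ^+ (d * j).
  by rewrite iter -mulrA -exprMn mulfV // expr1n mulr1.
rewrite normrM [`|2^-1 ^+ _|]ger0_norm ?exprn_ge0 ?invr_ge0 // ler_wpM2r ?exprn_ge0 ?invr_ge0 //.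
have := HC (row_mx (dilation e1 (2^-1 ^+ j) x) (dilation e2 (2^-1 ^+ j) xi)); rewrite row_mxKl row_mxKr; apply.
split; rewrite /= ?row_mxKl ?row_mxKr; last by apply/negP; rewrite -leNgt.
split.
  apply: le_trans (norm_dilation_le _ e1_gt0 _) _; first by rewrite (ltW hj).
  rewrite exprVn mulrC ler_pdivrMr ?exprn_gt0 //; apply: le_trans xr _; lra.
have -> : dilation e2 (2^-1 ^+ j) xi = dilation e2 2 (dilation e2 (2^-1 ^+ j.+1) xi).
  by rewrite dilation_dilation exprS mulrA mulfV // mul1r.
apply: le_trans (norm_dilation_le_expr _ _ _) _; first by rewrite ler1n.
by rewrite -[leRHS]mulr1 ler_wpM2l ?exprn_ge0 // ltW.
Qed.

(** The dilation by 2^(j+1) expands the norm by at most 2^((j+1) E), with E the sum of the weights,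
    so a point beyond 2^(j0 E) is not in a shell of index below [j0]. *)
Lemma outer_shell_index (j0 : nat) (xi : 'rV[R]_p) : 2 ^+ (j0 * \sum_i e2 i) <= `|xi| ->
  exists2 j, (j0 <= j)%N &
  1 <= `|dilation e2 (2^-1 ^+ j) xi| /\ `|dilation e2 (2^-1 ^+ j.+1) xi| < 1.
Proof.
move=> hxi; have [|j [h1 h2]] := dyadic_outer_shell e2_gt0 (x := xi).
  by apply: le_trans hxi; rewrite exprn_ege1 // ler1n.
exists j => //; rewrite leqNgt; apply/negP => jj.
move: hxi; apply/negP; rewrite -ltNge.
have -> : xi = dilation e2 (2 ^+ j.+1) (dilation e2 (2^-1 ^+ j.+1) xi).
  by rewrite dilation_dilation -exprMn mulfV // expr1n dilation1.
apply: le_lt_trans (norm_dilation_le_expr _ _ _) _; first by rewrite exprn_ege1 // ler1n.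
rewrite -exprM; apply: lt_le_trans (_ : 2 ^+ (j.+1 * \sum_i e2 i) <= _).
  by rewrite -[ltRHS]mulr1 ltr_pM2l // exprn_gt0.
by rewrite ler_weXn2l ?ler1n // leq_mul2r jj orbT.
Qed.

Lemma decay_at_infinity (r eps : R) : (0 < d)%N -> 0 < eps ->
  exists M : R, forall x xi, `|x| <= r -> M < `|xi| -> `|H x xi| < eps.
Proof.
move=> d0 eps0; have [C C0 HC] := shell_decay.
(* The first bound secures 2 |r| <= 2^j for [shell_decay], the second C 2^(-j) < eps. *)
pose j0 := maxn (Num.bound (2 * `|r|)) (Num.bound (C / eps)).
exists (2 ^+ (j0 * \sum_i e2 i)) => x xi xr /ltW /outer_shell_index[j jj [h1 h2]].
have b1 : (Num.bound (2 * `|r|))%:R <= 2 ^+ j :> R.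
  apply: le_trans (_ : j%:R <= _); last exact: expr2_ge_nat.
  by rewrite ler_nat (leq_trans _ jj) // leq_maxl.
have b2 : (Num.bound (C / eps))%:R <= 2 ^+ j :> R.
  apply: le_trans (_ : j%:R <= _); last exact: expr2_ge_nat.
  by rewrite ler_nat (leq_trans _ jj) // leq_maxr.
apply: le_lt_trans (HC `|r| j x xi _ _ h1 h2) _.
- exact: le_trans xr (ler_norm r).
- by apply: le_trans b1; apply: ltW; apply: archi_boundP; rewrite mulr_ge0.
apply: le_lt_trans (_ : C * 2^-1 ^+ j < _).
  rewrite ler_wpM2l ?(ltW C0) // ler_wiXn2l ?invr_ge0 ?invf_le1 ?ler1n //.
  by rewrite leq_pmull.
rewrite exprVn ltr_pdivrMr ?exprn_gt0 // mulrC -ltr_pdivrMr //.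
by apply: lt_le_trans b2; apply: archi_boundP; rewrite divr_ge0 // ltW.
Qed.

(** The j-th shell lies in a set of volume at most v 2^(E (j+1)) and [|H|] is at most C 2^(-d j) on
    it, so E < d gives a geometric series. The majorant is common to all [x] in the ball. *)
Lemma fiber_dominant (r : R) : (\sum_i e2 i < d)%N -> exists (rho : R) (g : 'rV[R]_p -> R),
  [/\ 0 < rho, Rintegrable (leb p) g & forall x xi, `|x| <= r -> rho <= `|xi| -> `|H x xi| <= g xi].
Proof.
move=> ed; have [C C0 HC] := shell_decay.
set E := (\sum_i e2 i)%N in ed *.
pose A j : set 'rV[R]_p := [set xi | `|dilation e2 (2^-1 ^+ j.+1) xi| < 1].
have oB1 : open [set x : 'rV[R]_p | `|x| < 1].
  by have := @open_norm_lt R p 0 1; under eq_fun do rewrite subr0.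
have mA j : measurable (A j).
  by have := @measurable_dilation R p e2 (2^-1 ^+ j.+1) measurableT _ (open_measurable_rV oB1); rewrite setTI.
pose v := fine (leb p [set x : 'rV[R]_p | `|x| <= 1]).
have cB1 := @compact_closed_ball_rV R p 1.
have mB1 := compact_measurable_rV cB1.
have vE : leb p [set x : 'rV[R]_p | `|x| <= 1] = v%:E.
  by rewrite fineK // ge0_fin_numE //; exact: lebesgue_rV_compact_lty.
have v0 : 0 <= v by rewrite fine_ge0.
have vol j : (leb p (A j) <= (2 ^+ (E * j.+1) * v)%:E)%E.
  have h0 : 0 < 2 ^+ j.+1 :> R by rewrite exprn_gt0.
  rewrite (lebesgue_rV_dilation e2 h0 (mA j)) -/E -exprM mulnC EFinM.
  apply: lee_wpmul2l; first by rewrite lee_fin exprn_ge0.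
  rewrite -vE; apply: le_measure; rewrite ?inE //.
    by have := @measurable_dilation R p e2 (2 ^+ j.+1) measurableT _ (mA j); rewrite setTI.
  by move=> x; rewrite /A /= dilation_dilation -exprMn mulVf // expr1n dilation1 => /ltW.
have [j|j| |j|x|g Ig gA] := @dyadic_dominant R _ _ (leb p) A (fun j => C * 2^-1 ^+ (d * j)) (C * 2 ^+ E * v).
- exact: mA.
- by rewrite mulr_ge0 ?exprn_ge0 ?invr_ge0 // ltW.
- by rewrite !mulr_ge0 ?exprn_ge0 // ltW.
- apply: (@le_trans _ _ ((C * 2^-1 ^+ (d * j))%:E * (2 ^+ (E * j.+1) * v)%:E)%E).
    by apply: lee_wpmul2l; [rewrite lee_fin mulr_ge0 ?exprn_ge0 ?invr_ge0 // ltW|exact: vol].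
  rewrite -EFinM lee_fin mulnS exprD.
  have -> : C * 2^-1 ^+ (d * j) * (2 ^+ E * 2 ^+ (E * j) * v) = C * 2 ^+ E * v * (2 ^+ (E * j) * 2^-1 ^+ (d * j)) by ring.
  rewrite ler_wpM2l ?mulr_ge0 ?exprn_ge0 ?(ltW C0) //.
  rewrite (_ : (d * j = E * j + (d - E) * j)%N); last by rewrite -mulnDl subnKC // ltnW.
  rewrite exprD mulrA -exprMn mulfV // expr1n mul1r.
  rewrite ler_wiXn2l ?invr_ge0 ?invf_le1 ?ler1n //.
  by rewrite -{1}[j]mul1n leq_mul2r subn_gt0 ed orbT.
- exists (C * 2) => l; apply: le_trans (_ : \sum_(0 <= i < l) C * 2^-1 ^+ i <= _); last first.
    by rewrite -mulr_sumr ler_wpM2l ?(ltW C0) // geometric_half_sum.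
  apply: ler_sum => i _; rewrite -[leRHS]mulr1; apply: ler_pM => //.
  + by rewrite mulr_ge0 ?exprn_ge0 ?invr_ge0 // ltW.
  + rewrite ler_wpM2l ?(ltW C0) // ler_wiXn2l ?invr_ge0 ?invf_le1 ?ler1n //.
    by rewrite leq_pmull // (leq_ltn_trans _ ed).
pose j0 := Num.bound (2 * `|r|).
exists (2 ^+ (j0 * E)), g; split; [by rewrite exprn_gt0|exact: Ig|].
move=> x xi xr /outer_shell_index[j jj [h1 h2]].
apply: le_trans (HC `|r| j x xi _ _ h1 h2) (gA j xi h2).
  exact: le_trans xr (ler_norm r).
apply: le_trans (_ : j0%:R <= _); first by apply: ltW; apply: archi_boundP; rewrite mulr_ge0.
apply: le_trans (_ : j%:R <= _); last exact: expr2_ge_nat.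
by rewrite ler_nat.
Qed.

End decay.

Lemma partials_row_mx k p (H : 'rV[R]_(k + p) -> R) (xi : 'rV[R]_p) s x :
  partials s (fun x => H (row_mx x xi)) x = partials [seq lshift p i | i <- s] H (row_mx x xi).
Proof.
elim: s x => //= i s IH x; rewrite (funext IH).
by apply: partial_line_eq => t; rewrite row_mx_line_l.
Qed.

(** * Smoothness of fibre integrals *)

Section smooth_fiber_integral.
Variables (k p : nat) (e1 : 'I_k -> nat) (e2 : 'I_p -> nat) (H : 'rV[R]_(k + p) -> R) (d : nat)
  (V : set 'rV[R]_(k + p)) (W : set 'rV[R]_k).
Hypothesis e1_gt0 : forall i, (0 < e1 i)%N.
Hypothesis e2_gt0 : forall i, (0 < e2 i)%N.
Hypothesis oV : open V.
Hypothesis V2 : forall v, V v -> V (dilation (cat_exp e1 e2) 2 v).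
Hypothesis V0 : forall v, rsubmx v != 0 -> V v.
Hypothesis sH : smooth_on V H.
Hypothesis hom : forall v, V v -> H (dilation (cat_exp e1 e2) 2 v) * 2 ^+ d = H v.
Hypothesis d_gt : (\sum_i e2 i < d)%N.
Hypothesis oW : open W.
Hypothesis WV : forall x xi, W x -> V (row_mx x xi).

(** Differentiation in the base variables only improves the decay along the fibres, so
    [fiber_dominant] serves every derivative; the part with bounded fibre variable is controlled by
    compactness inside [V]. *)
Lemma smooth_on_fiber_integral : smooth_on W (fun x => \int[leb p]_xi H (row_mx x xi)).
Proof.
have ne0 (xi : 'rV[R]_p) : 1 <= `|xi| -> xi != 0.
  by move=> h; rewrite -normr_gt0; exact: lt_le_trans h.
apply: (smooth_on_Rintegral (F := fun x xi => H (row_mx x xi)) oW).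
- move=> xi; apply: (smooth_on_comp oW oV sH) => [x Wx|j]; first exact: WV.
  exact: (smooth_smooth_on (smooth_map_row_mx (@smooth_map_id R k) (@smooth_map_cst R k p xi) j)).
- move=> s x Wx.
  have -> : (fun t => partials s (fun x => H (row_mx x t)) x) =
      (fun t => partials [seq lshift p i | i <- s] H (row_mx x t)).
    by apply/funext => t; rewrite partials_row_mx.
  apply: continuous_measurable_rV => t.
  apply: (@continuous_comp _ _ _ (fun t => row_mx x t) (partials [seq lshift p i | i <- s] H)).
    by apply: continuous_row_mx; [exact: cst_continuous|].
  exact: (smooth_on_continuous (smooth_on_partials _ sH) (WV t Wx)).
move=> s x0 Wx0; set s' := [seq lshift p i | i <- s].
have sHs := smooth_on_partials s' sH.
have homs := partials_dyadic s' oV V2 sH hom.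
pose Hs x xi := partials s' H (row_mx x xi).
have hHs x (xi : 'rV[R]_p) : xi != 0 -> Hs (dilation e1 2 x) (dilation e2 2 xi) *
    2 ^+ (d + \sum_(i <- s') cat_exp e1 e2 i) = Hs x xi.
  move=> xi0; have Vv : V (row_mx x xi) by apply: V0; rewrite row_mxKr.
  by rewrite /Hs -(homs _ Vv) dilation_row_mx.
have cHs x (xi : 'rV[R]_p) : `|x| <= 2^-1 -> 1 <= `|xi| ->
    {for row_mx x xi, continuous (fun v => Hs (lsubmx v) (rsubmx v))}.
  move=> _ /ne0 xi0; apply: continuous_at_ext (_ : {for _, continuous (partials s' H)}).
    by move=> v; rewrite /Hs hsubmxK.
  by apply: (smooth_on_continuous sHs); apply: V0; rewrite row_mxKr.
have [r0 r00 r0W] := nbhs_norm_lt (open_nbhs_nbhs (conj oW Wx0)).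
have [|rho [g [rho0 Ig Hg]]] := fiber_dominant e1_gt0 e2_gt0 hHs cHs (`|x0| + r0).
  exact: leq_trans d_gt (leq_addr _ _).
(* The closed ball of radius r0 / 2 around [x0] stays in [W], so this compact set stays in [V]. *)
pose S : set 'rV[R]_(k + p) := [set v | `|lsubmx v| <= `|x0| + r0 /\ `|rsubmx v| <= rho] `&`
  ((@lsubmx R 1 k p) @^-1` [set x | `|x - x0| <= r0 / 2]).
have cS : compact S.
  apply: (subclosed_compact _ (@compact_box_rV k p (`|x0| + r0) rho)); last by move=> v [].
  apply: closedI; first by apply: compact_closed_rV; exact: compact_box_rV.
  apply: closed_comp; first by move=> v _; exact: continuous_lsubmx.
  by apply: compact_closed_rV; exact: compact_ball_at.
have SV v : S v -> V v.
  move=> [_ /= h]; rewrite -[v]hsubmxK; apply: WV; apply: r0W; apply: le_lt_trans h _; lra.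
have [M M0 HM] := compact_continuous_bound cS (fun v Sv => smooth_on_continuous sHs (SV v Sv)).
pose B : set 'rV[R]_p := [set xi | `|xi| <= rho].
have cB : compact B by exact: compact_closed_ball_rV.
exists (r0 / 2), (fun xi => `|g xi| + M * \1_B xi); split; first by rewrite divr_gt0.
  apply: RintegrableD; first exact: Rintegrable_abs.
  apply: RintegrableZ; apply: (@bounded_supported_integrable _ _ _ B 1) => //.
  - by apply: measurable_indic; exact: compact_measurable_rV.
  - by move=> xi nB; rewrite indicE memNset.
  - by move=> xi; rewrite indicE ger0_norm // lern1 leq_b1.
move=> y t yr; rewrite partials_row_mx -/s'.
have yx : `|y| <= `|x0| + r0.
  rewrite -[y](subrK x0) addrC; apply: le_trans (ler_normD _ _) _; rewrite lerD2l ltW //.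
  by apply: lt_trans yr _; lra.
case: (leP `|t| rho) => ht; last first.
  by apply: le_trans (Hg y t yx (ltW ht)) _; apply: le_trans (ler_norm _) _; rewrite lerDl mulr_ge0 // ltW.
rewrite indicE mem_set // mulr1; apply: le_trans (HM (row_mx y t) _) _; last by rewrite lerDr.
by split; rewrite /= ?row_mxKl ?row_mxKr //; exact: ltW.
Qed.

End smooth_fiber_integral.

End fiber_integrals.

(** * Integrals that may diverge, and local integrability through balls *)

Section integration_complements.
Context {R : realType}.
Local Notation leb k := (@lebesgue_rV R k).

(** If the extended integral were finite, both the positive and the negative part would have finite
    integral. So it is infinite and [fine] returns 0. *)
Lemma Rintegral_nonintegrable d (T : measurableType d) (mu : {measure set T -> \bar R}) (f : T -> R) :
  measurable_fun setT f -> ~ Rintegrable mu f -> \int[mu]_x f x = 0.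
Proof.
move=> mf nf; rewrite /Rintegral.
have mf' : measurable_fun setT (EFin \o f) by exact/measurable_EFinP.
case: (boolP ((\int[mu]_x (f x)%:E)%E \is a fin_num)); last first.
  by case: (\int[mu]_x (f x)%:E)%E.
rewrite integralE fin_numB => /andP[f1 f2]; exfalso; apply: nf; apply/integrableP; split => //.
rewrite -[X in (\int[_]_x X x)%E]/(abse \o (EFin \o f)) fune_abse ge0_integralD //; last 2 first.
- exact: measurable_funepos.
- exact: measurable_funeneg.
by rewrite lte_add_pinfty // ltey_eq ?f1 ?f2.
Qed.

Lemma norm_Rintegral_le_abs d (T : measurableType d) (mu : {measure set T -> \bar R}) (f : T -> R) :
  measurable_fun setT f -> `|\int[mu]_x f x| <= \int[mu]_x `|f x|.
Proof.
move=> mf; have [If|nf] := pselect (Rintegrable mu f).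
  by apply: norm_Rintegral_le => //; exact: Rintegrable_abs.
by rewrite (Rintegral_nonintegrable mf nf) normr0; apply: Rintegral_ge0.
Qed.

(** A non-zero factor does not affect integrability, and in the divergent case both sides are 0.
    Fibre integrals can thus be scaled at every point. *)
Lemma RintegralZl_measurable d (T : measurableType d) (mu : {measure set T -> \bar R}) (c : R) (f : T -> R) :
  c != 0 -> measurable_fun setT f -> \int[mu]_x (c * f x) = c * \int[mu]_x f x.
Proof.
move=> c0 mf; have [If|nf] := pselect (Rintegrable mu f); first by rewrite RintegralZl.
rewrite (Rintegral_nonintegrable mf nf) mulr0; apply: Rintegral_nonintegrable.
  exact: measurable_funM.
move=> Ic; apply: nf; have := RintegrableZ c^-1 Ic.
by congr (Rintegrable mu _); apply/funext => x; rewrite mulKf.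
Qed.

Lemma measurable_ge0_integral_row n p (f : 'rV[R]_(n + p) -> \bar R) : measurable_fun setT f ->
  (forall z, 0 <= f z)%E -> measurable_fun setT (fun x : 'rV[R]_n => \int[leb p]_y f (row_mx x y))%E.
Proof.
move=> mf f0; apply: (@measurable_fun_fubini_tonelli_F _ _ 'rV[R]_n 'rV[R]_p R (leb p) (fun z => f (row_mx z.1 z.2))) => //.
by apply: (measurableT_comp mf); have [] := @transports_row_mx R n p.
Qed.

Lemma Rintegrable_tensor n p (a : 'rV[R]_n -> R) (b : 'rV[R]_p -> R) :
  Rintegrable (leb n) a -> Rintegrable (leb p) b ->
  Rintegrable (leb (n + p)) (fun z => a (lsubmx z) * b (rsubmx z)).
Proof.
move=> Ia Ib; have ma := Rintegrable_measurable Ia; have mb := Rintegrable_measurable Ib.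
apply/(@Rintegrable_rowP R n p); first apply: measurable_funM.
- exact: (measurableT_comp ma (@measurable_lsubmx R n p)).
- exact: (measurableT_comp mb (@measurable_rsubmx R n p)).
have /integrableP[_ fb] := Ib; have /integrableP[_ fa] := Ia.
under eq_integral => x _.
  under eq_integral do rewrite row_mxKl row_mxKr normrM EFinM.
  rewrite ge0_integralZl //; last by apply/measurable_EFinP; apply: measurableT_comp.
  over.
rewrite ge0_integralZr //=; last 2 first.
- by apply/measurable_EFinP; apply: measurableT_comp.
- exact: integral_ge0.
by rewrite lte_mul_pinfty ?integral_ge0 // ge0_fin_numE ?integral_ge0.
Qed.

Lemma Rintegrable_indic_ball n (r : R) :
  Rintegrable (leb n) (\1_[set x : 'rV[R]_n | `|x| <= r] : 'rV[R]_n -> R).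
Proof.
have cB := @compact_closed_ball_rV R n r.
apply: (@bounded_supported_integrable _ _ _ [set x | `|x| <= r] 1) => //.
- by apply: measurable_indic; exact: compact_measurable_rV.
- by move=> x nB; rewrite indicE memNset.
- by move=> x; rewrite indicE ger0_norm // lern1 leq_b1.
Qed.

Lemma L1loc_of_balls n (f : 'rV[R]_n -> R) : measurable_fun setT f ->
  (forall r, Rintegrable (leb n) (fun x => \1_[set x : 'rV[R]_n | `|x| <= r] x * f x)) -> L1loc f.
Proof.
move=> mf If; split => // A cA; have [r r0 Ar] := compact_norm_bound cA.
have mA := compact_measurable_rV cA.
have /integrableP[mfr] := If r; apply: le_lt_trans.
rewrite integral_mkcond; apply: ge0_le_integral => //.
- by move=> x _; rewrite patchE; case: ifP => // _; rewrite lee_fin.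
- apply: (measurable_restrictT (D := A) _ mA).1.
  by apply: measurable_funTS; apply/measurable_EFinP; apply: measurableT_comp.
- exact: measurableT_comp.
- move=> x _; rewrite patchE; case: ifPn => [/set_mem Ax|_] /=; last by rewrite lee_fin.
  by rewrite indicE mem_set ?mul1r //; exact: Ar.
Qed.

End integration_complements.

(** * Smoothness, decay and integrability of the projected kernel *)

Section projected_kernel.
Context {R : realType} (n p : nat) (sigma : 'I_n -> nat) (tau : 'I_p -> nat)
  (mul : 'rV[R]_(n + p) -> 'rV[R]_(n + p) -> 'rV[R]_(n + p)) (inv : 'rV[R]_(n + p) -> 'rV[R]_(n + p)).
Hypothesis hg : homogeneous_group (cat_exp sigma tau) mul inv.
Local Notation e := (cat_exp sigma tau).
Local Notation leb k := (@lebesgue_rV R k).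
Variables (K : 'rV[R]_(n + p) -> R) (d : nat).
Hypothesis sK : smooth_on [set z | z != 0] K.
Hypothesis K0 : K 0 = 0.
Hypothesis homK : forall z : 'rV[R]_(n + p), z != 0 -> K (dilation e 2 z) * 2 ^+ d = K z.
Hypothesis LK : L1loc K.
Hypothesis d_gt : (\sum_i tau i < d)%N.

Definition projected_kernel (x y : 'rV[R]_n) : R :=
  \int[leb p]_xi K (mul (inv (row_mx y 0)) (row_mx x xi)).
Local Notation G := projected_kernel.

Let sigma_gt0 := base_exp_gt0 hg.
Let tau_gt0 := fiber_exp_gt0 hg.
Let mK : measurable_fun setT K := LK.1.

(** The argument of [K] as one smooth map of ((x, y), xi). It commutes with the dilations, which
    makes [K o kmap] an instance of the homogeneous functions treated above. *)
Let kmap (v : 'rV[R]_(n + n + p)) :=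
  mul (inv (row_mx (rsubmx (lsubmx v)) 0)) (row_mx (lsubmx (lsubmx v)) (rsubmx v)).

Let smooth_kmap : smooth_map kmap.
Proof.
have sl := @smooth_map_lsubmx R (n + n) p.
apply: (smooth_mul hg).
  apply: (smooth_inv hg); apply: smooth_map_row_mx (smooth_map_cst _).
  exact: (smooth_map_comp (@smooth_map_rsubmx R n n) sl).
apply: smooth_map_row_mx (@smooth_map_rsubmx R _ _).
exact: (smooth_map_comp (@smooth_map_lsubmx R n n) sl).
Qed.

Let kmap_dilation (l : R) v : 0 < l ->
  kmap (dilation (cat_exp (cat_exp sigma sigma) tau) l v) = dilation e l (kmap v).
Proof.
move=> l0; rewrite /kmap !(lsubmx_dilation, rsubmx_dilation) (hg_dilation hg) //.
by rewrite -(group_inv_dilation hg) // !dilation_row_mx dilation0.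
Qed.

(** The singularity of [K] is met only for [x = y] and [xi = 0]: this gives smoothness off the
    diagonal, and on it away from the origin of the fibre. *)
Let kmap_eq0 v : kmap v = 0 -> lsubmx (lsubmx v) = rsubmx (lsubmx v) /\ rsubmx v = 0.
Proof.
move=> h; have := group_mulKV hg (row_mx (rsubmx (lsubmx v)) 0) (row_mx (lsubmx (lsubmx v)) (rsubmx v)).
by rewrite -/(kmap v) h (hg_mulx0 hg) => /eq_row_mx[-> ->].
Qed.

Let V : set 'rV[R]_(n + n + p) := [set v | kmap v != 0].

Let open_ne0 k : open [set x : 'rV[R]_k | x != 0].
Proof.
rewrite (_ : [set x | _] = ~` [set x : 'rV[R]_k | `|x| <= 0]); last first.
  by apply/seteqP; split => x /=; rewrite normr_le0 => /negP.
by apply: closed_openC; apply: compact_closed_rV; exact: compact_closed_ball_rV.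
Qed.

Let oV : open V.
Proof.
apply: (@open_comp _ _ kmap [set z | z != 0]); last exact: open_ne0.
by move=> v _; exact: (smooth_map_continuous smooth_kmap).
Qed.

Let V0 v : rsubmx v != 0 -> V v.
Proof. by move=> h; apply/eqP => /kmap_eq0[_ h']; rewrite h' eqxx in h. Qed.

Let two0 : 0 < 2 :> R. Proof. by []. Qed.

Let homK' z : K (dilation e 2 z) * 2 ^+ d = K z.
Proof. by case: (eqVneq z 0) => [->|z0]; [rewrite dilation0 K0 mul0r|exact: homK]. Qed.

Let sKm : smooth_on V (fun v => K (kmap v)).
Proof.
apply: (smooth_on_comp oV (@open_ne0 (n + p)) sK) => // j.
exact: (smooth_smooth_on (smooth_kmap j)).
Qed.

Let homKm v : K (kmap (dilation (cat_exp (cat_exp sigma sigma) tau) 2 v)) * 2 ^+ d = K (kmap v).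
Proof. by rewrite kmap_dilation // homK'. Qed.

Let joint_kernelE z : joint G z = \int[leb p]_xi K (kmap (row_mx z xi)).
Proof. by apply: eq_Rintegral => xi _; rewrite /kmap row_mxKl row_mxKr. Qed.

Lemma open_off_diagonal : open [set z : 'rV[R]_(n + n) | lsubmx z != rsubmx z].
Proof.
have -> : [set z : 'rV[R]_(n + n) | lsubmx z != rsubmx z] = (fun z => lsubmx z - rsubmx z) @^-1` [set x | x != 0].
  by apply/seteqP; split => z /=; rewrite subr_eq0.
apply: open_comp; last exact: open_ne0.
move=> z _; apply: smooth_map_continuous => j; under eq_fun do rewrite !mxE.
by apply: (smooth_onB openT); exact: (smooth_on_coord _ openT).
Qed.

Lemma kernel_smooth : smooth_off_diagonal G.
Proof.
rewrite /smooth_off_diagonal (funext joint_kernelE).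
have ss0 := cat_exp_gt0 sigma_gt0 sigma_gt0.
apply: (smooth_on_fiber_integral ss0 tau_gt0 oV _ V0 sKm (fun v _ => homKm v) d_gt open_off_diagonal).
  move=> v; rewrite /V /= kmap_dilation // => vn0; apply/eqP => /dilation_eq0 h.
  by move/eqP: vn0; apply; apply: h.
move=> z xi /= zn; apply/eqP => /kmap_eq0; rewrite row_mxKl => -[h _].
by rewrite h eqxx in zn.
Qed.

Let measurable_Km : measurable_fun setT (fun v => K (kmap v)).
Proof.
apply: (measurableT_comp (f := K)) => //.
exact: (continuous_map_measurable (smooth_map_continuous smooth_kmap)).
Qed.

Lemma measurable_kernel : measurable_fun setT (joint G).
Proof. by rewrite (funext joint_kernelE); exact: (@measurable_Rintegral_row R (n + n) p _ measurable_Km). Qed.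

Let measurable_fiber x y : measurable_fun setT (fun xi => K (mul (inv (row_mx y 0)) (row_mx x xi))).
Proof.
have : measurable_fun setT (fun xi => K (kmap (row_mx (row_mx x y) xi))).
  apply: (measurableT_comp (f := fun v => K (kmap v))) => //.
  by apply: measurable_row_mx.
by under eq_fun do rewrite /kmap !row_mxKl !row_mxKr.
Qed.

(** Dilating the fibre variable costs 2 to the sum of [tau]. The relation includes the diagonal,
    where a divergent integral would be 0 on both sides. *)
Lemma kernel_dyadic x y :
  G (dilation sigma 2 x) (dilation sigma 2 y) * 2 ^+ (d - \sum_i tau i) = G x y.
Proof.
rewrite /G (Rintegral_dilation tau two0 (measurable_fiber _ _)) mulrC mulrA -exprD subnK ?(ltnW d_gt) //.
have E : (fun xi => K (mul (inv (row_mx y 0)) (row_mx x xi))) =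
    (fun xi => 2 ^+ d * K (mul (inv (row_mx (dilation sigma 2 y) 0)) (row_mx (dilation sigma 2 x) (dilation tau 2 xi)))).
  apply/funext => xi; have := homKm (row_mx (row_mx x y) xi).
  by rewrite dilation_row_mx dilation_row_mx /kmap !row_mxKl !row_mxKr mulrC => <-.
rewrite E; apply/esym; apply: RintegralZl_measurable; first by rewrite expf_neq0.
exact: (measurableT_comp (measurable_fiber (dilation sigma 2 x) (dilation sigma 2 y)) (@measurable_dilation R p tau 2)).
Qed.

Lemma kernel_continuous x y : x != y -> {for row_mx x y, continuous (joint G)}.
Proof. by move=> xy; apply: (smooth_on_continuous kernel_smooth); rewrite /= row_mxKl row_mxKr. Qed.

Let norm_ne (x y : 'rV[R]_n) : `|x| <= 2^-1 -> 1 <= `|y| -> x != y.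
Proof.
move=> x1 y1; apply/eqP => xy; move: y1; rewrite -xy leNgt => /negP; apply.
by apply: le_lt_trans x1 _; lra.
Qed.

(** [G] is dyadically homogeneous in both arguments and continuous off the diagonal, so
    [decay_at_infinity] applies with either point in the place of the fibre variable. *)
Lemma kernel_decay (r eps : R) : 0 < eps -> exists M : R, forall x y, `|y| <= r -> M < `|x| ->
  `|G x y| < eps /\ `|G y x| < eps.
Proof.
move=> eps0; have d0 : (0 < d - \sum_i tau i)%N by rewrite subn_gt0.
have h1 (y x : 'rV[R]_n) : x != 0 -> G (dilation sigma 2 x) (dilation sigma 2 y) * 2 ^+ (d - \sum_i tau i) = G x y.
  by move=> _; exact: kernel_dyadic.
have c1 (y x : 'rV[R]_n) : `|y| <= 2^-1 -> 1 <= `|x| ->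
    {for row_mx y x, continuous (fun v => G (rsubmx v) (lsubmx v))}.
  move=> hy hx.
  apply: continuous_at_ext (_ : {for row_mx y x, continuous (joint G \o (fun v => row_mx (rsubmx v) (lsubmx v)))}).
    by move=> v; rewrite /joint /= row_mxKl row_mxKr.
  apply: continuous_comp; last by rewrite row_mxKl row_mxKr; apply: kernel_continuous; rewrite eq_sym; exact: norm_ne.
  by apply: continuous_row_mx; [exact: continuous_rsubmx|exact: continuous_lsubmx].
have h2 (y x : 'rV[R]_n) : x != 0 -> G (dilation sigma 2 y) (dilation sigma 2 x) * 2 ^+ (d - \sum_i tau i) = G y x.
  by move=> _; exact: kernel_dyadic.
have c2 (y x : 'rV[R]_n) : `|y| <= 2^-1 -> 1 <= `|x| ->
    {for row_mx y x, continuous (fun v => G (lsubmx v) (rsubmx v))}.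
  by move=> hy hx; apply: kernel_continuous; exact: norm_ne.
have [M1 HM1] := decay_at_infinity sigma_gt0 sigma_gt0 h1 c1 r d0 eps0.
have [M2 HM2] := decay_at_infinity sigma_gt0 sigma_gt0 h2 c2 r d0 eps0.
exists (Num.max M1 M2) => x y yr; rewrite gt_max => /andP[x1 x2].
by split; [exact: HM1|exact: HM2].
Qed.

(** Both base points together form the parameter block, so the majorant in [xi] is uniform in the
    two. *)
Let far_dominant (r : R) : exists (rho : R) (g : 'rV[R]_p -> R), [/\ 0 < rho, Rintegrable (leb p) g &
  forall x y xi, `|x| <= r -> `|y| <= r -> rho <= `|xi| -> `|K (mul (inv (row_mx y 0)) (row_mx x xi))| <= g xi].
Proof.
have ss0 := cat_exp_gt0 sigma_gt0 sigma_gt0.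
pose H v xi := K (kmap (row_mx v xi)).
have hH v (xi : 'rV[R]_p) : xi != 0 -> H (dilation (cat_exp sigma sigma) 2 v) (dilation tau 2 xi) * 2 ^+ d = H v xi.
  by move=> _; rewrite /H -dilation_row_mx homKm.
have cH (v : 'rV[R]_(n + n)) (xi : 'rV[R]_p) : `|v| <= 2^-1 -> 1 <= `|xi| ->
    {for row_mx v xi, continuous (fun v => H (lsubmx v) (rsubmx v))}.
  move=> _ xi1; apply: continuous_at_ext (_ : {for _, continuous (fun v => K (kmap v))}).
    by move=> v'; rewrite /H hsubmxK.
  apply: (smooth_on_continuous sKm); apply: V0; rewrite row_mxKr -normr_gt0; exact: lt_le_trans xi1.
have [rho [g [rho0 Ig Hg]]] := fiber_dominant ss0 tau_gt0 hH cH `|r| d_gt.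
exists rho, g; split => // x y xi xr yr hxi.
have := Hg (row_mx x y) xi; rewrite /H /kmap !row_mxKl !row_mxKr; apply => //.
by rewrite norm_row_mx_le // !(le_trans _ (ler_norm r)).
Qed.

(** * Uniform integrability over strips with bounded base *)

Section strip.
Variable Phi : 'rV[R]_n -> 'rV[R]_(n + p) -> 'rV[R]_(n + p).
Hypothesis Phi_preserves : forall t, transports (leb (n + p)) (leb (n + p)) (Phi t).
Hypothesis Phi_continuous : continuous (fun v : 'rV[R]_(n + (n + p)) => Phi (lsubmx v) (rsubmx v)).
Hypothesis Phi_far : forall r : R, exists (rho : R) (g : 'rV[R]_p -> R), [/\ 0 < rho, Rintegrable (leb p) g &
  forall t z, `|t| <= r -> `|lsubmx z| <= r -> rho <= `|rsubmx z| -> `|K (Phi t z)| <= g (rsubmx z)].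

Lemma Phi_near (r rho : R) : exists2 M : R, 0 < M & forall t z, `|t| <= r -> `|lsubmx z| <= r ->
  `|rsubmx z| <= rho -> `|Phi t z| <= M.
Proof.
have cN : continuous (fun v : 'rV[R]_(n + (n + p)) => `|Phi (lsubmx v) (rsubmx v)|).
  move=> v; apply: (@continuous_comp _ _ _ (fun v => Phi (lsubmx v) (rsubmx v)) (fun z => `|z|)).
    exact: Phi_continuous.
  exact: norm_continuous.
have [M M0 HM] := compact_continuous_bound (@compact_closed_ball_rV R (n + (n + p)) (`|r| + `|rho|)) (fun v _ => cN v).
have rr : r <= `|r| + `|rho| by apply: le_trans (ler_norm _) _; rewrite lerDl.
have rho' : rho <= `|r| + `|rho| by apply: le_trans (ler_norm _) _; rewrite lerDr.
exists M => // t z tr zr zrho; have := HM (row_mx t z); rewrite row_mxKl row_mxKr normr_id; apply => /=.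
rewrite norm_row_mx_le ?addr_ge0 // (le_trans tr) //=.
by rewrite -[z]hsubmxK norm_row_mx_le ?addr_ge0 // (le_trans zr) // (le_trans zrho).
Qed.

Lemma Phi_measurable t : measurable_fun setT (fun z => K (Phi t z)).
Proof. by apply: (measurableT_comp (f := K)) => //; have [] := Phi_preserves t. Qed.

Lemma ball_kernel_integrable (M : R) : Rintegrable (leb (n + p)) (fun z => K z * \1_[set z | `|z| <= M] z).
Proof.
have cB := @compact_closed_ball_rV R (n + p) M.
apply: (@L1loc_mul_integrable _ _ _ _ [set z | `|z| <= M] 1 LK) => //.
- by apply: measurable_indic; exact: compact_measurable_rV.
- by move=> x nB; rewrite indicE memNset.
- by move=> x; rewrite indicE ger0_norm // lern1 leq_b1.
Qed.

(** Where the fibre coordinate is bounded, [Phi t] lands in a fixed ball, on which [K] is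
    integrable, and it preserves the measure. Elsewhere [Phi_far] gives a majorant depending on the
    fibre only. Neither bound depends on [t]. *)
Lemma strip_integrable (r : R) : exists2 C : R, 0 <= C & forall t, `|t| <= r ->
  Rintegrable (leb (n + p)) (fun z => \1_[set x | `|x| <= r] (lsubmx z) * K (Phi t z)) /\
  \int[leb (n + p)]_z `|\1_[set x | `|x| <= r] (lsubmx z) * K (Phi t z)| <= C.
Proof.
have [rho [g [rho0 Ig Hg]]] := Phi_far r; have [M M0 HM] := Phi_near r rho.
pose B : set 'rV[R]_n := [set x | `|x| <= r].
have IB := Rintegrable_indic_ball n r; rewrite -/B in IB.
have I2 := Rintegrable_tensor IB (Rintegrable_abs Ig).
pose k (z : 'rV[R]_(n + p)) : R := `|K z * \1_[set z | `|z| <= M] z|.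
have Ik : Rintegrable (leb (n + p)) k by apply: Rintegrable_abs; exact: ball_kernel_integrable.
have mk := Rintegrable_measurable Ik.
exists (\int[leb (n + p)]_z k z + \int[leb (n + p)]_z (\1_B (lsubmx z) * `|g (rsubmx z)|)).
  apply: addr_ge0; first by apply: Rintegral_ge0 => z _; exact: normr_ge0.
  by apply: Rintegral_ge0 => z _; rewrite mulr_ge0.
move=> t tr.
have Ikt : Rintegrable (leb (n + p)) (fun z => k (Phi t z)).
  exact/(transports_integrable (Phi_preserves t) mk).
have Isum := RintegrableD Ikt I2.
have bound z : `|\1_B (lsubmx z) * K (Phi t z)| <= k (Phi t z) + \1_B (lsubmx z) * `|g (rsubmx z)|.
  have k0 : 0 <= k (Phi t z) by exact: normr_ge0.
  case: (pselect (B (lsubmx z))) => [Bz|nB]; last first.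
    by rewrite !indicE (memNset nB) !mul0r normr0 addr0.
  rewrite indicE (mem_set Bz) !mul1r; case: (leP `|rsubmx z| rho) => hz.
    apply: le_trans (_ : k (Phi t z) <= _); last by rewrite lerDl.
    rewrite /k indicE mem_set ?mulr1 //=; exact: HM.
  apply: le_trans (Hg t z tr Bz (ltW hz)) _; apply: le_trans (ler_norm _) _; by rewrite lerDr.
have mI : measurable_fun setT (fun z => \1_B (lsubmx z) * K (Phi t z)).
  apply: measurable_funM; last exact: Phi_measurable.
  exact: (measurableT_comp (Rintegrable_measurable IB) (@measurable_lsubmx R n p)).
have I1 := Rintegrable_le mI Isum bound.
split; first exact: I1.
have -> : \int[leb (n + p)]_z k z = \int[leb (n + p)]_z k (Phi t z).
  exact/esym/(transports_Rintegral (Phi_preserves t) mk).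
rewrite -RintegralD //; apply: le_Rintegral => //; exact: Rintegrable_abs.
Qed.

End strip.

Let PhiY (y : 'rV[R]_n) (z : 'rV[R]_(n + p)) := mul (inv (row_mx y 0)) z.
Let PhiX (x : 'rV[R]_n) (z : 'rV[R]_(n + p)) := mul (inv (row_mx (lsubmx z) 0)) (row_mx x (rsubmx z)).

Let sl := @smooth_map_lsubmx R n (n + p).
Let sr := @smooth_map_rsubmx R n (n + p).

Let PhiY_continuous : continuous (fun v : 'rV[R]_(n + (n + p)) => PhiY (lsubmx v) (rsubmx v)).
Proof.
apply: smooth_map_continuous; apply: (smooth_mul hg) => //.
by apply: (smooth_inv hg); exact: (smooth_map_row_mx sl (smooth_map_cst _)).
Qed.

Let PhiX_continuous : continuous (fun v : 'rV[R]_(n + (n + p)) => PhiX (lsubmx v) (rsubmx v)).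
Proof.
apply: smooth_map_continuous; apply: (smooth_mul hg).
  apply: (smooth_inv hg); apply: smooth_map_row_mx (smooth_map_cst _).
  exact: (smooth_map_comp (@smooth_map_lsubmx R n p) sr).
apply: smooth_map_row_mx; first exact: sl.
exact: (smooth_map_comp (@smooth_map_rsubmx R n p) sr).
Qed.

Let PhiY_far (r : R) : exists (rho : R) (g : 'rV[R]_p -> R), [/\ 0 < rho, Rintegrable (leb p) g &
  forall t z, `|t| <= r -> `|lsubmx z| <= r -> rho <= `|rsubmx z| -> `|K (PhiY t z)| <= g (rsubmx z)].
Proof.
have [rho [g [rho0 Ig Hg]]] := far_dominant r; exists rho, g; split => // t z tr zr hz.
by rewrite /PhiY -[z in K (_ z)]hsubmxK; exact: Hg.
Qed.

Let PhiX_far (r : R) : exists (rho : R) (g : 'rV[R]_p -> R), [/\ 0 < rho, Rintegrable (leb p) g &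
  forall t z, `|t| <= r -> `|lsubmx z| <= r -> rho <= `|rsubmx z| -> `|K (PhiX t z)| <= g (rsubmx z)].
Proof.
have [rho [g [rho0 Ig Hg]]] := far_dominant r; exists rho, g; split => // t z tr zr hz.
exact: Hg.
Qed.

Lemma strip_integrable_y (r : R) : exists2 C : R, 0 <= C & forall y, `|y| <= r ->
  Rintegrable (leb (n + p)) (fun z => \1_[set x | `|x| <= r] (lsubmx z) * K (mul (inv (row_mx y 0)) z)) /\
  \int[leb (n + p)]_z `|\1_[set x | `|x| <= r] (lsubmx z) * K (mul (inv (row_mx y 0)) z)| <= C.
Proof. exact: (strip_integrable (fun t => left_translation_preserves hg _) PhiY_continuous PhiY_far). Qed.

Lemma strip_integrable_x (r : R) : exists2 C : R, 0 <= C & forall x, `|x| <= r ->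
  Rintegrable (leb (n + p)) (fun z => \1_[set x | `|x| <= r] (lsubmx z) *
    K (mul (inv (row_mx (lsubmx z) 0)) (row_mx x (rsubmx z)))) /\
  \int[leb (n + p)]_z `|\1_[set x | `|x| <= r] (lsubmx z) *
    K (mul (inv (row_mx (lsubmx z) 0)) (row_mx x (rsubmx z)))| <= C.
Proof. exact: (strip_integrable (section_inverse_preserves hg) PhiX_continuous PhiX_far). Qed.

Let indicM (r : R) (x : 'rV[R]_n) (f : 'rV[R]_p -> R) : measurable_fun setT f ->
  \int[leb p]_xi (\1_[set x : 'rV[R]_n | `|x| <= r] x * f xi) = \1_[set x : 'rV[R]_n | `|x| <= r] x * \int[leb p]_xi f xi.
Proof.
move=> mf; rewrite indicE; case: (_ \in _); last first.
  by under eq_Rintegral do rewrite mul0r; rewrite /Rintegral integral0 mul0r.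
by under eq_Rintegral do rewrite mul1r; rewrite mul1r.
Qed.

Lemma kernel_L1loc_x y : L1loc (fun x => G x y).
Proof.
apply: L1loc_of_balls.
  have -> : (fun x => G x y) = joint G \o (fun x => row_mx x y).
    by apply/funext => x; rewrite /joint /= row_mxKl row_mxKr.
  by apply: measurableT_comp; [exact: measurable_kernel|apply: measurable_row_mx].
(* The radius is enlarged so that [y] is itself an admissible parameter of the strip estimate. *)
move=> r; have [C _ /(_ y)] := strip_integrable_y (Num.max r `|y|).
rewrite le_max lexx orbT => /(_ isT)[I1 _].
have Ir : Rintegrable (leb n) (fun x => \1_[set x : 'rV[R]_n | `|x| <= Num.max r `|y|] x * G x y).
  have := Rintegrable_row I1; congr (Rintegrable _ _); apply/funext => x.
  by under eq_Rintegral do rewrite row_mxKl; rewrite indicM.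
apply: (Rintegrable_le _ (Rintegrable_abs Ir)).
  apply: measurable_funM; first exact: (Rintegrable_measurable (Rintegrable_indic_ball n r)).
  have -> : (fun x => G x y) = joint G \o (fun x => row_mx x y).
    by apply/funext => x; rewrite /joint /= row_mxKl row_mxKr.
  by apply: measurableT_comp; [exact: measurable_kernel|apply: measurable_row_mx].
move=> x; rewrite !normrM ler_wpM2r // !indicE !ger0_norm // ler_nat.
case: (boolP (x \in _)) => //; rewrite inE /= => xr; rewrite mem_set //=.
by rewrite le_max xr.
Qed.

(** The strip estimate with the integrated point in the base block; that [C] is uniform in [x] is
    what joint integrability rests on. *)
Let kernel_ball_y (r : R) : exists2 C : R, 0 <= C & forall x, `|x| <= r ->
  Rintegrable (leb n) (fun y => \1_[set y : 'rV[R]_n | `|y| <= r] y * G x y) /\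
  \int[leb n]_y `|\1_[set y : 'rV[R]_n | `|y| <= r] y * G x y| <= C.
Proof.
have [C C0 HC] := strip_integrable_x r; exists C => // x xr; have [I1 I2] := HC x xr.
have Er : (fun y => \int[leb p]_xi (\1_[set x | `|x| <= r] (lsubmx (row_mx y xi)) *
     K (mul (inv (row_mx (lsubmx (row_mx y xi)) 0)) (row_mx x (rsubmx (row_mx y xi)))))) =
   (fun y => \1_[set y : 'rV[R]_n | `|y| <= r] y * G x y).
  apply/funext => y; under eq_Rintegral do rewrite !row_mxKl row_mxKr.
  by rewrite indicM.
have Iy : Rintegrable (leb n) (fun y => \1_[set y : 'rV[R]_n | `|y| <= r] y * G x y).
  by rewrite -Er; exact: (Rintegrable_row I1).
split; first exact: Iy.
apply: le_trans I2; have I3 := Rintegrable_abs I1.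
rewrite (Rintegral_row I3).
have Iabs := Rintegrable_row I3.
apply: le_Rintegral => //; first exact: Rintegrable_abs.
move=> y _; have := congr1 (fun f => f y) Er => /= <-.
apply: norm_Rintegral_le_abs.
by apply: (measurableT_comp (Rintegrable_measurable I1)); apply: measurable_row_mx.
Qed.

Lemma kernel_L1loc_y x : L1loc (fun y => G x y).
Proof.
have mG : measurable_fun setT (fun y => G x y).
  have -> : (fun y => G x y) = joint G \o (fun y => row_mx x y).
    by apply/funext => y; rewrite /joint /= row_mxKl row_mxKr.
  by apply: measurableT_comp; [exact: measurable_kernel|apply: measurable_row_mx].
apply: L1loc_of_balls => // r.
have [C _ /(_ x)] := kernel_ball_y (Num.max r `|x|).
rewrite le_max lexx orbT => /(_ isT)[I1 _].
apply: (Rintegrable_le _ (Rintegrable_abs I1)).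
  by apply: measurable_funM => //; exact: (Rintegrable_measurable (Rintegrable_indic_ball n r)).
move=> y; rewrite !normrM ler_wpM2r // !indicE !ger0_norm // ler_nat.
case: (boolP (y \in _)) => //; rewrite inE /= => yr; rewrite mem_set //=.
by rewrite le_max yr.
Qed.

(** Tonelli: the inner integral over a ball in [y] is bounded uniformly for [x] in a ball, by
    [kernel_ball_y]. *)
Lemma kernel_L1loc_joint : L1loc (joint G).
Proof.
apply: L1loc_of_balls; first exact: measurable_kernel.
move=> r0; pose r := `|r0|.
have IB2 := Rintegrable_indic_ball (n + n) r0; have IB := Rintegrable_indic_ball n r.
apply/(@Rintegrable_rowP R n n).
  by apply: measurable_funM; [exact: (Rintegrable_measurable IB2)|exact: measurable_kernel].
have [C C0 HC] := kernel_ball_y r.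
apply: (@le_lt_trans _ _ (\int[leb n]_x (C * \1_[set x : 'rV[R]_n | (`|x| <= r)%R] x)%:E)%E); last first.
  by have /integrableP[_] := RintegrableZ C IB; apply: le_lt_trans; apply: ge0_le_integral => //;
    [by move=> x _; rewrite lee_fin mulr_ge0|
     by apply/measurable_EFinP; exact: (Rintegrable_measurable (RintegrableZ C IB))|
     by apply: measurableT_comp => //; apply/measurable_EFinP; exact: (Rintegrable_measurable (RintegrableZ C IB))|
     by move=> x _; rewrite lee_fin ler_norm].
have mabs : measurable_fun setT (fun v => `|\1_[set z : 'rV[R]_(n + n) | `|z| <= r0] v * joint G v|%:E).
  apply/measurable_EFinP; apply: measurableT_comp => //.
  by apply: measurable_funM; [exact: (Rintegrable_measurable IB2)|exact: measurable_kernel].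
apply: ge0_le_integral => //.
- by move=> x _; exact: integral_ge0.
- exact: (measurable_ge0_integral_row mabs (fun v => normr_ge0 _)).
- by apply/measurable_EFinP; exact: (Rintegrable_measurable (RintegrableZ C IB)).
move=> x _; case: (leP `|x| r) => xr; last first.
  rewrite (_ : (\int[leb n]_y _)%E = 0%E); first by rewrite lee_fin mulr_ge0.
  under eq_integral => y _.
    rewrite indicE memNset; last first.
      move=> /= h; have r00 : 0 <= r0 by exact: le_trans h.
      by move: h xr; rewrite norm_row_mx_le // /r (ger0_norm r00) ltNge => /andP[->].
    rewrite mul0r normr0; over.
  by rewrite integral0.
have [I1 I2] := HC x xr.
rewrite indicE mem_set //= mulr1; apply: le_trans (_ : (C%:E <= C%:E)%E) => //.
have fin := integrable_fin_num measurableT (Rintegrable_abs I1).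
apply: (@le_trans _ _ (\int[leb n]_y `|\1_[set y : 'rV[R]_n | (`|y| <= r)%R] y * G x y|%:E)%E); last first.
  by rewrite -(fineK fin) lee_fin.
apply: ge0_le_integral => //.
- by apply: (measurableT_comp (f := fun v => `|\1_[set z : 'rV[R]_(n + n) | `|z| <= r0] v * joint G v|%:E)) => //; apply: measurable_row_mx.
- by apply/measurable_EFinP; exact: (Rintegrable_measurable (Rintegrable_abs I1)).
move=> y _; rewrite lee_fin /joint row_mxKl row_mxKr !normrM ler_wpM2r // !indicE !ger0_norm // ler_nat.
case: (boolP (row_mx x y \in _)) => //; rewrite inE /= => h.
have r00 : 0 <= r0 by exact: le_trans h.
by rewrite mem_set //=; move: h; rewrite norm_row_mx_le // /r (ger0_norm r00) => /andP[].
Qed.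

End projected_kernel.

(** * Integration of test functions along the fibres *)

Section fiber_projection.
Context {R : realType} (n p : nat).
Local Notation leb k := (@lebesgue_rV R k).

Definition fiber_integral (psi : 'rV[R]_(n + p) -> R) (x : 'rV[R]_n) : R :=
  \int[leb p]_xi psi (row_mx x xi).

Lemma ball_support (K : set 'rV[R]_(n + p)) (psi : 'rV[R]_(n + p) -> R) : compact K -> supported_in K psi ->
  exists2 r : R, 0 < r & forall z, psi z != 0 -> `|lsubmx z| <= r /\ `|rsubmx z| <= r.
Proof.
move=> cK Kp; have [r r0 Kr] := compact_norm_bound cK; exists r => // z pz.
have : `|z| <= r by apply: Kr; apply: contrapT => /Kp h; rewrite h eqxx in pz.
by rewrite -{1}[z]hsubmxK norm_row_mx_le ?(ltW r0) // => /andP[].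
Qed.

Lemma smooth_fiber_integral psi : test_fun setT psi -> test_fun setT (fiber_integral psi).
Proof.
move=> [sp [K [cK _ Kp]]]; have [r r0 Kr] := ball_support cK Kp.
have cclK := compact_closed_rV cK.
split; last first.
  exists [set x | `|x| <= r]; split => //; first exact: compact_closed_ball_rV.
  move=> x nx; rewrite /fiber_integral (_ : (fun xi => _) = (fun=> 0)) /Rintegral ?integral0 //.
  by apply/funext => xi; apply: contrapT => /eqP/Kr[+ _]; rewrite row_mxKl => h; exact: nx.
apply: (smooth_on_Rintegral (F := fun x xi => psi (row_mx x xi)) openT).
- move=> xi; exact: (smooth_comp sp (smooth_map_row_mx (@smooth_map_id R n) (@smooth_map_cst R n p xi))).
- move=> s x _.
  have -> : (fun t => partials s (fun x => psi (row_mx x t)) x) =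
      (fun t => partials [seq lshift p i | i <- s] psi (row_mx x t)).
    by apply/funext => t; rewrite partials_row_mx.
  apply: continuous_measurable_rV => t.
  apply: (@continuous_comp _ _ _ (fun t => row_mx x t) (partials [seq lshift p i | i <- s] psi)).
    by apply: continuous_row_mx; [exact: cst_continuous|].
  exact: (smooth_continuous (smooth_on_partials _ sp)).
move=> s x _; set s' := [seq lshift p i | i <- s].
have sps := smooth_on_partials s' sp.
have Kps : supported_in K (partials s' psi) by exact: partials_supported.
have [M M0 HM] := supported_bound (smooth_continuous sps) cK Kps.
have [r' r'0 Kr'] := ball_support cK Kps.
exists 1, (fun xi => M * \1_[set xi : 'rV[R]_p | `|xi| <= r'] xi); split => //.
  by apply: RintegrableZ; exact: Rintegrable_indic_ball.
move=> y t _; rewrite partials_row_mx -/s'.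
case: (eqVneq (partials s' psi (row_mx y t)) 0) => [->|/Kr'[_]]; first by rewrite normr0 mulr_ge0 // ltW.
by rewrite row_mxKr => tr; rewrite indicE mem_set // mulr1.
Qed.

Lemma test_fun_integrable k (phi : 'rV[R]_k -> R) : test_fun setT phi -> Rintegrable (leb k) phi.
Proof. by move=> [sp [B [cB _ Bp]]]; exact: (smooth_supported_integrable sp cB Bp). Qed.

Lemma unit_test_fun k : exists2 th : 'rV[R]_k -> R, test_fun setT th & \int[leb k]_x th x = 1.
Proof.
have [th [sth th01 th1 ths tth]] := @ball_test_fun R k setT 0 1 ltr01 (fun _ _ => I).
have Ith := test_fun_integrable tth.
have J0 : 0 < \int[leb k]_x th x.
  by apply: (@bump_integral_gt0 _ _ th 0 (1 / 4)) => // x; have /andP[] := th01 x.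
set J := (\int[leb k]_x th x) in J0.
exists (fun x => J^-1 * th x); last by rewrite RintegralZl // mulVf // gt_eqF.
split; first exact: (smooth_onZ J^-1 openT sth).
by have [_ [B [cB _ Bth]]] := tth; exists B; split => //; exact: test_mul.
Qed.

Lemma test_fun_tensor (phi : 'rV[R]_n -> R) (th : 'rV[R]_p -> R) : test_fun setT phi -> test_fun setT th ->
  test_fun setT (fun z : 'rV[R]_(n + p) => phi (lsubmx z) * th (rsubmx z)).
Proof.
move=> [sphi [B [cB _ Bphi]]] [sth [B' [cB' _ Bth]]]; split.
  exact: (smooth_onM openT (smooth_comp sphi (@smooth_map_lsubmx R n p)) (smooth_comp sth (@smooth_map_rsubmx R n p))).
have [r r0 Br] := compact_norm_bound cB; have [r' r'0 Br'] := compact_norm_bound cB'.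
exists [set z | `|z| <= Num.max r r']; split => //; first exact: compact_closed_ball_rV.
move=> z nz; case: (pselect (B (lsubmx z))) => [Bz|/Bphi->]; last by rewrite mul0r.
case: (pselect (B' (rsubmx z))) => [Bz'|/Bth->]; last by rewrite mulr0.
case: nz => /=; rewrite -[z]hsubmxK norm_row_mx_le; last by rewrite le_max (ltW r0).
by rewrite !le_max (Br _ Bz) (Br' _ Bz') orbT.
Qed.

Lemma fiber_integral_tensor (phi : 'rV[R]_n -> R) (th : 'rV[R]_p -> R) : test_fun setT th ->
  \int[leb p]_x th x = 1 -> fiber_integral (fun z => phi (lsubmx z) * th (rsubmx z)) = phi.
Proof.
move=> tth th1; apply/funext => x; rewrite /fiber_integral; under eq_Rintegral do rewrite row_mxKl row_mxKr.
by rewrite RintegralZl ?th1 ?mulr1 //; exact: test_fun_integrable.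
Qed.

Section transpose.
Variables (m : nat) (X : 'I_m -> @vfield R n) (Xt : 'I_m -> @vfield R (n + p)) (w : 'I_m -> nat)
  (nu : nat) (c : seq 'I_m -> R).
Hypothesis sX : forall i, smooth_map (X i).
Hypothesis X0 : forall j i x, partial i (fun y => X j y 0 i) x = 0.
Hypothesis sXt : forall i, smooth_map (Xt i).
Hypothesis Xt0 : forall j i x, partial i (fun y => Xt j y 0 i) x = 0.
Hypothesis proj : forall j z, lsubmx (Xt j z) = X j (lsubmx z).

Lemma L1loc_lsubmx (v : 'rV[R]_n -> R) : L1loc v -> L1loc (fun z : 'rV[R]_(n + p) => v (lsubmx z)).
Proof.
move=> Lv; have [mv _] := Lv.
have mvl : measurable_fun setT (fun z : 'rV[R]_(n + p) => v (lsubmx z)).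
  exact: (measurableT_comp mv (@measurable_lsubmx R n p)).
apply: L1loc_of_balls => // r.
have Iv : Rintegrable (leb n) (fun x => v x * \1_[set x : 'rV[R]_n | `|x| <= `|r|] x).
  have cB := @compact_closed_ball_rV R n `|r|.
  apply: (@L1loc_mul_integrable _ _ _ _ [set x | `|x| <= `|r|] 1 Lv) => //.
  - by apply: measurable_indic; exact: compact_measurable_rV.
  - by move=> x nB; rewrite indicE memNset.
  - by move=> x; rewrite indicE ger0_norm // lern1 leq_b1.
apply: (Rintegrable_le _ (Rintegrable_tensor (Rintegrable_abs Iv) (Rintegrable_indic_ball p `|r|))).
  by apply: measurable_funM => //; exact: (Rintegrable_measurable (Rintegrable_indic_ball (n + p) r)).
move=> z; rewrite [\1_[set z | `|z| <= r] z]indicE; case: (boolP (z \in _)); rewrite ?mul0r ?normr0 ?mulr_ge0 //.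
rewrite inE /= => zr; have r0 : 0 <= r by exact: le_trans zr.
move: zr; rewrite -{1}[z]hsubmxK norm_row_mx_le // => /andP[z1 z2].
rewrite /= -(ger0_norm r0) in z1 z2.
rewrite !indicE (mem_set (z1 : [set x : 'rV[R]_n | `|x| <= `|r|] (lsubmx z))).
by rewrite (mem_set (z2 : [set x : 'rV[R]_p | `|x| <= `|r|] (rsubmx z))) /= !mulr1 mul1r.
Qed.

(** Fubini: integration along the fibres is adjoint to pulling a function back from the base. *)
Lemma base_pairing (v : 'rV[R]_n -> R) psi : L1loc v -> test_fun setT psi ->
  \int[leb (n + p)]_z (v (lsubmx z) * psi z) = \int[leb n]_x (v x * fiber_integral psi x).
Proof.
move=> Lv [sp [K [cK _ Kp]]]; have cp := smooth_continuous sp.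
have [M M0 HM] := supported_bound cp cK Kp.
have I1 : Rintegrable (leb (n + p)) (fun z => v (lsubmx z) * psi z).
  exact: (L1loc_mul_integrable (L1loc_lsubmx Lv) (continuous_measurable_rV cp) cK Kp HM).
rewrite (Rintegral_row I1); apply: eq_Rintegral => x _.
under eq_Rintegral do rewrite row_mxKl.
have [->|fx] := eqVneq (v x) 0.
  by under eq_Rintegral do rewrite mul0r; rewrite /Rintegral integral0 mul0r.
apply: RintegralZl_measurable => //; apply: continuous_measurable_rV => t.
apply: (@continuous_comp _ _ _ (fun t => row_mx x t) psi); last exact: cp.
by apply: continuous_row_mx; [exact: cst_continuous|].
Qed.

Lemma test_fun_hom_op n' m' (Y : 'I_m' -> @vfield R n') w' c' psi : (forall i, smooth_map (Y i)) ->
  test_fun setT psi -> test_fun setT (hom_op Y w' nu c' psi).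
Proof.
move=> sY [sp [K [cK _ Kp]]]; split; first exact: (smooth_hom_op _ sY _ _ sp).
by exists K; split => //; apply: hom_op_supported => //; exact: compact_closed_rV.
Qed.

(* Both sides have the same pairing with every test function on the base, since
   the lifted operator applied to a function of the base variables is [L]. *)
Lemma fiber_integral_hom_op psi x : test_fun setT psi ->
  fiber_integral (hom_op Xt w nu (transpose_coef c) psi) x =
  hom_op X w nu (transpose_coef c) (fiber_integral psi) x.
Proof.
move=> tp; have tP := smooth_fiber_integral tp.
have tL := test_fun_hom_op w (transpose_coef c) sXt tp.
have tPL := smooth_fiber_integral tL; have tLP := test_fun_hom_op w (transpose_coef c) sX tP.
have [sp [K [cK _ Kp]]] := tp; have [sP [K' [cK' _ Kp']]] := tP.
have [sPL _] := tPL; have [sLP _] := tLP.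
apply/eqP; rewrite -subr_eq0; apply/eqP.
have cd : continuous (fun x => fiber_integral (hom_op Xt w nu (transpose_coef c) psi) x -
    hom_op X w nu (transpose_coef c) (fiber_integral psi) x).
  exact: (smooth_continuous (smooth_onB openT sPL sLP)).
apply: (fundamental_lemma openT (fun y _ => cd y) _ (I : setT x)) => f [sf [A [cA _ Af]]].
have sfl := smooth_comp sf (@smooth_map_lsubmx R n p).
have E1 := base_pairing (L1loc_continuous (smooth_continuous sf)) tL.
have E2 := integral_hom_op_parts w nu c sXt Xt0 sfl sp cK Kp.
have E3 := base_pairing (L1loc_continuous (smooth_continuous (smooth_hom_op w sX nu c sf))) tp.
have E4 := integral_hom_op_parts w nu c sX X0 sf sP cK' Kp'.
rewrite (hom_op_lsubmx proj) in E2.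
have I1 : Rintegrable (leb n) (fun x => f x * fiber_integral (hom_op Xt w nu (transpose_coef c) psi) x).
  have := smooth_supported_integrable (smooth_onM openT sPL sf) cA (test_mul _ Af).
  by congr (Rintegrable _ _); apply/funext => y; rewrite mulrC.
have I2 : Rintegrable (leb n) (fun x => f x * hom_op X w nu (transpose_coef c) (fiber_integral psi) x).
  have := smooth_supported_integrable (smooth_onM openT sLP sf) cA (test_mul _ Af).
  by congr (Rintegrable _ _); apply/funext => y; rewrite mulrC.
transitivity (\int[leb n]_x (f x * fiber_integral (hom_op Xt w nu (transpose_coef c) psi) x) -
  \int[leb n]_x (f x * hom_op X w nu (transpose_coef c) (fiber_integral psi) x)); last first.
  by rewrite -E1 -E2 E3 E4 subrr.
by rewrite -RintegralB //; apply: eq_Rintegral => y _; rewrite mulrC mulrBr.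
Qed.

End transpose.

End fiber_projection.

(** * The projected kernel reproduces test functions *)

Section reproducing_property.
Context {R : realType} (n m p : nat) (sigma : 'I_n -> nat) (tau : 'I_p -> nat)
  (mul : 'rV[R]_(n + p) -> 'rV[R]_(n + p) -> 'rV[R]_(n + p)) (inv : 'rV[R]_(n + p) -> 'rV[R]_(n + p))
  (X : 'I_m -> @vfield R n) (Xt : 'I_m -> @vfield R (n + p)) (w : 'I_m -> nat)
  (nu : nat) (c : seq 'I_m -> R).
Hypothesis hg : homogeneous_group (cat_exp sigma tau) mul inv.
Hypothesis gen : forall Z, left_invariant mul Z -> lie_generated Xt Z.
Hypothesis proj : forall j z, lsubmx (Xt j z) = X j (lsubmx z).
Hypothesis sX : forall i, smooth_map (X i).
Hypothesis X0 : forall j i x, partial i (fun y => X j y 0 i) x = 0.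
Hypothesis linv : forall j, left_invariant mul (Xt j).
Hypothesis Xt0 : forall j i x, partial i (fun y => Xt j y 0 i) x = 0.
Local Notation e := (cat_exp sigma tau).
Local Notation leb k := (@lebesgue_rV R k).
Variables (K : 'rV[R]_(n + p) -> R) (d : nat).
Hypothesis sK : smooth_on [set z | z != 0] K.
Hypothesis K0 : K 0 = 0.
Hypothesis homK : forall z : 'rV[R]_(n + p), z != 0 -> K (dilation e 2 z) * 2 ^+ d = K z.
Hypothesis LK : L1loc K.
Hypothesis d_gt : (\sum_i tau i < d)%N.
Hypothesis solK : forall psi, test_fun setT psi ->
  \int[leb (n + p)]_z (K z * hom_op Xt w nu (transpose_coef c) psi z) = - psi 0.
Local Notation G := (projected_kernel mul inv K).
Local Notation Ls := (hom_op X w nu (transpose_coef c)).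
Local Notation Lts := (hom_op Xt w nu (transpose_coef c)).

Let mK : measurable_fun setT K := LK.1.
Let sXt i : smooth_map (Xt i). Proof. by have [] := linv i. Qed.

Let fiber_shift eta z : row_mx (lsubmx z) (rsubmx (mul (row_mx 0 eta) z)) = mul (row_mx 0 eta) z.
Proof. by rewrite -{1}(fiber_invariant hg gen proj eta z) hsubmxK. Qed.

Let measurable_left a : measurable_fun setT (fun z => K (mul a z)).
Proof. by apply: (measurableT_comp mK); have [] := left_translation_preserves hg a. Qed.

Let measurable_fiber a x : measurable_fun setT (fun xi => K (mul a (row_mx x xi))).
Proof. by apply: (measurableT_comp (measurable_left a)); apply: measurable_row_mx. Qed.

(** The fibre over the base point of [z] is parametrised by the action of the elements (0, eta) on
    [z], which preserves the measure of the fibre and the base coordinates. *)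
Let kernel_fiberE y z : G (lsubmx z) y = \int[leb p]_eta K (mul (inv (row_mx y 0)) (mul (row_mx 0 eta) z)).
Proof.
rewrite /projected_kernel -(transports_Rintegral (fiber_translation_preserves hg z) (measurable_fiber _ _)).
by apply: eq_Rintegral => eta _; rewrite fiber_shift.
Qed.

Let twist y (v : 'rV[R]_(n + p + p)) := K (mul (inv (row_mx y 0)) (mul (row_mx 0 (rsubmx v)) (lsubmx v))).

Let measurable_twist y : measurable_fun setT (twist y).
Proof.
apply: (measurableT_comp (measurable_left _)); apply: continuous_map_measurable.
apply: smooth_map_continuous; apply: (smooth_mul hg) (@smooth_map_lsubmx R _ _).
exact: (smooth_map_row_mx (smooth_map_cst _) (@smooth_map_rsubmx R _ _)).
Qed.

(** Integrating in [eta] leaves [|A z|] times [E] at the base point of [z], where [E] is the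
    absolute fibre integral. [A] has compact support and [E] is integrable over balls by the strip
    estimate. This is what allows the integrals in [z] and [eta] to be exchanged. *)
Let twist_integrable y A (B : set 'rV[R]_(n + p)) : continuous A -> compact B -> supported_in B A ->
  Rintegrable (leb (n + p + p)) (fun v => twist y v * A (lsubmx v)).
Proof.
move=> cA cB BA; have [M M0 HM] := supported_bound cA cB BA.
have [r0 r00 Br] := ball_support cB BA; pose r := Num.max r0 `|y|.
have mA := continuous_measurable_rV cA.
have [C _ /(_ y)] := strip_integrable_y hg sK K0 homK LK d_gt r.
rewrite /r le_max lexx orbT -/r => /(_ isT)[I1 _].
have mF : measurable_fun setT (fun v => twist y v * A (lsubmx v)).
  apply: measurable_funM (measurable_twist y) _.
  exact: (measurableT_comp mA (@measurable_lsubmx R (n + p) p)).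
apply/(@Rintegrable_rowP R (n + p) p) => //.
pose E (x : 'rV[R]_n) := (\int[leb p]_xi `|K (mul (inv (row_mx y 0)) (row_mx x xi))|%:E)%E.
have E0 x : (0 <= E x)%E by apply: integral_ge0 => xi _; rewrite lee_fin.
pose h (z : 'rV[R]_(n + p)) := M * \1_[set x : 'rV[R]_n | `|x| <= r] (lsubmx z) * \1_[set x : 'rV[R]_p | `|x| <= r] (rsubmx z).
have mE : measurable_fun setT E.
  by apply: (measurable_ge0_integral_row (f := fun z => `|K (mul (inv (row_mx y 0)) z)|%:E)) => //;
    apply/measurable_EFinP; apply: measurableT_comp.
have IBp := Rintegrable_indic_ball p r; have IBn := RintegrableZ M (Rintegrable_indic_ball n r).
have Ih : Rintegrable (leb (n + p)) h by exact: Rintegrable_tensor IBn IBp.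
have h0 z : 0 <= h z by rewrite /h !mulr_ge0 // ltW.
have EE z : (\int[leb p]_eta `|twist y (row_mx z eta) * A (lsubmx (row_mx z eta))|%:E =
    `|A z|%:E * E (lsubmx z))%E.
  under eq_integral do rewrite row_mxKl normrM mulrC EFinM.
  rewrite ge0_integralZl //; last first.
    apply/measurable_EFinP; apply: measurableT_comp => //.
    by apply: (measurableT_comp (measurable_twist y)); apply: measurable_row_mx.
  congr (_ * _)%E; rewrite /E.
  have mm : measurable_fun setT (fun xi => `|K (mul (inv (row_mx y 0)) (row_mx (lsubmx z) xi))|%:E).
    by apply/measurable_EFinP; apply: measurableT_comp.
  rewrite -(transports_ge0_integral (fiber_translation_preserves hg z) mm) //.
  by apply: eq_integral => eta _; rewrite fiber_shift /twist row_mxKl row_mxKr.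
under eq_integral do rewrite EE.
have mEl : measurable_fun setT (fun z : 'rV[R]_(n + p) => E (lsubmx z)).
  exact: (measurableT_comp mE (@measurable_lsubmx R n p)).
apply: (@le_lt_trans _ _ (\int[leb (n + p)]_z ((h z)%:E * E (lsubmx z)))%E).
  apply: ge0_le_integral => //.
  - by move=> z _; rewrite mule_ge0.
  - by apply: emeasurable_funM => //; apply/measurable_EFinP; apply: measurableT_comp.
  - by apply: emeasurable_funM => //; apply/measurable_EFinP; exact: Rintegrable_measurable Ih.
  move=> z _; rewrite lee_pmul //; rewrite lee_fin.
  case: (eqVneq (A z) 0) => [->|/Br[z1 z2]]; first by rewrite normr0.
  rewrite /h !indicE (mem_set (_ : [set x : 'rV[R]_n | `|x| <= r] (lsubmx z))); last by rewrite /= le_max z1.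
  by rewrite (mem_set (_ : [set x : 'rV[R]_p | `|x| <= r] (rsubmx z))) ?mulr1 //= le_max z2.
rewrite (@ge0_integral_row R n p) //; last 2 first.
- by apply: emeasurable_funM => //; apply/measurable_EFinP; exact: Rintegrable_measurable Ih.
- by move=> z; rewrite mule_ge0 // lee_fin.
under eq_integral => x _.
  under eq_integral do rewrite /h row_mxKl row_mxKr EFinM muleAC.
  rewrite ge0_integralZl //; last 2 first.
  - by apply/measurable_EFinP; exact: Rintegrable_measurable IBp.
  - by rewrite mule_ge0 // lee_fin mulr_ge0 // ltW.
  over.
rewrite ge0_integralZr //=; last 3 first.
- by apply: emeasurable_funM => //; apply/measurable_EFinP; exact: Rintegrable_measurable IBn.
- by move=> x _; rewrite mule_ge0 // lee_fin mulr_ge0 // ltW.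
- by apply: integral_ge0 => x _; rewrite lee_fin.
have fB : (\int[leb p]_x (\1_[set x : 'rV[R]_p | (`|x| <= r)%R] x)%:E)%E \is a fin_num.
  exact: integrable_fin_num IBp.
apply: lte_mul_pinfty => //.
- by apply: integral_ge0 => x _; rewrite mule_ge0 // lee_fin mulr_ge0 // ltW.
- rewrite ge0_fin_numE; last by apply: integral_ge0 => x _; rewrite mule_ge0 // lee_fin mulr_ge0 // ltW.
  have /(@Rintegrable_rowP R n p _ (Rintegrable_measurable I1)) := I1.
  have M0' : (0 <= M%:E)%E by rewrite lee_fin ltW.
  move=> fI; apply: (@le_lt_trans _ _ (M%:E * \int[leb n]_x \int[leb p]_xi `|\1_[set x | (`|x| <= r)%R] (lsubmx (row_mx x xi)) *
          K (mul (inv (row_mx y 0)) (row_mx x xi))|%:E)%E); last first.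
    by apply: lte_mul_pinfty.
  rewrite -ge0_integralZl //; last 2 first.
  - apply: (measurable_ge0_integral_row (f := fun v => `|\1_[set x | (`|x| <= r)%R] (lsubmx v) *
          K (mul (inv (row_mx y 0)) v)|%:E)) => //.
    by apply/measurable_EFinP; apply: measurableT_comp => //; exact: Rintegrable_measurable I1.
  - by move=> x _; apply: integral_ge0 => xi _; rewrite lee_fin.
  rewrite le_eqVlt; apply/orP; left; apply/eqP; apply: eq_integral => x _.
  rewrite EFinM -muleA; congr (_ * _)%E; rewrite /E -ge0_integralZl //; last first.
    by apply/measurable_EFinP; apply: measurableT_comp.
  by apply: eq_integral => xi _; rewrite row_mxKl -EFinM normrM [`|\1_[set x | `|x| <= r] x|]ger0_norm.
by rewrite -(fineK fB) ltry.
Qed.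

Lemma test_fun_left_translation a psi : test_fun setT psi -> test_fun setT (psi \o mul a).
Proof.
move=> [sp [B [cB _ Bp]]].
have sm b : smooth_map (mul b) by exact: (smooth_mul hg (@smooth_map_cst R _ _ b) (@smooth_map_id R _)).
split; first exact: (smooth_comp sp (sm a)).
exists (mul (inv a) @` B); split => //.
  apply: continuous_compact cB; apply: continuous_subspaceT => z.
  exact: (smooth_map_continuous (sm (inv a))).
move=> z nz /=; apply: Bp => Bz; apply: nz; exists (mul a z) => //; exact: (group_mulVK hg).
Qed.

(** The translation is moved from [K] to [psi] by invariance of the measure and left invariance of
    the fields; then [solK] evaluates the translated function at the origin. *)
Let left_pairing b psi : test_fun setT psi ->
  \int[leb (n + p)]_z (K (mul b z) * Lts psi z) = - psi (inv b).
Proof.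
move=> tp; have [sp _] := tp.
have tq := test_fun_left_translation (inv b) tp.
have := solK tq; rewrite /= (hg_mulx0 hg) => <-.
have mL : measurable_fun setT (fun z => K z * Lts (psi \o mul (inv b)) z).
  apply: measurable_funM mK _; apply: continuous_measurable_rV.
  by have [sL _] := test_fun_hom_op nu w (transpose_coef c) sXt tq; exact: (smooth_continuous sL).
rewrite -(transports_Rintegral (left_translation_preserves hg b) mL); apply: eq_Rintegral => z _.
by rewrite (hom_op_left_translation w linv nu _ (inv b) _ sp) (group_mulVK hg).
Qed.

(* A test function [phi] on the base is tested upstairs as [phi (x) * theta (xi)] with
   [theta] of integral one; the fibre integral defining the kernel is unfolded by the
   left action of the elements [(0, eta)], which leaves the base coordinates alone. *)
Lemma kernel_reproducing : fs_reproducing Ls G.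
Proof.
move=> phi tphi y; have [th tth th1] := @unit_test_fun R p; have Ith := test_fun_integrable tth.
pose psi (z : 'rV[R]_(n + p)) := phi (lsubmx z) * th (rsubmx z).
have tpsi : test_fun setT psi := test_fun_tensor tphi tth.
have Epsi : fiber_integral psi = phi := fiber_integral_tensor phi tth th1.
have tA := test_fun_hom_op nu w (transpose_coef c) sXt tpsi; have [sA [BA [cBA _ BAA]]] := tA.
have EA := fiber_integral_hom_op w nu c sX X0 sXt Xt0 proj; rewrite /= in EA.
transitivity (\int[leb n]_x (G x y * fiber_integral (Lts psi) x)).
  by apply: eq_Rintegral => x _; rewrite EA // Epsi.
rewrite -(base_pairing (kernel_L1loc_x hg sK K0 homK LK d_gt y) tA).
have IF := twist_integrable y (smooth_continuous sA) cBA BAA.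
transitivity (\int[leb (n + p + p)]_v (twist y v * Lts psi (lsubmx v))).
  rewrite (Rintegral_row IF); apply: eq_Rintegral => z _.
  under [RHS]eq_Rintegral do rewrite row_mxKl mulrC.
  have [->|A0] := eqVneq (Lts psi z) 0.
    by under eq_Rintegral do rewrite mul0r; rewrite /Rintegral integral0 mulr0.
  rewrite RintegralZl_measurable //; last first.
    by apply: (measurableT_comp (measurable_twist y)); apply: measurable_row_mx.
  by rewrite mulrC kernel_fiberE; congr (_ * _); apply: eq_Rintegral => eta _; rewrite /twist row_mxKl row_mxKr.
rewrite (Rintegral_row_swap IF).
(* For fixed [eta] this is [left_pairing] at y^-1 (0, eta), whose inverse (0, eta)^-1 (y, 0) has
   base part [y]. The remaining fibre integral of [th] equals 1 by [fiber_inverse_preserves]. *)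
transitivity (\int[leb p]_eta (- phi y * th (rsubmx (mul (inv (row_mx 0 eta)) (row_mx y 0))))).
  apply: eq_Rintegral => eta _; rewrite /twist; under eq_Rintegral do rewrite row_mxKl row_mxKr (hg_mulA hg).
  rewrite left_pairing // (group_invM hg) (group_invK hg) /psi mulNr; congr (- (phi _ * _)).
  by rewrite -(fiber_invariant hg gen proj eta) (group_mulKV hg) row_mxKl.
have mth : measurable_fun setT (fun x => - phi y * th x).
  by exact: (Rintegrable_measurable (RintegrableZ _ Ith)).
by rewrite (transports_Rintegral (fiber_inverse_preserves hg y) mth) RintegralZl // th1 mulr1.
Qed.

End reproducing_property.
(** * Regularity, uniqueness and transposition on the base *)

Section local_integrability_complements.
Context {R : realType}.
Local Notation leb k := (@lebesgue_rV R k).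

Lemma L1loc_ball n (v : 'rV[R]_n -> R) (r : R) : L1loc v ->
  Rintegrable (leb n) (fun x => \1_[set x : 'rV[R]_n | `|x| <= r] x * v x).
Proof.
move=> Lv; have cB := @compact_closed_ball_rV R n r.
under eq_fun do rewrite mulrC.
apply: (@L1loc_mul_integrable _ _ _ _ [set x | `|x| <= r] 1 Lv) => //.
- by apply: measurable_indic; exact: compact_measurable_rV.
- by move=> x nB; rewrite indicE memNset.
- by move=> x; rewrite indicE ger0_norm // lern1 leq_b1.
Qed.

Lemma L1loc_add n (a : R) (u v : 'rV[R]_n -> R) : L1loc u -> L1loc v -> L1loc (fun x => u x + a * v x).
Proof.
move=> Lu Lv; have [mu _] := Lu; have [mv _] := Lv; apply: L1loc_of_balls.
  by apply: measurable_funD => //; exact: measurable_funM.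
move=> r; have := RintegrableD (L1loc_ball r Lu) (RintegrableZ a (L1loc_ball r Lv)).
by congr (Rintegrable _ _); apply/funext => x; rewrite mulrDr mulrCA.
Qed.

Lemma L1loc_test n (v phi : 'rV[R]_n -> R) : L1loc v -> test_fun setT phi ->
  Rintegrable (leb n) (fun x => v x * phi x).
Proof.
move=> Lv [sp [B [cB _ Bp]]]; have cp := smooth_continuous sp.
have [M M0 HM] := supported_bound cp cB Bp.
exact: (L1loc_mul_integrable Lv (continuous_measurable_rV cp) cB Bp HM).
Qed.

Lemma Rintegral_pairing_add n (a : R) (u v phi : 'rV[R]_n -> R) : L1loc u -> L1loc v -> test_fun setT phi ->
  \int[leb n]_x ((u x + a * v x) * phi x) = \int[leb n]_x (u x * phi x) + a * \int[leb n]_x (v x * phi x).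
Proof.
move=> Lu Lv tp; have Iu := L1loc_test Lu tp; have Iv := L1loc_test Lv tp.
rewrite -RintegralZl // -RintegralD //; last exact: RintegrableZ.
by apply: eq_Rintegral => x _; rewrite mulrDl mulrA.
Qed.

Lemma test_fun_sub n (V W : set 'rV[R]_n) phi : V `<=` W -> test_fun V phi -> test_fun W phi.
Proof. by move=> VW [sp [B [cB BV Bp]]]; split => //; exists B; split => // x /BV /VW. Qed.

End local_integrability_complements.

(** * Weak solutions on the base: regularity and Liouville theorem *)

Section base_operator.
Context {R : realType} (n m p : nat) (sigma : 'I_n -> nat) (tau : 'I_p -> nat)
  (X : 'I_m -> @vfield R n) (Xt : 'I_m -> @vfield R (n + p)) (w : 'I_m -> nat)
  (nu : nat) (c : seq 'I_m -> R) (i0 : 'I_n).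
Local Notation e := (cat_exp sigma tau).
Local Notation leb k := (@lebesgue_rV R k).
Local Notation L := (hom_op X w nu c).
Local Notation Ls := (hom_op X w nu (transpose_coef c)).
Hypothesis e_gt0 : forall i, (0 < e i)%N.
Hypothesis sX : forall i, smooth_map (X i).
Hypothesis X0 : forall j i x, partial i (fun y => X j y 0 i) x = 0.
Hypothesis sXt : forall i, smooth_map (Xt i).
Hypothesis Xt0 : forall j i x, partial i (fun y => Xt j y 0 i) x = 0.
Hypothesis hXt : forall j, vf_homogeneous e (Xt j) (w j).
Hypothesis proj : forall j z, lsubmx (Xt j z) = X j (lsubmx z).
Hypothesis hypo : hypoelliptic Xt w nu c.

(* [v], viewed as a distribution on the lifted space, is smooth there, and it is
   invariant under translations along the fibres. *)
Lemma weak_regularity (v g : 'rV[R]_n -> R) : L1loc v -> smooth g ->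
  (forall psi, test_fun setT psi -> \int[leb n]_x (v x * Ls psi x) = \int[leb n]_x (g x * psi x)) ->
  exists vs, [/\ smooth vs, forall psi, test_fun setT psi ->
    \int[leb n]_x (v x * psi x) = \int[leb n]_x (vs x * psi x) & forall x, L vs x = g x].
Proof.
move=> Lv sg Hv; pose V (z : 'rV[R]_(n + p)) := v (lsubmx z).
have LV : L1loc V by exact: L1loc_lsubmx.
have sgl : smooth (fun z : 'rV[R]_(n + p) => g (lsubmx z)) by exact: (smooth_comp sg (@smooth_map_lsubmx R n p)).
have Lg := L1loc_continuous (smooth_continuous sg).
have EA := fiber_integral_hom_op w nu c sX X0 sXt Xt0 proj; rewrite /= in EA.
have [F sF HF] : dist_smooth_on setT (fun psi => \int[leb (n + p)]_z (V z * psi z)).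
  apply: (hypo openT openT (fun _ _ => I) (L1loc_distribution setT LV)).
  exists (fun z => g (lsubmx z)) => // psi tp; rewrite /dist_hom_op /V.
  have tA := test_fun_hom_op nu w (transpose_coef c) sXt tp.
  rewrite (base_pairing Lv tA) (base_pairing Lg tp) -Hv; last exact: smooth_fiber_integral.
  by apply: eq_Rintegral => x _; rewrite EA.
have cF := smooth_continuous sF.
have inv_F h z : F (z + row_mx 0 h) = F z.
  have sT (b : 'rV[R]_(n + p)) : smooth_map (fun z => z + b).
    by move=> j; under eq_fun do rewrite mxE; exact: (smooth_onD openT (smooth_on_coord j openT) (smooth_on_cst (b 0 j) openT)).
  have sFh := smooth_comp sF (sT (row_mx 0 h)); have cFh := smooth_continuous sFh.
  apply/eqP; rewrite -subr_eq0; apply/eqP.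
  apply: (fundamental_lemma openT (fun y _ => smooth_continuous (smooth_onB openT sFh sF) (x := y)) _ (I : setT z)) => psi tp.
  have [sp [B [cB _ Bp]]] := tp.
  pose psih z := psi (z + row_mx 0 (- h)).
  have tph : test_fun setT psih.
    split; first exact: (smooth_comp sp (sT (row_mx 0 (- h)))).
    exists ((fun z => z + row_mx 0 h) @` B); split => //.
      by apply: continuous_compact cB; apply: continuous_subspaceT; exact: (smooth_map_continuous (sT _)).
    move=> x nx; apply: Bp => Bx; apply: nx; exists (x + row_mx 0 (- h)) => //.
    by rewrite -addrA add_row_mx addr0 addNr row_mx0 addr0.
  have LF := L1loc_continuous cF; have LFh := L1loc_continuous cFh.
  have -> : \int[leb (n + p)]_x ((F (x + row_mx 0 h) - F x) * psi x) =
      \int[leb (n + p)]_x (F (x + row_mx 0 h) * psi x) - \int[leb (n + p)]_x (F x * psi x).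
    have := Rintegral_pairing_add (-1) LFh LF tp; rewrite mulN1r => <-.
    by apply: eq_Rintegral => x _; rewrite mulN1r.
  have tr (f : 'rV[R]_(n + p) -> R) : L1loc f -> \int[leb (n + p)]_x (f (x + row_mx 0 h) * psi x) = \int[leb (n + p)]_x (f x * psih x).
    move=> Lf; rewrite -(transports_Rintegral (preserves_translation (row_mx 0 h)) (Rintegrable_measurable (L1loc_test Lf tph))).
    by apply: eq_Rintegral => x _; rewrite /psih -[_ + _ + _]addrA add_row_mx addr0 addrN row_mx0 addr0.
  rewrite (tr F LF) -HF // -HF // -(tr V LV) /V.
  apply/eqP; rewrite subr_eq0; apply/eqP; apply: eq_Rintegral => x _.
  rewrite [in LHS](_ : lsubmx (x + row_mx 0 h) = lsubmx x) //.
  by rewrite raddfD /= row_mxKl addr0.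
pose vs x := F (row_mx x 0).
have EF z : F z = vs (lsubmx z).
  by rewrite /vs -(inv_F (rsubmx z) (row_mx _ 0)) add_row_mx addr0 add0r hsubmxK.
have svs : smooth vs by exact: (smooth_comp sF (smooth_map_row_mx (@smooth_map_id R n) (smooth_map_cst _))).
have Lvs := L1loc_continuous (smooth_continuous svs).
have Evs psi : test_fun setT psi -> \int[leb n]_x (v x * psi x) = \int[leb n]_x (vs x * psi x).
  move=> tp; have [th tth th1] := @unit_test_fun R p.
  have tt := test_fun_tensor tp tth.
  have := HF _ tt; rewrite /V (base_pairing Lv tt) (fiber_integral_tensor psi tth th1) => ->.
  under eq_Rintegral do rewrite EF.
  by rewrite (base_pairing Lvs tt) (fiber_integral_tensor psi tth th1).
exists vs; split => // x; apply/eqP; rewrite -subr_eq0; apply/eqP.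
have sL := smooth_hom_op w sX nu c svs.
apply: (fundamental_lemma openT (fun y _ => smooth_continuous (smooth_onB openT sL sg) (x := y)) _ (I : setT x)) => psi tp.
have LL := L1loc_continuous (smooth_continuous sL).
have [sp [B [cB _ Bp]]] := tp.
have := Rintegral_pairing_add (-1) LL Lg tp.
rewrite (integral_hom_op_parts w nu c sX X0 svs sp cB Bp) -Evs; last exact: test_fun_hom_op.
rewrite Hv // mulN1r subrr => <-.
by apply: eq_Rintegral => y _; rewrite mulN1r.
Qed.

(** The smooth representative inherits the decay of [v] through the fundamental lemma outside a
    ball, so it is bounded. Its pull-back to the group is then constant by [liouville], and decay
    makes the constant 0. *)
Lemma weak_liouville (v : 'rV[R]_n -> R) : L1loc v ->
  (forall eps : R, 0 < eps -> exists M : R, forall x, M < `|x| -> `|v x| < eps) ->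
  (forall psi, test_fun setT psi -> \int[leb n]_x (v x * Ls psi x) = 0) ->
  forall phi, test_fun setT phi -> \int[leb n]_x (v x * phi x) = 0.
Proof.
move=> Lv v0 Hv.
have [vs [svs Evs Lvs]] : exists vs, [/\ smooth vs, forall psi, test_fun setT psi ->
    \int[leb n]_x (v x * psi x) = \int[leb n]_x (vs x * psi x) & forall x, L vs x = 0].
  apply: weak_regularity => //; first exact: (smooth_on_cst 0 openT).
  by move=> psi tp; rewrite Hv //; under [RHS]eq_Rintegral do rewrite mul0r; rewrite /Rintegral integral0.
have cvs := smooth_continuous svs.
have vs0 (eps : R) : 0 < eps -> exists M : R, forall x, M < `|x| -> `|vs x| <= eps.
  move=> eps0; have [M HM] := v0 _ eps0; exists M.
  have oW : open [set x : 'rV[R]_n | M < `|x|].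
    rewrite (_ : [set x | _] = ~` [set x : 'rV[R]_n | `|x| <= M]); last first.
      by apply/seteqP; split => x /=; rewrite ltNge => /negP.
    by apply: closed_openC; apply: compact_closed_rV; exact: compact_closed_ball_rV.
  apply: (fundamental_lemma_norm_le oW (fun x _ => cvs x)) => phi tp p0.
  have tp' := test_fun_sub (@subsetT _ _) tp; have Ip := test_fun_integrable tp'.
  rewrite -Evs // -RintegralZl //; apply: norm_Rintegral_le => //.
  - exact: (Rintegrable_measurable (L1loc_test Lv tp')).
  - exact: RintegrableZ.
  move=> x; rewrite normrM (ger0_norm (p0 x)).
  have [_ [B [_ BW Bp]]] := tp; case: (pselect (B x)) => [/BW/HM/ltW h|/Bp ->]; last by rewrite !mulr0.
  by rewrite ler_wpM2r.
have cst x y : vs x = vs y.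
  have [M1 HM1] := vs0 1 ltr01.
  have [M2 M20 HM2] := compact_continuous_bound (@compact_closed_ball_rV R n M1) (fun x _ => cvs x).
  have svl := smooth_comp svs (@smooth_map_lsubmx R n p).
  have bd z : `|vs (@lsubmx R 1 n p z)| <= Num.max 1 M2.
    rewrite le_max; case: (leP `|@lsubmx R 1 n p z| M1) => h; first by rewrite HM2 ?orbT.
    by rewrite HM1.
  have L0 z : hom_op Xt w nu c (fun z : 'rV[R]_(n + p) => vs (lsubmx z)) z = 0.
    by rewrite (hom_op_lsubmx proj) Lvs.
  by have := liouville e_gt0 sXt Xt0 hXt hypo svl bd L0 (row_mx x 0) (row_mx y 0); rewrite !row_mxKl.
have z x : vs x = 0.
  apply/normr0_eq0/eqP; rewrite eq_le normr_ge0 andbT; apply/ler_addgt0Pl => eps eps0; rewrite addr0.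
  have [M HM] := vs0 _ eps0.
  (* A point of norm greater than [M]; the index [i0] guarantees that there is a coordinate. *)
  rewrite (cst x (const_mx (`|M| + 1))); apply: HM.
  have := coord_le_norm (const_mx (`|M| + 1) : 'rV[R]_n) i0; rewrite mxE.
  apply: lt_le_trans; rewrite [ltRHS]ger0_norm ?addr_ge0 //.
  by rewrite (le_lt_trans (ler_norm M)) // ltrDl.
move=> phi tp; rewrite Evs //; under eq_Rintegral do rewrite z mul0r.
by rewrite /Rintegral integral0.
Qed.

End base_operator.

(** * Kernels, their potentials and exchange of variables *)

Section kernels.
Context {R : realType}.
Local Notation leb k := (@lebesgue_rV R k).

Lemma transports_swap n k : transports (leb (n + k)) (leb (k + n)) (fun z => row_mx (rsubmx z) (lsubmx z)).
Proof.
have mF : measurable_fun setT (fun z : 'rV[R]_(n + k) => row_mx (rsubmx z) (lsubmx z)).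
  by apply: measurable_row_mx; [exact: measurable_rsubmx|exact: measurable_lsubmx].
split => // A mA; rewrite -[LHS]/(push_measure (leb (n + k)) mF A).
apply: lebesgue_rV_unique => // B mB; rewrite /= /pushforward.
pose B' (i : 'I_(n + k)) := match fintype.split i with inl j => B (rshift k j) | inr j => B (lshift n j) end.
have Bl j : B' (lshift k j) = B (rshift k j) by rewrite /B' (unsplitK (inl j)).
have Br j : B' (rshift n j) = B (lshift n j) by rewrite /B' (unsplitK (inr j)).
have mB' i : measurable (B' i) by rewrite /B'; case: fintype.split.
rewrite (_ : _ @^-1` _ = [set z : 'rV[R]_(n + k) | forall i, B' i (z 0 i)]); last first.
  apply/seteqP; split => z /= H j; case: (split_ordP j) => l ->.
  - by rewrite Bl; have := H (rshift k l); rewrite row_mxEr mxE.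
  - by rewrite Br; have := H (lshift n l); rewrite row_mxEl mxE.
  - by rewrite row_mxEl mxE -Br.
  - by rewrite row_mxEr mxE -Bl.
have E1 := lebesgue_rV_box mB'; rewrite [LHS]E1 [LHS]big_split_ord [RHS]big_split_ord /= muleC.
by congr (_ * _)%E; apply: eq_bigr => i _; rewrite ?Bl ?Br.
Qed.

Variable n : nat.
Implicit Type G : 'rV[R]_n -> 'rV[R]_n -> R.

Lemma L1loc_joint_swap G : L1loc (joint G) -> L1loc (joint (fun x y => G y x)).
Proof.
move=> LG; have sw := transports_swap n n.
have E z : joint (fun x y => G y x) z = joint G (row_mx (rsubmx z) (lsubmx z)) by rewrite /joint row_mxKl row_mxKr.
apply: L1loc_of_balls.
  by rewrite (funext E); apply: (measurableT_comp LG.1); have [] := sw.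
move=> r; have LGr := L1loc_ball `|r| LG.
have := (transports_integrable sw (Rintegrable_measurable LGr)).1 LGr.
move=> Is; apply: (Rintegrable_le _ (Rintegrable_abs Is)).
  apply: measurable_funM; first exact: (Rintegrable_measurable (Rintegrable_indic_ball (n + n) r)).
  by rewrite (funext E); apply: (measurableT_comp LG.1); have [] := sw.
move=> z; rewrite E /comp !normrM ler_wpM2r // !indicE !normr_nat ler_nat.
case: (boolP (z \in _)) => //; rewrite inE /= => zr; rewrite mem_set //=.
move: zr; rewrite -{1}[z]hsubmxK => zr; have r0 : 0 <= r by exact: le_trans zr.
by move: zr; rewrite !norm_row_mx_le // ger0_norm // andbC.
Qed.

Lemma kernel_tensor_integrable G (phi psi : 'rV[R]_n -> R) : L1loc (joint G) ->
  test_fun setT phi -> test_fun setT psi ->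
  Rintegrable (leb (n + n)) (fun z => joint G z * (phi (lsubmx z) * psi (rsubmx z))).
Proof. by move=> LG tp tq; exact: (L1loc_test LG (test_fun_tensor tp tq)). Qed.

Let potentialE G (phi psi : 'rV[R]_n -> R) x : L1loc (fun y => G x y) -> test_fun setT psi ->
  \int[leb n]_y (joint G (row_mx x y) * (phi (lsubmx (row_mx x y)) * psi (rsubmx (row_mx x y)))) =
  (\int[leb n]_y (G x y * psi y)) * phi x.
Proof.
move=> LG tq; rewrite mulrC -RintegralZl //; last exact: L1loc_test.
by apply: eq_Rintegral => y _; rewrite /joint row_mxKl row_mxKr mulrCA.
Qed.

Lemma potential_L1loc G psi : (forall x, L1loc (fun y => G x y)) -> L1loc (joint G) -> test_fun setT psi ->
  L1loc (fun x => \int[leb n]_y (G x y * psi y)).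
Proof.
move=> LGy LG tq; have [sq _] := tq.
have mu : measurable_fun setT (fun x => \int[leb n]_y (G x y * psi y)).
  have -> : (fun x => \int[leb n]_y (G x y * psi y)) =
      (fun x => \int[leb n]_y (joint G (row_mx x y) * psi (rsubmx (row_mx x y)))).
    by apply/funext => x; apply: eq_Rintegral => y _; rewrite /joint row_mxKl row_mxKr.
  apply: (@measurable_Rintegral_row R n n (fun z => joint G z * psi (rsubmx z))).
  apply: measurable_funM LG.1 _.
  exact: (measurableT_comp (continuous_measurable_rV (smooth_continuous sq)) (@measurable_rsubmx R n n)).
apply: L1loc_of_balls => // r.
(* [ball_test_fun] equals 1 on a quarter of the radius, so this [phi] is 1 on the ball of radius
   [r], and the potential coincides there with an integrable function. *)
have r0 : 0 < 4 * (`|r| + 1) by rewrite mulr_gt0 // ltr_wpDl.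
have [phi [_ _ phi1 _ tp]] := @ball_test_fun R n setT 0 _ r0 (fun _ _ => I).
apply: (Rintegrable_le _ (Rintegrable_abs (Rintegrable_row (kernel_tensor_integrable LG tp tq)))).
  by apply: measurable_funM => //; exact: (Rintegrable_measurable (Rintegrable_indic_ball n r)).
move=> x; rewrite potentialE // indicE; case: (boolP (x \in _)); last by rewrite mul0r normr0.
rewrite inE /= => xr; rewrite phi1 ?mulr1 ?mul1r // subr0.
apply: le_trans xr _; have := ler_norm r; set a := `|r|; lra.
Qed.

Lemma kernel_fubini G phi psi : fs_integrable G -> test_fun setT phi -> test_fun setT psi ->
  \int[leb n]_x ((\int[leb n]_y (G x y * psi y)) * phi x) =
  \int[leb n]_y ((\int[leb n]_x (G x y * phi x)) * psi y).
Proof.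
move=> [LGx LGy LG] tp tq; have I1 := kernel_tensor_integrable LG tp tq.
transitivity (\int[leb (n + n)]_z (joint G z * (phi (lsubmx z) * psi (rsubmx z)))).
  by rewrite (Rintegral_row I1); apply: eq_Rintegral => x _; rewrite potentialE.
rewrite (Rintegral_row_swap I1); apply: eq_Rintegral => y _.
rewrite mulrC -RintegralZl //; last exact: L1loc_test.
by apply: eq_Rintegral => x _; rewrite /joint row_mxKl row_mxKr mulrA [RHS]mulrC.
Qed.

(* Uniform in [y] on bounded sets, and symmetric under exchange of the variables,
   unlike [vanishing_at_infinity]. *)
Definition kernel_decays G := forall r eps : R, 0 < eps ->
  exists M : R, forall x y, `|y| <= r -> M < `|x| -> `|G x y| < eps /\ `|G y x| < eps.

Lemma kernel_decays_vanishing G : kernel_decays G -> vanishing_at_infinity G.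
Proof.
move=> dG y eps eps0; have [M HM] := dG `|y| eps eps0; exists M => x xM.
by have [] := HM x y (lexx _) xM.
Qed.

Lemma potential_decays G psi : kernel_decays G -> (forall x, measurable_fun setT (fun y => G x y)) -> test_fun setT psi ->
  forall eps : R, 0 < eps -> exists M : R, forall x, M < `|x| -> `|\int[leb n]_y (G x y * psi y)| < eps.
Proof.
move=> dG mG tq eps eps0; have [sq [B [cB _ Bq]]] := tq; have [r r0 Br] := compact_norm_bound cB.
have Iq := Rintegrable_abs (test_fun_integrable tq).
set J := \int[leb n]_y `|psi y|.
have J0 : 0 <= J by apply: Rintegral_ge0 => y _; exact: normr_ge0.
have J1 : 0 < J + 1 by rewrite ltr_wpDl.
have [M HM] := dG r (eps / (J + 1)) (divr_gt0 eps0 J1); exists M => x xM.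
apply: (@le_lt_trans _ _ (eps / (J + 1) * J)).
  rewrite /J -RintegralZl //; apply: norm_Rintegral_le.
  - by apply: measurable_funM => //; exact: continuous_measurable_rV (smooth_continuous sq).
  - exact: RintegrableZ.
  move=> y; rewrite normrM; case: (pselect (B y)) => [/Br yr|/Bq ->]; last by rewrite normr0 !mulr0.
  by rewrite ler_wpM2r // ltW //; have [] := HM x y yr xM.
by rewrite -mulrA gtr_pMr // mulrC ltr_pdivrMr // mul1r ltrDl.
Qed.

Lemma compact_row_mx (A B : set 'rV[R]_n) : compact A -> compact B ->
  compact [set z : 'rV[R]_(n + n) | A (lsubmx z) /\ B (rsubmx z)].
Proof.
move=> cA cB; have [a a0 Aa] := compact_norm_bound cA; have [b b0 Bb] := compact_norm_bound cB.
apply: (subclosed_compact _ (@compact_box_rV R n n a b)).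
  apply: (@closedI _ [set z : 'rV[R]_(n + n) | A (lsubmx z)] [set z | B (rsubmx z)]).
    apply: (@closed_comp _ _ (@lsubmx R 1 n n) _ _ (compact_closed_rV cA)) => x _; exact: continuous_lsubmx.
  apply: (@closed_comp _ _ (@rsubmx R 1 n n) _ _ (compact_closed_rV cB)) => x _; exact: continuous_rsubmx.
by move=> z [/Aa ? /Bb ?].
Qed.

(** The fundamental lemma is used twice. For [psi] supported away from [x0] the potential is
    continuous off the support of [psi], as only values off the diagonal enter, so it vanishes at
    [x0]. Varying [psi] then gives [H x0 y = 0] for all [y] other than [x0]. *)
Lemma kernel_eq0_off_diagonal (H : 'rV[R]_n -> 'rV[R]_n -> R) : (forall x, measurable_fun setT (fun y => H x y)) ->
  (forall x y : 'rV[R]_n, x != y -> {for row_mx x y, continuous (joint H)}) ->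
  (forall phi psi, test_fun setT phi -> test_fun setT psi ->
    \int[leb n]_x ((\int[leb n]_y (H x y * psi y)) * phi x) = 0) ->
  forall x y, x != y -> H x y = 0.
Proof.
move=> mH cH H0 x0 y0 xy0.
have jH x y : joint H (row_mx x y) = H x y by rewrite /joint row_mxKl row_mxKr.
have oW' : open [set y : 'rV[R]_n | y != x0].
  rewrite (_ : [set y | _] = ~` [set x0]); last by apply/seteqP; split => y /= /eqP.
  by apply: closed_openC; apply: compact_closed_rV; exact: compact_set1.
apply: (@fundamental_lemma R n _ (H x0) oW' _ _ y0); last by rewrite /= eq_sym.
  move=> y /= yx; apply: (continuous_at_ext (fun y => esym (jH x0 y))).
  apply: (@continuous_comp _ _ _ (fun y => row_mx x0 y) (joint H)); last by apply: cH; rewrite eq_sym.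
  by apply: continuous_row_mx; [exact: cst_continuous|].
move=> psi tq; have [sq [B [cB BW Bq]]] := tq; have cq := smooth_continuous sq.
have mq := continuous_measurable_rV cq.
have oW : open (~` B) by apply: closed_openC; exact: compact_closed_rV.
have tq' := test_fun_sub (@subsetT _ _) tq.
apply: (@fundamental_lemma R n _ (fun x => \int[leb n]_y (H x y * psi y)) oW _ _ x0); last first.
- by move=> /BW /=; rewrite eqxx.
- by move=> phi tp; apply: H0 => //; exact: test_fun_sub tp.
move=> x nBx.
have [r r0 rB] := nbhs_norm_lt (open_nbhs_nbhs (conj oW nBx)).
have cC := compact_row_mx (@compact_ball_at R n x (r / 2)) cB.
have [M M0 HM] : exists2 M : R, 0 < M & forall z, [set z : 'rV[R]_(n + n) | `|lsubmx z - x| <= r / 2 /\ B (rsubmx z)] z -> `|joint H z| <= M.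
  apply: compact_continuous_bound => // z [/= zx Bz]; rewrite -[z]hsubmxK; apply: cH.
  apply/eqP => E; have /rB : `|lsubmx z - x| < r by apply: le_lt_trans zx _; lra.
  by rewrite E.
have [Mq Mq0 HMq] := supported_bound cq cB Bq.
apply: (@continuous_Rintegral _ _ _ _ _ (fun x y => H x y * psi y) x (fun y => M * `|psi y|) (r / 2)).
- by rewrite divr_gt0.
- by move=> t _; apply: measurable_funM.
- move=> y; case: (pselect (B y)) => [By|/Bq q0]; last first.
    by apply: (continuous_at_ext (g := fun=> 0)); [move=> t; rewrite q0 mulr0|exact: continuous_at_cst].
  apply: continuous_atM; last exact: continuous_at_cst.
  apply: (continuous_at_ext (fun x => esym (jH x y))).
  apply: (@continuous_comp _ _ _ (fun x => row_mx x y) (joint H)).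
    by apply: continuous_row_mx; [|exact: cst_continuous].
  by apply: cH; apply/eqP => E; apply: nBx; rewrite E.
- by apply: RintegrableZ; exact: (Rintegrable_abs (test_fun_integrable tq')).
move=> t y tx; rewrite normrM; case: (pselect (B y)) => [By|/Bq ->]; last by rewrite normr0 !mulr0.
by rewrite ler_wpM2r // -jH; apply: HM; rewrite /= row_mxKl row_mxKr (ltW tx).
Qed.

End kernels.

(** * Uniqueness, solvability, homogeneity and transposition *)

Section fundamental_solution_theory.
Context {R : realType} (n m p : nat) (sigma : 'I_n -> nat) (tau : 'I_p -> nat)
  (X : 'I_m -> @vfield R n) (Xt : 'I_m -> @vfield R (n + p)) (w : 'I_m -> nat)
  (nu : nat) (c : seq 'I_m -> R) (i0 : 'I_n).
Local Notation e := (cat_exp sigma tau).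
Local Notation leb k := (@lebesgue_rV R k).
Local Notation L := (hom_op X w nu c).
Local Notation Ls := (hom_op X w nu (transpose_coef c)).
Hypothesis e_gt0 : forall i, (0 < e i)%N.
Hypothesis sX : forall i, smooth_map (X i).
Hypothesis X0 : forall j i x, partial i (fun y => X j y 0 i) x = 0.
Hypothesis hX : forall j, vf_homogeneous sigma (X j) (w j).
Hypothesis sXt : forall i, smooth_map (Xt i).
Hypothesis Xt0 : forall j i x, partial i (fun y => Xt j y 0 i) x = 0.
Hypothesis hXt : forall j, vf_homogeneous e (Xt j) (w j).
Hypothesis proj : forall j z, lsubmx (Xt j z) = X j (lsubmx z).
Hypothesis hypo : hypoelliptic Xt w nu c.
Implicit Types (G g : 'rV[R]_n -> 'rV[R]_n -> R).

Let Wliouville := weak_liouville i0 e_gt0 sX X0 sXt Xt0 hXt proj hypo.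

Section uniqueness.
Variables g1 g2 : 'rV[R]_n -> 'rV[R]_n -> R.
Hypotheses (L1 : forall y, L1loc (fun x => g1 x y)) (L2 : forall y, L1loc (fun x => g2 x y)).
Hypotheses (r1 : fs_reproducing Ls g1) (r2 : fs_reproducing Ls g2).
Hypotheses (v1 : vanishing_at_infinity g1) (v2 : vanishing_at_infinity g2).

(** The contributions of the two kernels against [Ls psi] cancel, so the difference of columns is a
    weak solution vanishing at infinity. *)
Let unique_pairing y phi : test_fun setT phi -> \int[leb n]_x ((g1 x y + (-1) * g2 x y) * phi x) = 0.
Proof.
apply: Wliouville; first exact: L1loc_add.
  move=> eps eps0; have e2 : 0 < eps / 2 by rewrite divr_gt0.
  have [M1 H1] := v1 y e2; have [M2 H2] := v2 y e2.
  exists (Num.max M1 M2) => x; rewrite gt_max => /andP[x1 x2].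
  apply: le_lt_trans (ler_normD _ _) _; rewrite mulN1r normrN.
  by have := ltrD (H1 _ x1) (H2 _ x2); rewrite -splitr.
move=> psi tp; rewrite Rintegral_pairing_add //; last exact: test_fun_hom_op.
by rewrite r1 // r2 // mulN1r opprK addNr.
Qed.

Lemma fs_unique_ae y : {ae leb n, forall x, g1 x y = g2 x y}.
Proof.
have := fundamental_lemma_ae (L1loc_add (-1) (L1 y) (L2 y)) (@unique_pairing y).
by apply: filterS => x /eqP; rewrite mulN1r subr_eq0 => /eqP.
Qed.

Lemma fs_unique_off_diagonal y : (forall x, x != y -> {for x, continuous (fun x => g1 x y)}) ->
  (forall x, x != y -> {for x, continuous (fun x => g2 x y)}) -> forall x, x != y -> g1 x y = g2 x y.
Proof.
move=> c1 c2 x xy.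
have oW : open [set x : 'rV[R]_n | x != y].
  rewrite (_ : [set x | _] = ~` [set y]); last by apply/seteqP; split => z /= /eqP.
  by apply: closed_openC; apply: compact_closed_rV; exact: compact_set1.
have := @fundamental_lemma R n _ (fun x => g1 x y + (-1) * g2 x y) oW _ _ x xy.
move=> H; apply/eqP; rewrite -subr_eq0 -mulN1r; apply/eqP; apply: H.
  move=> z zy; apply: continuous_atD; first exact: c1.
  by apply: continuous_atM; [exact: continuous_at_cst|exact: c2].
by move=> phi tp; apply: unique_pairing; exact: test_fun_sub tp.
Qed.

End uniqueness.

Lemma continuous_column G y : smooth_off_diagonal G ->
  forall x, x != y -> {for x, continuous (fun x => G x y)}.
Proof.
move=> sG x xy; apply: (continuous_at_ext (g := fun x => joint G (row_mx x y))).
  by move=> z; rewrite /joint row_mxKl row_mxKr.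
apply: (@continuous_comp _ _ _ (fun x => row_mx x y) (joint G)).
  by apply: continuous_row_mx; [|exact: cst_continuous].
by apply: (smooth_on_continuous sG); rewrite /= row_mxKl row_mxKr.
Qed.

(** Fubini turns the pairing of the potential with [Ls psi] into the reproducing property integrated
    against [phi]; regularity on the base provides the smooth representative. *)
Lemma reproducing_solving G : fs_integrable G -> fs_reproducing Ls G -> fs_solving L Ls G.
Proof.
move=> iG rG phi tp u; have [LGx LGy LG] := iG; have [sp _] := tp.
have Lu : L1loc u by exact: potential_L1loc.
have Hu psi : test_fun setT psi -> \int[leb n]_x (u x * Ls psi x) = \int[leb n]_x (- phi x * psi x).
  move=> tq; rewrite (kernel_fubini iG (test_fun_hom_op nu w _ sX tq) tp).
  by apply: eq_Rintegral => y _; rewrite rG // !mulNr mulrC.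
split => //.
have [us [sus Eus Lus]] := weak_regularity sX X0 sXt Xt0 proj hypo Lu (smooth_onN openT sp) Hu.
exists us; split => //.
have := fundamental_lemma_ae (L1loc_add (-1) Lu (L1loc_continuous (smooth_continuous sus))) _.
move=> H; have : {ae leb n, forall x, u x + -1 * us x = 0}.
  apply: H => psi tq; rewrite Rintegral_pairing_add //; last exact: L1loc_continuous (smooth_continuous sus).
  by rewrite Eus // mulN1r subrr.
by apply: filterS => x /eqP; rewrite mulN1r subr_eq0 => /eqP.
Qed.

Lemma dilation_bound (l r : R) : exists M : R, forall x : 'rV[R]_n, `|x| <= r -> `|dilation sigma l x| <= M.
Proof.
have [M M0 HM] := @compact_continuous_bound R _ [set x : 'rV[R]_n | `|x| <= r] (fun x => `|dilation sigma l x|)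
  (@compact_closed_ball_rV R n r) (fun x _ => continuous_comp (smooth_map_continuous (smooth_dilation sigma l) (x := x)) (@norm_continuous _ _ _)).
by exists M => x xr; have := HM x xr; rewrite normr_id.
Qed.

Lemma L1loc_dilation (l : R) (f : 'rV[R]_n -> R) : 0 < l -> L1loc f -> L1loc (f \o dilation sigma l).
Proof.
move=> l0 Lf; have mf : measurable_fun setT (f \o dilation sigma l).
  by apply: (measurableT_comp Lf.1); exact: measurable_dilation.
apply: L1loc_of_balls => // r; have [M HM] := dilation_bound l r.
apply: (Rintegrable_le _ (Rintegrable_abs (Rintegrable_dilation sigma l0 (L1loc_ball M Lf)))).
  by apply: measurable_funM => //; exact: (Rintegrable_measurable (Rintegrable_indic_ball n r)).
move=> x; rewrite /comp !normrM ler_wpM2r // !indicE !normr_nat ler_nat.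
by case: (boolP (x \in _)) => //; rewrite inE /= => /HM h; rewrite mem_set.
Qed.

(* By uniqueness, applied to [l^(q - nu) G(delta_l x, delta_l y)]. *)
Lemma fs_homogeneous G : (forall y, L1loc (fun x => G x y)) -> fs_reproducing Ls G -> vanishing_at_infinity G ->
  smooth_off_diagonal G -> (nu <= \sum_i sigma i)%N -> forall (l : R) x y, 0 < l -> x != y ->
  l ^+ (\sum_i sigma i - nu) * G (dilation sigma l x) (dilation sigma l y) = G x y.
Proof.
move=> LG rG vG sG nuq l x y l0 xy; set q := (\sum_i sigma i)%N in nuq *.
have ln0 := lt0r_neq0 l0; have lV0 : 0 < l^-1 by rewrite invr_gt0.
(* The summand 0 gives [g] the shape to which [L1loc_add] applies. *)
pose g (x y : 'rV[R]_n) := 0 + l ^+ (q - nu) * G (dilation sigma l x) (dilation sigma l y).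
have Lg y' : L1loc (fun x => g x y').
  apply: L1loc_add; first exact: (L1loc_continuous (@cst_continuous 'rV[R]_n R 0)).
  exact: (L1loc_dilation l0 (LG (dilation sigma l y'))).
rewrite -[LHS]add0r; apply: (@fs_unique_off_diagonal g G) => //.
- move=> phi tp y'.
  have tpl : test_fun setT (phi \o dilation sigma l^-1) by exact: test_fun_dil.
  have [sp _] := tp.
  have E z : hom_op X w nu (transpose_coef c) (phi \o dilation sigma l^-1) (dilation sigma l z) = l ^- nu * Ls phi z.
    by rewrite (hom_op_dilation sX hX nu _ _ lV0 sp) (dilationK sigma ln0) exprVn.
  have := rG _ tpl (dilation sigma l y'); rewrite /= (dilationK sigma ln0) => <-.
  have LL := L1loc_test (LG (dilation sigma l y')) (test_fun_hom_op nu w (transpose_coef c) sX tpl).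
  rewrite (Rintegral_dilation sigma l0 (Rintegrable_measurable LL)) -/q.
  rewrite -RintegralZl //; last exact: (Rintegrable_dilation sigma l0 LL).
  apply: eq_Rintegral => z _; rewrite E /g add0r.
  have -> : l ^+ q = l ^+ (q - nu) * l ^+ nu by rewrite -exprD subnK.
  by field; rewrite expf_eq0 (negbTE ln0) andbF.
- move=> y' eps eps0; have l1 : 0 < l ^+ (q - nu) by rewrite exprn_gt0.
  have [M HM] := vG (dilation sigma l y') _ (divr_gt0 eps0 l1).
  have [M' HM'] := dilation_bound l^-1 M; exists M' => z zM.
  rewrite /g add0r normrM (ger0_norm (ltW l1)) mulrC -ltr_pdivlMr //; apply: HM.
  rewrite ltNge; apply/negP => /HM'; rewrite (dilationK sigma ln0) leNgt => /negP; exact.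
- move=> z zy; apply: continuous_atD; first exact: continuous_at_cst.
  apply: continuous_atM; first exact: continuous_at_cst.
  apply: (@continuous_comp _ _ _ (dilation sigma l) (fun x => G x (dilation sigma l y))).
    exact: (smooth_map_continuous (smooth_dilation sigma l)).
  apply: (continuous_column sG); apply: contra zy => /eqP /(congr1 (dilation sigma l^-1)).
  by rewrite !(dilationK sigma ln0) => ->.
exact: continuous_column.
Qed.

Section transposition.
Hypothesis hypo_tr : hypoelliptic Xt w nu (transpose_coef c).
Variables G Gs : 'rV[R]_n -> 'rV[R]_n -> R.
Hypotheses (iG : fs_integrable G) (iGs : fs_integrable Gs).
Hypotheses (rG : fs_reproducing Ls G) (rGs : fs_reproducing L Gs).
Hypotheses (dG : kernel_decays G) (dGs : kernel_decays Gs).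
Hypotheses (sG : smooth_off_diagonal G) (sGs : smooth_off_diagonal Gs).

(* [u (y) = \int G (y, x) L phi (x) dx] satisfies [L (u + phi) = 0] weakly and vanishes at
   infinity. *)
Let transpose_pairing phi psi : test_fun setT phi -> test_fun setT psi ->
  \int[leb n]_y ((\int[leb n]_x (G y x * L phi x)) * psi y) = - \int[leb n]_y (phi y * psi y).
Proof.
move=> tp tq; have [LGx LGy LG] := iG.
have tL := test_fun_hom_op nu w c sX tp; have [sp [B [cB _ Bp]]] := tp.
have Lphi := L1loc_continuous (smooth_continuous sp).
have Lu := potential_L1loc LGy LG tL.
have := Wliouville (L1loc_add 1 Lu Lphi) _ _ tq; rewrite Rintegral_pairing_add // mul1r => H.
apply/eqP; rewrite -addr_eq0; apply/eqP; apply: H => [eps eps0|psi' tq'].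
  have [M1 H1] := potential_decays dG (fun x => (LGy x).1) tL eps0.
  have [r r0 Br] := compact_norm_bound cB.
  exists (Num.max M1 r) => x; rewrite gt_max => /andP[x1 x2].
  rewrite Bp ?mulr0 ?addr0; first exact: H1.
  by move=> /Br; rewrite leNgt x2.
have tLs := test_fun_hom_op nu w (transpose_coef c) sX tq'.
have [sq' [B' [cB' _ Bq']]] := tq'.
rewrite Rintegral_pairing_add // mul1r (kernel_fubini iG tLs tL).
rewrite -(integral_hom_op_parts w nu c sX X0 sp sq' cB' Bq').
have I1 : Rintegrable (leb n) (fun x => L phi x * psi' x).
  exact: (L1loc_test (L1loc_continuous (smooth_continuous (smooth_hom_op w sX nu c sp))) tq').
rewrite -RintegralD //; last first.
  have := RintegrableN I1; congr (Rintegrable _ _); apply/funext => x.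
  by rewrite rG // mulNr mulrC.
rewrite (_ : (fun x => _) = (fun=> 0)); first by rewrite /Rintegral integral0.
by apply/funext => x; rewrite rG // mulNr mulrC addNr.
Qed.

(** That (x, y) -> G y x reproduces for [L] is available only after pairing with a test function, so
    the columns are not compared directly. For each [psi] the two potentials have a difference that
    decays and solves the equation of [Ls] weakly, hence pairs to zero by the Liouville theorem for
    [Ls]; equality of the kernels off the diagonal follows. *)
Lemma fs_transpose x y : x != y -> Gs x y = G y x.
Proof.
have [LGx LGy LG] := iG; have [LGsx LGsy LGs] := iGs.
pose GT (x y : 'rV[R]_n) := G y x.
move=> xy; apply/eqP; rewrite -subr_eq0 -mulN1r; apply/eqP; move: x y xy.
apply: (@kernel_eq0_off_diagonal R n (fun x y => Gs x y + (-1) * GT x y)).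
- move=> x; apply: measurable_funD (LGsy x).1 _.
  exact: measurable_funM (measurable_cst _) (LGx x).1.
- move=> x y xy; apply: continuous_atD.
    by apply: (smooth_on_continuous sGs); rewrite /= row_mxKl row_mxKr.
  apply: continuous_atM; first exact: continuous_at_cst.
  apply: (continuous_at_ext (g := fun z => joint G (row_mx (rsubmx z) (lsubmx z)))).
    by move=> z; rewrite /joint /GT row_mxKl row_mxKr.
  apply: (@continuous_comp _ _ _ (fun z => row_mx (rsubmx z) (lsubmx z)) (joint G)).
    by apply: continuous_row_mx; [exact: continuous_rsubmx|exact: continuous_lsubmx].
  by apply: (smooth_on_continuous sG); rewrite /= !row_mxKl !row_mxKr eq_sym.
move=> phi psi tp tq.
have Ev x := Rintegral_pairing_add (-1) (LGsy x) (LGx x : L1loc (GT x)) tq.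
under eq_Rintegral do rewrite Ev.
have dGT : kernel_decays GT.
  by move=> r eps eps0; have [M HM] := dG r eps0; exists M => x y yr xM; have [] := HM x y yr xM.
have Lv1 := potential_L1loc LGsy LGs tq.
have Lv2 := @potential_L1loc R n GT psi LGx (L1loc_joint_swap LG) tq.
apply: (weak_liouville i0 e_gt0 sX X0 sXt Xt0 hXt proj hypo_tr) tp; first exact: L1loc_add.
  move=> eps eps0; have e2 : 0 < eps / 2 by rewrite divr_gt0.
  have [M1 H1] := potential_decays dGs (fun x => (LGsy x).1) tq e2.
  have [M2 H2] := @potential_decays R n GT psi dGT (fun x => (LGx x).1) tq _ e2.
  exists (Num.max M1 M2) => x; rewrite gt_max => /andP[x1 x2].
  apply: le_lt_trans (ler_normD _ _) _; rewrite mulN1r normrN.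
  by have := ltrD (H1 _ x1) (H2 _ x2); rewrite -splitr.
move=> phi' tp'; rewrite transpose_coefK; have tL := test_fun_hom_op nu w c sX tp'.
rewrite Rintegral_pairing_add // (kernel_fubini iGs tL tq) -(kernel_fubini iG tq tL) transpose_pairing //.
under eq_Rintegral do rewrite rGs // mulNr.
rewrite mulN1r opprK (_ : \int[leb n]_x (- (phi' x * psi x)) = - \int[leb n]_x (phi' x * psi x)) ?addNr //.
have [sp' _] := tp'; have I1 := L1loc_test (L1loc_continuous (smooth_continuous sp')) tq.
by rewrite -mulN1r -RintegralZl //; apply: eq_Rintegral => x _; rewrite mulN1r.
Qed.

End transposition.

End fundamental_solution_theory.

(** * The fundamental solution obtained from the lifting *)

Section lifted_fundamental_solution.
Context {R : realType} (n m p : nat) (sigma : 'I_n -> nat) (w : 'I_m -> nat) (X : 'I_m -> @vfield R n)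
  (tau : 'I_p -> nat) (mul : 'rV[R]_(n + p) -> 'rV[R]_(n + p) -> 'rV[R]_(n + p))
  (inv : 'rV[R]_(n + p) -> 'rV[R]_(n + p)) (Xt : 'I_m -> @vfield R (n + p)) (nu : nat) (c : seq 'I_m -> R).
Hypotheses (vX : vf_assumption sigma w X) (lX : is_lifting sigma w X tau mul inv Xt).
Hypotheses (nu_gt0 : (0 < nu)%N) (nu_lt : (nu < \sum_(i < n) sigma i)%N).

Lemma lifting_projects j z : lsubmx (Xt j z) = X j (lsubmx z).
Proof. by have [Rj [_ _ ->]] := lift_proj lX j; rewrite row_mxKl. Qed.

Lemma lifting_smooth j : smooth_map (Xt j).
Proof. by have [] := lift_inv lX j. Qed.

Lemma lifting_divergence0 j i x : partial i (fun y => Xt j y 0 i) x = 0.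
Proof. exact: (vf_divergence0 i x (hg_exp_gt0 (lift_group lX)) (vfa_w_gt0 vX j) (lifting_smooth j) (lift_hom lX j)). Qed.

Lemma base_divergence0 j i x : partial i (fun y => X j y 0 i) x = 0.
Proof. exact: (vf_divergence0 i x (base_exp_gt0 (lift_group lX)) (vfa_w_gt0 vX j) (vfa_smooth vX j) (vfa_hom vX j)). Qed.

Lemma fundamental_kernel : hypoelliptic Xt w nu c -> hypoelliptic Xt w nu (transpose_coef c) ->
  exists G : 'rV[R]_n -> 'rV[R]_n -> R, [/\ fs_integrable G,
    fs_reproducing (hom_op X w nu (transpose_coef c)) G, kernel_decays G & smooth_off_diagonal G].
Proof.
move=> hypo hypo_tr; have hg := lift_group lX.
have q_le : (\sum_i cat_exp sigma tau i = \sum_i sigma i + \sum_i tau i)%N := sum_cat_exp sigma tau.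
have nuQ : (nu < \sum_i cat_exp sigma tau i)%N by rewrite q_le ltn_addr.
have [K [sK K0 homK LK solK]] := group_kernel (lshift p (Ordinal (vfa_dim vX))) (hg_exp_gt0 hg)
  lifting_smooth lifting_divergence0 (lift_hom lX) hypo hypo_tr nu_gt0 nuQ.
(* The convergence condition along the fibres amounts to nu < q. *)
have d_gt : (\sum_i tau i < \sum_i cat_exp sigma tau i - nu)%N.
  by rewrite q_le ltn_subRL ltn_add2r.
exists (projected_kernel mul inv K); split.
- split.
  + exact: (kernel_L1loc_x hg sK K0 homK LK d_gt).
  + exact: (kernel_L1loc_y hg sK K0 homK LK d_gt).
  + exact: (kernel_L1loc_joint hg sK K0 homK LK d_gt).
- exact: (kernel_reproducing hg (lift_gen lX) lifting_projects (vfa_smooth vX) base_divergence0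
    (lift_inv lX) lifting_divergence0 sK K0 homK LK d_gt solK).
- exact: (kernel_decay hg sK K0 homK LK d_gt).
- exact: (kernel_smooth hg sK K0 homK d_gt).
Qed.

End lifted_fundamental_solution.

(** Uniqueness is almost everywhere in [x] for each [y], since the reproducing identity does not see
    null sets and a competitor carries no continuity. The transposition holds at every point off the
    diagonal because the [Gs] considered are smooth there. *)
Theorem theorem1p14 (R : realType) (n m p : nat) (sigma : 'I_n -> nat)
    (w : 'I_m -> nat) (X : 'I_m -> @vfield R n) (tau : 'I_p -> nat)
    (mul : 'rV[R]_(n + p) -> 'rV[R]_(n + p) -> 'rV[R]_(n + p))
    (inv : 'rV[R]_(n + p) -> 'rV[R]_(n + p))
    (Xt : 'I_m -> @vfield R (n + p)) (nu : nat) (c : seq 'I_m -> R)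
    (nu_gt0 : (0 < nu)%N) (nu_lt_q : (nu < \sum_(i < n) sigma i)%N)
    (rockland_L : generalized_rockland sigma w X tau mul inv Xt nu c)
    (rockland_Ls :
      generalized_rockland sigma w X tau mul inv Xt nu (transpose_coef c)) :
  let L := hom_op X w nu c in
  let Ls := hom_op X w nu (transpose_coef c) in
  exists G : 'rV[R]_n -> 'rV[R]_n -> R,
    global_fundamental_solution L Ls G /\
    smooth_off_diagonal G /\
    jointly_homogeneous sigma (nu%:Z - (\sum_(i < n) sigma i)%N%:Z) G /\
    vanishing_at_infinity G /\
    (forall g : 'rV[R]_n -> 'rV[R]_n -> R,
       (forall y, L1loc (fun x => g x y)) -> fs_reproducing Ls g ->
       vanishing_at_infinity g ->
       forall y, {ae lebesgue_rV n, forall x, g x y = G x y}) /\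
    (forall Gs : 'rV[R]_n -> 'rV[R]_n -> R,
       global_fundamental_solution Ls L Gs -> smooth_off_diagonal Gs ->
       vanishing_at_infinity Gs ->
       forall x y, x != y -> Gs x y = G y x) /\
    ((forall u, smooth u -> forall x, Ls u x = L u x) ->
       forall x y, x != y -> G x y = G y x).
Proof.
move=> L Ls; have [vX _ lX hypo] := rockland_L; have [_ _ _ hypo_tr] := rockland_Ls.
have hypo_trtr : hypoelliptic Xt w nu (transpose_coef (transpose_coef c)) by rewrite transpose_coefK.
have [G [iG rG dG sG]] := fundamental_kernel vX lX nu_gt0 nu_lt_q hypo hypo_tr.
(* The same construction for the transposed operator, on the same lifting. *)
have [G' [iG' rG' dG' sG']] := fundamental_kernel vX lX nu_gt0 nu_lt_q hypo_tr hypo_trtr.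
have vG := kernel_decays_vanishing dG; have vG' := kernel_decays_vanishing dG'.
have [LGx LGy LG] := iG; have [LGx' LGy' LG'] := iG'.
pose i0 := Ordinal (vfa_dim vX).
have e_gt0 := hg_exp_gt0 (lift_group lX).
have sX := vfa_smooth vX; have X0 := base_divergence0 vX lX.
have sXt := lifting_smooth lX; have Xt0 := lifting_divergence0 vX lX.
have hXt := lift_hom lX; have proj := lifting_projects lX.
have ET : hom_op X w nu (transpose_coef (transpose_coef c)) = L by rewrite transpose_coefK.
have GT : forall x y, x != y -> G' x y = G y x.
  rewrite ET in rG'.
  exact: (fs_transpose i0 e_gt0 sX X0 sXt Xt0 hXt proj hypo hypo_tr iG iG' rG rG' dG dG' sG sG').
(* A competitor for [Ls] is compared with the constructed [G'], not directly with [G]: transposition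
   relies on the decay [kernel_decays], which is known for [G'] but is not among the assumptions on
   [g]. *)
have uniq' g : (forall y, L1loc (fun x => g x y)) -> fs_reproducing L g -> vanishing_at_infinity g ->
    smooth_off_diagonal g -> forall x y, x != y -> g x y = G y x.
  move=> Lg rg vg sg x y xy; rewrite -GT //; rewrite -ET in rg.
  apply: (fs_unique_off_diagonal i0 e_gt0 sX X0 sXt Xt0 hXt proj hypo_tr Lg LGx' rg rG' vg vG') xy.
    exact: continuous_column.
  exact: continuous_column.
exists G; split; first split => //.
  exact: (reproducing_solving sX X0 sXt Xt0 proj hypo iG rG).
split; first exact: sG.
split.
  move=> x y l xy l0.
  have := fs_homogeneous i0 e_gt0 sX X0 (vfa_hom vX) sXt Xt0 hXt proj hypo LGx rG vG sG (ltnW nu_lt_q) l0 xy.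
  move=> <-; rewrite -opprB subzn ?(ltnW nu_lt_q) // -exprnN mulKf //.
  by rewrite expf_eq0 gt_eqF // andbF.
split; first exact: vG.
split.
  move=> g Lg rg vg y.
  exact: (fs_unique_ae i0 e_gt0 sX X0 sXt Xt0 hXt proj hypo Lg LGx rg rG vg vG).
split.
  move=> Gs [[LGs _ _] rGs _] sGs vGs; exact: uniq'.
(* In the self-adjoint case [G] itself reproduces for [L], so it is one of the kernels identified
   with the transpose of [G]. *)
move=> selfadj; apply: uniq' => // phi tp y; rewrite -rG //.
by apply: eq_Rintegral => x _; have [sp _] := tp; rewrite -selfadj.
Qed.
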